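(* Let $H(\beta,p_1,p_2,\dots)$ be the generating series of the Hurwitz numbers $h_{g;b_1,\dots,b_n}$ and $L_p=\sum_{b\ge1} b\,p_b\,\frac{\partial}{\partial p_b}$ (both as defined in the context). Then the series $L_p^2H$ is a $\tau$-function of the Kadomtsev--Petviashvili hierarchy in the variables $p_i$, i.e. it satisfies the full set of bilinear Hirota equations $$\mathrm{Hir}_{i,j}(L_p^2H)=0\qquad\text{for all } 2\le i\le j .$$ In addition, $L_p^2H$ satisfies the linearized KP equations $$\mathrm{LKP}_{i,j}(L_p^2H)=0\qquad\text{for all } 2\le i\le j .$$
   Context: Hurwitz numbers. For $g\ge 0$, $n\ge 1$ and positive integers $b_1,\dots,b_n$ with $d=\sum b_i$, $h_{g;b_1,\dots,b_n}$ is the number of degree $d$ ramified coverings of the sphere by a (connected) genus $g$ surface with a unique preimage of $0$, with $n$ numbered preimages of $\infty$ of multiplicities $b_1,\dots,b_n$, and with $2g-1+n$ fixed simple branch points (isomorphism classes of coverings, each counted with weight $1/|\mathrm{Aut}|$). For instance $h_{0;b}=1/b$. Generating series (a formal power series in $\beta,p_1,p_2,\dots$): $$H(\beta,p_1,p_2,\dots)=\sum_{g\ge0,\,n\ge1}\frac1{n!}\frac{\beta^{2g-1+n}}{(2g-1+n)!}\sum_{b_1,\dots,b_n\ge1}\frac{h_{g;b_1,\dots,b_n}}{d}\,p_{b_1}\cdots p_{b_n},\qquad d=\sum b_i .$$ Operators $D_\mu$. For partitions $\lambda,\mu$ of the same integer $d$, $\chi_\mu(\lambda)$ is the value, on permutations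 of cycle type $\lambda$, of the character of the irreducible representation of the symmetric group $S_d$ assigned to $\mu$ (with $\mu=(d)$ the trivial representation). $|\mathrm{Aut}(\lambda)|$ is the number of permutations of the parts of $\lambda$ preserving their values. With $d_i=\partial/\partial p_i$, $$D_\mu=\sum_{|\lambda|=|\mu|}\chi_\mu(\lambda)\,\frac{d_{\lambda_1}\cdots d_{\lambda_k}}{|\mathrm{Aut}(\lambda)|},$$ $k$ being the number of parts of $\lambda$; $D_{()}=1$. Hierarchies. For $2\le i\le j$ and a formal power series $\tau$ in $p_1,p_2,\dots$, $$\mathrm{Hir}_{i,j}(\tau)=D_{()}\tau\cdot D_{(j,i)}\tau-D_{(i-1)}\tau\cdot D_{(j,1)}\tau+D_{(j)}\tau\cdot D_{(i-1,1)}\tau .$$ $\mathrm{KP}_{i,j}(F)=\mathrm{Hir}_{i,j}(e^F)/e^{2F}$, which is a polynomial in the partial derivatives of $F$, and $\mathrm{LKP}_{i,j}(F)$ is the part of $\mathrm{KP}_{i,j}(F)$ linear in $F$ and its derivatives. *)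

(* Defs.v *)
From HB Require Import structures.
From mathcomp Require Import all_boot all_order all_algebra all_fingroup.
From mathcomp Require Import all_field all_character.
From mathcomp Require Import finmap multiset complex.
From mathcomp Require Import all_classical all_reals all_analysis.

Set Implicit Arguments.
Unset Strict Implicit.
Unset Printing Implicit Defensive.

Import Order.TTheory GRing.Theory Num.Theory.
Import numFieldNormedType.Exports.

Local Open Scope classical_set_scope.
Local Open Scope ring_scope.

(** * Ramified coverings of the sphere *)

Section Topology.
Context {T U : topologicalType}.

Definition homeomorphism (A : set T) (B : set U) (u : T -> U) : Prop :=
  exists v : U -> T,
    [/\ {within A, continuous u}, {within B, continuous v},
        forall x, A x -> B (u x) /\ v (u x) = x
      & forall y, B y -> A (v y) /\ u (v y) = y].

Definition homeomorphic (A : set T) (B : set U) : Prop :=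
  exists u, homeomorphism A B u.

End Topology.

Definition plane (R : realType) : topologicalType := R[i]^o.

(* The Riemann sphere: [Some z] is the finite point z and [None] is infinity. *)
Definition sphere (R : realType) : topologicalType :=
  one_point_compactification (plane R).

Definition disc (R : realType) : set (plane R) :=
  [set z : plane R | `|(z : R[i])| < 1].

Section Surfaces.
Variable R : realType.
Implicit Type X : topologicalType.

Definition open_cell X (k : nat) (A : set X) : Prop :=
  match k with
  | 0 => exists x, A = [set x]
  | 1 => homeomorphic A [set: R]
  | 2 => homeomorphic A [set: plane R]
  | _ => False
  end.

(* X is cut into finitely many disjoint open cells of dimension at most 2, the
   boundary of each cell lying in cells of smaller dimension; c is the
   alternating sum V - E + F of the numbers of cells.  The value c does not
   depend on the decomposition when X is compact Hausdorff (additivity of the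
   Euler characteristic with compact supports). *)
Definition euler_characteristic X (c : int) : Prop :=
  exists (r : nat) (cell : 'I_r -> set X) (dim : 'I_r -> nat),
    [/\ forall x, exists! a, cell a x,
        forall a, open_cell (dim a) (cell a),
        forall a x, closure (cell a) x -> ~ cell a x ->
          exists2 b, (dim b < dim a)%N & cell b x
      & c = \sum_(a < r) (-1) ^+ dim a].

Definition chart_at X (x : X) (A : set X) (u : X -> plane R) : Prop :=
  [/\ open A, A x, homeomorphism A (@disc R) u & u x = 0 :> R[i]].

(* In suitable local coordinates centred at x and f x, the map f is z |-> z^k;
   the case k = 0 is excluded by u x = 0 and v (f x) = 0. *)
Definition ramification_index X (f : X -> sphere R) (x : X) (k : nat) : Prop :=
  exists (A : set X) (B : set (sphere R))
         (u : X -> plane R) (v : sphere R -> plane R),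
    [/\ chart_at x A u, chart_at (f x) B v
      & forall y, A y -> B (f y) /\ v (f y) = (u y : R[i]) ^+ k].

(* l numbers the preimages of y; their multiplicities are listed in s. *)
Definition numbered_fiber X (f : X -> sphere R) (y : sphere R) (s : seq nat)
    (l : 'I_(size s) -> X) : Prop :=
  [/\ injective l, range l = f @^-1` [set y]
    & forall k, ramification_index f (l k) (nth 0%N s k)].

Definition fiber_profile X (f : X -> sphere R) (y : sphere R) (s : seq nat) :=
  exists l, @numbered_fiber X f y s l.

Record marked_covering (n : nat) := MarkedCovering {
  surface : topologicalType;
  covering_map : surface -> sphere R;
  mark : 'I_n -> surface }.

Definition covering_iso n (X Y : marked_covering n)
    (phi : surface X -> surface Y) : Prop :=
  [/\ homeomorphism [set: surface X] [set: surface Y] phi,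
      forall x, covering_map (phi x) = covering_map x
    & forall k, phi (mark X k) = mark Y k].

(* Degree d coverings by a genus g surface with a unique preimage of 0,
   numbered preimages of infinity of multiplicities b, and one simple branch
   point at each element of w.  Every point of the total space lies in one of
   the fibers described, so the local model z |-> z^k makes it an orientable
   topological surface; its genus is prescribed by its Euler characteristic. *)
Definition hurwitz_covering (w : seq R[i]) (g : nat) (b : seq nat)
    (X : marked_covering (size b)) : Prop :=
  let d := sumn b in
  let f := @covering_map _ X in
  [/\ [/\ compact [set: surface X], hausdorff_space (surface X),
          connected [set: surface X]
        & euler_characteristic (surface X) (2%:Z - (2 * g)%N%:Z)],
      continuous f
    & [/\ fiber_profile f (Some 0) [:: d],
          @numbered_fiber _ f None b (mark X),
          forall z, z \in w ->
            (1 < d)%N /\ fiber_profile f (Some z) (2%N :: nseq (d - 2) 1%N)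
        & forall z, z \notin 0 :: w ->
            fiber_profile f (Some z) (nseq d 1%N)]].

(* c is the number of isomorphism classes of coverings, each counted with
   weight 1/|Aut|; rep lists one representative of each class. *)
Definition is_hurwitz_number (w : seq R[i]) (g : nat) (b : seq nat)
    (c : algC) : Prop :=
  exists (r : nat) (rep : 'I_r -> marked_covering (size b)) (a : 'I_r -> nat),
    [/\ forall k, hurwitz_covering w g (rep k),
        forall X : marked_covering (size b), hurwitz_covering w g X ->
          exists k phi, @covering_iso _ (rep k) X phi,
        forall k l phi, @covering_iso _ (rep k) (rep l) phi -> k = l,
        forall k, ([set phi | @covering_iso _ (rep k) (rep k) phi] #= `I_(a k))%card
      & c = \sum_(k < r) (a k)%:R^-1].

(* w m is the chosen set of m simple branch points; h_(g;b) uses m = 2g-1+n. *)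
Definition hurwitz (w : nat -> seq R[i]) (g : nat) (b : seq nat) : algC :=
  xget 0 [set c | is_hurwitz_number (w (2 * g + size b - 1)%N) g b c].

End Surfaces.

(** * Formal power series *)

(* Monomials are multisets of variables; the variable of index 0 is beta and,
   for b > 0, the variable of index b is p_b.  A series is the function giving
   the coefficient of each monomial, so that the library's pointwise addition
   of functions is that of series. *)
Notation monomial := ({mset nat}%mset).
Notation fps := (monomial -> algC).

Definition fps1 : fps := fun m => (m == mset0)%:R.

Definition fps_var (b : nat) : fps := fun m => (m == [mset b]%mset)%:R.

Definition fps_mul (F G : fps) : fps := fun m =>
  \sum_(uv \in [set uv : monomial * monomial | (uv.1 `+` uv.2)%mset = m])
     F uv.1 * G uv.2.

Definition fps_exp_nat (F : fps) (k : nat) : fps := iter k (fps_mul F) fps1.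

(* Meaningful when the constant term of F vanishes: the sum is then finite in
   each monomial. *)
Definition fps_exp (F : fps) : fps := fun m =>
  \sum_(k \in [set: nat]) k`!%:R^-1 * fps_exp_nat F k m.

Definition fps_deriv (b : nat) (F : fps) : fps := fun m =>
  (m b).+1%:R * F (m `+` [mset b])%mset.

Definition fps_derivs (la : seq nat) (F : fps) : fps := foldr fps_deriv F la.

Definition Lp (F : fps) : fps := fun m =>
  \sum_(b \in [set b : nat | (0 < b)%N])
     b%:R * fps_mul (fps_var b) (fps_deriv b F) m.

Definition hurwitz_series (h : nat -> seq nat -> algC) : fps := fun m =>
  \sum_(gb \in [set gb : nat * seq nat | (0 < size gb.2)%N && (0%N \notin gb.2)])
     let: (g, b) := gb in let r := (2 * g + size b - 1)%N in
     (size b)`!%:R^-1 * r`!%:R^-1 * (h g b / (sumn b)%:R) *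
     (m == seq_mset (nseq r 0%N ++ b))%:R.

(** * Characters of the symmetric groups *)

Definition is_part (la : seq nat) : bool :=
  sorted geq la && (0%N \notin la).

Definition cycle_type d (s : 'S_d) : seq nat :=
  sort geq [seq #|(C : {set 'I_d})| | C in porbits s].

Section Specht.
Variable mu : seq nat.
Let d := sumn mu.
Local Notation G := [set: 'S_d]%G.

(* The tableau of shape mu with 0, 1, 2, etc. in reading order has i in row
   [reshape_index mu i] and column [reshape_offset mu i]. *)
Definition row_stab : {set 'S_d} :=
  [set s : 'S_d | [forall k, reshape_index mu (s k) == reshape_index mu k]]%SET.

Definition col_stab : {set 'S_d} :=
  [set s : 'S_d | [forall k, reshape_offset mu (s k) == reshape_offset mu k]]%SET.

Definition young_symmetrizer : 'rV[algC]_#|G| :=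
  \sum_(p in row_stab) \sum_(q in col_stab)
     (-1) ^+ q *: delta_mx 0 (gring_index G (p * q)%g).

(* The character of the ideal of the group algebra generated by the Young
   symmetrizer. *)
Definition irr_char : 'CF(G) :=
  cfRepr (submod_repr
    (cyclic_mx_module (regular_repr algC G) young_symmetrizer)).

Definition chi (la : seq nat) : algC :=
  if [pick s : 'S_d | cycle_type s == la] is Some s then irr_char s else 0.

End Specht.

Definition card_Aut (la : seq nat) : nat :=
  #|[set s : 'S_(size la) | [forall k, nth 0%N la (s k) == nth 0%N la k]]%SET|.

(** * The KP hierarchy *)

Definition Dop (mu : seq nat) (F : fps) : fps := fun m =>
  \sum_(la \in [set la : seq nat | is_part la && (sumn la == sumn mu)])
     chi mu la * (fps_derivs la F m / (card_Aut la)%:R).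

Definition Hir (i j : nat) (tau : fps) : fps :=
  fps_mul (Dop [::] tau) (Dop [:: j; i] tau)
  - fps_mul (Dop [:: (i - 1)%N] tau) (Dop [:: j; 1%N] tau)
  + fps_mul (Dop [:: j] tau) (Dop [:: (i - 1)%N; 1%N] tau).

(* Hir(e^F) / e^(2F) *)
Definition KP (i j : nat) (F : fps) : fps :=
  fps_mul (Hir i j (fps_exp F)) (fps_exp (- (F + F))).

(* Polynomials in the partial derivatives of an unknown series: lists of terms
   (c, [:: la_1; ...; la_k]) standing for c * d_(la_1) F * ... * d_(la_k) F. *)
Definition dpoly := seq (algC * seq (seq nat)).

Definition dp_eval (P : dpoly) (F : fps) : fps := fun m =>
  \sum_(t <- P) t.1 * (\big[fps_mul/fps1]_(la <- t.2) fps_derivs la F) m.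

Definition dp_linear (P : dpoly) : dpoly := [seq t <- P | size t.2 == 1%N].

(* G = LKP_(i,j)(F).  The polynomial P is the one representing KP_(i,j)(F') for
   all F' for which e^(F') is defined, which determines it up to reordering
   and collecting terms. *)
Definition is_LKP (i j : nat) (F G : fps) : Prop :=
  exists P : dpoly,
    (forall F' : fps, F' mset0 = 0 -> KP i j F' = dp_eval P F') /\
    G = dp_eval (dp_linear P) F.

(* Main.v *)
(* A covering is encoded by its monodromy: cutting the sphere along the rays
   below the (straightened) branch points identifies coverings with tuples of
   permutations, so h_(g;b) counts products of a d-cycle and r transpositions
   together with a numbering of the cycles of the product.  Multiplying by a
   transposition cuts or joins cycles, hence Z = L_p^2 H satisfies the
   cut-and-join equation.  Writing D_b = b d/dp_b, that equation forces
   D_b Z = sum_(j < b) A_(b-j) B_j for explicit series with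
   D_b A_k = A_(k+b) and D_b B_l = - B_(l+b).  Newton's identities then give
   D_((k)) Z = A_k B_0 and D_((k,1)) Z = - A_k B_1, while D_((j,i)) Z = 0 for
   i >= 2, because D_((j,i)) = D_((j)) D_((i)) - D_((j+1)) D_((i-1)); the
   three-term Hirota expression cancels and its linear part vanishes. *)
From HB Require Import structures.
From Pilot Require Import Defs.
From mathcomp Require Import all_boot all_order all_algebra all_fingroup.
From mathcomp Require Import all_field all_character.
From mathcomp Require Import finmap multiset complex.
From mathcomp Require Import all_classical all_reals all_analysis.
From mathcomp Require Import zify ring lra.

Set Implicit Arguments.
Unset Strict Implicit.
Unset Printing Implicit Defensive.

Import Order.TTheory GRing.Theory Num.Theory.
Import numFieldNormedType.Exports.


(** Once the branch values are real, the covering is trivial over each open half-plane, and a point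
    is encoded by the finite set of sheets whose closures contain it. These label sets take the
    place of paths and fundamental groups: they yield the permutations, the isomorphisms and
    automorphisms and, read backwards, a covering with prescribed permutations. The genus is
    controlled by counting cells; connectedness follows from the single preimage of 0. Origin of the
    series: a d-cycle sees only hook shapes, and the sum of all transpositions acts by the content
    sum. A_k weights degree n by the exponential of beta times the content sum of a row of n + k
    boxes, B_l by that of a column of n + l boxes below the corner. The formula for D_b Z is
    obtained as the unique solution of a linear system in beta, so the hook expansion itself is
    never written. The two-row characters come from Young symmetrizers. Scalar products identify
    them with differences of permutation characters on subsets, which turns D_((j,i)) into a 2 by 2
    determinant. *)

Module Covering_01.

(** * Topology of the plane and of the sphere *)

Section Plane.
Variable R : realType.
Local Open Scope classical_set_scope.
Local Open Scope ring_scope.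
Local Open Scope complex_scope.
Local Notation re := (@complex.Re R).
Local Notation im := (@complex.Im R).
Implicit Types (z w : plane R) (A B : set (plane R)).

Lemma normc_le_sum (x : R[i]) : `|x| <= (`|re x| + `|im x|)%:C.
Proof.
case: x => a b; rewrite normc_def lecR /= -[leRHS]ger0_norm ?addr_ge0 //.
rewrite -(sqrtr_sqr (`|a| + _)) ler_wsqrtr // sqrrD !real_normK ?num_real //.
by rewrite lerD2r lerDl mulrn_wge0 ?mulr_ge0.
Qed.

Lemma re_sub (x y : R[i]) : re (x - y) = re x - re y.
Proof. by case: x y => [? ?] [? ?]. Qed.

Lemma im_sub (x y : R[i]) : im (x - y) = im x - im y.
Proof. by case: x y => [? ?] [? ?]. Qed.

Lemma normc_ge_im (x : R[i]) : `|im x|%:C <= `|x|.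
Proof.
by rewrite normc_def lecR -sqrtr_sqr ler_sqrt ?lerDr ?sqr_ge0 // addr_ge0 ?sqr_ge0.
Qed.

(** Boxes are preferred to balls because the modulus takes its values in [R[i]], whereas coordinates
    are real and fall under linear arithmetic. *)
Lemma nbhs_plane z A : nbhs z A <->
  exists2 e : R, 0 < e & forall w : R[i],
    `|re w - re (z : R[i])| < e -> `|im w - im (z : R[i])| < e -> A w.
Proof.
split.
  move=> /nbhs_ballP[/= e e0 eA].
  (* The radius of a ball is a positive element of [R[i]], and the order there forces such an
     element to be real. *)
  have [e0' eE] : 0 < re e /\ e = (re e)%:C.
    move: e0; rewrite ltcE /= => /andP[/eqP h1 h2]; split=> //.
    by apply/eqP; rewrite eq_complex /= h1 !eqxx.
  exists (re e / 2); first by rewrite divr_gt0.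
  move=> w h1 h2; apply: eA; rewrite -ball_normE /= eE.
  apply: le_lt_trans (normc_le_sum _) _; rewrite ltcR re_sub im_sub.
  by rewrite distrC (distrC (im _)) (splitr (re e)) ltrD.
move=> [e e0 eA]; apply/nbhs_ballP; exists e%:C => /=; first by rewrite ltcR.
move=> w; rewrite -ball_normE /= => zw.
by apply: eA; rewrite -ltcR distrC -(re_sub, im_sub);
  apply: le_lt_trans zw; [exact: normc_ge_Re | exact: normc_ge_im].
Qed.

Lemma re_continuous : continuous (re : plane R -> R).
Proof.
move=> z A /nbhs_ballP[e e0 eA]; apply/nbhs_plane; exists e => // w h _.
by apply: eA; rewrite -ball_normE /= distrC.
Qed.

Lemma im_continuous : continuous (im : plane R -> R).
Proof.
move=> z A /nbhs_ballP[e e0 eA]; apply/nbhs_plane; exists e => // w _ h.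
by apply: eA; rewrite -ball_normE /= distrC.
Qed.

Lemma cvg_plane T (F : set_system T) (FF : Filter F) (a b : T -> R) (x y : R) :
  a @ F --> x -> b @ F --> y -> (fun t => (a t +i* b t : plane R)) @ F --> (x +i* y : plane R).
Proof.
move=> /cvgrPdist_lt ax /cvgrPdist_lt bY A /nbhs_plane [e e0 eA].
apply: filterS (filterI (ax e e0) (bY e e0)) => t /= [h1 h2].
by apply: eA => /=; rewrite distrC.
Qed.

Lemma plane_hausdorff : hausdorff_space (plane R).
Proof. exact: (@norm_hausdorff _ R[i]^o). Qed.

Lemma compact_box (a b c d : R) :
  compact [set z : plane R | a <= re z <= b /\ c <= im z <= d].
Proof.
have -> : [set z : plane R | a <= re z <= b /\ c <= im z <= d] =
  (fun p : R * R => (p.1 +i* p.2 : plane R)) @` (`[a, b] `*` `[c, d]).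
  apply/seteqP; split=> [[x y] /= [h1 h2]|_ [[x y] /= [+ +] <-] /=].
    by exists (x, y) => //=; rewrite !in_itv.
  by rewrite !in_itv.
apply: continuous_compact; last by apply: compact_setX; exact: segment_compact.
apply: continuous_subspaceT => -[x y].
by apply: cvg_plane; [exact: cvg_fst|exact: cvg_snd].
Qed.

Lemma closed_box (a b c d : R) :
  closed [set z : plane R | a <= re z <= b /\ c <= im z <= d].
Proof. exact: (@compact_closed (plane R) _ plane_hausdorff (@compact_box _ _ _ _)). Qed.

Lemma plane_locally_compact : locally_compact [set: plane R].
Proof.
move=> z _; rewrite withinET.
exists [set w : plane R | re z - 1 <= re w <= re z + 1 /\ im z - 1 <= im w <= im z + 1].
  apply/nbhs_plane; exists 1 => // w; rewrite !ltr_distl /= => /andP[h1 h2] /andP[h3 h4].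
  by rewrite !ltW.
by split; [exact: compact_box|exact: closed_box].
Qed.

Lemma sphere_hausdorff : hausdorff_space (sphere R).
Proof.
apply: one_point_compactification_hausdorff; last exact: plane_hausdorff.
exact: plane_locally_compact.
Qed.

Lemma sphere_compact : compact [set: sphere R].
Proof. exact: one_point_compactification_compact. Qed.

Lemma nbhs_sphere z (A : set (sphere R)) :
  nbhs (Some z : sphere R) A <-> nbhs z (Some @^-1` A).
Proof. by []. Qed.

(** Compact sets have bounded coordinates and closed boxes are compact, so exteriors of boxes form a
    basis at infinity. *)
Lemma nbhs_infty (A : set (sphere R)) : nbhs (None : sphere R) A <->
  A None /\ exists M : R, forall w : R[i], M < `|re w| \/ M < `|im w| -> A (Some w).
Proof.
split.
  move=> [U [cU clU] UA]; split; first by apply: UA; right.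
  have [M UM] : exists M : R, forall w, U w -> `|re w| <= M /\ `|im w| <= M.
    have bd (g : plane R -> R) : continuous g -> exists M, forall w, U w -> `|g w| <= M.
      move=> cg; have /compact_bounded[M [_ hM]] : compact (g @` U).
        by apply: continuous_compact cU; exact: continuous_subspaceT.
      have hM1 : M < M + 1 by rewrite ltrDl.
      by exists (M + 1) => w Uw; apply: (hM _ hM1); exists w.
    have [M1 h1] := bd _ re_continuous; have [M2 h2] := bd _ im_continuous.
    exists (Num.max M1 M2) => w Uw.
    by rewrite !le_max h1 // h2 // orbT.
  exists M => w hw; apply: UA; left; exists w => // Uw.
  have [h1 h2] := UM _ Uw.
      by case: hw; rewrite ltNge ?h1 ?h2.
move=> [A0 [M hM]].
exists [set z : plane R | - M <= re z <= M /\ - M <= im z <= M].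
  by split; [exact: compact_box|exact: closed_box].
move=> _ [[w' /= nw <-]|-> //]; apply: hM.
apply: contrapT => /not_orP[/negP h1 /negP h2]; apply: nw.
by rewrite -!ler_norml !leNgt.
Qed.

(** Seen from one fixed point [z], the set is a union of segments issuing from [z]. *)
Lemma convex_connected A :
  (forall z w (t : R), A z -> A w -> 0 <= t <= 1 ->
     A (((1 - t) * re z + t * re w) +i* ((1 - t) * im z + t * im w))) -> connected A.
Proof.
move=> cA; have [->|/set0P[z Az]] := eqVneq A set0; first exact: connected0.
pose seg (w : plane R) := (fun t : R => (((1 - t) * re z + t * re w) +i* ((1 - t) * im z + t * im w) : plane R)) @` `[0, 1].
have -> : A = \bigcup_(w in A) seg w.
  apply/seteqP; split=> [w Aw|w [w' Aw' [t] + <-]].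
    exists w => //; exists 1; first by rewrite /= in_itv /= lexx ler01.
    by rewrite subrr !mul0r !mul1r !add0r; case: (w).
  by rewrite /= in_itv => /= h; exact: cA.
apply: bigcup_connected.
  exists z => w Aw; exists 0; first by rewrite /= in_itv /= lexx ler01.
  by rewrite subr0 !mul0r !mul1r !addr0; case: (z).
move=> w Aw; apply: connected_continuous_connected; first exact: segment_connected.
apply: continuous_subspaceT => t.
by apply: cvg_plane; apply: cvgD; apply: cvgM; first [exact: cvg_cst | exact: cvg_id | apply: cvgB; [exact: cvg_cst|exact: cvg_id]].
Qed.

End Plane.
End Covering_01.
Import Covering_01.

(** * General topology: local constancy, properness, separation, subdivision *)

Module Covering_02.
Section General.
Local Open Scope classical_set_scope.
Local Open Scope ring_scope.

Lemma connected_locally_const (T : topologicalType) (A : set T) (P : T -> Prop) z0 :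
  connected A -> A z0 -> P z0 ->
  (forall z, A z -> \forall w \near z, A w -> (P z <-> P w)) ->
  forall z, A z -> P z.
Proof.
move=> cA Az0 Pz0 locP.
suff AP : A `&` P = A by move=> z; rewrite -AP => -[].
apply: cA; first by exists z0.
  exists (interior [set w | A w -> P w]); first exact: open_interior.
  apply/seteqP; split=> [z [Az Pz]|z [Az /nbhs_singleton/(_ Az)] //]; split=> //.
  by apply: filterS (locP z Az) => w h /h [+ _]; apply.
exists (~` interior [set w | A w -> ~ P w]); first exact/open_closedC/open_interior.
apply/seteqP; split=> [z [Az Pz]|z [Az nint]]; split=> //.
  by move=> /nbhs_singleton /(_ Az).
apply: contrapT => nPz; apply: nint.
by apply: filterS (locP z Az) => w h /h [_ +] Pw; move=> /(_ Pw).
Qed.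

(** The image of the complement of [O] is compact, hence closed, and misses [y]. This is the
    properness that keeps the points of nearby fibres from escaping. *)
Lemma proper_near (X Y : topologicalType) (f : X -> Y) (y : Y) (O : set X) :
  compact [set: X] -> hausdorff_space Y -> continuous f -> open O ->
  f @^-1` [set y] `<=` O -> \forall y' \near y, f @^-1` [set y'] `<=` O.
Proof.
move=> cX hY cf oO fO.
have clf : closed (f @` (~` O)).
  apply: compact_closed => //; apply: continuous_compact.
    exact: continuous_subspaceT.
  by apply: subclosed_compact cX _ => //; exact: open_closedC.
have : nbhs y (~` (f @` (~` O))).
  apply: open_nbhs_nbhs; split; first exact: closed_openC.
  by move=> [x nOx fx]; apply: nOx; apply: fO.
by apply: filterS => y' ny' x fx; apply: contrapT => nOx; apply: ny'; exists x.
Qed.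

Lemma hausdorff_sep (X : topologicalType) (x y : X) : hausdorff_space X -> x <> y ->
  exists A B : set X, [/\ open A, open B, A x, B y & A `&` B = set0].
Proof.
rewrite open_hausdorff => h /eqP/h [[A B] /= []]; rewrite !inE => Ax By [oA oB AB].
by exists A, B; split=> //; exact/eqP.
Qed.

Lemma finite_sep (X : topologicalType) (n : nat) (l : 'I_n -> X) :
  hausdorff_space X -> injective l ->
  exists W : 'I_n -> set X,
    (forall i, open (W i) /\ W i (l i)) /\ (forall i j x, W i x -> W j x -> i = j).
Proof.
move=> hX lI.
have sep (p : 'I_n * 'I_n) : exists AB : set X * set X,
    p.1 <> p.2 -> [/\ open AB.1, open AB.2, AB.1 (l p.1), AB.2 (l p.2) & AB.1 `&` AB.2 = set0].
  have [->|/eqP ne] := eqVneq p.1 p.2; first by exists (set0, set0).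
  have ne' : l p.1 <> l p.2 by move/lI.
  by have [A [B [? ? ? ? ?]]] := hausdorff_sep hX ne'; exists (A, B).
have [AB hAB] := choice sep.
pose V i := [set x | forall j, i <> j -> (AB (i, j)).1 x /\ (AB (j, i)).2 x].
have Vl i : nbhs (l i) (V i).
  apply: (@filter_forall _ _ (fun j x => i <> j -> (AB (i, j)).1 x /\ (AB (j, i)).2 x)) => j.
  have [->|/eqP ne] := eqVneq i j; first exact: nearW.
  have [oAi _ mAi _ _] := hAB (i, j) ne; have [_ oAj _ mAj _] := hAB (j, i) (nesym ne).
  have n1 : nbhs (l i) (AB (i, j)).1 by apply: open_nbhs_nbhs.
  have n2 : nbhs (l i) (AB (j, i)).2 by apply: open_nbhs_nbhs.
  exact: filterS (filterI n1 n2).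
exists (fun i => interior (V i)); split.
  by move=> i; split; [exact: open_interior|exact: Vl].
move=> i j x /nbhs_singleton hi /nbhs_singleton hj; apply: contrapT => ne.
have [h _] := hi _ ne; have [_ h'] := hj _ (nesym ne).
have [_ _ _ _ e] := hAB (i, j) ne.
by have : set0 x by rewrite -e.
Qed.

Lemma near_forall (T : topologicalType) (I : finType) (y : T) (P : I -> T -> Prop) :
  (forall i, \forall y' \near y, P i y') -> \forall y' \near y, forall i, P i y'.
Proof. by move=> h; apply: filter_forall. Qed.

Lemma near_all (T : topologicalType) (y : T) (P : T -> Prop) :
  (forall w, P w) -> \forall w \near y, P w.
Proof. exact: nearW. Qed.

Lemma near_imp (T : topologicalType) (y : T) (P Q : T -> Prop) :
  (forall w, P w -> Q w) -> (\forall w \near y, P w) -> \forall w \near y, Q w.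
Proof. by move=> PQ; apply: filterS. Qed.

Lemma withinP (T U : topologicalType) (A : set T) (g : T -> U) :
  {within A, continuous g} <->
  forall x, A x -> forall P, nbhs (g x) P -> \forall w \near x, A w -> P (g w).
Proof. exact: subspace_continuousP. Qed.

Lemma within_eq (T U : topologicalType) (A : set T) (g h : T -> U) :
  {within A, continuous g} -> (forall z, A z -> h z = g z) -> {within A, continuous h}.
Proof.
move=> /subspace_continuousP c e; apply/subspace_continuousP => x Ax P.
have e' : from_subspace A h x = g x := e x Ax.
rewrite e' => hP.
have hh : \forall w \near x, A w -> P (g w) := c x Ax P hP.
by apply: near_imp hh => w h1 Aw; rewrite /= /from_subspace e //; exact: h1.
Qed.

(** A subdivision argument without Lebesgue numbers: the supremum of the [t] with [Q a t] is reached
    and cannot be smaller than [b]. *)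
Lemma interval_induction (R : realType) (Q : R -> R -> Prop) (a b : R) :
  (forall x y z, x <= y -> y <= z -> Q x y -> Q y z -> Q x z) ->
  (forall t, a <= t <= b -> exists2 e, 0 < e &
     forall x y, a <= x -> x <= y -> y <= b -> t - e < x -> y < t + e -> Q x y) ->
  a <= b -> Q a b.
Proof.
move=> tr loc ab.
pose S := [set t : R | a <= t <= b /\ Q a t].
have Sa : S a.
  split; first by rewrite lexx.
  have [|e e0] := loc a; first by rewrite lexx.
  by apply; rewrite ?lexx // ?ltrBlDr ?ltrDl.
have hS : has_sup S by split; [exists a|exists b => t [/andP[]]].
have aS : a <= sup S by apply: ub_le_sup Sa; case: hS.
have Sb : sup S <= b by apply: ge_sup; [exists a|move=> t [/andP[]]].
have [|e e0 he] := loc (sup S); first by rewrite aS.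
have [t [/andP[at_ tb] Qt] ht] := sup_adherent e0 hS.
have ts : t <= sup S by apply: ub_le_sup; [case: hS|split=> //; rewrite at_].
(* [m] overshoots the supremum by half the local radius, cut off at [b]; since [Q a m] holds, [m]
   cannot exceed the supremum, and only the cut-off at [b] explains this. *)
pose m := Num.min (sup S + e / 2) b.
have e2 : 0 < e / 2 by rewrite divr_gt0.
have e2e : e / 2 < e by rewrite ltr_pdivrMr // ltr_pMr // ltr1n.
have sm : sup S <= m by rewrite le_min Sb lerDl ltW.
have Qm : Q a m.
  apply: (tr _ t) => //; first exact: le_trans sm.
  apply: he => //; first exact: le_trans sm.
    by rewrite ge_min lexx orbT.
  by rewrite gt_min ltrD2l e2e.
have : m <= sup S.
  apply: ub_le_sup; first by case: hS.
  by split=> //; rewrite (le_trans aS) //= ge_min lexx orbT.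
rewrite /m ge_min => /orP[|bs]; first by rewrite gerDl leNgt e2.
by move: Qm; rewrite /m min_r // (le_trans bs) // lerDl ltW.
Qed.

End General.
End Covering_02.
Import Covering_02.

(** * Local structure of a map at a point of given ramification index *)

Module Covering_03.
Section Local.
Local Open Scope classical_set_scope.
Local Open Scope ring_scope.
Local Open Scope complex_scope.
Variable R : realType.
Local Notation re := (@complex.Re R).
Local Notation im := (@complex.Im R).

Lemma roots_of_unit (k : nat) (c : R[i]) : (0 < k)%N -> c != 0 ->
  exists zeta : 'I_k -> R[i], injective zeta /\
    forall z, z ^+ k = c <-> exists j, z = zeta j.
Proof.
move=> k0 c0; pose p : {poly R[i]} := 'X^k - c%:P.
have spc : (size (- c%:P : {poly R[i]}) < size ('X^k : {poly R[i]}))%N.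
  by rewrite size_polyXn size_polyN (leq_ltn_trans (size_polyC_leq1 _)).
have pm : p \is monic by rewrite monicE lead_coefDl // lead_coefXn.
have [r pr] := closed_field_poly_normal p.
rewrite (monicP pm) scale1r in pr.
have sr : size r = k.
  have : size p = k.+1 by rewrite size_polyDl // size_polyXn.
  by rewrite pr size_prod_XsubC => -[].
have ur : uniq r.
  rewrite -separable_prod_XsubC -pr separable_poly.unlock.
  have pD : deriv p = 'X^(k.-1) *+ k by rewrite /p derivB derivC subr0 derivXn.
  have cop : (k%:R * - c) != 0 :> R[i] by rewrite mulf_neq0 ?oppr_eq0 // pnatr_eq0 -lt0n.
  (* For [p = 'X^k - c] the combination [k p - 'X p'] is the constant [- k c]; dividing by it gives
     a Bezout relation, so [p] is separable. *)
  apply/Bezout_eq1_coprimepP.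
  exists ((k%:R * - c)^-1%:P * k%:R, - ((k%:R * - c)^-1%:P * 'X)) => /=.
  have -> : (k%:R * - c)^-1%:P * k%:R * p + - ((k%:R * - c)^-1%:P * 'X) * deriv p =
    (k%:R * - c)^-1%:P * (k%:R * p - 'X * deriv p) by ring.
  have -> : k%:R * p - 'X * deriv p = (k%:R * - c)%:P.
    rewrite pD -mulr_natl /p -{2}(prednK k0) exprS.
    by rewrite polyCM polyCN -(polyC_natr _ k); ring.
  by rewrite -polyCM mulVf.
exists (fun j => nth 0 r j); split.
  by move=> i j /eqP; rewrite nth_uniq ?sr ?ltn_ord // => /eqP/val_inj.
move=> z; have -> : (z ^+ k = c) <-> root p z.
  rewrite /root /p !hornerE; split; first by move=> ->; rewrite subrr.
  by rewrite subr_eq0 => /eqP.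
rewrite pr root_prod_XsubC; split.
  move=> zr; have h : (index z r < k)%N by rewrite -sr index_mem.
  by exists (Ordinal h); rewrite /= nth_index.
by move=> [j ->]; rewrite mem_nth // sr.
Qed.

Variable X : topologicalType.
Implicit Type f : X -> sphere R.

Lemma ram_gt0 f x k : ramification_index f x k -> (0 < k)%N.
Proof.
move=> [A [B [u [v [[_ Ax _ ux] [_ _ _ vx] h]]]]].
have [_] := h x Ax; rewrite vx ux; case: k {h} => // /eqP.
by rewrite expr0 eq_sym oner_eq0.
Qed.

(** The local model z^k in purely topological form: the k-th roots of [v y], pulled back by the
    chart, are the points of a nearby fibre inside [A]. Uniqueness of the index and the count of
    labels at a point rest on this alone. *)
Lemma ram_local f x k : ramification_index f x k ->
  exists2 A : set X, open A /\ A x & forall W, nbhs x W ->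
    \forall y \near f x, y <> f x ->
      A `&` f @^-1` [set y] `<=` W /\
      exists g : 'I_k -> X, injective g /\ range g = A `&` f @^-1` [set y].
Proof.
move=> rx; have k0 := ram_gt0 rx; case: rx => A [B [u [v [cA cB h]]]].
case: cA => oA Ax [u' [_ cu' uK u'K]] ux; case: cB => oB Bx [v' [cv _ vK _]] vx.
exists A => // W Wx.
have d0 : @disc R 0 by rewrite /disc /= normr0.
have [e e0 eW] : exists2 e : R, 0 < e < 1 & forall z, `|z : R[i]| < e%:C -> W (u' z).
  have : \forall z \near within (@disc R) (nbhs (0 : plane R)), W (u' z).
    have u'0 : u' 0 = x by have [_] := uK _ Ax; rewrite ux.
    have /subspace_continuousP/(_ 0 d0) := cu'; apply.
    by rewrite /from_subspace u'0.
  move=> /nbhs_ballP[/= e e0 he].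
  have [e0' eE] : 0 < re e /\ e = (re e)%:C.
    move: e0; rewrite ltcE /= => /andP[/eqP h1 h2]; split=> //.
    by apply/eqP; rewrite eq_complex /= h1 !eqxx.
  have h2 : 0 < 1 / 2 :> R by lra.
  have h3 : 1 / 2 < 1 :> R by lra.
  exists (Num.min (re e) (1 / 2)).
    by rewrite lt_min e0' h2 gt_min h3 orbT.
  move=> z hz; apply: he.
    rewrite -ball_normE /= sub0r normrN eE; apply: lt_le_trans hz _.
    by rewrite lecR ge_min lexx.
  rewrite /disc /=; apply: lt_trans hz _.
  by rewrite ltcR gt_min h3 orbT.
(* The bound [e ^+ k] on [v y] puts all its k-th roots in the disc of radius [e], which the inverse
   chart sends into [W]. *)
have : \forall y \near f x, B y /\ `|(v y : R[i])| < e%:C ^+ k.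
  have nB : nbhs (f x) B by apply: open_nbhs_nbhs.
  have cvx : v @ nbhs (f x) --> (v (f x) : plane R).
    by have := cv; rewrite (continuous_open_subspace v oB) => /(_ _ (mem_set Bx)).
  have /cvx : nbhs (v (f x)) [set z : plane R | `|(z : R[i])| < e%:C ^+ k].
    rewrite vx; apply/nbhs_ballP; exists (e%:C ^+ k) => /=.
      by rewrite exprn_gt0 // ltcR; case/andP: e0.
    by move=> z; rewrite -ball_normE /= sub0r normrN.
  by move=> h1; apply: filterI.
apply: filterS => y [By hy] ny.
have vy0 : (v y : R[i]) != 0.
  apply/eqP => vy0; apply: ny; have [_ <-] := vK _ By; have [_ <-] := vK _ Bx.
  by rewrite vx vy0.
have [zeta [zI zP]] := roots_of_unit k0 vy0.
have small z : z ^+ k = v y -> `|z| < e%:C.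
  move=> zk; rewrite -(ltr_pXn2r k0) ?nnegrE ?normr_ge0 //; first by rewrite -normrX zk.
  by rewrite ltW // ltcR; case/andP: e0.
have sd z : `|z| < e%:C -> @disc R z.
  by move=> hz; apply: lt_trans hz _; rewrite ltcR; case/andP: e0.
have fA x' : A x' -> f x' = y <-> (u x' : R[i]) ^+ k = v y.
  move=> Ax'; have [Bf <-] := h x' Ax'; split=> [->//|].
  by move=> e1; have [_ <-] := vK _ Bf; have [_ <-] := vK _ By; rewrite e1.
have u'A z : z ^+ k = v y -> A (u' z) /\ u (u' z) = z.
  by move=> /small/sd/u'K.
split.
  move=> x' [Ax' /(fA _ Ax')/small]; have [_ {2}<-] := uK _ Ax'; exact: eW.
exists (fun j => u' (zeta j)).
have zk j : zeta j ^+ k = v y by apply/zP; exists j.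
split.
  move=> i j /(congr1 u); have [_ ->] := u'A _ (zk i); have [_ ->] := u'A _ (zk j).
  exact: zI.
apply/seteqP; split.
  move=> _ [j _ <-]; have [Aj uj] := u'A _ (zk j); split=> //.
  by apply/(fA _ Aj); rewrite uj.
move=> x' [Ax' /(fA _ Ax')/zP[j uj]]; exists j => //.
by rewrite -uj; have [_ ->] := uK _ Ax'.
Qed.

Lemma ram1_section f x : ramification_index f x 1 ->
  exists (A : set X) (B : set (sphere R)) (g : sphere R -> X),
    [/\ open A /\ A x, open B /\ B (f x), {within B, continuous g},
        (forall x', A x' -> B (f x') /\ g (f x') = x')
      & (forall y, B y -> A (g y) /\ f (g y) = y)].
Proof.
move=> [A [B [u [v [[oA Ax [u' [cu cu' uK u'K]] ux] [oB Bx [v' [cv cv' vK v'K]] vx] h]]]]].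
have h1 x' : A x' -> B (f x') /\ v (f x') = u x' by move/h; rewrite expr1.
exists A, B, (u' \o v); split=> //.
- apply/subspace_continuousP => y By /=.
  have [dvy _] := vK _ By.
  have /subspace_continuousP/(_ _ dvy) c1 := cu'.
  have /subspace_continuousP/(_ _ By) c2 := cv.
  apply: cvg_comp c1 => P /= Pd; have := c2 _ Pd.
  apply: filterS2 (withinT B (nbhs_filter y)) => y' By'; apply; exact: (vK _ By').1.
- move=> x' Ax'; have [Bx' e] := h1 _ Ax'; split=> //=; rewrite e.
  by have [_ ->] := uK _ Ax'.
- move=> y By /=; have [dvy vyK] := vK _ By; have [Au uu] := u'K _ dvy.
  split=> //; have [Bf e] := h1 _ Au.
  by have [_ <-] := vK _ Bf; rewrite e uu.
Qed.

End Local.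
End Covering_03.
Import Covering_03.

(** * Trivialising a covering over the two open half-planes *)

Module Covering_04.
Section Cover.
Local Open Scope classical_set_scope.
Local Open Scope ring_scope.
Local Open Scope complex_scope.
Variable R : realType.
Local Notation re := (@complex.Re R).
Local Notation im := (@complex.Im R).

(** Infinity always counts as special. As the other special values are real, both open half-planes
    consist of generic values. *)
Definition special (xs : seq R) (y : sphere R) : bool :=
  if y is Some z then (im z == 0) && (re z \in xs) else true.

(** The common framework of three kinds of maps: Hurwitz coverings, the model built from
    permutations, and the power map z^k used to produce charts of the model. *)
Definition branched (xs : seq R) (d : nat) (X : topologicalType) (f : X -> sphere R) :=
  [/\ compact [set: X], hausdorff_space X, continuous f
    & forall y, exists s l,
        [/\ @numbered_fiber R X f y s l, sumn s = d & ~~ special xs y -> s = nseq d 1%N]].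

Definition face (e : bool) : set (plane R) :=
  [set z | if e then 0 < im z else im z < 0].

Variables (xs : seq R) (d : nat) (X : topologicalType) (f : X -> sphere R).
Hypothesis brf : branched xs d f.

Let cX : compact [set: X]. Proof. by case: brf. Qed.
Let hX : hausdorff_space X. Proof. by case: brf. Qed.
Let cf : continuous f. Proof. by case: brf. Qed.

Lemma generic_fiber y : ~~ special xs y -> exists l : 'I_d -> X,
  [/\ injective l, range l = f @^-1` [set y] & forall i, ramification_index f (l i) 1].
Proof.
case: brf => _ _ _ /(_ y) [s [l [nf _ +]]] ny => /(_ ny) sE; move: l nf; rewrite {}sE.
move=> l [lI lr lram]; have sz := size_nseq d 1%N.
exists (l \o cast_ord (esym sz)); split.
- by move=> i j /lI /cast_ord_inj.
- rewrite -lr; apply/seteqP; split=> [_ [i _ <-]|_ [i _ <-]]; first by exists (cast_ord (esym sz) i).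
  by exists (cast_ord sz i) => //=; rewrite cast_ordK.
- by move=> i; have := lram (cast_ord (esym sz) i); rewrite nth_nseq /= ltn_ord.
Qed.

(** Index 1 gives a local section through each point of the fibre; properness confines nearby fibres
    to disjoint neighbourhoods of these points, so no further sheet appears. *)
Lemma evenly_covered y : ~~ special xs y ->
  exists (N : set (sphere R)) (g : 'I_d -> sphere R -> X),
    [/\ open N /\ N y, forall i, {within N, continuous g i},
        forall i y', N y' -> f (g i y') = y',
        forall y', N y' -> injective (g^~ y')
      & forall x, N (f x) -> exists i, g i (f x) = x].
Proof.
move=> ny; have [l [lI lr lram]] := generic_fiber ny.
have fl i : f (l i) = y by have : (f @^-1` [set y]) (l i) by rewrite -lr; exists i.
have sec i : exists ABg : set X * set (sphere R) * (sphere R -> X),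
    [/\ open ABg.1.1 /\ ABg.1.1 (l i), open ABg.1.2 /\ ABg.1.2 y, {within ABg.1.2, continuous ABg.2},
        (forall x', ABg.1.1 x' -> ABg.1.2 (f x') /\ ABg.2 (f x') = x')
      & (forall y, ABg.1.2 y -> ABg.1.1 (ABg.2 y) /\ f (ABg.2 y) = y)].
  have [A [B [g [h1 h2 h3 h4 h5]]]] := ram1_section (lram i).
  by rewrite fl in h2; exists (A, B, g).
have [ABg hABg] := choice sec.
pose A i := (ABg i).1.1; pose B i := (ABg i).1.2; pose g i := (ABg i).2.
have [W [Wo Wd]] := finite_sep hX lI.
pose O := \bigcup_(i in [set: 'I_d]) (A i `&` W i).
have oO : open O.
  by apply: bigcup_open => i _; apply: openI; [case: (hABg i) => -[]|case: (Wo i)].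
have fO : f @^-1` [set y] `<=` O.
  rewrite -lr => _ [i _ <-]; exists i => //; split; [by case: (hABg i) => -[]|by case: (Wo i)].
have gN i : \forall y' \near y, B i y' /\ W i (g i y').
  case: (hABg i) => -[_ Al] [oB By] cg h1 h2.
  apply: filterI; first exact: open_nbhs_nbhs.
  have : g i @ nbhs y --> g i y.
    by have := cg; rewrite (continuous_open_subspace (g i) oB) => /(_ _ (mem_set By)).
  apply; have -> : g i y = l i by have [_] := h1 _ Al; rewrite fl.
  exact: open_nbhs_nbhs (Wo i).
have gNall : \forall y' \near y, forall i, B i y' /\ W i (g i y') by exact: (@near_forall _ _ y (fun i y0 => B i y0 /\ W i (g i y0)) gN).
pose N := [set y' | (forall i, B i y' /\ W i (g i y')) /\ f @^-1` [set y'] `<=` O].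
have nN : nbhs y N.
  by apply: filterI => //; apply: proper_near oO fO => //; exact: sphere_hausdorff.
have NS : interior N `<=` N by exact: interior_subset.
exists (interior N), g; split.
- by split; [exact: open_interior|].
- move=> i; case: (hABg i) => _ [oB _] cg _ _.
  by apply: continuous_subspaceW cg => z /NS [+ _] => /(_ i)[].
- by move=> i y' /NS [/(_ i) [By' _] _]; case: (hABg i) => _ _ _ _ /(_ _ By')[].
- move=> y' /NS [h _] i j /= e; apply: (Wd i j (g i y')); first by case: (h i).
  by rewrite e; case: (h j).
- move=> x /NS [_ /(_ x erefl) [i _ [Ax _]]]; exists i.
  by case: (hABg i) => _ _ _ /(_ _ Ax) [].
Qed.

Definition lift_on (A : set (plane R)) (s : plane R -> X) :=
  {within A, continuous s} /\ forall z, A z -> f (s z) = Some z.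

Definition triv (A : set (plane R)) (t : 'I_d -> plane R -> X) :=
  [/\ forall i, lift_on A (t i), forall z, A z -> injective (t^~ z)
    & forall z x, A z -> f x = Some z -> exists i, t i z = x].

Lemma lift_onS A B s : B `<=` A -> lift_on A s -> lift_on B s.
Proof.
by move=> BA [c h]; split=> [|z /BA/h//]; apply: continuous_subspaceW c.
Qed.

Lemma trivS A B t : B `<=` A -> triv A t -> triv B t.
Proof.
move=> BA [h1 h2 h3]; split=> [i|z /BA/h2//|z x /BA/h3 h /h//].
exact: lift_onS (h1 i).
Qed.

Lemma lift_neq A s s' z : lift_on A s -> lift_on A s' -> A z -> s z <> s' z ->
  \forall w \near z, A w -> s w <> s' w.
Proof.
move=> [/subspace_continuousP cs _] [/subspace_continuousP cs' _] Az ne.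
have [U [V [oU oV Us Vs UV]]] := hausdorff_sep hX ne.
have h1 : \forall w \near z, A w -> U (s w) by exact: cs z Az _ (open_nbhs_nbhs (conj oU Us)).
have h2 : \forall w \near z, A w -> V (s' w) by exact: cs' z Az _ (open_nbhs_nbhs (conj oV Vs)).
apply: near_imp (filterI h1 h2) => w /= [{}h1 {}h2] Aw e.
have : (U `&` V) (s w) by split; [exact: h1|rewrite e; exact: h2].
by rewrite UV.
Qed.

(** Near a point, the lift keeps away from all sheets but the one it meets there; hence meeting
    sheet [i] is locally constant. *)
Lemma lift_agree A t s i z0 : connected A -> triv A t -> lift_on A s -> A z0 ->
  s z0 = t i z0 -> forall z, A z -> s z = t i z.
Proof.
move=> cA [tl tI tS] sl Az0 e0; apply: connected_locally_const (z0) _ _ _ _ => //.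
move=> z Az; have [j tj] := tS z (s z) Az (sl.2 z Az).
have : \forall w \near z, forall k, k <> j -> A w -> s w <> t k w.
  apply: near_forall => k; have [->|/eqP ne] := eqVneq k j; first by apply: near_all => w /(_ erefl).
  have /(lift_neq sl (tl k) Az) : s z <> t k z by rewrite -tj => /(tI z Az)/esym.
  by apply: near_imp => w + _; apply.
apply: near_imp => w h Aw; have [j' tj'] := tS w (s w) Aw (sl.2 w Aw).
have jj : j' = j by apply: contrapT => /h/(_ Aw); rewrite tj'.
rewrite -tj -tj' jj; split=> [/(tI z Az) <-//|/(tI w Aw) <-//].
Qed.

(** On a connected overlap the two numberings of the sheets differ by a single permutation [p],
    which can be read at any one point. *)
Lemma triv_glue A B tA tB : closed A -> closed B -> connected (A `&` B) ->
  A `&` B !=set0 -> triv A tA -> triv B tB -> exists t, triv (A `|` B) t.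
Proof.
move=> clA clB cAB [z0 [Az0 Bz0]] hA hB.
have [Al AI AS] := hA; have [Bl BI BS] := hB.
have /choice[p pP] : forall i, exists j, tB j z0 = tA i z0.
  by move=> i; apply: BS => //; exact: (Al i).2.
have pI : injective p by move=> i j e; apply: (AI z0 Az0) => /=; rewrite -!pP e.
have agree i z : A z -> B z -> tA i z = tB (p i) z.
  move=> Az Bz; apply: (@lift_agree (A `&` B) tB (tA i) (p i) z0) => //.
    exact: trivS hB.
  exact: lift_onS (Al i).
pose t i z := if pselect (A z) then tA i z else tB (p i) z.
have tAE i z : A z -> t i z = tA i z by rewrite /t; case: pselect.
have tBE i z : B z -> t i z = tB (p i) z.
  by rewrite /t; case: pselect => // Az Bz; exact: agree.
exists t; split.
- move=> i; split; last first.
    by move=> z [Az|Bz]; [rewrite tAE //; exact: (Al i).2|rewrite tBE //; exact: (Bl _).2].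
  apply: withinU_continuous => //.
    by apply: within_eq (Al i).1 _ => z /tAE.
  by apply: within_eq (Bl (p i)).1 _ => z /tBE.
- move=> z [Az|Bz] i j /=; first by rewrite !tAE //; exact: AI.
  by rewrite !tBE // => /(BI z Bz)/pI.
- move=> z x [Az|Bz] fx.
    by have [i <-] := AS z x Az fx; exists i; rewrite tAE.
  have [j <-] := BS z x Bz fx; have [q _ qK] := injF_bij pI.
  by exists (q j); rewrite tBE // qK.
Qed.

Definition rect (a b c e : R) : set (plane R) := [set z | a <= re z <= b /\ c <= im z <= e].

Lemma rect_connected a b c e : connected (rect a b c e).
Proof.
apply: convex_connected => z w t [h1 h2] [h3 h4] ht; split=> /=; nra.
Qed.

(** Small rectangles are evenly covered. They are stacked into vertical strips and the strips are
    put side by side, each time by interval induction and gluing. *)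
Lemma triv_rect a b c e : a <= b -> c <= e ->
  (forall z, rect a b c e z -> ~~ special xs (Some z)) -> exists t, triv (rect a b c e) t.
Proof.
move=> ab ce ns.
have loc z : rect a b c e z -> exists2 r, 0 < r & forall x x' y y',
    re z - r < x -> x' < re z + r -> im z - r < y -> y' < im z + r ->
    exists t, triv (rect x x' y y') t.
  move=> /ns/evenly_covered[N [g [[oN Ny] gc fg gI gS]]].
  have /nbhs_sphere/nbhs_plane[r r0 rN] : nbhs (Some z : sphere R) N by apply: open_nbhs_nbhs.
  exists r => // x x' y y' h1 h2 h3 h4.
  have sub : rect x x' y y' `<=` Some @^-1` N.
    by move=> w [h5 h6]; apply: rN; rewrite ltr_distl; lra.
  exists (fun i => g i \o Some); split.
  - move=> i; split=> [|w /sub/fg]; last exact.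
    apply/subspace_continuousP => w /sub Nw /=.
    have c1 : g i @ nbhs (Some w : sphere R) --> g i (Some w).
      by have := gc i; rewrite (continuous_open_subspace (g i) oN) => /(_ _ (mem_set Nw)).
    move=> P /c1 hP; have hP' : \forall w' \near w, P (g i (Some w')) by exact: hP.
    by apply: near_imp hP' => w' + _.
  - by move=> w /sub/gI.
  - by move=> w x0 /sub Nw fx; have := gS x0; rewrite fx; apply.
(* The inductive statement carries a width [r] around the abscissa [t]: each stacking keeps only the
   smaller of the two widths. *)
have vert t : a <= t <= b -> exists2 r, 0 < r & forall x x',
    a <= x -> x <= x' -> x' <= b -> t - r < x -> x' < t + r -> exists s, triv (rect x x' c e) s.
  move=> ht.
  apply: (@interval_induction R (fun c e => exists2 r, 0 < r & forall x x',
    a <= x -> x <= x' -> x' <= b -> t - r < x -> x' < t + r -> exists s, triv (rect x x' c e) s) c e) => //.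
    move=> y1 y2 y3 h12 h23 [r1 r10 hr1] [r2 r20 hr2].
    exists (Num.min r1 r2); first by rewrite lt_min r10.
    move=> x x' ax xx' xb h1 h2.
    have m1 : Num.min r1 r2 <= r1 by rewrite ge_min lexx.
    have m2 : Num.min r1 r2 <= r2 by rewrite ge_min lexx orbT.
    have [||s1 t1] := hr1 x x' ax xx' xb; [lra|lra|].
    have [||s2 t2] := hr2 x x' ax xx' xb; [lra|lra|].
    have -> : rect x x' y1 y3 = rect x x' y1 y2 `|` rect x x' y2 y3.
      apply/seteqP; split=> [w [h3 h4]|w [[h3 h4]|[h3 h4]]]; try by split=> //; lra.
      by case: (leP (im w) y2) => h5; [left|right]; split=> //; lra.
    have E : rect x x' y1 y2 `&` rect x x' y2 y3 = rect x x' y2 y2.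
      apply/seteqP; split=> [w [[h3 h4] [h5 h6]]|w [h3 h4]]; first by split=> //; lra.
      by split; split=> //; lra.
    apply: triv_glue t1 t2; try exact: closed_box.
      by rewrite E; exact: rect_connected.
    by rewrite E; exists (x +i* y2); split=> /=; lra.
  move=> y hy; have [//|r r0 hr] := loc (t +i* y); exists r => // y1 y2 h1 h2 h3 h4 h5.
  by exists r => // x x' h6 h7 h8 h9 h10; apply: hr.
apply: (@interval_induction R (fun x x' => exists s, triv (rect x x' c e) s) a b) => //.
move=> x1 x2 x3 h12 h23 [s1 t1] [s2 t2].
have -> : rect x1 x3 c e = rect x1 x2 c e `|` rect x2 x3 c e.
  apply/seteqP; split=> [w [h3 h4]|w [[h3 h4]|[h3 h4]]]; try by split=> //; lra.
  by case: (leP (re w) x2) => h5; [left|right]; split=> //; lra.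
have E : rect x1 x2 c e `&` rect x2 x3 c e = rect x2 x2 c e.
  apply/seteqP; split=> [w [[h3 h4] [h5 h6]]|w [h3 h4]]; first by split=> //; lra.
  by split; split=> //; lra.
apply: triv_glue t1 t2; try exact: closed_box.
  by rewrite E; exact: rect_connected.
by rewrite E; exists (x2 +i* c); split=> /=; lra.
Qed.

(** The sheets over each [K n] are renumbered by [p] to agree at [z0] with those over [K 0].
    Uniqueness of lifts then makes them agree on overlaps, so any [n] with [z] in the interior of
    [K n] gives the same value. *)
Lemma triv_exhaust (K : nat -> set (plane R)) A z0 :
  (forall n, exists t, triv (K n) t) -> (forall n, connected (K n)) ->
  (forall n, K n `<=` K n.+1) -> (forall n, K n `<=` A) -> K 0%N z0 ->
  (forall z, A z -> exists n, nbhs z (K n)) -> exists t, triv A t.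
Proof.
move=> /choice[t tP] Kc KS KA K0 Kn.
have Kmono m n : (m <= n)%N -> K m `<=` K n.
  by move=> /subnK <-; elim: (n - m)%N => //= k h z /h; rewrite addSn; exact: KS.
have Kz n : K n z0 by apply: (Kmono 0%N).
have /choice[p pP] : forall ni : nat * 'I_d, exists j, t ni.1 j z0 = t 0%N ni.2 z0.
  move=> [n i]; have [_ _ h] := tP n; apply: h => //.
  by have [h _ _] := tP 0%N; exact: (h i).2.
have agree m n i z : (m <= n)%N -> K m z -> t m (p (m, i)) z = t n (p (n, i)) z.
  move=> mn Kmz; apply: (@lift_agree (K m) (t n) _ _ z0) => //.
  - exact: trivS (Kmono _ _ mn) (tP n).
  - by have [h _ _] := tP m; exact: h.
  - by rewrite (pP (m, i)) (pP (n, i)).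
have pI n : injective (fun i => p (n, i)).
  move=> i j e; have [_ h _] := tP 0%N; apply: (h z0 K0) => /=.
  by rewrite -(pP (n, i)) -(pP (n, j)) /= e.
have /choice[nz nzP] : forall z, exists n, A z -> nbhs z (K n).
  by move=> z; have [/Kn[n ?]|?] := pselect (A z); [exists n|exists 0%N].
have inK z : A z -> K (nz z) z by move=> /nzP/nbhs_singleton.
pose s i z := t (nz z) (p (nz z, i)) z.
have sE n i z : A z -> K n z -> s i z = t n (p (n, i)) z.
  move=> Az Knz; have [h|h] := leqP (nz z) n; first exact/agree/inK.
  by rewrite (agree n (nz z)) // ltnW.
exists s; split.
- move=> i; split; last first.
    by move=> z Az; have [h _ _] := tP (nz z); rewrite /s (h _).2 //; exact: inK.
  apply/withinP => z Az P; have [h _ _] := tP (nz z).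
  have /withinP/(_ z (inK _ Az) P) c := (h (p (nz z, i))).1.
  move=> /c hP; apply: near_imp (filterI hP (nzP _ Az)) => w [h1 h2] Aw.
  by rewrite (sE _ _ _ Aw h2); exact: h1.
- move=> z Az i j; rewrite /s => e; have [_ h _] := tP (nz z).
  exact: pI _ _ _ (h z (inK _ Az) _ _ e).
- move=> z x Az fx; have [_ _ h] := tP (nz z); have [j <-] := h z x (inK _ Az) fx.
  by have [q _ qK] := injF_bij (pI (nz z)); exists (q j); rewrite /s qK.
Qed.

Lemma triv_face e : exists t, triv (face e) t.
Proof.
(* The half-plane is exhausted by rectangles of half-width [u n] between the heights [v n] and
   [u n], up to sign; [u] grows without bound and [v] tends to 0. *)
have [u [v [v0 vu [uS vS] [u1 v1] lim]]] : exists u v : nat -> R,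
  [/\ forall n, 0 < v n, forall n, v n <= u n,
      (forall n, u n <= u n.+1) /\ (forall n, v n.+1 <= v n), 1 <= u 0%N /\ v 0%N <= 1
    & forall M y, 0 < y -> exists n, M < u n /\ v n < y].
  exists (fun n => n.+1%:R), (fun n => n.+1%:R^-1); split=> [n|n||//|M y y0].
  - by rewrite invr_gt0.
  - by apply: (@le_trans _ _ 1); rewrite ?invf_le1 ?ler1n.
  - by split=> n; rewrite ?lef_pV2 ?posrE // ler_nat.
  - by rewrite invr1.
  - exists (Num.truncn (`|M| + y^-1)).
    have h := truncnS_gt (`|M| + y^-1); have iy : 0 < y^-1 by rewrite invr_gt0.
    split; first by apply: le_lt_trans h; rewrite (le_trans (ler_norm M)) // lerDl ltW.
    by rewrite invf_plt ?posrE //; apply: le_lt_trans h; rewrite lerDr.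
pose K n := rect (- u n) (u n) (if e then v n else - u n) (if e then u n else - v n).
have Kf n : K n `<=` face e.
  by move=> z [_]; rewrite /face /=; have := v0 n; case: (e) => /=; lra.
apply: (@triv_exhaust K _ (if e then 'i else - 'i)) => //.
- move=> n; have := v0 n; have := vu n => h1 h2; apply: triv_rect.
  + by lra.
  + by case: (e); lra.
  + move=> z /Kf; rewrite /face /special /= negb_and => h.
    by apply/orP; left; apply/eqP; case: (e) h; lra.
- by move=> n; exact: rect_connected.
- move=> n z [h1 h2]; have := uS n; have := vS n => h3 h4.
  by split; [lra|case: (e) h2; lra].
- split; first by case: (e) => /=; rewrite ?oppr0; lra.
  by case: (e) => /=; lra.
- move=> z fz.
  have iz : 0 < `|im z| by rewrite normr_gt0; apply/eqP; move: fz; rewrite /face /=; case: (e); lra.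
  have [n [h1 h2]] := lim (`|re z| + `|im z| + 1) _ iz; exists n.
  have [g1 g2] : `|re z| < u n - 1 /\ `|im z| < u n - 1.
    by have := normr_ge0 (re z); split; lra.
  pose r := Num.min 1 (`|im z| - v n).
  have rp : 0 < r by rewrite lt_min ltr01 subr_gt0.
  have [r1 r2] : r <= 1 /\ r <= `|im z| - v n by split; rewrite ge_min lexx ?orbT.
  apply/nbhs_plane; exists r => // w; rewrite !ltr_distl => h3 h4.
  move: g1 g2; rewrite !ltr_norml => g1 g2; split; first lra.
  move: fz r2; rewrite /face /=; case: (e) => s; rewrite ?(gtr0_norm s) ?(ltr0_norm s); lra.
Qed.

End Cover.
End Covering_04.
Import Covering_04.

(** * Closed half-planes and connected neighbourhoods *)

Module Covering_05.
Section PlaneSets.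
Local Open Scope classical_set_scope.
Local Open Scope ring_scope.
Local Open Scope complex_scope.
Variable R : realType.
Local Notation re := (@complex.Re R).
Local Notation im := (@complex.Im R).

(** The closure of a half-plane in the sphere; infinity belongs to both. *)
Definition cface (e : bool) : set (sphere R) :=
  [set y | if y is Some z then (if e then 0 <= im z else im z <= 0) else True].

Lemma conv_gt (t a b c : R) : 0 <= t <= 1 -> c < a -> c < b -> c < (1 - t) * a + t * b.
Proof.
move=> /andP[t0 t1] ca cb; rewrite -subr_gt0.
have -> : (1 - t) * a + t * b - c = (1 - t) * (a - c) + t * (b - c) by ring.
have h1 : 0 <= (1 - t) * (a - c) by rewrite mulr_ge0; lra.
move: t0; rewrite le_eqVlt => /orP[/eqP <-|t0]; first by rewrite subr0 mul1r mul0r; lra.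
by have h2 : 0 < t * (b - c); [rewrite mulr_gt0 ?subr_gt0|lra].
Qed.

Lemma conv_lt (t a b c : R) : 0 <= t <= 1 -> a < c -> b < c -> (1 - t) * a + t * b < c.
Proof.
move=> ht ca cb; have := @conv_gt t (- a) (- b) (- c) ht; rewrite !ltrN2 => /(_ ca cb).
by rewrite !mulrN -opprD ltrN2.
Qed.

Lemma face_conv e (w w' : plane R) (t : R) : 0 <= t <= 1 -> face e w -> face e w' ->
  face e (((1 - t) * re w + t * re w') +i* ((1 - t) * im w + t * im w')).
Proof. by rewrite /face /=; case: e; [exact: conv_gt|exact: conv_lt]. Qed.

Lemma closed_cface e : closed (cface e).
Proof.
move=> [z|//] cl; rewrite /cface /=.
apply: contrapT => h.
pose r := `|im z|.
have r0 : 0 < r by rewrite normr_gt0; apply/eqP => iz; apply: h; rewrite iz; case: (e).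
have : nbhs (Some z : sphere R) [set y | ~ cface e y].
  apply/nbhs_sphere/nbhs_plane; exists r => // w _; rewrite /cface /= ltr_distl /r.
  move: h; case: (e) => h.
    by rewrite ltr0_norm; lra.
  by rewrite gtr0_norm; lra.
by move=> /cl [y []].
Qed.

Lemma face_near e y (N : set (sphere R)) : cface e y -> nbhs y N ->
  exists z, [/\ face e z, N (Some z) & Some z <> y].
Proof.
case: y => [z|] cy.
  move=> /nbhs_sphere/nbhs_plane[r r0 h].
  have hr : 0 < r / 2 < r by lra.
  exists (re z +i* (if e then im z + r / 2 else im z - r / 2)); split.
  - by move: cy; rewrite /face /cface /=; case: (e); lra.
  - apply: h => /=; first by rewrite subrr normr0.
    by case: (e); rewrite ltr_norml; lra.
  - by case: z {cy h} => a b [] /=; case: (e); lra.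
move=> /nbhs_infty[_ [M hM]].
exists (0 +i* (if e then `|M| + 1 else - (`|M| + 1))); split=> //.
  by rewrite /face /=; have := normr_ge0 M; case: (e); lra.
apply: hM; right => /=; have := ler_norm M; have := normr_ge0 M; case: (e).
  by move=> h1 h2; rewrite ger0_norm; lra.
by move=> h1 h2; rewrite normrN ger0_norm; lra.
Qed.

(** A half-plane is locally connected along its boundary. At a finite value a half-box is convex; at
    infinity the exterior of a box is the union of three convex pieces, the middle one [P1] meeting
    both others. *)
Lemma face_connected_nbhs e y (N : set (sphere R)) : cface e y -> nbhs y N ->
  exists P : set (plane R), [/\ connected P, P `<=` face e, (forall z, P z -> N (Some z))
    & \forall y' \near y, forall z, y' = Some z -> face e z -> P z].
Proof.
case: y => [z|] cy.
  move=> /nbhs_sphere/nbhs_plane[r r0 h].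
  exists [set w | face e w /\ (`|re w - re z| < r /\ `|im w - im z| < r)]; split.
  - apply: convex_connected => w w' t /= [f1 +] [f2 +]; rewrite !ltr_distl => h1 h2 h3.
    split; first exact: face_conv.
    by case: h1 h2 => /andP[? ?] /andP[? ?] [/andP[? ?] /andP[? ?]];
      split; rewrite conv_gt ?conv_lt.
  - by move=> w [].
  - by move=> w [_ [h1 h2]]; apply: h.
  - apply/nbhs_sphere/nbhs_plane; exists r => // w h1 h2 z' [<-] fw.
    by split.
move=> /nbhs_infty[_ [M' hM']].
have [M [M0 hM]] : exists M, 0 < M /\ (forall w : R[i], M < `|re w| \/ M < `|im w| -> N (Some w)).
  exists (`|M'| + 1); split=> [|w hw]; first by rewrite ltr_pwDr.
  apply: hM'; have := ler_norm M'; case: hw => hw; [left|right]; lra.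
pose P1 : set (plane R) := [set w | face e w /\ M < `|im w|].
pose P2 : set (plane R) := [set w | face e w /\ M < re w].
pose P3 : set (plane R) := [set w | face e w /\ re w < - M].
exists (P1 `|` P2 `|` P3); split.
- have cP1 : connected P1.
    apply: convex_connected => w w' t [f1 h1] [f2 h2] h3.
    split; first exact: face_conv.
    move: f1 h1 f2 h2; rewrite /face /=; case: (e) => f1 + f2.
      by rewrite (gtr0_norm f1) (gtr0_norm f2) (gtr0_norm (conv_gt h3 f1 f2)); exact: conv_gt.
    rewrite (ltr0_norm f1) (ltr0_norm f2) (ltr0_norm (conv_lt h3 f1 f2)) !(ltrNr M).
    exact: conv_lt.
  have cP2 : connected P2.
    apply: convex_connected => w w' t [f1 h1] [f2 h2] h3.
    by split; [exact: face_conv|exact: conv_gt].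
  have cP3 : connected P3.
    apply: convex_connected => w w' t [f1 h1] [f2 h2] h3.
    by split; [exact: face_conv|exact: conv_lt].
  have hq s : face e (s +i* (if e then M + 1 else - (M + 1))) /\ M < `|if e then M + 1 else - (M + 1)|.
    rewrite /face /=; case: (e); first by rewrite gtr0_norm; lra.
    by rewrite normrN gtr0_norm; lra.
  apply: connectedU => //.
    exists ((- (M + 1)) +i* (if e then M + 1 else - (M + 1))); have [h1 h2] := hq (- (M + 1)).
    by split; [left; split|split=> //=; lra].
  apply: connectedU => //.
  exists ((M + 1) +i* (if e then M + 1 else - (M + 1))); have [h1 h2] := hq (M + 1).
  by split; split=> //=; lra.
- by move=> w [[]|] [].
- move=> w hw; apply: hM; case: hw => [[[_ h]|[_ h]]|[_ h]]; first by right.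
    by left; rewrite gtr0_norm; lra.
  by left; rewrite ltr0_norm; lra.
- apply/nbhs_infty; split=> //; exists M => w hw z [<-] fw.
  case: hw => [|h]; last by do 2 left.
  by rewrite lter_normr => /orP[h|h]; [left; right|right]; split=> //; lra.
Qed.

(** Four convex half-boxes, one for each sign of each coordinate, cover the punctured box, and
    neighbouring ones meet. *)
Lemma punctured_box_connected (r : R) : 0 < r ->
  connected [set z : plane R | (`|re z| < r /\ `|im z| < r) /\ (re z != 0) || (im z != 0)].
Proof.
move=> r0.
pose B (g : plane R -> R) : set (plane R) := [set z | (`|re z| < r /\ `|im z| < r) /\ 0 < g z].
have cB g (a b : R) : (forall z, g z = a * re z + b * im z) -> connected (B g).
  move=> gE; apply: convex_connected => w w' t [[h1 h2] h3] [[h4 h5] h6] ht.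
  move: h1 h2 h3 h4 h5 h6; rewrite /B /= !gE /= !ltr_norml.
  move=> /andP[? ?] /andP[? ?] h3 /andP[? ?] /andP[? ?] h6.
  split; first by split; rewrite conv_gt ?conv_lt.
  have -> : a * ((1 - t) * re w + t * re w') + b * ((1 - t) * im w + t * im w') =
    (1 - t) * (a * re w + b * im w) + t * (a * re w' + b * im w') by ring.
  exact: conv_gt.
have -> : [set z : plane R | (`|re z| < r /\ `|im z| < r) /\ (re z != 0) || (im z != 0)] =
    (B re `|` B im) `|` (B (fun z => - re z) `|` B (fun z => - im z)).
  apply/seteqP; split=> z.
    move=> [h]; case: (ltgtP (re z) 0) => [h1|h1|h1] /= h2.
    - by right; left; split=> //; rewrite oppr_gt0.
    - by left; left.
    - case: (ltgtP (im z) 0) h2 => //= h2 _; last by left; right.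
      by right; right; split=> //; rewrite oppr_gt0.
  case=> [[]|[]] [h1 h2]; split=> //; apply/orP.
  - by left; rewrite gt_eqF.
  - by right; rewrite gt_eqF.
  - by left; rewrite lt_eqF // -oppr_gt0.
  - by right; rewrite lt_eqF // -oppr_gt0.
have c2 : 0 < r / 2 < r by lra.
have nr (s : R) : s = r / 2 \/ s = - (r / 2) -> `|s| < r.
  by case=> ->; rewrite ?normrN gtr0_norm; lra.
apply: connectedU.
- exists ((- (r / 2)) +i* (r / 2)); split; [right|left]; split=> /=; try (split; apply: nr; tauto); lra.
- apply: connectedU.
  + exists ((r / 2) +i* (r / 2)); split; split=> /=; try (split; apply: nr; tauto); lra.
  + by apply: (cB _ 1 0) => z; lra.
  + by apply: (cB _ 0 1) => z; lra.
- apply: connectedU.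
  + exists ((- (r / 2)) +i* (- (r / 2))); split; split=> /=; try (split; apply: nr; tauto); lra.
  + by apply: (cB _ (-1) 0) => z; lra.
  + by apply: (cB _ 0 (-1)) => z; lra.
Qed.

Lemma punctured_nbhs_connected (X : topologicalType) (f : X -> sphere R) x k :
  ramification_index f x k -> forall W, nbhs x W ->
  exists V, [/\ nbhs x V, V `<=` W & connected (V `\ x)].
Proof.
move=> [A [B [u [v [[oA Ax [u' [cu cu' uK u'K]] ux] _ _]]]]] W Wx.
have u'0 : u' 0 = x by have [_] := uK _ Ax; rewrite ux.
have d0 : @disc R 0 by rewrite /disc /= normr0.
have h1 : \forall z \near (0 : plane R), @disc R z -> W (u' z).
  by move/withinP: cu' => /(_ 0 d0 W); rewrite u'0; apply.
have h2 : \forall z \near (0 : plane R), @disc R z.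
  by apply/nbhs_ballP; exists 1 => //= z; rewrite -ball_normE /= sub0r normrN.
have h3 : nbhs (0 : plane R) [set z | (@disc R z -> W (u' z)) /\ @disc R z] by exact: filterI.
move/nbhs_plane: h3 => [r r0 hr].
pose Q := [set z : plane R | `|re z| < r /\ `|im z| < r].
have Qd z : Q z -> @disc R z /\ W (u' z).
  by move=> [q1 q2]; have [] := hr z; rewrite /= ?subr0 // => h3 h4; split=> //; exact: h3.
exists (A `&` u @^-1` Q); split.
- have nA : nbhs x A by apply: open_nbhs_nbhs.
  apply: filterI => //.
  have /(_ Q) : u @ nbhs x --> (u x : plane R).
    by have := cu; rewrite (continuous_open_subspace u oA) => /(_ _ (mem_set Ax)).
  by apply; rewrite ux; apply/nbhs_plane; exists r => // w; rewrite /= !subr0.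
- by move=> x' [Ax' /= /Qd[_]]; have [_ ->] := uK _ Ax'.
- have -> : (A `&` u @^-1` Q) `\ x = u' @` [set z | (`|re z| < r /\ `|im z| < r) /\ (re z != 0) || (im z != 0)].
    apply/seteqP; split=> [x' [[Ax' Qx] nx]|_ [z [qz nz] <-]].
      exists (u x'); last by have [] := uK _ Ax'.
      split=> //; rewrite -negb_and; apply/negP => /andP[/eqP e1 /eqP e2]; apply: nx.
      have [_ <-] := uK _ Ax'; rewrite -u'0; congr u'; apply/eqP.
      by rewrite eq_complex /= e1 e2 !eqxx.
    have [dz _] := Qd z qz; have [Az uz] := u'K _ dz.
    split; first by split=> //=; rewrite uz.
    move=> e; have : z = 0 by rewrite -uz e ux.
    by move=> z0; move: nz; rewrite z0 /= eqxx.
  have := @connected_continuous_connected _ _ _ u' (punctured_box_connected r0); apply.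
  by apply: continuous_subspaceW cu' => z [/Qd[]].
Qed.

End PlaneSets.
End Covering_05.
Import Covering_05.

(** * Labelling the points of a covering by the sheets that reach them *)

Module Covering_06.
Section Labelling.
Local Open Scope classical_set_scope.
Local Open Scope ring_scope.
Local Open Scope complex_scope.
Variable R : realType.
Local Notation re := (@complex.Re R).
Local Notation im := (@complex.Im R).

(** [C x] stands for the set of pairs (half-plane, sheet) whose closure contains [x]. The fields
    isolate what is needed of it, so that the label sets of the permutation model can be treated on
    the same footing. Together with its value, any one label determines a point. *)
Record labelling (d : nat) (X : topologicalType) (f : X -> sphere R)
    (C : X -> {set bool * 'I_d}) : Prop := Labelling {
  lab_near : forall x, \forall x' \near x, C x' \subset C x;
  lab_inj : forall x x' l, f x = f x' -> l \in C x -> l \in C x' -> x = x';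
  lab_ex : forall y e i, cface e y -> exists x, f x = y /\ (e, i) \in C x;
  lab_cface : forall x e i, (e, i) \in C x -> cface e (f x);
  lab_card : forall x k e, ramification_index f x k -> cface e (f x) ->
    #|[set i | (e, i) \in C x]%SET| = k;
  lab_dense : forall x e i (W : set X), (e, i) \in C x -> nbhs x W ->
    exists x', [/\ W x', x' <> x, (exists2 z, f x' = Some z & face e z) & (e, i) \in C x'] }.

(** Connectedness of small punctured neighbourhoods in terms of labels: the labels at [x] cannot be
    split into two families that stay apart near [x]. It forces the labels of a point to form one
    cycle of the monodromy and not a union of several. *)
Definition lab_connected (d : nat) (X : topologicalType) (C : X -> {set bool * 'I_d}) :=
  forall x (D : {set bool * 'I_d}), D \subset C x -> D != finset.set0 ->
    (\forall x' \near x, x' <> x -> (C x' \subset D) \/ (C x' \subset finset.setC D)) ->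
    D = C x.

Variables (xs : seq R) (d : nat) (X : topologicalType) (f : X -> sphere R).
Hypothesis brf : branched xs d f.

Let cX : compact [set: X]. Proof. by case: brf. Qed.
Let hX : hausdorff_space X. Proof. by case: brf. Qed.
Let cf : continuous f. Proof. by case: brf. Qed.

Lemma branched_ram x : exists2 k, ramification_index f x k & (0 < k)%N.
Proof.
case: brf => _ _ _ /(_ (f x)) [s [l [[_ lr lram] _ _]]].
have [j _ <-] : (range l) x by rewrite lr.
by have := lram j; exists (nth 0%N s j) => //; exact: ram_gt0 (lram j).
Qed.

Lemma fiber_neighborhoods y : exists (n : nat) (l : 'I_n -> X) (W : 'I_n -> set X),
  [/\ range l = f @^-1` [set y], (forall j, open (W j) /\ W j (l j)),
      (forall i j x, W i x -> W j x -> i = j)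
    & \forall y' \near y, forall x, f x = y' -> exists j, W j x].
Proof.
case: brf => _ _ _ /(_ y) [s [l [[lI lr lram] _ _]]].
have [W [Wo Wd]] := finite_sep hX lI.
exists (size s), l, W; split=> //.
have oW : open (\bigcup_(j in [set: 'I_(size s)]) W j).
  by apply: bigcup_open => j _; case: (Wo j).
have sub : f @^-1` [set y] `<=` \bigcup_(j in [set: 'I_(size s)]) W j.
  by rewrite -lr => _ [j _ <-]; exists j => //; case: (Wo j).
have := proper_near cX (@sphere_hausdorff R) cf oW sub.
by apply: near_imp => y' h x fx; have [j _ Wx] := h x fx; exists j.
Qed.

Section Sheets.
Variable t : bool -> 'I_d -> plane R -> X.
Hypothesis tP : forall e, triv f (face e) (t e).

Let tl e i z : face e z -> f (t e i z) = Some z.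
Proof. by have [h _ _] := tP e; exact: (h i).2. Qed.

Definition sheet (l : bool * 'I_d) : set X := closure (t l.1 l.2 @` face l.1).
Definition labels x : {set bool * 'I_d} := [set l | `[< sheet l x >]]%SET.

Lemma in_labels l x : (l \in labels x) <-> sheet l x.
Proof. by rewrite inE; split=> /asboolP. Qed.

Let face_in_sheet e i z : face e z -> sheet (e, i) (t e i z).
Proof. by move=> fz; apply: subset_closure; exists z. Qed.

Let sheet_cface e i x : sheet (e, i) x -> cface e (f x).
Proof.
have : closed (f @^-1` cface e).
  by apply: preimage_closed => //; exact: closed_cface.
move=> cl sx; apply: cl; apply: closureS sx => _ [z fz <-] /=.
by rewrite tl // /cface /=; move: fz; rewrite /face /=; case: (e) => /ltW.
Qed.

Let sheet_ex y e i : cface e y -> exists x, f x = y /\ sheet (e, i) x.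
Proof.
move=> cy; have cl : closed (f @` sheet (e, i)).
  apply: compact_closed; first exact: sphere_hausdorff.
  apply: continuous_compact; first exact: continuous_subspaceT.
  by apply: subclosed_compact cX _ => //; exact: closed_closure.
have [x sx fx] : (f @` sheet (e, i)) y; last by exists x.
apply: cl => N nN; have [z [fz Nz _]] := face_near cy nN.
exists (Some z); split=> //; exists (t e i z); [exact: face_in_sheet|exact: tl].
Qed.

(* Near y all the points of a sheet lie in a single one of the disjoint
   neighbourhoods of the fibre, because the face is locally connected at its
   boundary. *)
Let sheet_nbhs y e i n (W : 'I_n -> set X) : cface e y -> (forall j, open (W j)) ->
  (forall i j x, W i x -> W j x -> i = j) ->
  (\forall y' \near y, forall x, f x = y' -> exists j, W j x) ->
  exists j, (\forall y' \near y, forall z, y' = Some z -> face e z -> W j (t e i z)).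
Proof.
move=> cy Wo Wd hN.
have [P [cP Pf PN nP]] := face_connected_nbhs cy hN.
have [z0 [fz0 Pz0 _]] := face_near cy nP.
have {}Pz0 : P z0 by exact: Pz0.
have [j Wj] := PN z0 Pz0 (t e i z0) (tl i fz0).
exists j; apply: near_imp nP => y' h z yz fz; have {h} Pz := h z yz fz.
have [/(_ i) [/withinP c _] _ _] := tP e.
apply: (@connected_locally_const _ P (fun z => W j (t e i z)) z0) => // w Pw.
have [j' Wj'] := PN w Pw (t e i w) (tl i (Pf _ Pw)).
have nW : nbhs (t e i w) (W j') by apply: open_nbhs_nbhs.
apply: near_imp (c w (Pf _ Pw) _ nW) => w' h Pw'; have {}h := h (Pf _ Pw').
by split=> h'; [have <- := Wd _ _ _ Wj' h'|have <- := Wd _ _ _ h h'].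
Qed.

Let sheet_in y e i n (l : 'I_n -> X) (W : 'I_n -> set X) j j' : cface e y ->
  (forall j, open (W j) /\ W j (l j)) -> (forall i j x, W i x -> W j x -> i = j) ->
  f (l j') = y -> sheet (e, i) (l j') ->
  (\forall y' \near y, forall z, y' = Some z -> face e z -> W j (t e i z)) -> j' = j.
Proof.
move=> cy Wo Wd fl sl hj.
have nW : nbhs (l j') (W j') by apply: open_nbhs_nbhs; exact: Wo.
have nf : nbhs (l j') (f @^-1` [set y' | forall z, y' = Some z -> face e z -> W j (t e i z)]).
  by apply: (@cf (l j')); rewrite fl.
have [_ [[z fz <-] [h1 h2]]] := sl _ (filterI nW nf).
by apply: Wd h1 _; apply: h2 => //; exact: tl.
Qed.

(** Near the common value the sheet stays in one of the disjoint neighbourhoods of the fibre, hence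
    it has only one limit there. *)
Let sheet_inj x x' l : f x = f x' -> sheet l x -> sheet l x' -> x = x'.
Proof.
case: l => e i fx sx sx'; have cy := sheet_cface sx.
have [n [l [W [lr Wo Wd hN]]]] := fiber_neighborhoods (f x).
have [j Wj] := sheet_nbhs i cy (fun j => (Wo j).1) Wd hN.
have [a _ ax] : range l x by rewrite lr.
have [a' _ ax'] : range l x' by rewrite lr /= fx.
rewrite -ax -ax'; rewrite -ax in sx; rewrite -ax' in sx'.
by rewrite (sheet_in cy Wo Wd _ sx Wj) ?ax // (sheet_in cy Wo Wd _ sx' Wj) // ax'.
Qed.

Let sheet_dense x e i W : sheet (e, i) x -> nbhs x W ->
  exists x', [/\ W x', x' <> x, (exists2 z, f x' = Some z & face e z) & sheet (e, i) x'].
Proof.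
move=> sx Wx; have [_ [[z fz <-] Wz]] := sx _ (nbhs_interior Wx).
have [tx|ne] := pselect (t e i z = x); last first.
  exists (t e i z); split=> //; first exact: nbhs_singleton.
    by exists z => //; exact: tl.
  exact: face_in_sheet.
have [/(_ i) [/withinP c _] _ _] := tP e.
(* The point found on the sheet may be [x] itself; another point of the same sheet, over a value
   close to [z], is then used. *)
have nz : nbhs (Some z : sphere R) (Some @` [set w | face e w -> W (t e i w)]).
  by apply: one_point_compactification_some_nbhs; exact: c.
have cz : cface e (Some z) by rewrite -(tl i fz); apply/sheet_cface/face_in_sheet.
have [z' [fz' [w hw [ww]] ne]] := face_near cz nz.
rewrite ww in hw; exists (t e i z'); split.
- exact: hw.
- by rewrite -tx => /(congr1 f); rewrite !tl // => /ne.
- by exists z' => //; exact: tl.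
- exact: face_in_sheet.
Qed.

(** At a value [z] of the half-plane close to [f x], the sheets reaching [x] are exactly those whose
    value at [z] lies in the chart domain of [x], and the fibre over [z] has [k] points there. *)
Let sheet_card x k e : ramification_index f x k -> cface e (f x) ->
  #|[set i | `[< sheet (e, i) x >]]%SET| = k.
Proof.
move=> rx cy; have [A [oA Ax] hA] := ram_local rx.
have [n [l [W [lr Wo Wd hN]]]] := fiber_neighborhoods (f x).
have [a _ ax] : range l x by rewrite lr.
have nWa : nbhs x (W a) by rewrite -ax; apply: open_nbhs_nbhs; exact: Wo.
have /choice[j jP] i := sheet_nbhs i cy (fun j => (Wo j).1) Wd hN.
have n1 := hA _ nWa.
have n2 : \forall y' \near f x, W a `&` f @^-1` [set y'] `<=` A.
  (* Membership in [A] is demanded only inside [W a], so that [O] still contains the whole fibre. *)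
  pose O := \bigcup_(j in [set: 'I_n]) (W j `&` [set x | j = a -> A x]).
  have oO : open O.
    apply: bigcup_open => j' _; have [->|/eqP ne] := eqVneq j' a.
      have -> : [set x | a = a -> A x] = A.
        by apply/seteqP; split=> x'; [exact|move=> h _].
      by apply: openI => //; case: (Wo a).
    have -> : [set x | j' = a -> A x] = setT by apply/seteqP; split=> // x' _ /ne.
    by rewrite setIT; case: (Wo j').
  have fO : f @^-1` [set f x] `<=` O.
    rewrite -lr => _ [j' _ <-]; exists j' => //; split; first by case: (Wo j').
    by move=> /= ->; rewrite ax.
  apply: near_imp (proper_near cX (@sphere_hausdorff R) cf oO fO) => y' h x' [Wx' fx'].
  by have [j' _ [Wj' hj']] := h _ fx'; apply: hj'; exact: Wd Wj' Wx'.
have n3 : \forall y' \near f x, forall i z, y' = Some z -> face e z -> W (j i) (t e i z).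
  have := @near_forall (sphere R) 'I_d (f x) (fun i y' => forall z, y' = Some z -> face e z -> W (j i) (t e i z)) jP.
  by apply: near_imp => y' h i; exact: h.
have [z [fz [[h1 h2] h3] nez]] := face_near cy (filterI (filterI n1 n2) n3).
have {h1} [h1 [g [gI gr]]] := h1 nez.
have sh i : sheet (e, i) x <-> W a (t e i z).
  have [x0 [fx0 sx0]] := sheet_ex i cy.
  have [b _ bx] : range l x0 by rewrite lr.
  rewrite -bx in fx0 sx0; have jb := sheet_in cy Wo Wd fx0 sx0 (jP i).
  split=> [sx|Wz].
    have -> : a = j i by apply: (sheet_in cy Wo Wd _ _ (jP i)); rewrite ax.
    exact: h3.
  have : a = b by rewrite jb; apply: Wd Wz _; apply: h3.
  by move=> ab; rewrite -ax ab.
have shA i : sheet (e, i) x <-> (A `&` f @^-1` [set Some z]) (t e i z).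
  rewrite sh; split=> [Wz|/h1//]; split; last exact: tl.
  by apply: h2; split=> //; exact: tl.
have [_ tI tS] := tP e.
rewrite -[RHS]card_ord; apply/eqP; rewrite eqn_leq; apply/andP; split.
  pose S := [set i | `[< sheet (e, i) x >]]%SET.
  have /choice[p pP] : forall i, exists q : 'I_k, i \in S -> g q = t e i z.
    move=> i; have [|_] := boolP (i \in S).
      by rewrite inE => /asboolP/shA; rewrite -gr => -[q _ gq]; exists q.
    have [k0 _] : exists k0 : 'I_k, True; last by exists k0.
    have k0 := ram_gt0 rx; by exists (Ordinal k0).
  rewrite -(card_in_imset (f := p) (D := S)); first exact: max_card.
  by move=> i i' iS iS' e1; apply: (tI z fz); rewrite /= -!pP // e1.
have /choice[p pP] : forall q : 'I_k, exists i, t e i z = g q.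
  move=> q; apply: tS => //; have [] : (A `&` f @^-1` [set Some z]) (g q) by rewrite -gr; exists q.
  by [].
have pI : injective p by move=> q q' e1; apply: gI; rewrite -!pP e1.
rewrite -(card_imset _ pI); apply: subset_leq_card; apply/fintype.subsetP => _ /imsetP[q _ ->].
by rewrite inE; apply/asboolP/shA; rewrite pP -gr; exists q.
Qed.

Lemma sheets_labelling : labelling f labels /\ lab_connected labels.
Proof.
have near x : \forall x' \near x, labels x' \subset labels x.
  have : \forall x' \near x, forall l, ~ sheet l x -> ~ sheet l x'.
    apply: (@near_forall _ _ _ (fun l x' => ~ sheet l x -> ~ sheet l x')) => l.
    have [sl|nl] := pselect (sheet l x); first by apply: near_all => x' /(_ sl).
    have : nbhs x (~` sheet l).
      by apply: open_nbhs_nbhs; split=> //; apply: closed_openC; exact: closed_closure.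
    by apply: near_imp => x' h _.
  apply: near_imp => x' h; apply/fintype.subsetP => l /in_labels sx'.
  by apply/in_labels; apply: contrapT => /h.
have dense x e i (W : set X) : (e, i) \in labels x -> nbhs x W ->
    exists x', [/\ W x', x' <> x, (exists2 z, f x' = Some z & face e z) & (e, i) \in labels x'].
  move=> /in_labels sx /(sheet_dense sx) [x' [? ? ? ?]].
  by exists x'; split=> //; apply/in_labels.
split; first split=> //.
- by move=> x x' l fx /in_labels h1 /in_labels; exact: sheet_inj.
- by move=> y e i /(sheet_ex i) [x [fx sx]]; exists x; split=> //; apply/in_labels.
- by move=> x e i /in_labels; exact: sheet_cface.
- move=> x k e rx cx; rewrite -(sheet_card rx cx); apply: eq_card => i.
  by rewrite !inE.
move=> x D DC D0 nD; have [k rx k0] := branched_ram x.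
have [V [nV VW cV]] := punctured_nbhs_connected rx nD.
have ne x' : labels x' != finset.set0.
  have [k' rx' k0'] := branched_ram x'.
  have [e ce] : exists e, cface e (f x').
    case: (f x') => [z|]; last by exists true.
    by case: (leP 0 (im z)) => h; [exists true|exists false; rewrite /cface /= ltW].
  move: k0'; rewrite -(sheet_card rx' ce) card_gt0 => h.
  have [i0] := elimT (finset.set0Pn _) h; rewrite inE => {}h.
  by apply/finset.set0Pn; exists (e, i0); rewrite inE.
(* Having all labels in [D] is locally constant on the connected punctured neighbourhood. By
   density, both a label of [D] and any other label of [x] occur there. *)
have incl l x1 x2 : l \in D -> (V `\ x) x1 -> l \in labels x1 -> (V `\ x) x2 -> labels x2 \subset D.
  move=> lD Vx1 l1 Vx2.
  apply: (connected_locally_const (P := fun x' => labels x' \subset D) cV Vx1) => //.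
    case: (VW _ Vx1.1 Vx1.2) => // /fintype.subsetP/(_ l l1); by rewrite inE lD.
  move=> w [Vw nw]; apply: near_imp (near w) => w' sub _; split=> h.
    exact: fintype.subset_trans h.
  case: (VW _ Vw nw) => // h'; have [l' ll'] := elimT (finset.set0Pn _) (ne w').
  by have /fintype.subsetP/(_ l' (fintype.subsetP sub l' ll')) := h'; rewrite inE (fintype.subsetP h).
have [[e i] lD] := elimT (finset.set0Pn _) D0.
have [x1 [Vx1 nx1 _ l1]] := dense x e i V (fintype.subsetP DC _ lD) nV.
apply/eqP; rewrite finset.eqEsubset DC /=; apply/fintype.subsetP => -[e' i'] l'.
have [x2 [Vx2 nx2 _ l2]] := dense x e' i' V l' nV.
by have /fintype.subsetP := incl _ x1 x2 lD (conj Vx1 nx1) l1 (conj Vx2 nx2); apply.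
Qed.

End Sheets.

Lemma labelling_exists : exists C : X -> {set bool * 'I_d}, labelling f C /\ lab_connected C.
Proof.
have /choice[t tP] e := triv_face brf e.
by exists (labels t); exact: sheets_labelling.
Qed.

End Labelling.
End Covering_06.
Import Covering_06.

(** * The real axis cut at the branch values *)

Module Covering_07.
Section Edges.
Local Open Scope classical_set_scope.
Local Open Scope ring_scope.
Local Open Scope complex_scope.
Variable R : realType.
Local Notation re := (@complex.Re R).
Local Notation im := (@complex.Im R).
Variable xs : seq R.

(** The closed edges. Edge [j] runs from entry [j - 1] to entry [j] of [xs]; edges [0] and [size xs]
    are rays, and both contain infinity. The open edge is [oint j]. *)
Definition act (j : nat) (y : sphere R) : bool :=
  if y is Some z then
    [&& im z == 0, (j == 0%N) || (nth 0 xs j.-1 <= re z) & (j == size xs) || (re z <= nth 0 xs j)]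
  else (j == 0%N) || (j == size xs).

Definition oint (j : nat) : set (plane R) :=
  [set z | [&& im z == 0, (j == 0%N) || (nth 0 xs j.-1 < re z) & (j == size xs) || (re z < nth 0 xs j)]].

Lemma oint_act j z : oint j z -> act j (Some z).
Proof.
by move=> /and3P[h0 h1 h2]; rewrite /act h0 /=; apply/andP; split;
  [case/orP: h1 => [->//|/ltW ->]|case/orP: h2 => [->//|/ltW ->]]; rewrite orbT.
Qed.

Lemma closed_act j : closed [set y | act j y].
Proof.
move=> y cl; apply: contrapT => ny.
suff : nbhs y [set y' | ~ act j y'] by move=> /cl [y' []].
case: y {cl} ny => [z|] ny.
  apply/nbhs_sphere/nbhs_plane; move: ny => /negP; rewrite /act !negb_and !negb_or.
  case/or3P => [h|/andP[j0 h]|/andP[jm h]].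
  - exists `|im z|; first by rewrite normr_gt0.
    move=> w _ h2 /= /and3P[/eqP w0 _ _]; move: h2.
    by rewrite w0 sub0r normrN ltxx.
  - rewrite -ltNge in h; exists (nth 0 xs j.-1 - re z); first by rewrite subr_gt0.
    move=> w; rewrite ltr_distl => h1 _ /= /and3P[_]; rewrite (negbTE j0) /= => h2 _.
    by lra.
  - rewrite -ltNge in h; exists (re z - nth 0 xs j); first by rewrite subr_gt0.
    move=> w; rewrite ltr_distl => h1 _ /= /and3P[_ _]; rewrite (negbTE jm) /= => h2.
    by lra.
have [j0 jm] : j != 0%N /\ j != size xs by move/negP: ny; rewrite negb_or => /andP.
apply/nbhs_infty; split=> //; exists (Num.max `|nth 0 xs j.-1| `|nth 0 xs j|).
move=> w hw; rewrite /act (negbTE j0) (negbTE jm) /= => /and3P[/eqP w0 h1 h2].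
case: hw; rewrite gt_max => /andP[h3 h4]; last first.
  by move: h3; rewrite w0 normr0 ltNge normr_ge0.
have := ler_norm (nth 0 xs j); have := ler_norm (- nth 0 xs j.-1); rewrite normrN => h5 h6.
by move: h3 h4; rewrite !ltr_normr => /orP[h3|h3] /orP[h4|h4]; lra.
Qed.

Lemma oint_connected j : connected (oint j).
Proof.
apply: convex_connected => w w' t /and3P[/eqP h1 h2 h3] /and3P[/eqP h4 h5 h6] ht.
rewrite /oint /=; apply/and3P; split.
- by rewrite h1 h4 !mulr0 addr0.
- by case/orP: h2 h5 => [->//|h2 /orP[->//|h5]]; rewrite conv_gt ?orbT.
- by case/orP: h3 h6 => [->//|h3 /orP[->//|h6]]; rewrite conv_lt ?orbT.
Qed.

Hypothesis xsS : sorted <%R xs.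

Lemma xs_lt i j : (i < j)%N -> (j < size xs)%N -> nth 0 xs i < nth 0 xs j.
Proof. by move=> ij js; rewrite lt_sorted_ltn_nth // inE (ltn_trans ij). Qed.

Lemma xs_le i j : (i <= j)%N -> (j < size xs)%N -> nth 0 xs i <= nth 0 xs j.
Proof. by rewrite leq_eqVlt => /orP[/eqP ->//|ij js]; rewrite ltW // xs_lt. Qed.

Lemma oint_ex j : (j <= size xs)%N -> exists z, oint j z.
Proof.
rewrite /oint /= => jm; have [j0|j0] := eqVneq j 0%N.
  by exists ((nth 0 xs j - 1) +i* 0); rewrite /= eqxx /= gtrBl ltr01 orbT.
have [je|je] := eqVneq j (size xs).
  by exists ((nth 0 xs j.-1 + 1) +i* 0); rewrite /= eqxx /= ltrDl ltr01.
have h : nth 0 xs j.-1 < nth 0 xs j.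
  by apply: xs_lt; [rewrite prednK // lt0n|rewrite ltn_neqAle je].
by exists (((nth 0 xs j.-1 + nth 0 xs j) / 2) +i* 0); rewrite /= eqxx /=; apply/andP; split; lra.
Qed.

(** A finite point of a closed edge is moved a small fraction [t] of the way to an interior point
    [c]; at infinity a point far out on the ray is taken. *)
Lemma act_near j y (N : set (sphere R)) : (j <= size xs)%N -> act j y -> nbhs y N ->
  exists2 z, oint j z & N (Some z).
Proof.
move=> jm; case: y => [z|].
  move=> /and3P[/eqP h1 h2 h3] /nbhs_sphere/nbhs_plane[r r0 hr].
  have [c /and3P[/eqP c1 c2 c3]] := oint_ex jm.
  pose D := `|re c - re z| + 1.
  have D0 : 0 < D by rewrite ltr_pwDr.
  pose t := Num.min 1 (r / D / 2).
  have t0 : 0 < t by rewrite lt_min ltr01 !divr_gt0.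
  have t1 : t <= 1 by rewrite ge_min lexx.
  have tr : t * D < r.
    have : t <= r / D / 2 by rewrite ge_min lexx orbT.
    rewrite -(ler_pM2r D0) => h; apply: le_lt_trans h _.
    by rewrite mulrAC divfK ?gt_eqF //; lra.
  exists (((1 - t) * re z + t * re c) +i* 0).
    rewrite /oint /= eqxx /=; apply/andP; split.
      case/orP: h2 c2 => [->//|h2 /orP[->//|c2]]; apply/orP; right.
      by have := mulr_gt0 t0 (etrans (subr_gt0 _ _) c2); nra.
    case/orP: h3 c3 => [->//|h3 /orP[->//|c3]]; apply/orP; right.
    by have := mulr_gt0 t0 (etrans (subr_gt0 _ _) c3); nra.
  apply: hr => /=; last by rewrite h1 subrr normr0.
  have -> : (1 - t) * re z + t * re c - re z = t * (re c - re z) by ring.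
  rewrite normrM gtr0_norm //; apply: le_lt_trans tr.
  by rewrite ler_pM2l // lerDl.
move=> jj /nbhs_infty[_ [M hM]].
have := ler_norm M; have := normr_ge0 M => M0 M1.
have [j0|j0] := eqVneq j 0%N.
  have := normr_ge0 (nth 0 xs j); have := ler_norm (- nth 0 xs j); rewrite normrN => n1 n0.
  exists ((- (`|M| + `|nth 0 xs j| + 1)) +i* 0).
    by rewrite /oint /= eqxx j0 eqxx /=; apply/orP; right; rewrite -j0; lra.
  by apply: hM; left; rewrite /= normrN gtr0_norm; lra.
have je : j == size xs by move: jj; rewrite /act (negbTE j0).
have := normr_ge0 (nth 0 xs j.-1); have := ler_norm (nth 0 xs j.-1) => n1 n0.
exists ((`|M| + `|nth 0 xs j.-1| + 1) +i* 0).
  by rewrite /oint /= eqxx je /= andbT; apply/orP; right; lra.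
by apply: hM; left; rewrite /= gtr0_norm; lra.
Qed.

Lemma oint_generic j z : (j <= size xs)%N -> oint j z -> ~~ special xs (Some z).
Proof.
move=> jm /and3P[z0 h1 h2]; rewrite /special z0 /=; apply/negP => /(nthP 0)[i im_ zi].
case: (ltnP i j) => ij.
  case/orP: h1 => [/eqP j0|]; first by rewrite j0 in ij.
  have : nth 0 xs i <= nth 0 xs j.-1.
    by apply: xs_le; [rewrite -ltnS (ltn_predK ij)|rewrite (leq_trans _ jm) // (ltn_predK ij)].
  by rewrite zi => h h'; lra.
case/orP: h2 => [/eqP je|]; first by move: im_; rewrite -je ltnNge ij.
by have := xs_le ij im_; rewrite zi => h h'; lra.
Qed.

Lemma real_oint z : im z = 0 -> ~~ special xs (Some z) -> exists2 j, (j <= size xs)%N & oint j z.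
Proof.
rewrite /special => z0; rewrite z0 eqxx /= => nz.
exists (find (fun x => re z < x) xs); first exact: find_size.
rewrite /oint /= z0 eqxx /=; apply/andP; split.
  have [//|j0] := eqVneq (find (fun x => re z < x) xs) 0%N.
  have jl : ((find (fun x => (re z < x)%R) xs).-1 < find (fun x => (re z < x)%R) xs)%N.
    by rewrite prednK // lt0n.
  have := before_find 0 jl => /negbT; rewrite -leNgt le_eqVlt => /orP[/eqP e|//].
  case/negP: nz; rewrite -e mem_nth //.
  exact: leq_trans jl (find_size _ _).
have [//|je] := eqVneq (find (fun x => re z < x) xs) (size xs).
by apply: (nth_find 0 (a := fun x => re z < x)); rewrite has_find ltn_neqAle je find_size.
Qed.

Lemma oint_act_inj j j' z : (j <= size xs)%N -> (j' <= size xs)%N -> oint j z -> act j' (Some z) -> j' = j.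
Proof.
move=> jm jm' /and3P[z0 h1 h2] /and3P[_ h3 h4].
case: (ltngtP j' j) => // h.
  case/orP: h4 => [/eqP je|h4]; first by move: (leq_trans h jm); rewrite je ltnn.
  case/orP: h1 => [/eqP j0|h1]; first by rewrite j0 in h.
  have : nth 0 xs j' <= nth 0 xs j.-1.
    by apply: xs_le; [rewrite -ltnS (ltn_predK h)|rewrite (leq_trans _ jm) // (ltn_predK h)].
  by move=> h5; exfalso; lra.
case/orP: h3 => [/eqP j0|h3]; first by rewrite j0 in h.
case/orP: h2 => [/eqP je|h2]; first by move: (leq_trans h jm'); rewrite je ltnn.
have : nth 0 xs j <= nth 0 xs j'.-1.
  by apply: xs_le; [rewrite -ltnS (ltn_predK h)|rewrite (leq_trans _ jm') // (ltn_predK h)].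
by move=> h5; exfalso; lra.
Qed.

Lemma generic_near (y : sphere R) : \forall y' \near y, y' <> y -> ~~ special xs y'.
Proof.
have : forall i : 'I_(size xs), \forall y' \near y, y' <> y -> y' <> Some (nth 0 xs i +i* 0).
  move=> i; have [e|ne] := pselect (y = Some (nth 0 xs i +i* 0)).
    by rewrite -e; apply: near_all.
  have [U [V [oU oV Uy Vx UV]]] := hausdorff_sep (@sphere_hausdorff R) ne.
  have : nbhs y U by apply: open_nbhs_nbhs.
  apply: near_imp => y' Uy' _ e; have : (U `&` V) y' by split=> //; rewrite e.
  by rewrite UV.
move=> /(@near_forall _ _ _ (fun i y' => y' <> y -> y' <> Some (nth 0 xs (nat_of_ord i) +i* 0))) h.
have hN : \forall y' \near y, y' <> y -> y' <> None.
  case: y {h} => [z|]; last by apply: near_all.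
  by have := @near_all (plane R) z (fun w => Some w <> Some z -> Some w <> None); apply.
apply: near_imp (filterI h hN) => -[z|] /= [h1 h2] ne; last by have := h2 ne.
apply/negP => /andP[/eqP z0 /(nthP 0)[k km zk]]; apply: (h1 (Ordinal km) ne).
by rewrite /= zk -z0; case: (z).
Qed.

End Edges.
End Covering_07.
Import Covering_07.

(** * Monodromy permutations read off the labels *)

Module Covering_08.
Section Monodromy.
Local Open Scope classical_set_scope.
Local Open Scope ring_scope.
Variable R : realType.
Local Notation re := (@complex.Re R).
Local Notation im := (@complex.Im R).
Variables (xs : seq R) (d : nat).

(** The gluing graph at [y]: along every closed edge [j] through [y], the lower sheet [b] is glued
    to the upper sheet [pi j b]. Its components, computed by [comp], are to be the points over
    [y]. *)
Definition edge_rel (pi : nat -> 'S_d) (y : sphere R) : rel (bool * 'I_d) := fun s t =>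
  [exists j : 'I_(size xs).+1, act xs j y &&
     ([&& ~~ s.1, t.1 & t.2 == pi j s.2] || [&& s.1, ~~ t.1 & s.2 == pi j t.2])].

Definition comp (pi : nat -> 'S_d) y t := [set t' | connect (edge_rel pi y) t t']%SET.

Lemma edge_rel_sym pi y : symmetric (edge_rel pi y).
Proof.
move=> s t; rewrite /edge_rel; apply: eq_existsb => j.
by congr (_ && _); rewrite orbC; congr (_ || _); rewrite andbCA.
Qed.

Lemma comp_sym pi y : connect_sym (edge_rel pi y).
Proof. exact/sym_connect_sym/edge_rel_sym. Qed.

Lemma mem_comp pi y t : t \in comp pi y t. Proof. by rewrite inE connect0. Qed.

Lemma comp_eq pi y s t : s \in comp pi y t -> comp pi y s = comp pi y t.
Proof.
rewrite inE => st; apply/setP => u; rewrite !inE.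
by rewrite (same_connect (@comp_sym pi y) st).
Qed.

Lemma edge_relP pi y (b : 'I_d) j : (j <= size xs)%N -> act xs j y ->
  edge_rel pi y (false, b) (true, pi j b).
Proof.
move=> js aj; apply/existsP; exists (Ordinal (n := (size xs).+1) (m := j) js).
by rewrite /= aj eqxx.
Qed.

Lemma act_cface e j y : act xs j y -> cface e y.
Proof.
by case: y => [z|] // /and3P[/eqP z0 _ _]; rewrite /cface /= z0; case: e.
Qed.

Variables (X : topologicalType) (f : X -> sphere R).
Hypothesis brf : branched xs d f.
Hypothesis xsS : sorted <%R xs.
Variable C : X -> {set bool * 'I_d}.
Hypothesis labC : labelling f C.

Let cX : compact [set: X]. Proof. by case: brf. Qed.
Let cf : continuous f. Proof. by case: brf. Qed.

Lemma generic_ram x : ~~ special xs (f x) -> ramification_index f x 1.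
Proof.
move=> /(generic_fiber brf)[l [_ lr lram]].
by have [i _ <-] : range l x by rewrite lr.
Qed.

Lemma generic_label x e : ~~ special xs (f x) -> cface e (f x) ->
  exists i0, forall i, ((e, i) \in C x) = (i == i0).
Proof.
move=> /generic_ram/(lab_card labC) h /h /eqP/cards1P[i0 /setP hi].
by exists i0 => i; have := hi i; rewrite !inE.
Qed.

Definition monodromy (pi : nat -> 'S_d) := forall x b j, (j <= size xs)%N -> act xs j (f x) ->
  (false, b) \in C x -> (true, pi j b) \in C x.

(** The values over which lower sheet [b] and upper sheet [a] meet form a closed set [Z b a]. Over
    an open edge each [b] meets exactly one [a], which is locally constant, hence constant;
    closedness carries this to the endpoints. *)
Lemma monodromy_exists : exists pi, monodromy pi.
Proof.
pose Z b a := f @` [set x | (false, b) \in C x /\ (true, a) \in C x].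
have clZ b a : closed (Z b a).
  apply: compact_closed; first exact: sphere_hausdorff.
  apply: continuous_compact; first exact: continuous_subspaceT.
  apply: subclosed_compact cX _ => // x cl; apply: contrapT => nx.
  have [x' [[h1 h2] /fintype.subsetP sub]] := cl _ (lab_near labC x).
  by apply: nx; split; exact: sub.
have Zz j z b : (j <= size xs)%N -> oint xs j z ->
    exists a0, forall a, Z b a (Some z) <-> a = a0.
  move=> js oz; have gz := oint_generic xsS js oz.
  have [x [fx bx]] := lab_ex labC b (act_cface false (oint_act oz)).
  have gx : ~~ special xs (f x) by rewrite fx.
  have cx : cface true (f x) by rewrite fx; exact: act_cface (oint_act oz).
  have [a0 ha] := generic_label gx cx.
  exists a0 => a; split=> [[x' [bx' ax'] fx']|->].
    apply/eqP; rewrite -ha.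
    by have <- : x' = x by apply: (lab_inj labC) bx' bx; rewrite fx'.
  by exists x => //; split=> //; rewrite ha.
have const j z z' b a : (j <= size xs)%N -> oint xs j z -> oint xs j z' ->
    Z b a (Some z) -> Z b a (Some z').
  move=> js oz oz' Zza.
  apply: (connected_locally_const (P := fun w => Z b a (Some w)) (@oint_connected _ xs j) oz Zza _ oz').
  move=> w ow; have [a0 ha0] := Zz j w b js ow.
  have : \forall w' \near w, forall a', a' <> a0 -> ~ Z b a' (Some w').
    apply: (@near_forall (plane R) _ _ (fun a' w' => a' <> a0 -> ~ Z b a' (Some w'))) => a'.
    have [->|/eqP ne] := eqVneq a' a0; first by apply: near_all.
    have : nbhs (Some w : sphere R) (~` Z b a').
      by apply: open_nbhs_nbhs; split; [exact: closed_openC|move=> /ha0].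
    by move=> h; have := (h : nbhs w (Some @^-1` (~` Z b a'))); apply: near_imp => w' + _.
  apply: near_imp => w' h ow'; have [a1 ha1] := Zz j w' b js ow'.
  have a10 : a1 = a0 by apply: contrapT => /h; apply; apply/ha1.
  by rewrite ha0 ha1 a10.
have /choice[p pP] : forall j, exists p : 'S_d, (j <= size xs)%N ->
    forall b z, oint xs j z -> Z b (p b) (Some z).
  move=> j; have [js|_] := leqP j (size xs); last by exists 1%g.
  have [z0 oz0] := oint_ex xsS js.
  have /choice[q qP] := fun b => Zz j z0 b js oz0.
  have qZ b : Z b (q b) (Some z0) by apply/qP.
  have qI : injective q.
    move=> b b' e; have [x [bx ax] fx] := qZ b; have [x' [bx' ax'] fx'] := qZ b'.
    have xx : x = x' by apply: (lab_inj labC) ax _; rewrite ?e // fx fx'.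
    have gx : ~~ special xs (f x) by rewrite fx; exact: oint_generic oz0.
    have cx : cface false (f x) by rewrite fx; exact: act_cface (oint_act oz0).
    have [i0 hi] := generic_label gx cx.
    by move: bx bx'; rewrite -xx !hi => /eqP -> /eqP ->.
  exists (perm qI) => _ b z oz; rewrite permE; exact: const (oz0) oz (qZ b).
exists p => x b j js aj bx.
have : Z b (p j b) (f x).
  apply: clZ => N nN; have [z oz Nz] := act_near xsS js aj nN.
  by exists (Some z); split=> //; apply: pP.
by move=> [x' [bx' ax'] fx']; have <- : x' = x by exact: (lab_inj labC) bx' bx.
Qed.

Lemma labels_neq0 x : exists l, l \in C x.
Proof.
have [k rx k0] := branched_ram brf x.
have [e ce] : exists e, cface e (f x).
  case: (f x) => [z|]; last by exists true.
  by case: (leP 0 (im z)) => h; [exists true|exists false; rewrite /cface /= ltW].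
have := lab_card labC rx ce => ck; rewrite -ck card_gt0 in k0.
by have [i0] := elimT (finset.set0Pn _) k0; rewrite inE => h; exists (e, i0).
Qed.

(** Labels of a point are closed under gluing, so they contain the component of [t]. Conversely, at
    points close to [x] the labels present are glued along edges through [f x], so the component and
    its complement stay apart and [lab_connected] applies. *)
Lemma labels_comp pi : lab_connected C -> monodromy pi ->
  forall x t, t \in C x -> C x = comp pi (f x) t.
Proof.
move=> conC mpi x t tx.
have step (x' : X) s u : s \in C x' -> edge_rel pi (f x') s u -> u \in C x'.
  move=> sx /existsP[[j /= js] /andP[aj]]; rewrite ltnS in js.
  case: s u sx => [[] a] [[] b] //= sx; rewrite ?orbF => /eqP e; last by rewrite e; exact: mpi.
  have [x0 [fx0 bx0]] := lab_ex labC b (act_cface false aj).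
  have ax0 : (true, pi j b) \in C x0 by apply: mpi => //; rewrite fx0.
  by rewrite -e in ax0; have -> : x' = x0 by apply: (lab_inj labC) sx ax0.
have clos (x' : X) s u : s \in C x' -> connect (edge_rel pi (f x')) s u -> u \in C x'.
  move=> sx /connectP[p pp ->]; elim: p s sx pp => //= v p IH s sx /andP[sv pv].
  by apply: IH pv; exact: step sx sv.
have sub : comp pi (f x) t \subset C x.
  by apply/fintype.subsetP => u; rewrite inE; exact: clos.
apply/esym; apply: conC => //.
  by apply/finset.set0Pn; exists t; exact: mem_comp.
have nact : \forall x' \near x, forall j : 'I_(size xs).+1, act xs j (f x') -> act xs j (f x).
  apply: (@near_forall X _ _ (fun j x' => act xs (nat_of_ord j) (f x') -> act xs j (f x))) => j.
  have [aj|naj] := boolP (act xs j (f x)); first by apply: near_all.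
  have : nbhs (f x) (~` [set y | act xs j y]).
    by apply: open_nbhs_nbhs; split; [apply/closed_openC/closed_act|exact/negP].
  by move=> /(@cf x); apply: near_imp => x' /= h /h.
have ngen : \forall x' \near x, f x' <> f x -> ~~ special xs (f x').
  by have := @cf x _ (generic_near xs (f x)); apply: near_imp.
apply: near_imp (filterI (filterI nact ngen) (lab_near labC x)) => x' [[h1 h2] h3] nx.
have ne : f x' <> f x.
  move=> e; apply: nx; have [l lx'] := labels_neq0 x'.
  exact: (lab_inj labC) lx' (fintype.subsetP h3 l lx').
have gx' := h2 ne.
have lift s u : edge_rel pi (f x') s u -> edge_rel pi (f x) s u.
  by move=> /existsP[j /andP[aj r]]; apply/existsP; exists j; rewrite h1.
have link s u : s \in C x' -> u \in C x' -> connect (edge_rel pi (f x)) s u.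
  have same e a b : (e, a) \in C x' -> (e, b) \in C x' -> a = b.
    move=> ax bx; have [i0 hi] := generic_label gx' (lab_cface labC ax).
    by move: ax bx; rewrite !hi => /eqP -> /eqP ->.
  have mixed a b : (false, b) \in C x' -> (true, a) \in C x' -> connect (edge_rel pi (f x)) (false, b) (true, a).
    move=> bx ax; have ca := lab_cface labC ax; have cb := lab_cface labC bx.
    case fx' : (f x') ca cb gx' => [z|] // ca cb gz.
    have [j js oz] : exists2 j, (j <= size xs)%N & oint xs j z.
      apply: real_oint => //; apply/eqP; rewrite eq_le.
      by move: ca cb; rewrite /cface /= => -> ->.
    have aj : act xs j (f x') by rewrite fx'; exact: oint_act.
    rewrite (same _ _ _ ax (mpi x' b j js aj bx)).
    by apply/connect1/lift; apply: edge_relP.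
  case: s u => [[] a] [[] b] sx ux.
  - by rewrite (same _ _ _ sx ux).
  - by rewrite comp_sym; exact: mixed.
  - exact: mixed.
  - by rewrite (same _ _ _ sx ux).
have [l lx'] := labels_neq0 x'.
have [lt|lt] := boolP (connect (edge_rel pi (f x)) t l); [left|right];
    apply/fintype.subsetP => u ux; rewrite !inE.
  by apply: connect_trans lt _; exact: link.
apply: contra lt => tu; apply: connect_trans tu _; exact: link.
Qed.

End Monodromy.

Section Relabel.
Local Open Scope classical_set_scope.
Local Open Scope ring_scope.
Variables (R : realType) (d : nat) (X : topologicalType) (f : X -> sphere R).

Definition relab (s : bool -> 'S_d) (l : bool * 'I_d) : bool * 'I_d := (l.1, s l.1 l.2).

Lemma relab_inj s : injective (relab s).
Proof. by move=> [e a] [e' b] [-> /perm_inj ->]. Qed.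

Lemma relabelling (C : X -> {set bool * 'I_d}) (s : bool -> 'S_d) :
  labelling f C -> labelling f (fun x => relab s @^-1: C x)%SET.
Proof.
move=> labC; split.
- by move=> x; apply: near_imp (lab_near labC x) => x' h; exact: preimsetS.
- by move=> x x' l fx; rewrite !inE; exact: (lab_inj labC).
- move=> y e a cy; have [x [fx ax]] := lab_ex labC (s e a) cy.
  by exists x; rewrite inE.
- by move=> x e a; rewrite inE; exact: (lab_cface labC).
- move=> x k e rx cx; rewrite -(lab_card labC rx cx).
  rewrite -(card_imset _ (@perm_inj _ (s e))); apply: eq_card => a; rewrite [RHS]inE.
  apply/imsetP/idP => [[a']|ax]; first by rewrite !inE => ax' ->.
  by exists ((s e)^-1%g a); rewrite ?inE /relab /= permKV.
- move=> x e a W; rewrite inE => ax Wx.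
  have [x' [? ? ? ?]] := lab_dense labC ax Wx; exists x'; rewrite inE; split=> //.
Qed.

Lemma relab_connected (C : X -> {set bool * 'I_d}) (s : bool -> 'S_d) :
lab_connected C -> lab_connected (fun x => relab s @^-1: C x)%SET.
Proof.
move=> conC x D DC D0 nD.
have DE : D = (relab s @^-1: (relab s @: D))%SET.
  apply/setP => l; rewrite inE; apply/idP/imsetP => [lD|[l' l'D /relab_inj ->//]].
  by exists l.
rewrite DE; suff -> : (relab s @: D)%SET = C x by [].
apply: conC.
+ by apply/fintype.subsetP => _ /imsetP[l /(fintype.subsetP DC) + ->]; rewrite inE.
+ have [l lD] := elimT (finset.set0Pn _) D0.
  by apply/finset.set0Pn; exists (relab s l); rewrite imset_f.
+ have surj l : exists l', l = relab s l'.
    by exists (l.1, (s l.1)^-1%g l.2); case: l => e a; rewrite /relab /= permKV.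
  apply: near_imp nD => x' h /h [] /fintype.subsetP h'; [left|right];
      apply/fintype.subsetP => l; have [l' ->] := surj l => lx.
    by rewrite imset_f // h' // inE.
  rewrite inE; apply/imsetP => -[l2 l2D /relab_inj e].
  by have := h' l'; rewrite !inE lx e l2D => /(_ isT).
Qed.

End Relabel.
End Covering_08.
Import Covering_08.

(** * A covering is determined by its permutations *)

Module Covering_09.
Section Present.
Local Open Scope classical_set_scope.
Local Open Scope ring_scope.
Variable R : realType.
Variables (xs : seq R) (d : nat).
Hypothesis xsS : sorted <%R xs.

Definition presents (pi : nat -> 'S_d) (X : topologicalType) (f : X -> sphere R)
    (C : X -> {set bool * 'I_d}) :=
  labelling f C /\ forall x t, t \in C x -> C x = comp xs pi (f x) t.

(** Renaming the lower sheets makes the gluing along the leftmost edge trivial. The only freedom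
    left is one permutation applied to the upper and the lower sheets at once. *)
Lemma presentation_exists (X : topologicalType) (f : X -> sphere R) : branched xs d f ->
  exists C pi, pi 0%N = 1%g /\ presents pi f C.
Proof.
move=> brf; have [C0 [lab0 con0]] := labelling_exists brf.
have [pi0 mon0] := monodromy_exists brf xsS lab0.
pose s e : 'S_d := if e then 1%g else (pi0 0%N)^-1%g.
pose C x := (relab s @^-1: C0 x)%SET.
have labC : labelling f C by exact: relabelling.
exists C, (fun j => (pi0 0%N)^-1 * pi0 j)%g; split; first by rewrite mulVg.
split=> //; apply: labels_comp => //; first exact: relab_connected.
move=> x b j js aj; rewrite !inE /relab /= => bx.
by rewrite perm1 permM; exact: mon0.
Qed.

Lemma face_cface e (z : plane R) : face e z -> cface e (Some z).
Proof. by rewrite /face /cface /=; case: e => /ltW. Qed.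

Lemma face_generic e (z : plane R) : face e z -> ~~ special xs (Some z).
Proof.
by rewrite /face /special /= negb_and => h; apply/orP; left; apply/eqP; case: e h => h; lra.
Qed.

Section Facts.
Variables (X : topologicalType) (f : X -> sphere R) (C : X -> {set bool * 'I_d}).
Hypotheses (brf : branched xs d f) (labC : labelling f C).

(** By properness, a point over a nearby value that shares a label with [x] is close to [x]. Maps
    defined through labels get their continuity from this. *)
Lemma lab_limit x (W : set X) : nbhs x W ->
  \forall y \near f x, forall x', f x' = y -> C x' :&: C x != finset.set0 -> W x'.
Proof.
move=> Wx; pose O := interior [set x' | C x' :&: C x != finset.set0 -> W x'].
have fO : f @^-1` [set f x] `<=` O.
  move=> x0 /= fx0; have [->|ne] := pselect (x0 = x).
    by apply: near_imp Wx => x' Wx' _.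
  have dis : C x0 :&: C x = finset.set0.
    apply/eqP; apply: contraT => /finset.set0Pn[l]; rewrite inE => /andP[l0 l1].
    by case: ne; exact: (lab_inj labC) l0 l1.
  apply: near_imp (lab_near labC x0) => x' sub /finset.set0Pn[l].
  rewrite inE => /andP[/(fintype.subsetP sub) l0 l1].
  by move/setP: dis => /(_ l); rewrite !inE l0 l1.
have [cX _ cf _] := brf.
have := proper_near cX (@sphere_hausdorff R) cf (@open_interior _ _) fO.
by apply: near_imp => y h x' fx; exact: (interior_subset (h x' fx)).
Qed.

Lemma lab_unique x e a b : ~~ special xs (f x) -> (e, a) \in C x -> (e, b) \in C x -> a = b.
Proof.
move=> gx ax bx; have [i0 hi] := generic_label brf labC gx (lab_cface labC ax).
by move: ax bx; rewrite !hi => /eqP -> /eqP ->.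
Qed.

End Facts.

Section Iso.
Variables (X Y : topologicalType) (f : X -> sphere R) (g : Y -> sphere R).
Hypotheses (brf : branched xs d f) (brg : branched xs d g).
Variables (pi rho : nat -> 'S_d) (C : X -> {set bool * 'I_d}) (D : Y -> {set bool * 'I_d}).
Hypotheses (pX : presents pi f C) (pY : presents rho g D).

Let labC : labelling f C. Proof. by case: pX. Qed.
Let labD : labelling g D. Proof. by case: pY. Qed.

Definition relab1 (s : 'S_d) : bool * 'I_d -> bool * 'I_d := relab (fun=> s).

Lemma mono_step (Z : topologicalType) (h : Z -> sphere R) (E : Z -> {set bool * 'I_d}) theta :
  presents theta h E -> forall z b j, (j <= size xs)%N -> act xs j (h z) ->
  ((true, theta j b) \in E z) = ((false, b) \in E z).
Proof.
move=> [_ hE] z b j js aj; have e := edge_relP theta b js aj.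
apply/idP/idP => /hE ->; rewrite inE; apply: connect1 => //.
by rewrite edge_rel_sym.
Qed.

(** The map carries sheets to sheets, by local constancy over each half-plane. Comparison along edge
    [0], glued trivially in both coverings, shows that upper and lower sheets undergo the same
    permutation; the other edges give the conjugation. *)
Lemma iso_perm (phi : X -> Y) : pi 0%N = 1%g -> rho 0%N = 1%g -> continuous phi ->
  injective phi -> (forall x, g (phi x) = f x) ->
  exists s : 'S_d, (forall x l, (relab1 s l \in D (phi x)) = (l \in C x)) /\
    (forall j, (j <= size xs)%N -> rho j = (s^-1 * pi j * s)%g).
Proof.
move=> pi0 rho0 cphi phiI gphi.
have [cX hX cf _] := brf.
pose Z e a b := f @` [set x | (e, a) \in C x /\ (e, b) \in D (phi x)].
have clZ e a b : closed (Z e a b).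
  apply: compact_closed; first exact: sphere_hausdorff.
  apply: continuous_compact; first exact: continuous_subspaceT.
  apply: subclosed_compact cX _ => // x cl; apply: contrapT => nx.
  have n2 : \forall x' \near x, D (phi x') \subset D (phi x).
    by have /(_ _ (lab_near labD (phi x))) := cphi x; apply: near_imp.
  have [x' [[h1 h2] [/fintype.subsetP s1 /fintype.subsetP s2]]] := cl _ (filterI (lab_near labC x) n2).
  by apply: nx; split; [exact: s1|exact: s2].
have fgen := @face_generic.
have fc := @face_cface.
have Zz e z a : face e z -> exists b0, forall b, Z e a b (Some z) <-> b = b0.
  move=> fz; have [x [fx ax]] := lab_ex labC a (fc e z fz).
  have gx : ~~ special xs (g (phi x)) by rewrite gphi fx; exact: fgen fz.
  have cgx : cface e (g (phi x)) by rewrite gphi fx; exact: fc.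
  have [b0 hb] := generic_label brg labD gx cgx.
  exists b0 => b; split=> [[x' [ax' bx'] fx']|->].
    apply/eqP; rewrite -hb.
    by have <- : x' = x by apply: (lab_inj labC) ax' ax; rewrite fx'.
  by exists x => //; split=> //; rewrite hb.
have const e z z' a b : face e z -> face e z' -> Z e a b (Some z) -> Z e a b (Some z').
  move=> fz fz' Zza.
  have cface : connected (face e : set (plane R)).
    by apply: convex_connected => w w' t fw fw' ht; exact: face_conv.
  apply: (connected_locally_const (P := fun w => Z e a b (Some w)) cface fz Zza _ fz').
  move=> w fw; have [b0 hb0] := Zz e w a fw.
  have : \forall w' \near w, forall b', b' <> b0 -> ~ Z e a b' (Some w').
    apply: (@near_forall (plane R) _ _ (fun b' w' => b' <> b0 -> ~ Z e a b' (Some w'))) => b'.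
    have [->|/eqP ne] := eqVneq b' b0; first by apply: near_all.
    have : nbhs (Some w : sphere R) (~` Z e a b').
      by apply: open_nbhs_nbhs; split; [exact: closed_openC|move=> /hb0].
    by move=> h; have := (h : nbhs w (Some @^-1` (~` Z e a b'))); apply: near_imp => w' + _.
  apply: near_imp => w' h fw'; have [b1 hb1] := Zz e w' a fw'.
  have b10 : b1 = b0 by apply: contrapT => /h; apply; apply/hb1.
  by rewrite hb0 hb1 b10.
have face_ex e : exists z : plane R, face e z.
  have [z [fz _ _]] := @face_near R e None setT I filterT; by exists z.
have /choice[s sP] : forall e, exists s : 'S_d, forall x a, (e, a) \in C x -> (e, s a) \in D (phi x).
  move=> e; have [z0 fz0] := face_ex e.
  have /choice[q qP] := fun a => Zz e z0 a fz0.
  have qZ a : Z e a (q a) (Some z0) by apply/qP.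
  have qx x a : (e, a) \in C x -> (e, q a) \in D (phi x).
    move=> ax; apply: contrapT => nx.
    have n2 : \forall x' \near x, D (phi x') \subset D (phi x).
      by have /(_ _ (lab_near labD (phi x))) := cphi x; apply: near_imp.
    have [x' [sub _ [z fx' fz] ax']] := lab_dense labC ax n2.
    have [x1 [ax1 bx1] fx1] := const _ _ _ a (q a) fz0 fz (qZ a).
    apply: nx; apply: (fintype.subsetP sub).
    by have <- : x1 = x' by apply: (lab_inj labC) ax1 ax'; rewrite fx1.
  have qI : injective q.
    move=> a a' e1; have [x [ax bx] fx] := qZ a; have [x' [ax' bx'] fx'] := qZ a'.
    have pp : phi x = phi x' by apply: (lab_inj labD) bx _; rewrite ?e1 // !gphi fx fx'.
    have gx : ~~ special xs (f x) by rewrite fx; exact: fgen fz0.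
    by apply: (lab_unique brf labC gx ax); rewrite (phiI _ _ pp).
  by exists (perm qI) => x a ax; rewrite permE; exact: qx.
have edge j x b : (j <= size xs)%N -> oint xs j x -> s true (pi j b) = rho j (s false b).
  move=> js ox; have aj := oint_act ox; have gx := oint_generic xsS js ox.
  have [x1 [fx1 bx1]] := lab_ex labC b (act_cface false aj).
  have ax1 : (true, pi j b) \in C x1 by rewrite (mono_step pX) // fx1.
  have gx1 : ~~ special xs (g (phi x1)) by rewrite gphi fx1.
  apply: (lab_unique brg labD gx1); first exact: sP.
  by rewrite (mono_step pY) ?gphi ?fx1 //; exact: sP.
have s0 : s true = s false.
  have [z oz] := oint_ex xsS (leq0n (size xs)).
  by apply/permP => b; have := edge 0%N z b (leq0n _) oz; rewrite pi0 rho0 !perm1.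
have sE e : s e = s true by case: e.
exists (s true); split; last first.
  move=> j js; have [z oz] := oint_ex xsS js.
  apply/permP => b; rewrite !permM (edge j z) // s0.
  by rewrite permKV.
move=> x [e a]; rewrite /relab1 /relab /=; apply/idP/idP => [ax|]; last first.
  by move=> /sP; rewrite sE.
have ce : cface e (f x) by rewrite -gphi; exact: lab_cface ax.
have [x1 [fx1 ax1]] := lab_ex labC a ce.
suff -> : x = x1 by [].
apply: phiI; apply: (lab_inj labD) ax _; first by rewrite !gphi fx1.
by have := sP _ _ _ ax1; rewrite sE.
Qed.

(** [s] maps one gluing graph isomorphically onto the other at every value, so the labels of [x]
    moved by [s] are the labels of exactly one point over [f x]. *)
Lemma perm_iso (s : 'S_d) : (forall j, (j <= size xs)%N -> rho j = (s^-1 * pi j * s)%g) ->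
  exists phi : X -> Y, [/\ continuous phi, forall x, g (phi x) = f x
    & forall x l, (relab1 s l \in D (phi x)) = (l \in C x)].
Proof.
move=> hs.
have er y t u : edge_rel xs rho y (relab1 s t) (relab1 s u) = edge_rel xs pi y t u.
  apply: eq_existsb => j /=; congr (_ && _).
  have h a b : (s b == rho j (s a)) = (b == pi j a).
    by rewrite hs -1?ltnS // !permM permK (inj_eq perm_inj).
  by rewrite !h.
have cr y t u : connect (edge_rel xs rho y) (relab1 s t) (relab1 s u) = connect (edge_rel xs pi y) t u.
  apply/idP/idP => /connectP[p pp lp]; apply/connectP.
    have surj v : exists v', v = relab1 s v'.
      by exists (v.1, s^-1%g v.2); case: v => e a; rewrite /relab1 /relab /= permKV.
    have [q pq] : exists q, p = map (relab1 s) q.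
      elim: p {pp lp} => [|v p [q ->]]; first by exists [::].
      by have [v' ->] := surj v; exists (v' :: q).
    exists q; last by move: lp; rewrite pq last_map => /(@relab_inj _ (fun=> s)).
    by move: pp; rewrite pq path_map; under eq_path => ? ? do rewrite /= er.
  exists (map (relab1 s) p); last by rewrite last_map lp.
  by rewrite path_map; under eq_path => ? ? do rewrite /= er.
have /choice[phi phiP] : forall x, exists y, g y = f x /\ forall l, (relab1 s l \in D y) = (l \in C x).
  move=> x; have [[e a] ax] := labels_neq0 brf labC x.
  have [y [gy ay]] := lab_ex labD (s a) (lab_cface labC ax).
  exists y; split=> // l; rewrite (pX.2 _ _ ax) (pY.2 _ _ ay) !inE gy.
  exact: (cr _ (e, a)).
exists phi; split=> [x W|x|x l]; [|by case: (phiP x)|by case: (phiP x)].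
have [fx _] := phiP x => /(lab_limit brg labD); rewrite fx => h.
have [_ _ cf _] := brf.
apply: near_imp (filterI (lab_near labC x) (@cf x _ h)) => x' [/fintype.subsetP sub h'].
have [fx' cx'] := phiP x'; apply: h' fx' _.
have [l lx'] := labels_neq0 brf labC x'.
apply/finset.set0Pn; exists (relab1 s l); rewrite inE cx' lx' /=.
by have [_ ->] := phiP x; exact: sub.
Qed.

Lemma presented_homeo (s : 'S_d) (phi : X -> Y) : continuous phi -> (forall x, g (phi x) = f x) ->
  (forall x l, (relab1 s l \in D (phi x)) = (l \in C x)) ->
  homeomorphism [set: X] [set: Y] phi.
Proof.
move=> cphi gphi hs.
have surj v : exists v', v = relab1 s v'.
  by exists (v.1, s^-1%g v.2); case: v => e a; rewrite /relab1 /relab /= permKV.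
have /choice[psi psiP] : forall y, exists x, phi x = y.
  move=> y; have [l ly] := labels_neq0 brg labD y.
  have [[e a] lE] := surj l; have ce : cface e (g y) by rewrite lE in ly; exact: lab_cface ly.
  have [x [fx ax]] := lab_ex labC a ce; exists x; apply: (lab_inj labD) _ ly.
    by rewrite gphi fx.
  by rewrite lE hs.
have phiI : injective phi.
  move=> x x' e; have [l lx] := labels_neq0 brf labC x.
  apply: (lab_inj labC) (lx) _; first by rewrite -!gphi e.
  by rewrite -hs -e hs.
have psiK x : psi (phi x) = x by apply: phiI; rewrite psiP.
have [_ _ cg _] := brg.
exists psi; split=> [||x _|y _]; [exact: continuous_subspaceT| |by split|by split].
apply: continuous_subspaceT => y W /(lab_limit brf labC) h.
have gy : f (psi y) = g y by rewrite -gphi psiP.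
rewrite gy in h.
apply: near_imp (filterI (lab_near labD y) (@cg y _ h)) => y' [/fintype.subsetP sub h'].
apply: h'; first by rewrite -gphi psiP.
have [l ly'] := labels_neq0 brg labD y'; have [l' lE] := surj l; rewrite lE in ly'.
apply/finset.set0Pn; exists l'; rewrite inE -!hs !psiP ly' /=; exact: sub.
Qed.

End Iso.
End Present.
End Covering_09.
Import Covering_09.

(** * The model covering built from given permutations *)

Module Covering_10.
Section ModelSpace.
Local Open Scope classical_set_scope.
Local Open Scope ring_scope.

Definition blocks (R : realType) (xs : seq R) d (pi : nat -> 'S_d) (y : sphere R) :
    {set {set bool * 'I_d}} :=
  [set comp xs pi y t | t in [set l : bool * 'I_d | `[< cface l.1 y >]]]%SET.

(** A point is a value together with a component of the gluing graph there. The space is a set of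
    pairs rather than a quotient of glued half-planes. *)
Definition model (R : realType) (xs : seq R) d (pi : nat -> 'S_d) : Type :=
  {p : sphere R * {set bool * 'I_d} | p.2 \in blocks xs pi p.1}.

HB.instance Definition _ R xs d pi := Choice.on (@model R xs d pi).

Variables (R : realType) (xs : seq R) (d : nat) (pi : nat -> 'S_d).
Local Notation M := (@model R xs d pi).

Definition mproj (p : M) : sphere R := (val p).1.
Definition mlab (p : M) : {set bool * 'I_d} := (val p).2.

Lemma model_eq p q : mproj p = mproj q -> mlab p = mlab q -> p = q.
Proof. by case: p q => [[a b] ?] [[a' b'] ?]; rewrite /mproj /mlab /= => e1 e2; apply: val_inj => /=; rewrite e1 e2. Qed.

Lemma comp_cface y s t : cface t.1 y -> s \in comp xs pi y t -> cface s.1 y.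
Proof.
move=> ct; rewrite inE => /connectP[p + ->]; elim: p t ct => //= u p IH t ct /andP[tu].
by apply: IH; have /existsP[j /andP[aj _]] := tu; exact: act_cface aj.
Qed.

Lemma mlabP p t : t \in mlab p -> cface t.1 (mproj p) /\ mlab p = comp xs pi (mproj p) t.
Proof.
rewrite /mproj /mlab; case: p => [[y D] /= /imsetP[t0]]; rewrite inE => /asboolP c0 -> tt0.
by split; [exact: comp_cface c0 tt0|rewrite (comp_eq tt0)].
Qed.

Lemma model_ex y t : cface t.1 y -> exists p : M, mproj p = y /\ t \in mlab p.
Proof.
move=> ct; have h : (y, comp xs pi y t).2 \in blocks xs pi (y, comp xs pi y t).1.
  by apply/imsetP; exists t => //; rewrite inE; apply/asboolP.
by exists (exist _ (y, comp xs pi y t) h); split=> //; exact: mem_comp.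
Qed.

Lemma mlab_neq0 p : exists t, t \in mlab p.
Proof.
rewrite /mlab; case: p => [[y D] /= /imsetP[t0 _ ->]]; exists t0; exact: mem_comp.
Qed.

Lemma mlab_inj p q t : mproj p = mproj q -> t \in mlab p -> t \in mlab q -> p = q.
Proof.
move=> e tp tq; apply: model_eq => //.
by have [_ ->] := mlabP tp; have [_ ->] := mlabP tq; rewrite e.
Qed.

(** Near [y] only edges and half-planes through [y] occur, so components can only shrink. The
    inclusion of label sets in [model_nbhs] expresses just this closeness. *)
Definition finer (y' y : sphere R) : Prop :=
  (forall j, (j <= size xs)%N -> act xs j y' -> act xs j y) /\ (forall e, cface e y' -> cface e y).

Lemma finer_near y : \forall y' \near y, finer y' y.
Proof.
have h1 : \forall y' \near y, forall j : 'I_(size xs).+1, act xs j y' -> act xs j y.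
  apply: (@near_forall _ _ _ (fun j y' => act xs (nat_of_ord j) y' -> act xs j y)) => j.
  have [aj|naj] := boolP (act xs j y); first by apply: near_all.
  have : nbhs y (~` [set y | act xs j y]).
    by apply: open_nbhs_nbhs; split; [apply/closed_openC/closed_act|exact/negP].
  by apply: near_imp => y' /= h /h.
have h2 : \forall y' \near y, forall e, cface e y' -> cface e y.
  apply: (@near_forall _ bool _ (fun e y' => cface e y' -> cface e y)) => e.
  have [ce|nce] := pselect (cface e y); first by apply: near_all.
  have : nbhs y (~` cface e).
    by apply: open_nbhs_nbhs; split=> //; apply/closed_openC/closed_cface.
  by apply: near_imp => y' /= h /h.
apply: near_imp (filterI h1 h2) => y' [h3 h4]; split=> // j js.
exact: (h3 (Ordinal (n := (size xs).+1) (m := j) js)).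
Qed.

Lemma finer_comp y' y t : finer y' y -> comp xs pi y' t \subset comp xs pi y t.
Proof.
move=> [h _]; apply/fintype.subsetP => u; rewrite !inE; apply: connect_sub => a b.
move=> /existsP[[j /= js] /andP[aj r]]; apply: connect1.
by apply/existsP; exists (Ordinal js); rewrite /= h.
Qed.

Lemma finer_mlab p q t : finer (mproj q) (mproj p) -> t \in mlab q -> t \in mlab p -> mlab q \subset mlab p.
Proof.
by move=> fqp /mlabP[_ ->] /mlabP[_ ->]; exact: finer_comp.
Qed.

Definition model_nbhs (p : M) : set_system M :=
  [set A | \forall y' \near mproj p, forall q, mproj q = y' -> mlab q \subset mlab p -> A q].

Let model_filter p : ProperFilter (model_nbhs p).
Proof.
split.
  by move=> /nbhs_singleton h; apply: (h p).
split.
- by apply: near_all.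
- by move=> A B hA hB; apply: near_imp (@filterI _ (nbhs (mproj p)) (nbhs_filter _) _ _ hA hB) => y' [h1 h2] q e s; split; [exact: h1|exact: h2].
- by move=> A B AB hA; apply: near_imp (hA : \forall y' \near mproj p, _) => y' h q e s; apply: AB; exact: h.
Qed.

Let model_singleton p A : model_nbhs p A -> A p.
Proof. by move=> /nbhs_singleton h; apply: h. Qed.

Let model_nbhs_nbhs p A : model_nbhs p A -> model_nbhs p (model_nbhs^~ A).
Proof.
move=> /nbhs_interior; apply: near_imp => y' hy q qy sq.
rewrite -qy in hy; apply: near_imp hy => y'' h r ry sr.
by apply: h ry _; exact: fintype.subset_trans sr sq.
Qed.

HB.instance Definition _ := hasNbhs.Build M model_nbhs.
HB.instance Definition _ := @Nbhs_isNbhsTopological.Build M model_filter model_singleton model_nbhs_nbhs.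

Lemma nbhs_model (p : M) A : nbhs p A <->
  \forall y' \near mproj p, forall q, mproj q = y' -> mlab q \subset mlab p -> A q.
Proof. by []. Qed.

Lemma mproj_continuous : continuous mproj.
Proof. by move=> p A nA; apply/nbhs_model; apply: near_imp nA => y' Ay q /= e _; rewrite e. Qed.

Lemma mlab_near p : \forall q \near p, mlab q \subset mlab p.
Proof. by apply/nbhs_model; apply: near_all. Qed.

Lemma model_hausdorff : hausdorff_space M.
Proof.
move=> p q pq.
have e : mproj p = mproj q.
  apply: (@sphere_hausdorff R) => A B /mproj_continuous nA /mproj_continuous nB.
  by have [r [rA rB]] := pq _ _ nA nB; exists (mproj r).
have [r [rp rq]] := pq _ _ (mlab_near p) (mlab_near q).
have [t tr] := mlab_neq0 r.
by apply: mlab_inj (fintype.subsetP rp _ tr) (fintype.subsetP rq _ tr).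
Qed.

(** The filter projected to the sphere clusters at some [y]. If no point over [y] were a cluster
    point, each of the finitely many labels would supply a member of the filter and a disjoint
    neighbourhood of its point; intersecting them contradicts the clustering at [y]. *)
Lemma model_compact : compact [set: M].
Proof.
move=> F PF _.
have [y [_ clu]] := @sphere_compact R (mproj @ F) (fmap_proper_filter _ PF) filterT.
apply: contrapT => nclu.
have /choice[AN hAN] : forall t : bool * 'I_d, exists AN : set M * set M, F AN.1 /\
    forall p, mproj p = y -> t \in mlab p -> nbhs p AN.2 /\ AN.1 `&` AN.2 = set0.
  move=> t; have [[p [py tp]]|np] := pselect (exists p, mproj p = y /\ t \in mlab p); last first.
    by exists (setT, setT); split; [exact: filterT|move=> p py tp; case: np; exists p].
  have : ~ cluster F p by move=> cp; apply: nclu; exists p.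
  rewrite /cluster /= => /existsNP[A /existsNP[N /not_implyP[FA /not_implyP[nN nAN]]]].
  exists (A, N); split=> // q qy tq; have -> : q = p by apply: mlab_inj tq tp; rewrite qy.
  by split=> //; apply/seteqP; split=> // r ANr; apply: nAN; exists r.
have FA : F [set q | forall t, (AN t).1 q].
  by apply: filter_forall => t; case: (hAN t).
have nN : \forall y' \near y, forall t q, mproj q = y' -> t \in mlab q -> cface t.1 y /\ (AN t).2 q.
  apply: (@near_forall _ _ _ (fun t y' => forall q, mproj q = y' -> t \in mlab q -> cface t.1 y /\ (AN t).2 q)) => t.
  have [ct|nct] := pselect (cface t.1 y); last first.
    apply: near_imp (finer_near y) => y' h q qy /mlabP[cq _]; case: nct.
    by apply: h.2; rewrite -qy.
  have [p [py tp]] := model_ex ct; have [_ /(_ p py tp)[/nbhs_model + _]] := hAN t.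
  rewrite py => hp; apply: near_imp (filterI hp (finer_near y)) => y' [h1 h2] q qy tq.
  by split=> //; apply: h1 => //; apply: finer_mlab tq tp; rewrite qy py.
have FA' : F (mproj @^-1` (mproj @` [set q | forall t, (AN t).1 q])).
  by apply: filterS FA => q hq; exists q.
have [_ [[q hq <-] hN]] := clu _ _ FA' nN.
have [t tq] := mlab_neq0 q; have [ct h2] := hN t q erefl tq.
have [p [py tp]] := model_ex ct; have [_ /(_ p py tp)[_ h3]] := hAN t.
by have : ((AN t).1 `&` (AN t).2) q by []; rewrite h3.
Qed.

End ModelSpace.
End Covering_10.
Import Covering_10.

(** * Charts of the sphere and the power map *)

Module Covering_11.
Section Power.
Local Open Scope classical_set_scope.
Local Open Scope ring_scope.
Local Open Scope complex_scope.
Variable R : realType.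
Local Notation re := (@complex.Re R).
Local Notation im := (@complex.Im R).
Local Notation nc := (@Normc.normc R).

Lemma ncE (x : R[i]) : `|x| = (nc x)%:C. Proof. by []. Qed.
Lemma nc_ge0 x : 0 <= nc x. Proof. by case: x => a b; exact: sqrtr_ge0. Qed.
Lemma ncD x y : nc (x + y) <= nc x + nc y.
Proof. by rewrite -lecR rmorphD /=; exact: (@ler_normD _ R[i]). Qed.
Lemma ncN x : nc (- x) = nc x.
Proof. by apply: complexI; exact: (@normrN R[i] R[i]). Qed.
Lemma ncM x y : nc (x * y) = nc x * nc y. Proof. exact: Normc.normcM. Qed.
Lemma nc_eq0 x : (nc x == 0) = (x == 0).
Proof. by apply/eqP/eqP => [/Normc.eq0_normc//|->]; rewrite Normc.normc0. Qed.
Lemma nc_gt0 x : (0 < nc x) = (x != 0).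
Proof. by rewrite lt_neqAle nc_ge0 andbT eq_sym nc_eq0. Qed.
Lemma ncX x k : nc (x ^+ k) = nc x ^+ k.
Proof. by elim: k => [|k IH]; rewrite ?exprS ?ncM ?IH // Normc.normc1. Qed.
Lemma ncV x : nc x^-1 = (nc x)^-1. Proof. exact: Normc.normcV. Qed.
Lemma nc_re x : `|re x| <= nc x. Proof. by rewrite -lecR; exact: normc_ge_Re. Qed.
Lemma nc_im x : `|im x| <= nc x. Proof. by rewrite -lecR; exact: normc_ge_im. Qed.
Lemma nc_le x : nc x <= `|re x| + `|im x|. Proof. by rewrite -lecR; exact: normc_le_sum. Qed.
Lemma nc_real (x : R) : nc x%:C = `|x|.
Proof. by rewrite /= expr0n addr0 sqrtr_sqr. Qed.

Lemma disc_nc (z : plane R) : @disc R z <-> nc z < 1.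
Proof. by rewrite /disc /= ncE -[1]/(1%:C) ltcR. Qed.

Lemma nbhs_nc (z : plane R) A : nbhs z A <-> exists2 e : R, 0 < e & forall w : R[i], nc (w - z) < e -> A w.
Proof.
rewrite nbhs_plane; split=> [[e e0 h]|[e e0 h]].
  exists e => // w zw; apply: h; rewrite -?re_sub -?im_sub.
    exact: le_lt_trans (nc_re _) zw.
  exact: le_lt_trans (nc_im _) zw.
exists (e / 2); first by rewrite divr_gt0.
move=> w h1 h2; apply: h; apply: le_lt_trans (nc_le _) _.
by rewrite re_sub im_sub (splitr e) ltrD.
Qed.

Lemma nbhs_infty_nc (A : set (sphere R)) : nbhs (None : sphere R) A <->
  A None /\ exists2 M : R, 0 < M & forall w : R[i], M < nc w -> A (Some w).
Proof.
rewrite nbhs_infty; split=> -[A0 [M]].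
  move=> hM; split=> //; exists (2 * (`|M| + 1)); first by rewrite mulr_gt0 // ltr_pwDr.
  move=> w hw; apply: hM; have h := lt_le_trans hw (nc_le w); have := ler_norm M => h'.
  by case: (ltP M `|re w|) => h1; [left|right; lra].
move=> M0 hM; split=> //; exists M => w [] h; apply: hM.
  exact: lt_le_trans h (nc_re _).
exact: lt_le_trans h (nc_im _).
Qed.

Lemma plane_exp_continuous k : continuous (fun z : plane R => (z : R[i]) ^+ k : plane R).
Proof.
elim: k => [|k IH].
  have -> : (fun z : plane R => (z : R[i]) ^+ 0 : plane R) = cst (1 : R[i]).
    by apply/funext => z; rewrite expr0.
  exact: cst_continuous.
have -> : (fun z : plane R => (z : R[i]) ^+ k.+1 : plane R) =
    (fun z : plane R => (z : R[i]) * (z : R[i]) ^+ k : plane R).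
  by apply/funext => z; rewrite exprS.
move=> z; exact: (@cvgM R[i] (plane R) (nbhs z) _ id _ _ _ cvg_id (IH z)).
Qed.

Lemma plane_affine_continuous (a b : R[i]) : continuous (fun z : plane R => a * (z : R[i]) + b : plane R).
Proof.
move=> z.
apply: (@cvgD R[i] R[i]^o (plane R) (nbhs z) _ _ _ _ _); last exact: cvg_cst.
exact: (@cvgM R[i] (plane R) (nbhs z) _ _ _ _ _ (cvg_cst _) cvg_id).
Qed.

Lemma plane_inv_continuous (z : plane R) : (z : R[i]) != 0 ->
  (fun z : plane R => (z : R[i])^-1 : plane R) @ nbhs z --> ((z : R[i])^-1 : plane R).
Proof. exact: inv_continuous. Qed.

(** The distances from [z0] to the [k] roots of ['X^k - y] multiply to the modulus of [z0 ^+ k - y],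
    so the smallest one satisfies the bound. It serves as a continuity estimate for k-th roots
    without logarithms. *)
Lemma near_root k (z0 y : R[i]) : (0 < k)%N ->
  exists z, z ^+ k = y /\ nc (z - z0) ^+ k <= nc (z0 ^+ k - y).
Proof.
move=> k0; pose p : {poly R[i]} := 'X^k - y%:P.
have spc : (size (- y%:P : {poly R[i]}) < size ('X^k : {poly R[i]}))%N.
  by rewrite size_polyXn size_polyN (leq_ltn_trans (size_polyC_leq1 _)).
have pm : p \is monic by rewrite monicE lead_coefDl // lead_coefXn.
have [r pr] := closed_field_poly_normal p.
rewrite (monicP pm) scale1r in pr.
have sr : size r = k.
  have : size p = k.+1 by rewrite size_polyDl // size_polyXn.
  by rewrite pr size_prod_XsubC => -[].
pose a i := nc (nth 0 r i - z0).
pose i0 := [arg min_(i < Ordinal k0) a (val i)]%O.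
have amin (i : 'I_k) : a i0 <= a i.
  by rewrite /i0; case: arg_minP => // j _; exact.
exists (nth 0 r i0); split.
  have : root p (nth 0 r i0) by rewrite pr root_prod_XsubC mem_nth // sr.
  by rewrite /root /p !hornerE subr_eq0 => /eqP.
have -> : z0 ^+ k - y = \prod_(i < k) (z0 - nth 0 r i).
  have -> : z0 ^+ k - y = p.[z0] by rewrite /p !hornerE.
  rewrite pr horner_prod (big_nth 0) sr big_mkord.
  by apply: eq_bigr => i _; rewrite !hornerE.
have -> : nc (\prod_(i < k) (z0 - nth 0 r i)) = \prod_(i < k) a i.
  rewrite (big_morph nc ncM (@Normc.normc1 R)); apply: eq_bigr => i _.
  by rewrite /a -opprB ncN.
have -> : nc (nth 0 r i0 - z0) ^+ k = \prod_(i < k) a i0 by rewrite prodr_const card_ord.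
by apply: ler_prod => i _; rewrite nc_ge0 amin.
Qed.

Definition pw (k : nat) (y : sphere R) : sphere R := if y is Some z then Some (z ^+ k) else None.

Lemma pw_continuous k : (0 < k)%N -> continuous (pw k).
Proof.
move=> k0 [z|] A.
  move=> /(@plane_exp_continuous k z) h.
  exact: h.
move=> /nbhs_infty_nc[A0 [M M0 hM]]; apply/nbhs_infty_nc; split=> //.
exists (M + 1); first by rewrite addr_gt0.
move=> w hw; apply: hM; rewrite ncX; apply: lt_le_trans (_ : nc w <= _); first lra.
by rewrite ler_eXnr //; lra.
Qed.

Definition ball_chart (z0 : R[i]) (r : R) (y : sphere R) : plane R :=
  if y is Some z then (z - z0) / r%:C else 0.

Definition ball_dom (z0 : R[i]) (r : R) : set (sphere R) :=
  [set y | if y is Some z then nc (z - z0) < r else False].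

Lemma open_ball_dom z0 r : open (ball_dom z0 r).
Proof.
rewrite openE => -[z|//] /= h; apply/nbhs_sphere/nbhs_nc.
exists (r - nc (z - z0)); first by rewrite subr_gt0.
move=> w hw /=; have -> : w - z0 = (w - z) + (z - z0) by ring.
by apply: le_lt_trans (ncD _ _) _; lra.
Qed.

Lemma ball_chartP z0 r : 0 < r -> chart_at (Some z0 : sphere R) (ball_dom z0 r) (ball_chart z0 r).
Proof.
move=> r0; have rC0 : r%:C != 0 :> R[i] by rewrite -nc_eq0 nc_real normr_eq0 gt_eqF.
split=> //=; first exact: open_ball_dom.
- by rewrite subrr Normc.normc0.
- exists (fun w => Some (r%:C * w + z0)); split.
  + apply/withinP => -[z|//] _ P hP.
    have e : (fun w : R[i] => (w - z0) / r%:C) = (fun w => r%:C^-1 * w + (- z0 / r%:C)).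
      by apply/funext => w; rewrite mulrBl mulrC mulNr.
    have := @plane_affine_continuous (r%:C^-1) (- z0 / r%:C) z P.
    rewrite -[_ * _ + _](congr1 (fun h => h z) e) => /(_ hP) h.
    have {}h : \forall w \near (z : plane R), P ((w - z0) / r%:C).
      by apply: near_imp h => w /=; rewrite -[_ * _ + _](congr1 (fun h => h w) e).
    by apply/nbhs_sphere; apply: near_imp h => w + _.
  + apply/withinP => w _ P hP; have h := @plane_affine_continuous r%:C z0 w _ hP.
    by apply: near_imp h => w' + _.
  + move=> [z|//] /= h; split; last by rewrite mulrC divfK // subrK.
    apply/disc_nc; rewrite ncM ncV nc_real gtr0_norm //.
    by rewrite ltr_pdivrMr // mul1r.
  + move=> w /disc_nc hw; split; rewrite /= addrK; last by rewrite mulrAC divff ?mul1r.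
    by rewrite ncM nc_real gtr0_norm // gtr_pMr.
- by rewrite subrr mul0r.
Qed.

(** The constant sets the size of the neighbourhood of infinity and its orientation: for a negative
    real [c], unlike for [c = 1], the upper and lower half-planes are preserved. *)
Definition inv_chart (c : R[i]) (y : sphere R) : plane R := if y is Some z then c / z else 0.

Definition inv_dom (c : R[i]) : set (sphere R) :=
  [set y | if y is Some z then nc c < nc z else True].

Lemma inv_chartP c : c != 0 -> chart_at (None : sphere R) (inv_dom c) (inv_chart c).
Proof.
move=> c0; have nc0 : 0 < nc c by rewrite nc_gt0.
split=> //=.
- rewrite openE => -[z|] /= h.
    apply/nbhs_sphere/nbhs_nc; exists (nc z - nc c); first by rewrite subr_gt0.
    move=> w hw /=; have : nc z <= nc (z - w) + nc w by rewrite -{1}(subrK w z) ncD.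
    by rewrite -opprB ncN; lra.
  by apply/nbhs_infty_nc; split=> //; exists (nc c).
- exists (fun w => if w == 0 :> R[i] then None else Some (c / w)); split.
  + apply/withinP => -[z|] /= h P hP.
      have z0 : z != 0 by rewrite -nc_gt0; exact: lt_trans h.
      have h1 := @plane_affine_continuous c 0 (z^-1) P; rewrite addr0 in h1.
      have h2 := @plane_inv_continuous z z0 _ (h1 hP).
      by apply/nbhs_sphere; apply: near_imp h2 => w /=; rewrite addr0.
    move/nbhs_nc: hP => [e e0 he]; apply/nbhs_infty_nc; split.
      by move=> _; apply: he; rewrite subrr Normc.normc0.
    exists (nc c / e); first by rewrite divr_gt0.
    move=> w hw _; apply: he; rewrite subr0 ncM ncV.
    have w0 : 0 < nc w by apply: lt_trans hw; rewrite divr_gt0.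
    by rewrite ltr_pdivrMr // mulrC -ltr_pdivrMr.
  + apply/withinP => w /disc_nc hw P; case: (eqVneq (w : R[i]) 0) => [w0|w0].
      move=> /nbhs_infty_nc[P0 [M M0 hM]]; apply/nbhs_nc; rewrite w0.
      exists (nc c / M); first by rewrite divr_gt0.
      move=> v; rewrite subr0 => hv _; case: (eqVneq v 0) => [//|v0].
      apply: hM; rewrite ncM ncV ltr_pdivlMr ?nc_gt0 // mulrC -ltr_pdivlMr //.
    move=> hP; have h1 := @plane_affine_continuous c 0 (w^-1) (Some @^-1` P).
    rewrite addr0 in h1.
    have h2 := @plane_inv_continuous w w0 _ (h1 hP).
    have h3 : \forall v \near w, (v : R[i]) != 0.
      apply/nbhs_nc; exists (nc w); first by rewrite nc_gt0.
      by move=> v hv; apply: contraTneq hv => ->; rewrite sub0r ncN ltxx.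
    have h4 : \forall v \near w, P (Some (c * (v : R[i])^-1 + 0)) by exact: h2.
    by apply: near_imp (filterI h4 h3) => v [+ v0] _; rewrite addr0 (negbTE v0).
  + move=> [z|] /= h; last by split=> //; [apply/disc_nc; rewrite Normc.normc0|rewrite eqxx].
    have z0 : 0 < nc z by exact: lt_trans h.
    split; first by apply/disc_nc; rewrite ncM ncV ltr_pdivrMr // mul1r.
    rewrite mulf_eq0 invr_eq0 (negbTE c0) -nc_eq0 gt_eqF //=.
    by rewrite invf_div mulrC divfK.
  + move=> w /disc_nc hw; case: (eqVneq (w : R[i]) 0) => [->//|w0] /=.
    split; last by rewrite invf_div mulrC divfK.
    by rewrite ncM ncV ltr_pdivlMr ?nc_gt0 // gtr_pMr.
Qed.

End Power.
End Covering_11.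
Import Covering_11.

(** * The power map as a branched covering *)

Module Covering_12.
Section PowerCover.
Local Open Scope classical_set_scope.
Local Open Scope ring_scope.
Local Open Scope complex_scope.
Variable R : realType.
Local Notation re := (@complex.Re R).
Local Notation im := (@complex.Im R).
Local Notation nc := (@Normc.normc R).

Lemma finite_min_pos k (e : 'I_k -> R) : (forall j, 0 < e j) ->
  exists2 m, 0 < m & forall j, m <= e j.
Proof.
move=> e0; exists (\big[Num.min/1]_(j < k) e j); first by apply: lt_bigmin.
by move=> j; apply: bigmin_le_cond.
Qed.

Lemma unity_sep k : (0 < k)%N -> exists2 m : R, 0 < m &
  forall w : R[i], w ^+ k = 1 -> w != 1 -> m <= nc (1 - w).
Proof.
move=> k0; have [zeta [_ zP]] := roots_of_unit k0 (oner_neq0 R[i]).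
have [j|m m0 hm] := @finite_min_pos k (fun j => if zeta j == 1 then 1 else nc (1 - zeta j)).
  by case: eqVneq => // h; rewrite nc_gt0 subr_eq0 eq_sym.
exists m => // w /zP[j ->] h; have := hm j; by rewrite (negbTE h).
Qed.

(** The quotient of two points with the same power is a root of unity, and the roots other than 1
    stay at distance [m] from 1. *)
Lemma power_inj_near k (z0 : R[i]) : (0 < k)%N -> z0 != 0 -> exists2 eta : R, 0 < eta &
  forall z1 z2, nc (z1 - z0) < eta -> nc (z2 - z0) < eta -> z1 ^+ k = z2 ^+ k -> z1 = z2.
Proof.
move=> k0 z00; have [m m0 hm] := unity_sep k0; have n0 : 0 < nc z0 by rewrite nc_gt0.
(* The half keeps the modulus of [z1] above half that of [z0]; the quarter makes [z1] and [z2]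
   closer than [nc z0 * m / 2], whereas distinct points would be farther apart than that. *)
exists (Num.min (nc z0 / 2) (nc z0 * m / 4)).
  by rewrite lt_min !divr_gt0 ?mulr_gt0.
move=> z1 z2; rewrite !lt_min => /andP[h1 h2] /andP[h3 h4] e.
have h5 : nc z0 / 2 < nc z1.
  have : nc z0 <= nc (z0 - z1) + nc z1 by rewrite -{1}(subrK z1 z0) ncD.
  by rewrite -opprB ncN; lra.
have z10 : z1 != 0 by rewrite -nc_gt0; lra.
apply/eqP; apply: contraT => ne.
have w1 : (z2 / z1) ^+ k = 1 by rewrite expr_div_n -e divff // expf_neq0.
have wn : z2 / z1 != 1.
  apply: contra ne => /eqP h; apply/eqP.
  by rewrite -[z2](divfK z10) h mul1r.
have := hm _ w1 wn.
have h6 : nc (z1 - z2) = nc z1 * nc (1 - z2 / z1).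
  by rewrite -ncM mulrBr mulr1 mulrC divfK.
have h7 : nc (z1 - z2) <= nc (z1 - z0) + nc (z2 - z0).
  by rewrite -(ncN (z2 - z0)) opprB (le_trans _ (ncD _ _)) // addrA subrK.
move=> h8; have h9 : nc z0 / 2 * m <= nc z1 * nc (1 - z2 / z1).
  by apply: ler_pM => //; rewrite ltW // ?divr_gt0.
by exfalso; lra.
Qed.

(** The inverse branch [g] is chosen by [near_root] and unique by [power_inj_near]; a second use of
    [near_root] gives its continuity. *)
Lemma pw_ram_generic k (z0 : R[i]) : (0 < k)%N -> z0 != 0 ->
  ramification_index (pw k) (Some z0 : sphere R) 1.
Proof.
move=> k0 z00; have [eta eta0 inj] := power_inj_near k0 z00.
(* A k-th power because [near_root] bounds the k-th power of the distance to the root. *)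
pose ep := eta ^+ k; have ep0 : 0 < ep by rewrite exprn_gt0.
have epC : ep%:C != 0 :> R[i] by rewrite -nc_eq0 nc_real normr_eq0 gt_eqF.
pose c := z0 ^+ k.
have /choice[g gP] : forall y, exists z : R[i], nc (y - c) < ep -> z ^+ k = y /\ nc (z - z0) < eta.
  move=> y; have [z [zk hz]] := near_root z0 y k0; exists z => hy; split=> //.
  rewrite -(ltr_pXn2r k0) ?nnegrE ?nc_ge0 ?ltW //; apply: le_lt_trans hz _.
  by rewrite -opprB ncN.
pose A : set (sphere R) := [set y | if y is Some z then nc (z - z0) < eta /\ nc (z ^+ k - c) < ep else False].
have cB := ball_chartP c ep0.
exists A, (ball_dom c ep), (fun x => ball_chart c ep (pw k x)), (ball_chart c ep).
have oA : open A.
  rewrite openE => -[z|//] /= [h1 h2].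
  have n1 : nbhs (z : plane R) [set w : plane R | nc ((w : R[i]) - z0) < eta].
    have : nbhs (Some z : sphere R) (ball_dom z0 eta).
      by apply: open_nbhs_nbhs; split=> //; exact: open_ball_dom.
    exact.
  have n2 : nbhs (z : plane R) [set w : plane R | nc ((w : R[i]) ^+ k - c) < ep].
    have : nbhs (Some (z ^+ k) : sphere R) (ball_dom c ep).
      by apply: open_nbhs_nbhs; split=> //; exact: open_ball_dom.
    by move/(@pw_continuous R k k0 (Some z)).
  by apply/nbhs_sphere; apply: near_imp (filterI n1 n2) => w [].
have xx : forall w : R[i], nc w < 1 -> nc (ep%:C * w + c - c) < ep.
  by move=> w hw; rewrite addrK ncM nc_real gtr0_norm // gtr_pMr.
split.
- split=> //=.
  + by split; rewrite subrr Normc.normc0.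
  + exists (fun w => Some (g (ep%:C * w + c))); split.
    * apply/withinP => -[z|//] hz P hP.
      have [oB _ [v' [/withinP cv _ _ _]] _] := cB.
      have hB : ball_dom c ep (pw k (Some z)) by case: hz.
      have nB : nbhs (pw k (Some z)) (ball_dom c ep) by apply: open_nbhs_nbhs.
      have h := @pw_continuous R k k0 (Some z) _ (filterI (cv _ hB P hP) nB).
      have h' : \forall y \near (Some z : sphere R), (ball_dom c ep (pw k y) -> P (ball_chart c ep (pw k y))) /\ ball_dom c ep (pw k y) by exact: h.
      by apply: near_imp h' => y [h1 h2] _; exact: h1.
    * apply/withinP => w /disc_nc hw P /nbhs_nc[e e0 he].
      have [gk gn] := gP _ (xx w hw).
      set z' := g _ in he gk gn.
      pose e1 := Num.min e (eta - nc (z' - z0)).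
      have e10 : 0 < e1 by rewrite lt_min e0 subr_gt0.
      apply/nbhs_nc; exists (e1 ^+ k / ep); first by rewrite divr_gt0 ?exprn_gt0.
      move=> w' hw' /disc_nc dw'.
      have [z2 [z2k hz2]] := near_root z' (ep%:C * w' + c) k0.
      have h2 : nc (z2 - z') < e1.
        rewrite -(ltr_pXn2r k0) ?nnegrE ?nc_ge0 ?ltW //; apply: le_lt_trans hz2 _.
        rewrite gk; have -> : ep%:C * w + c - (ep%:C * w' + c) = - (ep%:C * (w' - w)) by ring.
        by rewrite ncN ncM nc_real gtr0_norm // mulrC -ltr_pdivlMr.
      have [h3 h4] : nc (z2 - z') < e /\ nc (z2 - z') < eta - nc (z' - z0).
        by move: h2; rewrite lt_min => /andP.
      have [gk' gn'] := gP _ (xx w' dw').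
      have -> : g (ep%:C * w' + c) = z2.
        apply: inj => //; last by rewrite gk'.
        have -> : z2 - z0 = (z2 - z') + (z' - z0) by ring.
        by apply: le_lt_trans (ncD _ _) _; lra.
      exact: he.
    * move=> [z|//] /= [h1 h2]; split.
        by apply/disc_nc; rewrite ncM ncV nc_real gtr0_norm // ltr_pdivrMr // mul1r.
      have h3 : ep%:C * ((z ^+ k - c) / ep%:C) + c = z ^+ k by rewrite mulrC divfK // subrK.
      rewrite h3; have [gk gn] := gP _ h2; congr Some; exact: inj.
    * move=> w /disc_nc hw; have [gk gn] := gP _ (xx w hw); rewrite /A /= gk; split.
        by split=> //; exact: xx.
      by rewrite addrK mulrAC divff // mul1r.
  + by rewrite subrr mul0r.
- exact: cB.
- move=> [z|//] /= [h1 h2]; split=> //; by rewrite expr1.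
Qed.

Lemma pw_branched k : (0 < k)%N -> branched [:: 0] k (pw k : sphere R -> sphere R).
Proof.
move=> k0; split.
- exact: sphere_compact.
- exact: sphere_hausdorff.
- exact: pw_continuous.
have zero : ramification_index (pw k) (Some 0 : sphere R) k.
  have c := @ball_chartP R 0 1 ltr01.
  have e0 : (0 : R[i]) ^+ k = 0 by rewrite expr0n; case: k k0.
  exists (ball_dom 0 1), (ball_dom 0 1), (ball_chart 0 1), (ball_chart 0 1).
  split; [exact: c|by rewrite /pw e0; exact: c|].
  move=> [z|//] /=; rewrite !subr0 => h; split.
    by rewrite ncX exprn_ilt1 ?nc_ge0 // -lt0n.
  by rewrite !divr1.
have infty : ramification_index (pw k) (None : sphere R) k.
  have c := @inv_chartP R 1 (oner_neq0 _).
  exists (inv_dom 1), (inv_dom 1), (inv_chart 1), (inv_chart 1).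
  split; [exact: c|exact: c|].
  have n1 : nc 1 = 1 := Normc.normc1 R.
  move=> [z|] h; split=> //.
  - move: h; change (nc 1 < nc z -> nc 1 < nc (z ^+ k)).
    by rewrite n1 ncX => h; rewrite exprn_egt1 // -lt0n.
  - by rewrite /inv_chart /= !mul1r exprVn.
  - by rewrite /inv_chart /= expr0n; case: k k0 {zero c h}.
have single (y x : sphere R) : (forall x', pw k x' = y <-> x' = x) -> ramification_index (pw k) x k ->
    special [:: 0] y -> exists s l, [/\ numbered_fiber (pw k) y (s := s) l, sumn s = k
      & ~~ special [:: 0] y -> s = nseq k 1%N].
  move=> hx rx sy; exists [:: k], (fun=> x); split; last by rewrite sy.
  - split; first by move=> i j _; rewrite !ord1.
      apply/seteqP; split=> [_ [i0 _ <-]|x' /hx ->]; first by apply/hx.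
      by exists ord0.
    by move=> i0; rewrite ord1.
  - by rewrite /= addn0.
case=> [y|]; last by apply: single infty _ => // -[z|] //=; split.
have [->|y0] := eqVneq y 0.
  apply: (single _ (Some 0)) => //=.
    move=> [z|] //=; split=> [[/eqP]|[->]].
      by rewrite expf_eq0 k0 /= => /eqP ->.
    by rewrite expr0n; case: k k0 {single zero infty}.
  by rewrite eqxx inE eqxx.
have [zeta [zI zP]] := roots_of_unit k0 y0.
have sz : size (nseq k 1%N) = k by rewrite size_nseq.
exists (nseq k 1%N), (fun i => Some (zeta (cast_ord sz i))); split=> //; last by rewrite sumn_nseq mul1n.
split.
- by move=> i j [/zI /cast_ord_inj].
- apply/seteqP; split=> [_ [i0 _ <-]|[z|] //= [/zP[j ->]]].
    by rewrite /= ; congr Some; apply/zP; exists (cast_ord sz i0).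
  by exists (cast_ord (esym sz) j) => //; rewrite cast_ordKV.
- move=> i0; rewrite nth_nseq -[X in (_ < X)%N]sz ltn_ord; apply: pw_ram_generic => //.
  have : zeta (cast_ord sz i0) ^+ k = y by apply/zP; exists (cast_ord sz i0).
  by move=> h; apply: contraNneq y0 => z0; rewrite -h z0 expr0n; case: k k0 {zI zP sz zeta i0 z0 h single zero infty}.
Qed.

End PowerCover.
End Covering_12.
Import Covering_12.

(** * Rotation around a value, and charts of the model *)

Module Covering_13.
Section Orbits.
Local Open Scope ring_scope.

(** Both cycles have length [k], so the image of a base point under the n-th power depends on [n]
    modulo [k] only, and matching equal powers is well defined. *)
Lemma conj_orbit k d (s1 : 'S_k) (s : 'S_d) (a0 : 'I_k) (c0 : 'I_d) :
  (forall a, a \in porbit s1 a0) -> #|porbit s c0| = k ->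
  exists gam : 'I_k -> 'I_d, [/\ injective gam, forall a, gam (s1 a) = s (gam a)
    & forall c, c \in porbit s c0 <-> exists a, c = gam a].
Proof.
move=> tr ck.
have k1 : #|porbit s1 a0| = k by rewrite -[RHS]card_ord; apply: eq_card => a; rewrite tr.
have k0 : (0 < k)%N by apply: leq_ltn_trans (ltn_ord a0).
have pw_eq (T : finType) (t : {perm T}) x m n : #|porbit t x| = k ->
    ((t ^+ m)%g x = (t ^+ n)%g x) <-> m = n %[mod k].
  move=> tk; have tkx : (t ^+ k)%g x = x by rewrite permX -tk iter_porbit.
  have red j : (t ^+ j)%g x = (t ^+ (j %% k))%g x.
    rewrite {1}(divn_eq j k) expgD permM; congr ((t ^+ _)%g _).
    by elim: (j %/ _)%N => [|q IH]; rewrite ?perm1 // mulSn expgD permM tkx.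
  split=> [|e]; last by rewrite red e -red.
  rewrite red [RHS]red => e.
  have um := uniq_traject_porbit t x; rewrite tk in um.
  have mk : (m %% k < k)%N by rewrite ltn_mod. have nk : (n %% k < k)%N by rewrite ltn_mod.
  apply/eqP; rewrite -(nth_uniq x _ _ um) ?size_traject // !nth_traject //.
  by rewrite -!permX e.
have /choice[n nP] : forall a, exists n, (s1 ^+ n)%g a0 = a.
  by move=> a; have /porbitP[n ->] := tr a; exists n.
exists (fun a => (s ^+ n a)%g c0); split.
- by move=> a b /(pw_eq _ _ _ _ _ ck)/(pw_eq _ _ _ _ _ k1); rewrite !nP.
- move=> a; rewrite -permM -expgSr; apply/(pw_eq _ _ _ _ _ ck).
  by apply/(pw_eq _ _ _ _ _ k1); rewrite nP expgSr permM nP.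
- move=> c; split=> [/porbitP[m ->]|[a ->]]; last exact: mem_porbit.
  exists ((s1 ^+ m)%g a0); apply/(pw_eq _ _ _ _ _ ck).
  by apply/(pw_eq _ _ _ _ _ k1); rewrite nP.
Qed.

Variable R : realType.

(** A turn around [y] leaves the upper half-plane through edge [jl] and comes back through edge
    [jr]. The upper labels of a component are thus one cycle of this rotation; lower labels are
    carried up through [jl]. *)
Lemma comp_porbit (xs : seq R) d (pi : nat -> 'S_d) y jl jr : (jl <= size xs)%N -> (jr <= size xs)%N ->
  (forall j, (j <= size xs)%N -> act xs j y = (j == jl) || (j == jr)) ->
  forall a l, (l \in comp xs pi y (true, a)) =
    ((if l.1 then l.2 else pi jl l.2) \in porbit ((pi jl)^-1 * pi jr)%g a).
Proof.
move=> jls jrs hact a l; pose s := ((pi jl)^-1 * pi jr)%g.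
have al : act xs jl y by rewrite hact // eqxx.
have ar : act xs jr y by rewrite hact // eqxx orbT.
pose D (l : bool * 'I_d) := (if l.1 then l.2 else pi jl l.2) \in porbit s a.
have stepD x : (s x \in porbit s a) = (x \in porbit s a).
  by rewrite -!eq_porbit_mem; have := porbit_perm s 1 x; rewrite expg1 => ->.
have stepr b : (pi jr b \in porbit s a) = (pi jl b \in porbit s a).
  by rewrite -[RHS]stepD /s permM permK.
have edgeD j b : (j <= size xs)%N -> act xs j y -> (pi j b \in porbit s a) = (pi jl b \in porbit s a).
  by move=> js; rewrite hact // => /orP[/eqP ->//|/eqP ->].
rewrite -/s -/(D l); apply/idP/idP.
  have : D (true, a) by rewrite /D /= porbit_id.
  rewrite inE; move: (true, a) => t Dt /connectP[p + ->].
  elim: p t Dt => //= u p IH t Dt /andP[tu]; apply: IH.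
  have /existsP[[j js] /= /andP[aj]] := tu; rewrite ltnS in js.
  case: t u Dt {tu} => [[] t] [[] u] //=; rewrite /D /= ?orbF => Dt /eqP e.
    by rewrite -(edgeD j) // -e.
  by rewrite e edgeD.
have up b : connect (edge_rel xs pi y) (true, pi jl b) (false, b).
  by rewrite comp_sym connect1 // edge_relP.
have upr b : connect (edge_rel xs pi y) (false, b) (true, pi jr b).
  by rewrite connect1 // edge_relP.
have ct c : c \in porbit s a -> connect (edge_rel xs pi y) (true, a) (true, c).
  move=> /porbitP[n ->]; elim: n => [|n IH]; first by rewrite perm1 connect0.
  apply: connect_trans IH _; rewrite expgSr permM.
  set x := (s ^+ n)%g a; have := up ((pi jl)^-1%g x); rewrite permKV => h.
  by apply: connect_trans h _; rewrite /s permM.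
case: l => [[] l]; rewrite /D inE /=; first exact: ct.
by move=> /ct h; apply: connect_trans h (up l).
Qed.

End Orbits.

Section Chart.
Local Open Scope classical_set_scope.
Local Open Scope ring_scope.
Local Open Scope complex_scope.
Variables (R : realType) (xs : seq R) (d : nat) (pi : nat -> 'S_d).
Local Notation M := (@model R xs d pi).
Local Notation nc := (@Normc.normc R).

(** The coordinate [v] takes half-planes to half-planes and the edges [jl] and [jr] to the left and
    the right ray of the axis cut at 0, numbered 0 and 1 there. *)
Definition local_type (B : set (sphere R)) (v : sphere R -> plane R) (jl jr : nat) :=
  forall y, B y -> (forall e, cface e y <-> cface e (Some (v y))) /\
    (forall j, (j <= size xs)%N -> act xs j y =
      ((j == jl) && act [:: 0] 0 (Some (v y))) || ((j == jr) && act [:: 0] 1 (Some (v y)))).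

(* Near p the model is matched, through the labels, with the covering
   z |-> z^k of the sphere near 0. *)
Lemma model_chart (p : M) B v jl jr : (jl <= size xs)%N -> (jr <= size xs)%N ->
  chart_at (mproj p) B v -> local_type B v jl jr ->
  ramification_index (@mproj R xs d pi) p #|[set a | (true, a) \in mlab p]%SET|.
Proof.
move=> jls jrs cv lt; have [oB Bp [v' [/withinP cvB /withinP cv' vK v'K]] vp] := cv.
have act0 j : (j <= size xs)%N -> act xs j (mproj p) = (j == jl) || (j == jr).
  move=> js; have [_ ->//] := lt _ Bp; rewrite vp /act /= eqxx lexx /= !andbT.
  by [].
pose s := ((pi jl)^-1 * pi jr)%g; pose k := #|[set a | (true, a) \in mlab p]%SET|.
have [c0 c0p] : exists c0, (true, c0) \in mlab p.
  have [[[] b] tp] := mlab_neq0 p; first by exists b.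
  exists (pi jl b); have [_ ->] := mlabP tp; rewrite inE connect1 // edge_relP //.
  by rewrite act0 // eqxx.
have [_ mlabE] := mlabP c0p.
have memp l : (l \in mlab p) = ((if l.1 then l.2 else pi jl l.2) \in porbit s c0).
  by rewrite mlabE (comp_porbit pi jls jrs act0).
have ck : #|porbit s c0| = k by apply: eq_card => a; rewrite inE memp.
have k0 : (0 < k)%N by rewrite -ck lt0n card_porbit_neq0.
have brk := @pw_branched R k k0.
have xS : sorted <%R [:: 0 : R] by [].
have [C [rho [rho0 [labC compC]]]] := presentation_exists xS brk.
have C0 l : l \in C (Some 0).
  have cf0 e : cface e (Some 0 : sphere R) by rewrite /cface /=; case: e.
  case: l => e a; have [[z|] [fz az]] := lab_ex labC a (cf0 e) => //.
  suff z0 : z = 0 by rewrite -z0.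
  by move: fz => [/eqP]; rewrite expf_eq0 k0 /= => /eqP.
pose a0 : 'I_k := Ordinal k0.
have act1 j : (j <= size [:: (0 : R)%R])%N -> @act R [:: 0] j (pw k (Some 0 : sphere R)) = (j == 0%N :> nat) || (j == 1%N :> nat).
  have zk : (0 : R[i]) ^+ k = 0 by rewrite expr0n (gtn_eqF k0).
  by rewrite /pw zk; case: j => [|[|j']] //=; rewrite ?eqxx ?lexx.
(* 0 is the only point over 0 of the power map, so it carries all labels, and the rotation there is
   a single cycle of length [k]. *)
have tr a : a \in porbit (rho 1%N) a0.
  have := @comp_porbit R [:: 0] k rho _ 0%N 1%N (leq0n 1) (leqnn 1) act1 a0 (true, a).
  rewrite -(compC _ _ (C0 (true, a0))) C0 /= rho0 invg1 mul1g => /esym.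
  by [].
have [gam [gamI gamS gamP]] := conj_orbit tr ck.
(* Upper sheets are matched by [gam], which respects the rotations; lower sheets follow through edge
   [jl], whose counterpart for the power map is glued by the identity. *)
pose g (l : bool * 'I_k) : bool * 'I_d := (l.1, if l.1 then gam l.2 else (pi jl)^-1%g (gam l.2)).
have gI : injective g.
  by move=> [[] a] [[] b] // [] => [/gamI ->|/perm_inj/gamI ->].
have gp l : l \in mlab p <-> exists l', l = g l'.
  rewrite memp gamP; case: l => [[] l] /=; split=> [[a e]|[[[] a] //= [e]]].
  - by exists (true, a); rewrite /g /= -e.
  - by exists a.
  - by exists (false, a); rewrite /g /= -e permK.
  - by exists a; rewrite e permKV.
have edge y t u : B y -> edge_rel xs pi y (g t) u <->
    exists u', u = g u' /\ edge_rel [:: 0] rho (Some (v y)) t u'.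
  move=> By; have [_ aE] := lt y By; split.
    move=> /existsP[[j js] /= /andP[]]; rewrite ltnS in js; rewrite aE //.
    have mk i0 t' u' : (i0 <= 1)%N -> act [:: 0] i0 (Some (v y)) ->
      ([&& ~~ t'.1, u'.1 & u'.2 == rho i0 t'.2] || [&& t'.1, ~~ u'.1 & t'.2 == rho i0 u'.2]) ->
      edge_rel [:: 0] rho (Some (v y)) t' u'.
      by move=> hi ai hh; apply/existsP; exists (Ordinal (n := 2) (m := i0) hi); apply/andP; split.
    case: t u => [[] t] [[] u] /=; rewrite ?andbF ?orbF //= => aj /eqP e.
      have e' : u = (pi j)^-1%g (gam t) by rewrite e permK.
      case/orP: aj => /andP[/eqP jE aj].
        exists (false, t); rewrite /g /= e' jE; split=> //.
        by apply: (mk 0%N) => //=; rewrite rho0 perm1 eqxx.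
      exists (false, (rho 1%N)^-1%g t); rewrite /g /= e' jE; split.
        congr pair; apply: (@perm_inj _ (pi jr)); rewrite permKV.
        by rewrite -{1}(permKV (rho 1%N) t) gamS /s permM.
      by apply: (mk 1%N) => //=; rewrite permKV eqxx.
    case/orP: aj => /andP[/eqP jE aj].
      exists (true, t); rewrite /g /= e jE permKV; split=> //.
      by apply: (mk 0%N) => //=; rewrite rho0 perm1 eqxx.
    exists (true, rho 1%N t); rewrite /g /= e jE gamS /s permM; split=> //.
    by apply: (mk 1%N) => //=; rewrite eqxx.
  move=> [u' [-> /existsP[[j js] /andP[aj hh]]]]; have {}aj : act [:: 0] j (Some (v y)) := aj; move: hh => /=.
  have mk i0 t' w : (i0 <= size xs)%N -> act xs i0 y ->
      ([&& ~~ t'.1, w.1 & w.2 == pi i0 t'.2] || [&& t'.1, ~~ w.1 & t'.2 == pi i0 w.2]) ->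
      edge_rel xs pi y t' w.
    by move=> hi ai hh; apply/existsP; exists (Ordinal (n := (size xs).+1) (m := i0) hi); apply/andP; split.
  have al : act [:: 0] 0 (Some (v y)) -> act xs jl y by move=> h; rewrite aE // eqxx h.
  have ar : act [:: 0] 1 (Some (v y)) -> act xs jr y by move=> h; rewrite aE // eqxx h orbT.
  clear u; case: j js aj => [|[|//]] js aj; case: t u' => [[] t] [[] u'] //=; rewrite ?orbF ?rho0 ?perm1 => /eqP ->.
  - by apply: (mk jl _ _ jls (al aj)); rewrite /= permKV eqxx.
  - by apply: (mk jl _ _ jls (al aj)); rewrite /= permKV eqxx.
  - by apply: (mk jr _ _ jrs (ar aj)); rewrite /= gamS /s permM eqxx.
  - by apply: (mk jr _ _ jrs (ar aj)); rewrite /= gamS /s permM eqxx.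
have compg y t : B y -> comp xs pi y (g t) = (g @: comp [:: 0] rho (Some (v y)) t)%SET.
  move=> By; apply/setP => u; rewrite inE; apply/idP/imsetP.
    move=> /connectP[q pq ->]; elim: q t pq => [|w q IH] t /=.
      by move=> _; exists t => //; exact: mem_comp.
    move=> /andP[/(edge _ _ _ By)[w' [-> tw]] /IH[l lw ->]]; exists l => //.
    move: lw; rewrite !inE; apply: connect_trans; exact: connect1.
  move=> [l]; rewrite inE => /connectP[q pq ->] ->.
  elim: q t pq => [|w q IH] t /=; first by rewrite connect0.
  move=> /andP[tw /IH]; apply: connect_trans; apply: connect1.
  by apply/(edge _ _ _ By); exists w.
have fC z t : t \in C (Some z) -> cface t.1 (Some (z ^+ k)) /\ C (Some z) = comp [:: 0] rho (Some (z ^+ k)) t.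
  by move=> tz; split; [case: t tz => e a /(lab_cface labC)|exact: (compC _ _ tz)].
pose A := [set q : M | B (mproj q) /\ mlab q \subset mlab p].
have vK' y : B y -> nc (v y) < 1 /\ v' (v y) = y.
  by move=> /vK[/disc_nc].
have /choice[u uP] : forall q : M, exists z : plane R, A q ->
    (z : R[i]) ^+ k = v (mproj q) /\ (g @: C (Some z))%SET = mlab q.
  move=> q; have [[Bq sq]|nA] := pselect (A q); last by exists 0.
  have [t tq] := mlab_neq0 q; have [t' tt] := (gp t).1 (fintype.subsetP sq _ tq).
  have [ct mq] := mlabP tq; have [ce _] := lt _ Bq.
  have ct' : cface t'.1 (Some (v (mproj q))) by apply/ce; move: ct; rewrite tt.
  have ct2 : cface (t'.1, t'.2).1 (Some (v (mproj q))) by [].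
  have [[z|] [[fz] tz]] := lab_ex labC t'.2 ct2 => //; rewrite -surjective_pairing in tz.
  exists z => _; split=> //; have [_ ->] := fC _ _ tz.
  by rewrite mq tt compg // fz.
have dk (z : R[i]) : nc (z ^+ k) < 1 <-> nc z < 1.
  by rewrite ncX expr_lt1 // nc_ge0.
have /choice[h hP] : forall z : plane R, exists q : M, @disc R z ->
    [/\ A q, v (mproj q) = (z : R[i]) ^+ k :> R[i] & (g @: C (Some z))%SET = mlab q].
  move=> z; have [dz|] := pselect (@disc R z); last by exists p.
  have [t tz] := labels_neq0 brk labC (Some z); have [ct cz] := fC _ _ tz.
  have dz' : @disc R ((z : R[i]) ^+ k) by apply/disc_nc/dk/disc_nc.
  have [By vy] := v'K _ dz'; have [ce _] := lt _ By.
  have ct2 : cface (g t).1 (v' ((z : R[i]) ^+ k)) by apply/ce; rewrite vy.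
  have [q [qy tq]] := model_ex xs pi ct2; exists q => _.
  have e : (g @: C (Some z))%SET = mlab q.
    have [_ ->] := mlabP tq; rewrite qy compg // vy.
    by rewrite cz.
  split=> //; last by rewrite qy.
  split; first by rewrite qy.
  by rewrite -e; apply/fintype.subsetP => _ /imsetP[l _ ->]; apply/gp; exists l.
have uh z : @disc R z -> u (h z) = z.
  move=> /hP[Ah vh gh]; have [uk gu] := uP _ Ah.
  have [t tz] := labels_neq0 brk labC (Some z).
  have : Some (u (h z)) = Some z :> sphere R; last by case.
  apply: (lab_inj labC (l := t)) _ (tz); first by rewrite /= uk vh.
  have : g t \in (g @: C (Some (u (h z))))%SET by rewrite gu -gh imset_f.
  by rewrite mem_imset.
have Ap : A p by [].
exists A, B, u, v; split=> //; last by move=> q Aq; have [uk _] := uP _ Aq; case: (Aq).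
split=> //; last first.
- have [/eqP] := uP _ Ap; rewrite vp expf_eq0 k0 /= => /eqP -> _. by [].
- exists h; split.
  + apply/withinP => q Aq W nW; have [uk gu] := uP _ Aq.
    have nW' : nbhs (Some (u q) : sphere R) (Some @` W).
      exact: one_point_compactification_some_nbhs.
    have lim := lab_limit brk labC nW'.
    rewrite /pw uk in lim.
    have n1 : \forall q' \near q, B (mproj q') -> forall x', pw k x' = Some (v (mproj q')) ->
        C x' :&: C (Some (u q)) != finset.set0 -> (Some @` W) x'.
      have h1 : nbhs (v (mproj q)) [set z : plane R | forall x', pw k x' = Some z ->
        C x' :&: C (Some (u q)) != finset.set0 -> (Some @` W) x'] by exact: lim.
      exact: (@mproj_continuous _ _ _ _ q _ (cvB _ Aq.1 _ h1)).
    apply: near_imp (filterI n1 (mlab_near q)) => q' [h1 h2] Aq'.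
    have [uk' gu'] := uP _ Aq'.
    have h3 : C (Some (u q')) :&: C (Some (u q)) != finset.set0.
      have [t tq'] := labels_neq0 brk labC (Some (u q')).
      apply/finset.set0Pn; exists t; rewrite inE tq' /=.
      have : g t \in mlab q by apply: (fintype.subsetP h2); rewrite -gu' imset_f.
      by rewrite -gu mem_imset.
    have h4 : pw k (Some (u q')) = Some (v (mproj q')) by rewrite /= uk'.
    by have [z Wz [<-]] := h1 Aq'.1 (Some (u q')) h4 h3.
  + apply/withinP => z dz W /nbhs_model hW; have [Ah vh gh] := hP _ dz.
    have dz' : @disc R ((z : R[i]) ^+ k) by apply/disc_nc/dk/disc_nc.
    have e : mproj (h z) = v' ((z : R[i]) ^+ k) by rewrite -vh; have [_ ->] := vK _ Ah.1.
    rewrite e in hW; have n1 := @plane_exp_continuous R k z _ (cv' _ dz' _ hW).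
    have n1' : \forall z' \near z, @disc R ((z' : R[i]) ^+ k) -> forall q,
      mproj q = v' ((z' : R[i]) ^+ k) -> mlab q \subset mlab (h z) -> W q by exact: n1.
    have n2 : \forall z' \near z, C (Some z') \subset C (Some z).
      exact: (lab_near labC (Some z)).
    apply: near_imp (filterI n1' n2) => z' [h1 h2] dz2; have [Ah' vh' gh'] := hP _ dz2.
    apply: h1.
    * by apply/disc_nc/dk/disc_nc.
    * by rewrite -vh'; have [_ ->] := vK _ Ah'.1.
    * by rewrite -gh -gh'; exact: imsetS.
  + move=> q Aq; have [uk gu] := uP _ Aq.
    have du : @disc R (u q) by apply/disc_nc/dk; rewrite uk; case: (vK' _ Aq.1).
    split=> //; have [Ah vh gh] := hP _ du; apply: model_eq; last by rewrite -gh.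
    have [_ <-] := vK _ Ah.1; have [_ <-] := vK _ Aq.1; congr v'.
    by rewrite vh uk.
  + by move=> z dz; have [Ah _ _] := hP _ dz; split=> //; exact: uh.
- have nB : open [set q : M | B (mproj q)].
    by apply: (@open_comp _ _ (@mproj R xs d pi) B _ oB) => q _; exact: mproj_continuous.
  rewrite openE => q [Bq sq]; have n1 : nbhs q [set q | B (mproj q)] by apply: open_nbhs_nbhs.
  apply: near_imp (filterI n1 (mlab_near q)) => q' [B' s']; split=> //.
  exact: fintype.subset_trans s' sq.
Qed.

End Chart.
End Covering_13.
Import Covering_13.

(** * Local types at real values and at infinity *)

Module Covering_14.
Section LocalTypes.
Local Open Scope classical_set_scope.
Local Open Scope ring_scope.
Local Open Scope complex_scope.
Variables (R : realType) (xs : seq R).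
Hypothesis xsS : sorted <%R xs.
Local Notation re := (@complex.Re R).
Local Notation im := (@complex.Im R).
Local Notation nc := (@Normc.normc R).

Lemma mul_real_re (z : R[i]) (r : R) : re (z * r%:C) = re z * r.
Proof. by case: z => a b; rewrite /= mulr0 subr0. Qed.
Lemma mul_real_im (z : R[i]) (r : R) : im (z * r%:C) = im z * r.
Proof. by case: z => a b; rewrite /= mulr0 add0r. Qed.
Lemma div_real_re (z : R[i]) (r : R) : re (z / r%:C) = re z / r.
Proof. by rewrite -fmorphV mul_real_re. Qed.
Lemma div_real_im (z : R[i]) (r : R) : im (z / r%:C) = im z / r.
Proof. by rewrite -fmorphV mul_real_im. Qed.

Lemma local_type_ball (x : R) jl jr :
  (\forall y \near (Some (x +i* 0) : sphere R), forall w : R[i], y = Some w ->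
     forall j, (j <= size xs)%N -> act xs j (Some w : sphere R) =
     (im w == 0) && (((j == jl) && (re w <= x)) || ((j == jr) && (x <= re w)))) ->
  exists B v, chart_at (Some (x +i* 0) : sphere R) B v /\ local_type xs B v jl jr.
Proof.
move=> /nbhs_sphere/nbhs_nc[r r0 hr].
have cv := ball_chartP (x +i* 0) r0.
exists (ball_dom (x +i* 0) r), (ball_chart (x +i* 0) r); split=> // -[w|//] /= hw.
have rv : re ((w - (x +i* 0)) / r%:C) = (re w - x) / r by rewrite div_real_re re_sub.
have iv : im ((w - (x +i* 0)) / r%:C) = im w / r by rewrite div_real_im im_sub /= subr0.
have ri0 : 0 < r^-1 by rewrite invr_gt0.
split.
  by move=> e; rewrite /cface /= iv; case: e; rewrite ?pmulr_lge0 ?pmulr_lle0.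
move=> j js; apply: (etrans (hr w hw w erefl j js)); rewrite /= rv iv mulf_eq0 (gt_eqF ri0) orbF.
rewrite pmulr_lle0 // pmulr_lge0 // subr_le0 subr_ge0.
by case: (im w == 0); rewrite ?andbT //= ?andbF.
Qed.

(** Both sides of such a value belong to the same edge [j], so the rotation around it is trivial. *)
Lemma local_type_real j x : (j <= size xs)%N -> oint xs j (x +i* 0) ->
  exists B v, chart_at (Some (x +i* 0) : sphere R) B v /\ local_type xs B v j j.
Proof.
move=> js ox; apply: local_type_ball.
have n1 := finer_near xs (Some (x +i* 0) : sphere R).
have [/= _ h1 h2] := and3P ox.
have n2 : \forall y \near (Some (x +i* 0) : sphere R), forall w : R[i], y = Some w ->
    (j == 0%N) || (nth 0 xs j.-1 < re w).
  case/orP: h1 => [->|h1]; first by apply: near_all.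
  apply/nbhs_sphere.
  have := @re_continuous R (x +i* 0) _ (lt_nbhsr h1).
  by apply: near_imp => w /= h _ [<-]; rewrite h orbT.
have n3 : \forall y \near (Some (x +i* 0) : sphere R), forall w : R[i], y = Some w ->
    (j == size xs) || (re w < nth 0 xs j).
  case/orP: h2 => [->|h2]; first by apply: near_all.
  apply/nbhs_sphere.
  have := @re_continuous R (x +i* 0) _ (lt_nbhsl h2).
  by apply: near_imp => w /= h _ [<-]; rewrite h orbT.
apply: near_imp (filterI n1 (filterI n2 n3)) => y [[fy _] [k1 k2]] w e j' js'.
have {}k1 := k1 _ e; have {}k2 := k2 _ e; subst y.
apply/idP/idP => [a'|].
  have e := oint_act_inj xsS js js' ox (fy _ js' a').
  have [/= -> _ _] := and3P a'; rewrite e eqxx /=.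
  by case: (lerP (re w) x) => //= /ltW.
move=> /andP[w0]; rewrite -andb_orr => /andP[/eqP -> _].
rewrite /act w0 /=.
case/orP: k1 => [->|/ltW ->]; case/orP: k2 => [->|/ltW ->]; by rewrite ?orbT.
Qed.

Lemma local_type_special i : (i < size xs)%N ->
  exists B v, chart_at (Some (nth 0 xs i +i* 0) : sphere R) B v /\ local_type xs B v i i.+1.
Proof.
move=> si; set x := nth 0 xs i; apply: local_type_ball.
have n1 := finer_near xs (Some (x +i* 0) : sphere R).
have n2 : \forall y \near (Some (x +i* 0) : sphere R), forall w : R[i], y = Some w ->
    (i == 0%N) || (nth 0 xs i.-1 <= re w).
  have [i0|i0] := eqVneq i 0%N; first by apply: near_all.
  have h1 : nth 0 xs i.-1 < x by apply: xs_lt => //; rewrite prednK // lt0n.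
  apply/nbhs_sphere; have := @re_continuous R (x +i* 0) _ (lt_nbhsr h1).
  by apply: near_imp => w /= h _ [<-]; rewrite ltW.
have n3 : \forall y \near (Some (x +i* 0) : sphere R), forall w : R[i], y = Some w ->
    (i.+1 == size xs) || (re w <= nth 0 xs i.+1).
  have [i0|i0] := eqVneq i.+1 (size xs); first by apply: near_all.
  have h1 : x < nth 0 xs i.+1 by apply: xs_lt => //; rewrite ltn_neqAle i0 si.
  apply/nbhs_sphere; have := @re_continuous R (x +i* 0) _ (lt_nbhsl h1).
  by apply: near_imp => w /= h _ [<-]; rewrite ltW.
apply: near_imp (filterI n1 (filterI n2 n3)) => y [[fy _] [k1 k2]] w e j js.
have {}k1 := k1 _ e; have {}k2 := k2 _ e; subst y.
apply/idP/idP => [a'|].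
  have /and3P[/= _ b1 b2] := fy _ js a'; have /and3P[/= -> c1 c2] := a'.
  have [ji|ji|ji] := ltngtP j i.
  - case/orP: b2 => [/eqP je|b2]; first by move: (ltn_trans ji si); rewrite je ltnn.
    by have := xs_lt xsS ji si; rewrite -/x => h; exfalso; lra.
  - case/orP: b1 => [/eqP j0|b1]; first by rewrite j0 in ji.
    have [e|ni] := eqVneq j i.+1.
      by move: c1; rewrite e /= => ->.
    have h : (i < j.-1)%N by rewrite -ltnS prednK; [rewrite ltn_neqAle eq_sym ni|exact: leq_ltn_trans ji].
    have h2 : (j.-1 < size xs)%N by rewrite prednK //; exact: leq_ltn_trans ji.
    by have := xs_lt xsS h h2; rewrite -/x => h'; exfalso; lra.
  - case/orP: c2 => [/eqP je|]; first by move: si; rewrite -ji je ltnn.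
    by rewrite ji -/x => ->.
move=> /andP[w0 /orP[]/andP[/eqP -> h]]; rewrite /act w0 /=.
  by rewrite k1 h orbT.
by rewrite h k2.
Qed.

(** In the coordinate [- M / z] the last ray lies on the left, ray [0] on the right, and half-planes
    are kept. [M] exceeds every branch value in modulus, so no other edge is met. *)
Lemma local_type_infty :
  exists B v, chart_at (None : sphere R) B v /\ local_type xs B v (size xs) 0.
Proof.
pose M : R := 1 + \sum_(x <- xs) `|x|.
have s0 : 0 <= \sum_(x <- xs) `|x| by apply: sumr_ge0 => x _; exact: normr_ge0.
have M0 : 0 < M by rewrite ltr_pwDl.
have xM i : (i < size xs)%N -> `|nth 0 xs i| <= M.
  move=> si; rewrite /M (big_nth 0) big_mkord (bigD1 (Ordinal si)) //=.
  have := @sumr_ge0 R _ (index_enum 'I_(size xs)) (fun j => j != Ordinal si) (fun j => `|nth 0 xs j|) (fun j _ => normr_ge0 _).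
  by lra.
have c0 : (- M)%:C != 0 :> R[i] by rewrite -nc_eq0 nc_real normrN normr_eq0 gt_eqF.
exists (inv_dom (- M)%:C), (inv_chart (- M)%:C); split; first exact: inv_chartP.
move=> [w|] hw; last first.
  split=> [e|j js]; first by rewrite /cface /=; case: e; rewrite lexx.
  by rewrite /act /= eqxx lexx !andbT orbC.
have {}hw : nc (- M)%:C < nc w := hw.
rewrite nc_real normrN gtr0_norm // in hw.
have w0 : w != 0 by rewrite -nc_gt0; exact: lt_trans hw.
pose q := re w ^+ 2 + im w ^+ 2.
have q0 : 0 < q.
  rewrite lt0r addr_ge0 ?sqr_ge0 // andbT paddr_eq0 ?sqr_ge0 // !sqrf_eq0.
  by apply: contraNN w0 => /andP[/eqP a /eqP b]; apply/eqP; rewrite [w]complexE a b /= mulr0 addr0.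
have qi0 : 0 < q^-1 by rewrite invr_gt0.
have [rv iv] : re ((- M)%:C / w) = - (M * re w * q^-1) /\ im ((- M)%:C / w) = M * im w * q^-1.
  move: (w) @q {q0 qi0 w0 hw} => [a b]; rewrite /=; split; ring.
split.
  move=> e; rewrite /cface /= iv; case: e.
    by rewrite pmulr_lge0 // pmulr_rge0.
  by rewrite pmulr_lle0 // pmulr_rle0.
move=> j js; rewrite /act /= rv iv oppr_le0 oppr_ge0.
rewrite (pmulr_lge0 _ qi0) (pmulr_lle0 _ qi0) (pmulr_rge0 _ M0) (pmulr_rle0 _ M0).
rewrite !mulf_eq0 (gt_eqF M0) (gt_eqF qi0) orbF /= !andbT.
have [wi|//] := eqVneq (im w) 0; last by rewrite !andbF.
have nw : M < `|re w|.
  have e : w = (re w)%:C by rewrite [LHS]complexE wi mulr0 addr0.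
  by move: hw; rewrite {1}e nc_real.
have [rw|rw] := lerP 0 (re w).
  rewrite ger0_norm // in nw; have rn : (re w <= 0) = false by apply/negbTE; rewrite -ltNge; lra.
  rewrite rn !andbF orbF andbT /=.
  have [->|nj] := eqVneq j (size xs).
    rewrite andbT; have [//|s1] := eqVneq (size xs) 0%N.
    have := xM (size xs).-1; rewrite prednK ?lt0n // => /(_ (leqnn _)) h.
    by rewrite /= ; apply/idP; have := ler_norm (nth 0 xs (size xs).-1); lra.
  have sj : (j < size xs)%N by rewrite ltn_neqAle nj js.
  have := xM _ sj; have := ler_norm (nth 0 xs j) => h1 h2; apply/negbTE.
  by rewrite negb_and -!ltNge /=; apply/orP; right; lra.
rewrite ltr0_norm // in nw; have rn : (0 <= re w) = false by apply/negbTE; rewrite -ltNge.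
rewrite andbF (ltW rw) /=.
have [->|nj] := eqVneq j 0%N.
  rewrite /=; have [//|s1] := eqVneq 0%N (size xs).
  have s2 : (0 < size xs)%N by rewrite lt0n eq_sym.
  have := xM _ s2; have := ler_norm (- nth 0 xs 0); rewrite normrN => h1 h2.
  by rewrite /=; apply/idP; lra.
have sj : (j.-1 < size xs)%N by rewrite prednK // lt0n.
have := xM _ sj; have := ler_norm (- nth 0 xs j.-1); rewrite normrN => h1 h2.
by rewrite andbF /=; apply/negbTE; rewrite negb_and -!ltNge /=; apply/orP; left; lra.
Qed.

End LocalTypes.
End Covering_14.
Import Covering_14.

(** * Fibres, cycles, and the model as a branched covering *)

Module Covering_15.
Section Fibers.
Local Open Scope classical_set_scope.
Local Open Scope ring_scope.
Local Open Scope complex_scope.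
Variables (R : realType).
Local Notation re := (@complex.Re R).
Local Notation im := (@complex.Im R).
Local Notation nc := (@Normc.normc R).

(** The index is the number of points near [x] in a nearby fibre, whichever charts define it. *)
Lemma ram_unique (X : topologicalType) (f : X -> sphere R) x k k' :
  ramification_index f x k -> ramification_index f x k' -> k = k'.
Proof.
move=> /ram_local[A [oA Ax] hA] /ram_local[A' [oA' Ax'] hA'].
have n1 := hA _ (open_nbhs_nbhs (conj oA' Ax')).
have n2 := hA' _ (open_nbhs_nbhs (conj oA Ax)).
have [e ce] : exists e, cface e (f x).
  case: (f x) => [z|]; last by exists true.
  by have [h|h] := lerP 0 (im z); [exists true|exists false; apply: ltW].
have [z [_ [h1 h2] zy]] := face_near ce (filterI n1 n2).
have [s1 [g [gI gr]]] := h1 zy; have [s2 [g' [g'I g'r]]] := h2 zy.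
have e1 : range g = range g'.
  by rewrite gr g'r; apply/seteqP; split=> x' hx; split; [exact: s1|by case: hx|exact: s2|by case: hx].
have card_le (n n' : nat) (h : 'I_n -> X) (h' : 'I_n' -> X) : injective h -> range h `<=` range h' -> (n <= n')%N.
  move=> hI s; have /choice[u uP] : forall i0, exists j, h' j = h i0.
    by move=> i0; have [|j _ e2] := s (h i0); [exists i0|exists j].
  have uI : injective u by move=> a b ab; apply: hI; rewrite -!uP ab.
  by have := leq_card u uI; rewrite !card_ord.
by apply/eqP; rewrite eqn_leq (card_le _ _ g g') ?(card_le _ _ g' g) // e1.
Qed.

Section Numbered.
Variables (xs : seq R) (d : nat) (X : topologicalType) (f : X -> sphere R)
  (pi : nat -> 'S_d) (C : X -> {set bool * 'I_d}).
Hypotheses (brf : branched xs d f) (pX : presents xs pi f C).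
Let labC : labelling f C. Proof. by case: pX. Qed.

(** The combinatorial form of a numbered fibre: [kap a] is the number of the cycle of [sigma]
    through [a]. Positivity of the entries of [s] makes every number occur. *)
Definition cycle_numbering (sigma : 'S_d) (s : seq nat) (kap : 'I_d -> 'I_(size s)) :=
  (forall a b, (kap a == kap b) = (b \in porbit sigma a)) /\
  forall k : 'I_(size s), (0 < nth 0 s k)%N /\ #|[set a | kap a == k]%SET| = nth 0%N s k.

Variables (y : sphere R) (jl jr : nat).
Hypotheses (jls : (jl <= size xs)%N) (jrs : (jr <= size xs)%N).
Hypothesis hact : forall j, (j <= size xs)%N -> act xs j y = (j == jl) || (j == jr).

Let cy e : cface e y.
Proof. by apply: (@act_cface _ xs e jl); rewrite hact // eqxx. Qed.

Lemma fiber_porbit x a b : f x = y -> (true, a) \in C x ->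
  ((true, b) \in C x) = (b \in porbit ((pi jl)^-1 * pi jr)%g a).
Proof.
move=> fx ax; have [_ h] := pX; rewrite (h _ _ ax) fx.
by rewrite (comp_porbit pi jls jrs hact).
Qed.

Lemma numbered_fiber_numbering s l : @numbered_fiber R X f y s l ->
  exists2 kap, cycle_numbering ((pi jl)^-1 * pi jr)%g kap &
    forall a k, ((true, a) \in C (l k)) = (kap a == k).
Proof.
move=> [lI lr lram].
have fl k : f (l k) = y by have : range l (l k) by []; rewrite lr.
have /choice[kap kapP] : forall a, exists k, (true, a) \in C (l k).
  move=> a; have [x [fx ax]] := lab_ex labC a (cy true).
  have : range l x by rewrite lr. by move=> [k _ e]; exists k; rewrite e.
have kE a k : ((true, a) \in C (l k)) = (kap a == k).
  apply/idP/eqP => [h|<-//]; apply: lI.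
  by apply: (lab_inj labC) (kapP a) h; rewrite !fl.
exists kap => //; split=> [a b|k].
  by rewrite eq_sym -kE (fiber_porbit _ (fl _) (kapP a)).
split; first exact: ram_gt0 (lram k).
have := lab_card labC (lram k) (e := true); rewrite fl => /(_ (cy true)) <-.
by apply: eq_card => a; rewrite !inE kE.
Qed.

Lemma numbering_numbered_fiber s kap : @cycle_numbering ((pi jl)^-1 * pi jr)%g s kap ->
  exists2 l, @numbered_fiber R X f y s l & forall a k, ((true, a) \in C (l k)) = (kap a == k).
Proof.
move=> [kP ks].
have /choice[l lP] : forall k, exists x, f x = y /\ forall a, ((true, a) \in C x) = (kap a == k).
  move=> k; have [k0 kk] := ks k.
  have [a] : exists a, a \in [set a | kap a == k]%SET by apply/card_gt0P; rewrite kk.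
  rewrite inE => /eqP ak; have [x [fx ax]] := lab_ex labC a (cy true); exists x; split=> // b.
  by rewrite (fiber_porbit _ fx ax) -kP ak eq_sym.
exists l; last by move=> a k; case: (lP k).
have cl k : #|[set a | (true, a) \in C (l k)]%SET| = nth 0%N s k.
  by have [_ <-] := ks k; apply: eq_card => a; rewrite !inE; case: (lP k).
split.
- move=> k k' e; have [k0 kk] := ks k.
  have [a] : exists a, a \in [set a | kap a == k]%SET by apply/card_gt0P; rewrite kk.
  rewrite inE => ak; have [_ h] := lP k; have [_ h'] := lP k'.
  by move: (ak); rewrite -h e h' => /eqP <-; move: ak => /eqP.
- apply/seteqP; split=> [_ [k _ <-]|x fx]; first by case: (lP k).
  have [k ram k0] := branched_ram brf x.
  have := lab_card labC ram (e := true); rewrite fx => /(_ (cy true)) ck.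
  have [a] : exists a, a \in [set a | (true, a) \in C x]%SET by apply/card_gt0P; rewrite ck.
  rewrite inE => ax; exists (kap a) => //; have [fk h] := lP (kap a).
  by apply: (lab_inj labC) (_ : (true, a) \in _) ax; rewrite ?fk ?h.
- move=> k; have [k' ram _] := branched_ram brf (l k).
  by have := lab_card labC ram (e := true); rewrite (proj1 (lP k)) => /(_ (cy true)); rewrite cl => ->.
Qed.
End Numbered.

Section Model.
Variables (xs : seq R) (d : nat) (pi : nat -> 'S_d).
Hypothesis xsS : sorted <%R xs.
Local Notation M := (@model R xs d pi).

Lemma comp_face e z t : face e z -> comp xs pi (Some z) t = [set t]%SET.
Proof.
move=> fz; apply/setP => u; rewrite !inE; apply/idP/eqP => [|->]; last exact: connect0.
case/connectP=> -[|v q] //= /andP[/existsP[j /andP[/and3P[/eqP z0]]]] _ _.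
by move: fz; rewrite /face /= z0 ltxx; case: e.
Qed.

Lemma model_face_ram (p : M) e z : mproj p = Some z -> face e z ->
  ramification_index (@mproj R xs d pi) p 1.
Proof.
move=> pz fz; have [[e' a] tp] := mlab_neq0 p; have [ct lp] := mlabP tp.
have fe (w : plane R) e2 : face e w -> cface e2 (Some w : sphere R) -> e2 = e.
  by rewrite /face /cface /=; case: e {fz}; case: e2 => //= h1; rewrite leNgt h1.
have {ct} ee : e' = e by apply: fe fz _; rewrite -pz. subst e'.
rewrite pz (comp_face _ fz) in lp.
have [r r0 hr] : exists2 r : R, 0 < r & forall w : R[i], nc (w - z) < r -> face e w.
  apply/nbhs_nc; have ic := @im_continuous R z.
  by move: fz; rewrite /face /=; case: e {tp fe lp} => h; [exact: ic (lt_nbhsr h)|exact: ic (lt_nbhsl h)].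
pose A := [set q : M | ball_dom z r (mproj q) /\ mlab q = mlab p].
have cv : chart_at (mproj p) (ball_dom z r) (ball_chart z r) by rewrite pz; exact: ball_chartP.
exists A, (ball_dom z r), (fun q => ball_chart z r (mproj q)), (ball_chart z r).
have [oB Bp [v' [/withinP cvB /withinP cv' vK v'K]] vp] := cv.
split=> //; last by move=> q [Bq _]; rewrite expr1.
have domf y : ball_dom z r y -> exists2 w, y = Some w & face e w.
  by case: y => [w|//] h; exists w => //; apply: hr.
have labq (q : M) : ball_dom z r (mproj q) -> mlab q \subset mlab p -> mlab q = mlab p.
  move=> /domf[w qw fw] s; have [t tq] := mlab_neq0 q; have [_ lq] := mlabP tq.
  have := fintype.subsetP s _ tq; rewrite lq qw (comp_face _ fw) lp => /set1P ->. by [].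
have oA : open A.
  rewrite openE => q [Bq sq]; have n1 : nbhs q (@mproj _ _ _ _ @^-1` ball_dom z r).
    by apply: mproj_continuous; apply: open_nbhs_nbhs.
  apply: near_imp (filterI n1 (mlab_near q)) => q' [B' s']; split=> //.
  by apply: labq => //; rewrite -sq.
split=> //.
have /choice[h hP] : forall w : plane R, exists q : M, @disc R w -> mproj q = v' w /\ mlab q = mlab p.
  move=> w; have [dw|] := pselect (@disc R w); last by exists p.
  have [Bw _] := v'K _ dw; have [w2 vw fw] := domf _ Bw.
  have ct : cface (e, a).1 (v' w) by rewrite vw; exact: face_cface.
  have [q [qw aq]] := model_ex xs pi ct; exists q => _; split=> //.
  by have [_ ->] := mlabP aq; rewrite qw vw (comp_face _ fw) lp.
exists h; split.
- apply/withinP => q [Bq sq] P hP'.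
  have n1 : \forall q' \near q, ball_dom z r (mproj q') -> P (ball_chart z r (mproj q')).
    exact: (@mproj_continuous _ _ _ _ q _ (cvB _ Bq _ hP')).
  by apply: near_imp n1 => q' h' [B' _]; exact: h'.
- apply/withinP => w dw W /nbhs_model nW; have [e1 e2] := hP _ dw.
  rewrite e1 in nW; have := cv' _ dw _ nW; apply: near_imp => w' hw' dw'.
  by have [e3 e4] := hP _ dw'; apply: (hw' dw') => //; rewrite e4 e2.
- move=> q [Bq sq]; have [dq vq] := vK _ Bq; split=> //.
  by have [e1 e2] := hP _ dq; apply: model_eq; rewrite ?e1 ?e2.
- by move=> w dw; have [e1 e2] := hP _ dw; have [B1 v1] := v'K _ dw; rewrite /A /= e1 e2.
Qed.

Lemma local_type_ex y : cface true y -> cface false y ->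
  exists jl jr B v, [/\ (jl <= size xs)%N, (jr <= size xs)%N, chart_at y B v & local_type xs B v jl jr].
Proof.
case: y => [z|] ct cf; last first.
  by have [B [v [h1 h2]]] := local_type_infty xs; exists (size xs), 0%N, B, v.
have z0 : im z = 0 by apply/eqP; rewrite eq_le; apply/andP; split; [exact: cf|exact: ct].
have ze : z = re z +i* 0 by rewrite -z0; case: (z).
have [/andP[_]|ns] := boolP (special xs (Some z)).
  move=> /(nthP 0)[k km zk].
  have [B [v [h1 h2]]] := local_type_special xsS km.
  rewrite zk -ze in h1; by exists k, k.+1, B, v; split=> //; exact: ltnW.
have [j js oj] := real_oint z0 ns; rewrite {1}ze in oj.
have [B [v [h1 h2]]] := local_type_real xsS js oj.
by rewrite -ze in h1; exists j, j, B, v.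
Qed.

Lemma local_type_act y B v jl jr : chart_at y B v -> local_type xs B v jl jr ->
  forall j, (j <= size xs)%N -> act xs j y = (j == jl) || (j == jr).
Proof.
move=> [_ By _ vy] lt j js; have [_ ->//] := lt _ By.
by rewrite vy /act /= eqxx lexx /= !andbT.
Qed.

(** On the real axis and at infinity this is [model_chart], lower labels being equinumerous with
    upper ones through edge [jl]. Over an open half-plane the projection is a local homeomorphism
    and each point has a single label. *)
Lemma model_ram (p : M) e : cface e (mproj p) ->
  ramification_index (@mproj R xs d pi) p #|[set a | (e, a) \in mlab p]%SET|.
Proof.
move=> ce; have [cn|ncn] := pselect (cface (~~ e) (mproj p)).
  have cc e' : cface e' (mproj p) by case: e e' ce cn => [] [].
  have [jl [jr [B [v [h1 h2 cv lt]]]]] := local_type_ex (cc true) (cc false).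
  have := model_chart h1 h2 cv lt; set k := #|_|; set k' := #|_|.
  suff -> : k = k' by [].
  rewrite /k /k'; case: e {k k' ce cn} => //.
  have al : act xs jl (mproj p) by rewrite (local_type_act cv lt) // eqxx.
  rewrite -[RHS](card_imset _ (@perm_inj _ (pi jl))); apply: eq_card => b; rewrite inE.
  apply/idP/imsetP => [bp|[a]].
    exists ((pi jl)^-1%g b); last by rewrite permKV.
    have [_ lp] := mlabP bp; rewrite inE lp inE comp_sym connect1 //.
    by have := edge_relP pi ((pi jl)^-1%g b) h1 al; rewrite permKV.
  rewrite inE => ap ->; have [_ lp] := mlabP ap; rewrite lp inE connect1 //.
  exact: edge_relP.
case pz : (mproj p) ce ncn => [z|] ce // ncn.
have fz : face e z.
  by move: ce ncn; rewrite /face /cface /=; case: e => /= h1 /negP; rewrite -ltNge.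
have [[e' a] tp] := mlab_neq0 p; have [ct lp] := mlabP tp.
rewrite pz (comp_face _ fz) in lp ct.
have ee : e' = e by move: ct ncn; rewrite /=; case: e e' {lp tp ce fz} => [] [].
have -> : [set a | (e, a) \in mlab p]%SET = [set a]%SET.
  by apply/setP => b; rewrite lp !inE ee xpair_eqE eqxx.
by rewrite cards1; exact: model_face_ram pz fz.
Qed.

Lemma model_labelling : labelling (@mproj R xs d pi) (@mlab R xs d pi).
Proof.
split.
- exact: mlab_near.
- by move=> x x' l; exact: mlab_inj.
- by move=> y e i0 ce; apply: (@model_ex _ _ _ _ y (e, i0)).
- by move=> x e i0 /mlabP[].
- by move=> x k e ram ce; apply: ram_unique ram; exact: model_ram.
- move=> x e i0 W ex /nbhs_model nW; have [ce lx] := mlabP ex.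
  have [z [fz hz zx]] := face_near ce nW.
  have ct : cface (e, i0).1 (Some z : sphere R) by exact: face_cface.
  have [q [qz eq]] := model_ex xs pi ct; exists q; split=> //.
  + apply: hz => //; have [_ ->] := mlabP eq.
    by rewrite qz (comp_face _ fz) finset.sub1set.
  + by move=> qx; apply: zx; rewrite -qz qx.
  + by exists z.
Qed.

Lemma model_presents : presents xs pi (@mproj R xs d pi) (@mlab R xs d pi).
Proof. by split; [exact: model_labelling|move=> x t /mlabP[]]. Qed.

Lemma model_branched : branched xs d (@mproj R xs d pi).
Proof.
split; [exact: model_compact|exact: model_hausdorff|exact: mproj_continuous|move=> y].
have [e ce] : exists e, cface e y.
  case: y => [z|]; last by exists true.
  by have [h|h] := lerP 0 (im z); [exists true|exists false; apply: ltW].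
(* The half-plane [e] touches [y], so every point over [y] has labels in it. Their number is its
   multiplicity, and these numbers add up to [d]. *)
pose P := [set comp xs pi y (e, a) | a : 'I_d]%SET.
pose s := [seq #|[set a | (e, a) \in (D : {set bool * 'I_d})]%SET| | D <- enum P].
have ss : size s = #|P| by rewrite size_map -cardE.
have /choice[q qP] : forall D : {set bool * 'I_d}, exists q : option M, D \in P ->
    exists2 q', q = Some q' & mproj q' = y /\ mlab q' = D.
  move=> D; have [/imsetP[a _ ->]|_] := boolP (D \in P); last by exists None.
  have ct : cface (e, a).1 y by [].
  have [p [py ap]] := model_ex xs pi ct; exists (Some p) => _; exists p => //; split=> //.
  by have [_ ->] := mlabP ap; rewrite py.
have eP (k : 'I_(size s)) : nth finset.set0 (enum P) k \in P.
  by rewrite -mem_enum mem_nth // -(size_map (fun D : {set bool * 'I_d} => #|[set a | (e, a) \in D]%SET|)).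
have /choice[l lP] : forall k : 'I_(size s), exists q' : M, mproj q' = y /\ mlab q' = nth finset.set0 (enum P) k.
  by move=> k; have [q' _ h] := qP _ (eP k); exists q'.
have nf : numbered_fiber (@mproj R xs d pi) y (s := s) l.
  split.
  - move=> k k' kk; have kP (k1 : 'I_(size s)) : (k1 < size (enum P))%N by rewrite -cardE -ss.
    apply/val_inj/eqP; rewrite /= -(nth_uniq finset.set0 (kP k) (kP k') (enum_uniq P)).
    by have [_ <-] := lP k; have [_ <-] := lP k'; rewrite kk.
  - apply/seteqP; split=> [_ [k _ <-]|p py]; first by case: (lP k).
    have ram := @model_ram p e; rewrite py in ram.
    have [a] : exists a, a \in [set a | (e, a) \in mlab p]%SET by apply/card_gt0P; exact: ram_gt0 (ram ce).
    rewrite inE => ap; have [_ lp] := mlabP ap.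
    have Pp : mlab p \in enum P by rewrite mem_enum lp py; apply/imsetP; exists a.
    have ip : (index (mlab p) (enum P) < size s)%N by rewrite ss cardE index_mem.
    exists (Ordinal ip) => //; have [e1 e2] := lP (Ordinal ip); apply: model_eq; rewrite ?e1 ?e2 //=.
    by rewrite nth_index.
  - move=> k; have [e1 e2] := lP k; have := @model_ram (l k) e; rewrite e1 => /(_ ce).
    rewrite e2 (nth_map finset.set0) //; by rewrite -cardE -ss.
have sd : sumn s = d.
  rewrite sumnE big_map big_enum /= -[RHS]card_ord -sum1_card.
  rewrite (partition_big_imset (fun a => comp xs pi y (e, a))) /=.
  apply: eq_big => [D|D /imsetP[a _ ->]]; first by apply/imsetP/imsetP => -[a _ ->]; exists a.
  rewrite -sum1_card; apply: eq_bigl => b; rewrite inE /=.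
  apply/idP/eqP => [/comp_eq//|<-]; exact: mem_comp.
exists s, l; split=> // nsp.
have s1 x : x \in s -> x = 1%N.
  move=> /mapP[D]; rewrite mem_enum => /imsetP[a _ ->] ->.
  suff -> : [set b | (e, b) \in comp xs pi y (e, a)]%SET = [set a]%SET by rewrite cards1.
  apply/setP => b; rewrite !inE; apply/idP/eqP => [h|->]; last exact: connect0.
  case: y nsp ce h {q qP P s ss eP l lP nf sd} => [z|//] ns ce h.
  have [cn|ncn] := pselect (cface (~~ e) (Some z : sphere R)).
    have z0 : im z = 0.
      by apply/eqP; rewrite eq_le; move: ce cn; rewrite /cface /=; case: e {h} => /= -> ->.
    have [j js oj] := real_oint z0 ns.
    have hact j' : (j' <= size xs)%N -> act xs j' (Some z : sphere R) = (j' == j) || (j' == j).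
      move=> js'; rewrite orbb; apply/idP/eqP => [|->]; first exact: (oint_act_inj xsS js js' oj).
      exact: oint_act.
    have po c : porbit ((pi j)^-1 * pi j)%g c = [set c]%SET.
      by rewrite mulVg; apply/setP => u; rewrite inE; apply/porbitP/eqP => [[n ->]|->]; [rewrite expg1n perm1|exists 0%N; rewrite perm1].
    case: e {ce cn} h => h.
      have := comp_porbit pi js js hact a (true, b).
      by rewrite inE h po inE => /esym/eqP.
    have e1 : connect (edge_rel xs pi (Some z : sphere R)) (true, pi j a) (false, b).
      by apply: connect_trans h; rewrite comp_sym connect1 // edge_relP // hact // eqxx.
    have := comp_porbit pi js js hact (pi j a) (false, b).
    by rewrite inE e1 po inE => /esym/eqP/perm_inj.
  have fz : face e z.
    by move: ce ncn; rewrite /face /cface /=; case: e {h} => /= h1 /negP; rewrite -ltNge.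
  have : (e, b) \in comp xs pi (Some z) (e, a) by rewrite inE.
  by rewrite (comp_face _ fz) inE => /eqP[].
have sE : s = nseq (size s) 1%N by apply/all_pred1P/allP => x /s1 ->.
by rewrite -sd [in RHS]sE sumn_nseq mul1n.
Qed.

End Model.
End Fibers.
End Covering_15.
Import Covering_15.

(** * Cell decomposition and Euler characteristic *)

Module Covering_16.
Section Cells.
Local Open Scope classical_set_scope.
Local Open Scope ring_scope.
Local Open Scope complex_scope.
Variables (R : realType).
Local Notation re := (@complex.Re R).
Local Notation im := (@complex.Im R).

Lemma homeomorphic_trans (T U V : topologicalType) (A : set T) (B : set U) (C : set V) :
  homeomorphic A B -> homeomorphic B C -> homeomorphic A C.
Proof.
move=> [u [u' [/withinP cu /withinP cu' uK u'K]]] [v [v' [/withinP cv /withinP cv' vK v'K]]].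
exists (v \o u), (u' \o v'); split.
- apply/withinP => x Ax W nW; have [Bx _] := uK _ Ax.
  apply: near_imp (cu _ Ax _ (cv _ Bx _ nW)) => x' /= h Ax'.
  by have [Bx' _] := uK _ Ax'; exact: h.
- apply/withinP => y Cy W nW; have [By _] := v'K _ Cy.
  apply: near_imp (cv' _ Cy _ (cu' _ By _ nW)) => y' /= h Cy'.
  by have [By' _] := v'K _ Cy'; exact: h.
- by move=> x Ax; have [Bx e] := uK _ Ax; have [Cx e'] := vK _ Bx; rewrite /= e' e.
- by move=> y Cy; have [By e] := v'K _ Cy; have [Ay e'] := u'K _ By; rewrite /= e' e.
Qed.

Lemma continuous_withinI (T U : topologicalType) (A : set T) (g : T -> U) :
  (forall x, A x -> {for x, continuous g}) -> {within A, continuous g}.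
Proof. by move=> h; apply/withinP => x Ax P /(h _ Ax); apply: near_imp. Qed.

Lemma homeo_affine (A B : set R) (a b : R) : a != 0 -> (forall x, A x <-> B (a * x + b)) ->
  homeomorphic A B.
Proof.
move=> a0 h; have e1 x : a^-1 * (a * x + b - b) = x by rewrite addrK mulKf.
have e2 y : a * (a^-1 * (y - b)) + b = y by rewrite mulVKf // subrK.
exists (fun x => a * x + b), (fun y => a^-1 * (y - b)); split.
- apply: continuous_withinI => x _; apply: cvgD; last exact: cvg_cst.
  by apply: cvgM; [exact: cvg_cst|exact: cvg_id].
- apply: continuous_withinI => x _; apply: cvgM; first exact: cvg_cst.
  by apply: cvgB; [exact: cvg_id|exact: cvg_cst].
- by move=> x /h Bx; rewrite e1.
- by move=> y By; split=> //; apply/h; rewrite e2.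
Qed.

Lemma homeo_pos : homeomorphic [set x : R | 0 < x] [set: R].
Proof.
exists (@ln R), (@expR R); split.
- by apply: continuous_withinI => x x0; exact: continuous_ln.
- by apply: continuous_withinI => x _; exact: continuous_expR.
- by move=> x x0; split=> //; rewrite lnK.
- by move=> y _; split; [exact: expR_gt0|exact: expRK].
Qed.

Lemma homeo_bounded (a b : R) : a < b -> homeomorphic [set x : R | a < x < b] [set x : R | 0 < x].
Proof.
move=> ab; exists (fun x => (x - a) / (b - x)), (fun y => (a + b * y) / (1 + y)); split.
- apply: continuous_withinI => x /andP[_ xb]; apply: cvgM.
    by apply: cvgB; [exact: cvg_id|exact: cvg_cst].
  by apply: cvgV; [rewrite subr_eq0 gt_eqF|apply: cvgB; [exact: cvg_cst|exact: cvg_id]].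
- apply: continuous_withinI => y y0; rewrite /= in y0; apply: cvgM.
    by apply: cvgD; [exact: cvg_cst|apply: cvgM; [exact: cvg_cst|exact: cvg_id]].
  by apply: cvgV; [rewrite gt_eqF // ltr_wpDr // ltW|apply: cvgD; [exact: cvg_cst|exact: cvg_id]].
- move=> x /andP[ax xb]; have bx : b - x != 0 by rewrite subr_eq0 gt_eqF.
  split; first by rewrite /= divr_gt0 ?subr_gt0.
  have ba : b - a != 0 by rewrite subr_eq0 gt_eqF.
  have e : 1 + (x - a) / (b - x) = (b - a) / (b - x) by field.
  rewrite e; field. by rewrite ba bx.
- move=> y /= y0; have y1 : 0 < 1 + y by rewrite ltr_wpDl.
  have ba : b - a != 0 by rewrite subr_eq0 gt_eqF.
  split.
    rewrite ltr_pdivlMr // ltr_pdivrMr //; apply/andP; split; last by nra.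
    by have := mulr_gt0 y0 (etrans (subr_gt0 _ _) ab); nra.
  have y1' : 1 + y != 0 by rewrite gt_eqF.
  have e : b - (a + b * y) / (1 + y) = (b - a) / (1 + y) by field.
  rewrite e; field. by rewrite y1' ba.
Qed.

Lemma homeo_interval (lo hi : option R) :
  (if (lo, hi) is (Some a, Some b) then a < b else true) ->
  homeomorphic [set x : R | (if lo is Some a then a < x else true) && (if hi is Some b then x < b else true)]
    [set: R].
Proof.
have triv_affine A : (forall x : R, A x <-> 0 < (1 : R) * x + 0) -> homeomorphic A [set: R].
  by move=> h; apply: homeomorphic_trans homeo_pos; exact: homeo_affine (oner_neq0 _) h.
case: lo hi => [a|] [b|] /= h.
- exact: homeomorphic_trans (homeo_bounded h) homeo_pos.
- apply: homeomorphic_trans homeo_pos; apply: (@homeo_affine _ _ 1 (- a) (oner_neq0 _)) => x /=.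
  by rewrite mul1r subr_gt0 andbT.
- apply: homeomorphic_trans homeo_pos; have n1 : (-1 : R) != 0 by rewrite oppr_eq0 oner_neq0.
  by apply: (@homeo_affine _ _ (-1) b n1) => x /=; rewrite mulN1r addrC subr_gt0.
- by apply: (@homeo_affine _ _ 1 0 (oner_neq0 _)).
Qed.

Lemma homeo_face e : homeomorphic (@face R e) [set: plane R].
Proof.
pose s : R := if e then 1 else -1.
have ss : s * s = 1 by rewrite /s; case: (e); rewrite ?mulr1 // mulrNN mulr1.
have fE (z : plane R) : face e z <-> 0 < s * im z.
  by rewrite /s /face /=; case: (e); rewrite ?mul1r ?mulN1r ?oppr_gt0.
exists (fun z : plane R => (re z +i* ln (s * im z) : plane R)),
  (fun z : plane R => (re z +i* (s * expR (im z)) : plane R)); split.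
- apply: continuous_withinI => z /fE z0.
  apply: (cvg_plane (nbhs_filter z)); first exact: (@re_continuous R z).
  apply: (cvg_comp im (fun x => ln (s * x)) (@im_continuous R z)).
  apply: (continuous_comp (f := fun x => s * x) (g := @ln R)); last exact: continuous_ln.
  by apply: cvgM; [exact: cvg_cst|exact: cvg_id].
- apply: continuous_withinI => z _; apply: (cvg_plane (nbhs_filter z)); first exact: (@re_continuous R z).
  apply: (cvg_comp im (fun x => s * expR x) (@im_continuous R z)).
  by apply: cvgM; [exact: cvg_cst|exact: continuous_expR].
- by move=> [a b] /fE /= z0; split=> //; rewrite lnK // mulrA ss mul1r.
- move=> [a b] _; split; first by apply/fE; rewrite /= mulrA ss mul1r expR_gt0.
  by rewrite /= mulrA ss mul1r expRK.
Qed.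

Lemma homeo_oint (xs : seq R) j : sorted <%R xs -> (j <= size xs)%N -> homeomorphic (oint xs j) [set: R].
Proof.
move=> xsS js.
pose lo := if j == 0%N then None else Some (nth 0 xs j.-1).
pose hi := if j == size xs then None else Some (nth 0 xs j).
have lh : is_true (if (lo, hi) is (Some a, Some b) then a < b else true).
  rewrite /lo /hi; case: eqP => // /eqP j0; case: eqP => // /eqP j1.
  by apply: xs_lt => //; [rewrite prednK // lt0n|rewrite ltn_neqAle j1].
apply: homeomorphic_trans (homeo_interval lh).
have oE (z : plane R) : oint xs j z <-> im z = 0 /\
  (if lo is Some a then a < re z else true) && (if hi is Some b then re z < b else true).
  rewrite /oint /= /lo /hi; case: (j == 0%N); case: (j == size xs) => /=;
  by split=> [/andP[/eqP h1 h2]|[h1 h2]]; rewrite ?h1 ?eqxx.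
exists (re : plane R -> R), (fun x => (x +i* 0 : plane R)); split.
- by apply: continuous_withinI => z _; exact: (@re_continuous R z).
- by apply: continuous_withinI => z _; apply: (cvg_plane (nbhs_filter z)); [exact: cvg_id|exact: cvg_cst].
- by move=> [a b] /oE[/= -> h]; split.
- by move=> x hx; split=> //; apply/oE.
Qed.

Section Labelled.
Variables (xs : seq R) (d : nat) (X : topologicalType) (f : X -> sphere R)
  (C : X -> {set bool * 'I_d}).
Hypotheses (xsS : sorted <%R xs) (brf : branched xs d f) (labC : labelling f C).

Definition cell_over (A : set (plane R)) (t : bool * 'I_d) : set X :=
  [set x | exists z, [/\ A z, f x = Some z & t \in C x]].

(** Over each value of [A] exactly one point carries the label [t], which defines a section; its
    continuity is [lab_limit]. *)
Lemma cell_over_homeo A t z0 : A z0 -> (forall z, A z -> cface t.1 (Some z : sphere R)) ->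
  homeomorphic (cell_over A t) A.
Proof.
move=> Az0 cA; have [_ _ cf _] := brf.
have /choice[sec secP] : forall z : plane R, exists o : option X, A z ->
    exists2 x, o = Some x & f x = Some z /\ t \in C x.
  move=> z; have [Az|nA] := pselect (A z); last by exists None.
  have ct : cface (t.1, t.2).1 (Some z : sphere R) by exact: cA.
  have [x [fx tx]] := lab_ex labC t.2 ct.
  by exists (Some x) => _; exists x => //; rewrite [t]surjective_pairing.
have [x0 _ _] := secP _ Az0.
pose g z := odflt x0 (sec z).
have gP z : A z -> f (g z) = Some z /\ t \in C (g z).
  by move=> /secP[x e h]; rewrite /g e.
exists (fun x => if f x is Some z then z else 0), g; split.
- apply/withinP => x [z [Az fx tx]] P; rewrite fx => nP.
  have n1 : nbhs (Some z : sphere R) [set y | if y is Some w then P w else True] by exact/nbhs_sphere.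
  rewrite -fx in n1; have := cf _ _ n1.
  move=> n2; apply: near_imp (n2 : \forall x' \near x, if f x' is Some w then P w else True) => x' h [z' [_ fx' _]].
  by rewrite fx' in h *.
- apply/withinP => z Az W nW; have [fg tg] := gP _ Az.
  have := lab_limit brf labC nW; rewrite fg => /nbhs_sphere n1.
  apply: near_imp (n1 : \forall w \near z, forall x', f x' = Some w -> C x' :&: C (g z) != finset.set0 -> W x') => w h Aw.
  have [fw tw] := gP _ Aw; apply: h => //; apply/finset.set0Pn; exists t; by rewrite inE tw.
- move=> x [z [Az fx tx]]; rewrite fx; split=> //.
  by have [fg tg] := gP _ Az; apply: (lab_inj labC) tg tx; rewrite fg.
- by move=> z Az; have [fg tg] := gP _ Az; rewrite fg; split=> //; exists z.
Qed.

Lemma face_connected e : connected (@face R e).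
Proof. by apply: convex_connected => z w t fz fw ht; exact: face_conv. Qed.

Lemma face_neq0 e : exists z : plane R, face e z.
Proof.
exists (0 +i* (if e then 1 else -1)); rewrite /face /=; case: e; by rewrite ?ltr01 ?oppr_lt0 ?ltr01.
Qed.

(** Every closed sheet is connected and reaches the unique point over [y0], and the closed sheets
    cover the space. Total ramification over 0 thus yields connectedness. *)
Lemma one_point_connected y0 x0 : (forall e, cface e y0) -> (forall x, f x = y0 -> x = x0) ->
  connected [set: X].
Proof.
move=> c0 h0; pose A (t : bool * 'I_d) := closure (cell_over (face t.1) t).
have inA t x : t \in C x -> A t x.
  case: t => e a tx W nW; have [x' [Wx' _ [z fx' fz] tx']] := lab_dense labC tx nW.
  by exists x'; split=> //; exists z.
have -> : [set: X] = \bigcup_(t in [set: bool * 'I_d]) A t.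
  apply/seteqP; split=> // x _; have [t tx] := labels_neq0 brf labC x.
  by exists t => //; exact: inA.
apply: bigcup_connected.
  exists x0 => -[e a] _; have [x [fx ax]] := lab_ex labC a (c0 e).
  by apply: inA; rewrite -(h0 _ fx).
move=> [e a] _; apply: connected_closure; have [z0 fz0] := face_neq0 e.
have cf' (z : plane R) : face e z -> cface (e, a).1 (Some z : sphere R) by exact: face_cface.
have [u [v [_ cv uK vK]]] := cell_over_homeo (t := (e, a)) fz0 cf'.
have -> : cell_over (face (e, a).1) (e, a) = [set v z | z in face e].
  apply/seteqP; split=> [x cx|_ [z fz <-]]; last by have [] := vK _ fz.
  by have [fx ux] := uK _ cx; exists (u x).
by apply: connected_continuous_connected cv; exact: face_connected.
Qed.

Lemma euler_fin (T : finType) (cell : T -> set X) (dim : T -> nat) :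
  (forall x, exists! c, cell c x) -> (forall c, open_cell R (dim c) (cell c)) ->
  (forall c x, closure (cell c) x -> ~ cell c x -> exists2 b, (dim b < dim c)%N & cell b x) ->
  euler_characteristic R X (\sum_c (-1) ^+ dim c).
Proof.
move=> h1 h2 h3; exists #|T|, (cell \o enum_val), (dim \o enum_val); split.
- move=> x; have [c [cx cu]] := h1 x; exists (enum_rank c); split; first by rewrite /= enum_rankK.
  by move=> k kx; rewrite (cu _ kx) enum_valK.
- by move=> k; exact: h2.
- by move=> k x cx nx; have [b bd bx] := h3 _ _ cx nx; exists (enum_rank b); rewrite /= enum_rankK.
- by rewrite (reindex (@enum_val _ T)) //=; exact/onW_bij/enum_val_bij.
Qed.

(** The index [size xs] stands for infinity. *)
Definition special_point (i : nat) : sphere R :=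
  if (i < size xs)%N then Some (nth 0 xs i +i* 0) else None.

Lemma specialP y : special xs y <-> exists i : 'I_(size xs).+1, y = special_point i.
Proof.
split=> [|[i ->]]; last first.
  by rewrite /special_point /special; case: ifP => //= si; rewrite eqxx mem_nth.
case: y => [z|] /=; last by exists ord_max; rewrite /special_point ltnn.
move=> /andP[/eqP z0 /(nthP 0)[k km zk]]; have km' : (k < (size xs).+1)%N by rewrite ltnS ltnW.
by exists (Ordinal km'); rewrite /special_point /= km zk -z0; case: (z).
Qed.

Lemma special_point_inj (i j : 'I_(size xs).+1) : special_point i = special_point j -> i = j.
Proof.
have u : uniq xs by apply: sorted_uniq xsS; [exact: lt_trans|exact: ltxx].
rewrite /special_point => h; apply/val_inj; move: h => /=.
have := ltn_ord i; have := ltn_ord j; rewrite !ltnS.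
case: ltnP => hi; case: ltnP => hj //.
  by move=> _ _ [] /eqP; rewrite nth_uniq // => /eqP.
by move=> h1 h2 _; apply/eqP; rewrite eqn_leq (leq_trans h2 hj) (leq_trans h1 hi).
Qed.

(** The Riemann-Hurwitz formula as a count of cells: vertices lie over the special values, edges are
    the lifts of the open edges, named by their upper sheet, and faces are the lifts of the
    half-planes. *)
Lemma euler_cells (s : 'I_(size xs).+1 -> seq nat) :
  (forall i : 'I_(size xs).+1, fiber_profile f (special_point i) (s i)) ->
  euler_characteristic R X
    ((\sum_i size (s i))%N%:Z - ((size xs).+1 * d)%N%:Z + (2 * d)%N%:Z).
Proof.
move=> lf0; pose m := (size xs).+1.
pose l (i : 'I_m) := projT1 (cid (lf0 i)).
have lf (i : 'I_m) : numbered_fiber f (special_point i) (l i) := projT2 (cid (lf0 i)).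
pose T : finType := ({i : 'I_m & 'I_(size (s i))} + ('I_m * 'I_d + bool * 'I_d))%type.
pose cell (c : T) : set X := match c with
  | inl v => [set l (tag v) (tagged v)]
  | inr (inl e) => cell_over (oint xs e.1) (true, e.2)
  | inr (inr t) => cell_over (face t.1) t end.
pose dim (c : T) := match c with inl _ => 0%N | inr (inl _) => 1%N | inr (inr _) => 2%N end.
have [_ hX cf _] := brf.
have -> : (\sum_i size (s i))%N%:Z - (m * d)%N%:Z + (2 * d)%N%:Z = \sum_c (-1) ^+ dim c :> int.
  rewrite big_sumType big_sumType /= addrA; congr (_ + _ + _).
  - rewrite sumr_const expr0 natz card_tagged sumnE big_map big_enum /=; congr Posz.
    by apply: eq_bigr => i0 _; rewrite card_ord.
  - by rewrite sumr_const card_prod !card_ord expr1 mulNrn natz.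
  - by rewrite sumr_const card_prod card_bool card_ord sqrrN expr1n natz.
have fl (i : 'I_m) k : f (l i k) = special_point i.
  have [_ lr _] := lf i; have : range (l i) (l i k) by []. by rewrite lr.
have ns_edge c x : cell (inr c) x -> ~~ special xs (f x).
  case: c => [[j a] [z [oz -> _]]|[e a] [z [fz -> _]]]; last exact: face_generic fz.
  by apply: (oint_generic xsS _ oz); exact: (ltn_ord j).
have edge_real c x : cell (inr (inl c)) x -> exists z, f x = Some z /\ im z = 0.
  by move=> [z [/and3P[/eqP z0 _ _] fz _]]; exists z.
have face_im c x z : cell (inr (inr c)) x -> f x = Some z -> im z <> 0.
  by move=> [z' [fz' -> _]] [<-] z0; move: fz'; rewrite /face /= z0 ltxx; case: c.1.
have vert x : special xs (f x) -> exists v, cell (inl v) x.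
  move=> /specialP[i fi]; have [_ lr _] := lf i; have : range (l i) x by rewrite lr.
  by move=> [k _ <-]; exists (@Tagged _ i (fun i => 'I_(size (s i))) k).
have edge x z : f x = Some z -> im z = 0 -> ~~ special xs (f x) -> exists c, cell (inr (inl c)) x.
  move=> fx z0 ns; rewrite fx in ns; have [j js oj] := real_oint z0 ns; rewrite -fx in ns.
  have cx : cface true (f x) by rewrite fx /cface /= z0.
  have [a ha] := generic_label brf labC ns cx.
  by exists (Ordinal (n := m) (m := j) js, a), z; split=> //; rewrite ha.
have facec x z : f x = Some z -> im z <> 0 -> exists c, cell (inr (inr c)) x.
  move=> fx z0; pose e := 0 < im z; have fz : face e z.
    by rewrite /face /e /=; case: ltgtP z0 => // ->.
  have cx : cface e (f x) by rewrite fx; exact: face_cface.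
  have ns : ~~ special xs (f x) by rewrite fx; exact: face_generic fz.
  have [a ha] := generic_label brf labC ns cx.
  by exists (e, a), z; split=> //; rewrite ha.
have cellU c c' x : cell c x -> cell c' x -> c = c'.
  case: c => [v cx|c cx]; case: c' => [v' cx'|c' cx'].
  - case: v cx => i k /= ex; case: v' cx' => i' k' /= ex'.
    have ii : i = i' by apply: special_point_inj; rewrite -(fl i k) -(fl i' k') -ex -ex'.
    subst i'; have [lI _ _] := lf i; congr (inl (existT _ _ _)); apply: lI.
    by rewrite -ex -ex'.
  - have := ns_edge _ _ cx'; rewrite [x]cx fl => /negP[]; by apply/specialP; exists (tag v).
  - have := ns_edge _ _ cx; rewrite [x]cx' fl => /negP[]; by apply/specialP; exists (tag v').
  have ns := ns_edge _ _ cx.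
  case: c cx => [c|c] cx; case: c' cx' => [c'|c'] cx'.
  - case: c cx => j a [z [oz fz az]]; case: c' cx' => j' a' [z' [oz' fz' az']].
    have e : z' = z by move: fz'; rewrite fz => -[]. subst z'.
    have jm : (j <= size xs)%N by rewrite -ltnS. have jm' : (j' <= size xs)%N by rewrite -ltnS.
    have jj := oint_act_inj xsS jm' jm oz' (oint_act oz).
    have aa : a = a' := lab_unique brf labC ns az az'.
    by rewrite aa; congr (inr (inl (_, _))); apply: val_inj.
  - by have [z [fz z0]] := edge_real _ _ cx; case: (face_im _ _ _ cx' fz).
  - by have [z [fz z0]] := edge_real _ _ cx'; case: (face_im _ _ _ cx fz).
  - case: c cx => e a [z [fz fx az]]; case: c' cx' => e' a' [z' [fz' fx' az']].
    have ez : z' = z by move: fx'; rewrite fx => -[]. subst z'.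
    have ee : e = e'.
      move: fz fz'; rewrite /face /=; case: (e); case: (e') => //= h1 h2.
        by have := lt_trans h1 h2; rewrite ltxx.
      by have := lt_trans h1 h2; rewrite ltxx.
    by subst e'; have aa : a = a' := lab_unique brf labC ns az az'; rewrite aa.
apply: (@euler_fin T cell dim).
- move=> x; have [c cx] : exists c, cell c x; last by exists c; split=> // c'; exact: cellU cx.
  have [/vert[v]|ns] := boolP (special xs (f x)); first by exists (inl v).
  case fx : (f x) => [z|]; last by rewrite fx in ns.
  have [z0|z0] := eqVneq (im z) 0.
    by have [c cx] := edge _ _ fx z0 ns; exists (inr (inl c)).
  by have [c cx] := facec _ _ fx (elimN eqP z0); exists (inr (inr c)).
- move=> [v|[[j a]|[e a]]] /=; first by exists (l (tag v) (tagged v)).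
    have js : (j <= size xs)%N by rewrite -ltnS.
    have [z oz] := oint_ex xsS js.
    apply: homeomorphic_trans (homeo_oint xsS js); apply: cell_over_homeo oz _ => w ow.
    exact: act_cface (oint_act ow).
  have [z fz] := face_neq0 e; apply: homeomorphic_trans (homeo_face e).
  by apply: cell_over_homeo fz _ => w; exact: face_cface.
- have labcl t : closed [set x | t \in C x].
    rewrite -[X in closed X]setCK; apply: open_closedC; rewrite openE => x nx.
    apply: near_imp (lab_near labC x) => x' sx tx'; apply: nx; exact: (fintype.subsetP sx).
  move=> [v|[[j a]|[e a]]] x /= cl ncl.
  + have c1 : closed [set l (tag v) (tagged v)] by apply/accessible_closed_set1/hausdorff_accessible.
    by case: ncl; move: cl; rewrite -(closure_id _).1.
  + have c1 : closed [set x | (true, a) \in C x] := labcl _.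
    have c2 : closed (f @^-1` [set y | act xs j y]).
      by apply: preimage_closed (@closed_act _ xs j) => x0 _; exact: cf.
    have s12 : cell_over (oint xs j) (true, a) `<=` [set x | (true, a) \in C x] `&` (f @^-1` [set y | act xs j y]).
      by move=> x0 [z [oz fz az]]; split=> //=; rewrite fz; exact: oint_act.
    have [ax jx] := closedI c1 c2 (closureS s12 cl).
    have [/vert[v vx]|ns] := boolP (special xs (f x)); first by exists (inl v).
    case: ncl; have {}jx : act xs j (f x) := jx; case fx : (f x) jx ns => [z|] // jx ns.
    have z0 : im z = 0 by have /and3P[/eqP] := jx.
    have [j' js' oj'] := real_oint z0 ns.
    have jm : (j <= size xs)%N by rewrite -ltnS.
    by exists z; split=> //; rewrite (oint_act_inj xsS js' jm oj' jx).
  + have c1 : closed [set x | (e, a) \in C x] := labcl _.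
    have s1 : cell_over (face e) (e, a) `<=` [set x | (e, a) \in C x] by move=> x0 [z []].
    have ax := c1 _ (closureS s1 cl).
    have [/vert[v vx]|ns] := boolP (special xs (f x)); first by exists (inl v).
    have ce := lab_cface labC ax.
    case fx : (f x) ce ns => [z|] // ce ns.
    have [z0|z0] := eqVneq (im z) 0.
      by rewrite -fx in ns; have [c cx] := edge _ _ fx z0 ns; exists (inr (inl c)).
    case: ncl; exists z; split=> //; move: ce z0; rewrite /cface /face /=; case: (e) => h1 h2.
      by rewrite lt_neqAle eq_sym h2.
    by rewrite lt_neqAle h2.
Qed.

End Labelled.
End Cells.
End Covering_16.
Import Covering_16.

(** * Coverings and tuples of permutations *)

Module Covering_17.
Section ProductPrefix.
Variable (d : nat).
Implicit Types (t : seq 'S_d).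
Local Open Scope group_scope.

(** The gluing across edge [j] is the product of the first [j] local rotations: edge [0] gets the
    identity, and consecutive gluings differ by one entry of the tuple. *)
Definition prefix_prod t j : 'S_d := \prod_(x <- take j t) x.

Lemma prefix_prod0 t : prefix_prod t 0 = 1.
Proof. by rewrite /prefix_prod take0 big_nil. Qed.

Lemma prefix_prodS t j : (j < size t)%N -> prefix_prod t j.+1 = prefix_prod t j * nth 1 t j.
Proof. by move=> jt; rewrite /prefix_prod (take_nth 1) // -cats1 big_cat big_seq1. Qed.

Lemma prefix_prod_nth t j : (j < size t)%N -> (prefix_prod t j)^-1 * prefix_prod t j.+1 = nth 1 t j.
Proof. by move=> jt; rewrite prefix_prodS // mulKg. Qed.

Lemma prefix_prod_size t : prefix_prod t (size t) = \prod_(x <- t) x.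
Proof. by rewrite /prefix_prod take_size. Qed.

Lemma prefix_prod_mkseq (pi : nat -> 'S_d) m j : pi 0%N = 1 -> (j <= m)%N ->
  prefix_prod (mkseq (fun i => (pi i)^-1 * pi i.+1) m) j = pi j.
Proof.
move=> pi0; elim: j => [|j IH] jm; first by rewrite prefix_prod0 pi0.
by rewrite prefix_prodS ?size_mkseq // IH ?(ltnW jm) // nth_mkseq // mulKVg.
Qed.

Lemma prefix_prodJ t (s : 'S_d) j : prefix_prod [seq x ^ s | x <- t] j = prefix_prod t j ^ s.
Proof. by rewrite /prefix_prod -map_take big_map conjg_prod. Qed.

Lemma prefix_prod_inj t u : size t = size u ->
  (forall j, (j <= size t)%N -> prefix_prod t j = prefix_prod u j) -> t = u.
Proof.
move=> tu h; apply: (@eq_from_nth _ 1) => // j jt.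
by rewrite -!prefix_prod_nth -?tu // !h // ltnW.
Qed.

End ProductPrefix.

Section Correspondence.
Local Open Scope classical_set_scope.
Local Open Scope ring_scope.
Local Open Scope complex_scope.
Variables (R : realType) (xs : seq R) (w : seq R[i]) (g : nat) (b : seq nat).
Hypotheses (xsS : sorted <%R xs) (xw : forall z, (z \in 0 :: w) = special xs (Some z : sphere R)).
Hypotheses (w0 : 0 \notin w) (wr : size w = (2 * g + size b - 1)%N) (xr : size xs = (size w).+1).
Hypotheses (b0 : (0 < size b)%N) (bpos : 0%N \notin b).
Let d := sumn b.
Local Notation HC := (@hurwitz_covering R w g b).
Local Notation re := (@complex.Re R).
Local Notation im := (@complex.Im R).

Definition profile (i : nat) : seq nat :=
  if nth 0 xs i == 0 then [:: d] else 2%N :: nseq (d - 2) 1%N.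

Local Notation monodromy_data := ((size xs).-tuple 'S_d * {ffun 'I_d -> 'I_(size b)})%type.

(** Infinity lies between the last edge and edge [0], hence the inverse of the full product. The
    numbering is part of the data only there, where the preimages are marked. *)
Definition admissible (D : monodromy_data) : Prop :=
  (forall i, (i < size xs)%N -> exists kap, @cycle_numbering d (nth 1%g D.1 i) (profile i) kap) /\
  cycle_numbering (prefix_prod D.1 (size xs))^-1%g D.2.

Definition has_data (X : marked_covering R (size b)) (D : monodromy_data) : Prop :=
  exists2 C, presents xs (prefix_prod D.1) (@covering_map _ _ X) C &
    forall a k, ((true, a) \in C (mark X k)) = (D.2 a == k).

Lemma comp_ext (pi rho : nat -> 'S_d) y t : (forall j, (j <= size xs)%N -> pi j = rho j) ->
  comp xs pi y t = comp xs rho y t.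
Proof.
move=> e; apply/setP => u; rewrite !inE; apply: eq_connect => a c.
by apply: eq_existsb => j; rewrite e // -ltnS.
Qed.

Lemma presents_ext (pi rho : nat -> 'S_d) (X : topologicalType) (f : X -> sphere R) C :
  (forall j, (j <= size xs)%N -> pi j = rho j) -> presents xs pi f C -> presents xs rho f C.
Proof. by move=> e [h1 h2]; split=> // x t tx; rewrite -(comp_ext _ _ e); exact: h2. Qed.

Lemma act_special i : (i < size xs)%N -> forall j, (j <= size xs)%N ->
  act xs j (Some (nth 0 xs i +i* 0) : sphere R) = (j == i) || (j == i.+1).
Proof. by move=> si; have [B [v [cv lt]]] := local_type_special xsS si; exact: local_type_act cv lt. Qed.

Lemma act_infty j : (j <= size xs)%N -> act xs j (None : sphere R) = (j == size xs) || (j == 0%N).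
Proof. by move=> _; rewrite /act orbC. Qed.

Lemma special_root i : (i < size xs)%N -> nth 0 xs i = 0 \/ (nth 0 xs i +i* 0) \in w.
Proof.
move=> si; have : nth 0 xs i +i* 0 \in 0 :: w by rewrite xw /= eqxx mem_nth.
by rewrite inE => /orP[/eqP[->]|]; [left|right].
Qed.

Lemma special0 : exists2 i, (i < size xs)%N & nth 0 xs i = 0.
Proof.
have : special xs (Some 0 : sphere R) by rewrite -xw inE eqxx.
by move=> /andP[_ /(nthP 0)].
Qed.

Lemma profile_fiber i X : (i < size xs)%N -> HC X ->
  fiber_profile (@covering_map _ _ X) (Some (nth 0 xs i +i* 0)) (profile i).
Proof.
move=> si [_ _ [h0 _ hw _]]; rewrite /profile; case: eqP => [-> //|n0].
by have [//|/hw[_]] := special_root si.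
Qed.

Lemma hurwitz_branched X : HC X -> branched xs d (@covering_map _ _ X).
Proof.
move=> [[cX hX _ _] cf [h0 hi hw hg]]; split=> // -[z|]; last by exists b, (mark X).
have [zs|zg] := boolP (z \in 0 :: w); last first.
  have [l hl] := hg _ zg; exists (nseq d 1%N), l; split=> //.
  by rewrite sumn_nseq mul1n.
move: (zs); rewrite xw => /= zs'.
move: zs; rewrite inE => /orP[/eqP zz|/hw[d1 [l hl]]].
  have [l hl] := h0; rewrite zz; exists [:: d], l; split=> //; first by rewrite /= addn0.
  by rewrite -zz /= zs'.
exists (2%N :: nseq (d - 2) 1%N), l; split=> //; last by rewrite /= zs'.
by rewrite /= sumn_nseq mul1n subnKC.
Qed.

Lemma data_exists X : HC X -> exists2 D, admissible D & has_data X D.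
Proof.
move=> hX; have brf := hurwitz_branched hX.
have [C [pi [pi0 pC]]] := presentation_exists xsS brf.
pose t := mkseq (fun i => (pi i)^-1 * pi i.+1)%g (size xs).
have tP : size t == size xs by rewrite size_mkseq.
have [_ _ [_ hi _ _]] := hX.
have [kap kapP kC] := numbered_fiber_numbering pC (leqnn _) (leq0n _) act_infty hi.
exists (Tuple tP, [ffun a => kap a]); last first.
  exists C; last by move=> a k; rewrite kC ffunE.
  by apply: presents_ext pC => j js; rewrite prefix_prod_mkseq.
split=> [i si|]; last first.
  rewrite pi0 mulg1 in kapP; case: kapP => [h1 h2]; split.
    by move=> a a'; rewrite !ffunE h1 prefix_prod_mkseq.
  move=> k; have [k0 h3] := h2 k; split=> //; rewrite -h3.
    by apply: eq_card => a; rewrite !inE ffunE.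
have [l hl] := profile_fiber si hX.
have [kap' h _] := numbered_fiber_numbering pC (ltnW si) si (act_special si) hl.
by exists kap'; rewrite /= nth_mkseq.
Qed.

Lemma numbering_sum (s : 'S_d) c kap : @cycle_numbering d s c kap -> sumn c = d.
Proof.
move=> [_ h]; rewrite sumnE (big_nth 0%N) big_mkord -[RHS]card_ord -sum1_card.
rewrite (partition_big kap xpredT) //=; apply: eq_bigr => k _.
by have [_ <-] := h k; rewrite -sum1_card; apply: eq_bigl => a; rewrite inE.
Qed.

(** The model of the gluings [prefix_prod] works. With r simple branch values and n preimages of
    infinity its cells number 1 + r (d - 1) + n, (r + 2) d and 2 d, so the characteristic is 1 - r +
    n, that is 2 - 2 g. *)
Lemma cover_exists D : admissible D -> exists2 X, HC X & has_data X D.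
Proof.
case: D => t kap [/= ht hk]; pose pi := prefix_prod t; pose M := @model R xs d pi.
pose f := @mproj R xs d pi; pose C := @mlab R xs d pi.
have brf : branched xs d f := model_branched pi xsS.
have pC : presents xs pi f C := model_presents pi xsS.
have [cX hX cf _] := brf; have labC : labelling f C by case: pC.
have hk' : cycle_numbering ((pi (size xs))^-1 * pi 0%N)%g kap by rewrite /pi prefix_prod0 mulg1.
have [mk mkf mkC] := numbering_numbered_fiber brf pC (leqnn _) (leq0n _) act_infty hk'.
have fibP i : (i < size xs)%N -> fiber_profile f (Some (nth 0 xs i +i* 0)) (profile i).
  move=> si; have [ki kiP] := ht _ si; rewrite -prefix_prod_nth ?size_tuple // in kiP.
  by have [l hl _] := numbering_numbered_fiber brf pC (ltnW si) si (act_special si) kiP; exists l.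
have [i0 s0 x0] := special0.
have f0 : fiber_profile f (Some 0) [:: d] by have := fibP _ s0; rewrite /profile x0 eqxx.
have n0 i : (i < size xs)%N -> i != i0 -> nth 0 xs i != 0.
  move=> si; apply: contraNneq => h.
  have u : uniq xs by apply: sorted_uniq xsS; [exact: lt_trans|exact: ltxx].
  by rewrite -(nth_uniq 0 si s0 u) h x0.
have d1 i : (i < size xs)%N -> i != i0 -> (1 < d)%N.
  move=> si ne; have [ki kiP] := ht _ si; have := numbering_sum kiP.
  by rewrite /profile (negbTE (n0 _ si ne)) /= => <-.
exists (MarkedCovering f mk); last by exists C.
split=> //; last first.
- split=> //.
  + move=> z zw; have : z \in 0 :: w by rewrite inE zw orbT.
    rewrite xw => /andP[/eqP z0 /(nthP 0)[i si zi]].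
    have ze : z = nth 0 xs i +i* 0 by rewrite zi -z0; case: (z).
    have nz : nth 0 xs i != 0 by apply: contraNneq w0 => e; rewrite e in ze; move: zw; rewrite ze.
    have ni : i != i0 by apply: contraNneq nz => ->; rewrite x0.
    split; first exact: d1 si ni.
    by have := fibP _ si; rewrite -ze /profile (negbTE nz).
  + move=> z; rewrite xw => zg; have [_ _ _ /(_ (Some z))[s [l [hl sd sg]]]] := brf.
    by have {}sg := sg zg; subst s; exists l.
split=> //.
  have [l [lI lr _]] := f0.
  apply: (one_point_connected brf labC (y0 := Some 0) (x0 := l ord0)).
    by move=> e; rewrite /cface /=; case: e.
  move=> x fx; have : range l x by rewrite lr.
  by move=> [k _ <-]; rewrite ord1.
pose s (i : 'I_(size xs).+1) := if (i < size xs)%N then profile i else b.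
have lP : forall i : 'I_(size xs).+1, fiber_profile f (special_point xs i) (s i).
  move=> i; rewrite /s /special_point; case: ifP => si; last by exists mk.
  exact: fibP.
have := euler_cells xsS brf labC lP.
have -> : (\sum_i size (s i))%N = (1 + size w * (d - 1) + size b)%N.
  rewrite big_ord_recr /= {2}/s ltnn; congr (_ + _)%N.
  have eqs (i : 'I_(size xs)) : size (s (widen_ord (leqnSn _) i)) = if i == i0 :> nat then 1%N else (d - 1)%N.
    rewrite /s /= ltn_ord /profile; have [->|ne] := eqVneq (i : nat) i0; first by rewrite x0 eqxx.
    rewrite (negbTE (n0 _ _ ne)) //= size_nseq.
    have := d1 _ (ltn_ord i) ne; lia.
  rewrite (eq_bigr _ (fun i _ => eqs i)) (bigD1 (Ordinal s0)) //= eqxx; congr (_ + _)%N.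
  rewrite (eq_bigr (fun=> (d - 1)%N)); last first.
    by move=> i; rewrite -val_eqE /= => /negbTE ->.
  by rewrite sum_nat_const cardC1 card_ord xr.
set e1 := (_ - _ + _); set e2 := (_ - _); suff -> : e1 = e2 by [].
rewrite /e1 /e2 xr wr.
have dpos : (0 < d)%N.
  have [ki /numbering_sum] := ht _ s0; rewrite /profile x0 eqxx /d => _.
  case: (b) b0 bpos => [//|x b'] _ /=; rewrite inE negb_or eq_sym -lt0n => /andP[x0' _].
  by rewrite addn_gt0 x0'.
have : (2 * g + size b - 1)%N.+1 = (2 * g + size b)%N by rewrite subn1 prednK // addn_gt0 b0 orbT.
move: (2 * g + size b - 1)%N => r; nia.
Qed.

Definition conj_data (D : monodromy_data) (s : 'S_d) : monodromy_data :=
  (map_tuple (fun x => x ^ s)%g D.1, [ffun a => D.2 (s^-1%g a)]).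

Section Isos.
Variables (X Y : marked_covering R (size b)) (D E : monodromy_data).
Hypotheses (hX : HC X) (hY : HC Y).
Hypotheses (aD : admissible D) (XD : has_data X D) (YE : has_data Y E).

(* An isomorphism phi and the permutation s by which it moves the sheet labels. *)
Lemma iso_correspondence : exists F : 'S_d -> surface X -> surface Y,
  [/\ forall s, conj_data D s = E -> covering_iso (F s),
      forall s s', conj_data D s = E -> conj_data D s' = E -> F s = F s' -> s = s'
    & forall phi, @covering_iso _ _ X Y phi -> exists2 s, conj_data D s = E & phi = F s].
Proof.
have brX := hurwitz_branched hX; have brY := hurwitz_branched hY.
have [C pC CD] := XD; have [C' pC' CE] := YE.
have labC : labelling (@covering_map _ _ X) C by case: pC.
have labC' : labelling (@covering_map _ _ Y) C' by case: pC'.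
have piE s : conj_data D s = E -> forall j, (j <= size xs)%N ->
    prefix_prod E.1 j = (s^-1 * prefix_prod D.1 j * s)%g.
  by move=> <- j _; rewrite prefix_prodJ conjgE mulgA.
have /choice[F FP] : forall s, exists phi : surface X -> surface Y, conj_data D s = E ->
    [/\ continuous phi, forall x, covering_map (phi x) = covering_map x
    & forall x l, (relab1 s l \in C' (phi x)) = (l \in C x)].
  move=> s; have [e|ne] := pselect (conj_data D s = E).
    have [phi h] := perm_iso brX brY pC pC' (piE _ e); by exists phi.
  have kb : 'I_(size b) := Ordinal b0.
  by exists (fun=> mark Y kb) => e; case: ne.
exists F; split.
- move=> s e; have [c1 c2 c3] := FP _ e; split=> //.
    exact: (presented_homeo brX brY pC pC' (s := s)).
  move=> k; have [_ /(_ k)[k0 kk]] := aD.2.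
  have [a] : exists a, a \in [set a | D.2 a == k]%SET by apply/card_gt0P; rewrite kk.
  rewrite inE => ak; have ax : (true, a) \in C (mark X k) by rewrite CD.
  have [_ _ [_ [_ lr _] _ _]] := hX; have [_ _ [_ [_ lr' _] _ _]] := hY.
  have m1 : covering_map (mark X k) = None by have : range (mark X) (mark X k) by []; rewrite lr.
  have m2 : covering_map (mark Y k) = None by have : range (mark Y) (mark Y k) by []; rewrite lr'.
  apply: (lab_inj labC') (_ : (true, s a) \in _) _; first by rewrite c2 m1 m2.
    by have := c3 (mark X k) (true, a); rewrite ax => ->.
  by rewrite CE -e ffunE permK.
- move=> s s' e e' ee; apply/permP => a.
  have [_ c2 c3] := FP _ e; have [_ _ c3'] := FP _ e'; rewrite -ee in c3'.
  have [z fz] := face_neq0 R true; have cz : cface true (Some z : sphere R) by exact: face_cface.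
  have [x [fx ax]] := lab_ex labC a cz.
  apply: (lab_unique brY labC' (x := F s x) (e := true)).
  + by rewrite c2 fx; exact: face_generic fz.
  + by have := c3 x (true, a); rewrite ax => ->.
  + by have := c3' x (true, a); rewrite ax => ->.
- move=> phi [hphi fphi mphi].
  have [v [_ _ vK v'K]] := hphi.
  have cphi' : continuous phi.
    by have [v' [/withinP h _ _ _]] := hphi; move=> x P nP; apply: near_imp (h x I P nP) => x'; exact.
  have iphi : injective phi by move=> x x' e; have [_ <-] := vK x I; have [_ <-] := vK x' I; rewrite e.
  have [s [sP sE]] := iso_perm xsS brX brY pC pC' (prefix_prod0 _) (prefix_prod0 _) cphi' iphi fphi.
  have De : conj_data D s = E.
    rewrite [E]surjective_pairing; congr pair.
      apply/val_inj/prefix_prod_inj; first by rewrite !size_tuple.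
      by move=> j; rewrite size_tuple => js; rewrite prefix_prodJ sE // conjgE mulgA.
    apply/ffunP => a; rewrite ffunE; apply/eqP; rewrite eq_sym -CE -mphi.
    have := sP (mark X (D.2 (s^-1%g a))) (true, s^-1%g a).
    by rewrite /relab1 /relab /= permKV CD eqxx.
  exists s => //; apply/funext => x; have [_ c2 c3] := FP _ De.
  have [l lx] := labels_neq0 brX labC x.
  apply: (lab_inj labC') (_ : relab1 s l \in _) _; first by rewrite c2 fphi.
    by rewrite sP.
  by rewrite c3.
Qed.

End Isos.
End Correspondence.
End Covering_17.
Import Covering_17.

(** * Weighted count of isomorphism classes *)

Module Covering_18.
Section Counting.
Local Open Scope classical_set_scope.
Local Open Scope ring_scope.
Local Open Scope complex_scope.

Lemma porbitJ d (sigma s : 'S_d) a c :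
  (c \in porbit (sigma ^ s)%g a) = ((s^-1)%g c \in porbit sigma ((s^-1)%g a)).
Proof.
apply/porbitP/porbitP => -[n e]; exists n.
  by rewrite e -conjXg conjgE !permM permK.
by rewrite -conjXg conjgE !permM -e permKV.
Qed.

Lemma numberingJ d (sigma s : 'S_d) c kap kap' : @cycle_numbering d sigma c kap ->
  (forall a, kap' a = kap (s^-1%g a)) -> cycle_numbering (sigma ^ s)%g kap'.
Proof.
move=> [h1 h2] h; split=> [a a'|k]; first by rewrite porbitJ !h h1.
have [k0 k1] := h2 k; split=> //; rewrite -k1 -[RHS](card_imset _ (@perm_inj _ s)).
apply: eq_card => a; rewrite inE; apply/idP/imsetP => [ak|[a']].
  by exists (s^-1%g a); rewrite ?permKV // inE -h.
by rewrite inE => ak ->; rewrite h permK.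
Qed.

Variables (R : realType) (xs : seq R) (w : seq R[i]) (g : nat) (b : seq nat).
Hypotheses (xsS : sorted <%R xs) (xw : forall z, (z \in 0 :: w) = special xs (Some z : sphere R)).
Hypotheses (w0 : 0 \notin w) (wr : size w = (2 * g + size b - 1)%N) (xr : size xs = (size w).+1).
Hypotheses (b0 : (0 < size b)%N) (bpos : 0%N \notin b).
Let d := sumn b.
Local Notation HC := (@hurwitz_covering R w g b).
Local Notation D := ((size xs).-tuple 'S_d * {ffun 'I_d -> 'I_(size b)})%type.
Implicit Types (x y : D) (s : 'S_d).
Local Notation cj := (@conj_data R xs b).
Local Notation adm := (@admissible R xs b).

Lemma conj_data1 x : cj x 1%g = x.
Proof.
case: x => t kap; congr pair.
  by apply/val_inj; rewrite /= (eq_map (@conjg1 _)) map_id.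
by apply/ffunP => a; rewrite ffunE invg1 perm1.
Qed.

Lemma conj_dataM x s s' : cj x (s * s')%g = cj (cj x s) s'.
Proof.
case: x => t kap; congr pair.
  by apply/val_inj; rewrite /= -map_comp; apply: eq_map => u /=; rewrite conjgM.
by apply/ffunP => a; rewrite !ffunE invMg permM.
Qed.

Definition conj_action := TotalAction conj_data1 conj_dataM.

Lemma admissibleJ x s : adm x -> adm (cj x s).
Proof.
move=> [h1 h2]; split=> [k ks|].
  have [kap hk] := h1 _ ks; exists (fun a => kap (s^-1%g a)).
  have -> : nth 1%g (cj x s).1 k = (nth 1%g x.1 k ^ s)%g by rewrite (nth_map 1%g) ?size_tuple.
  exact: numberingJ hk _.
rewrite prefix_prodJ -conjVg; apply: numberingJ h2 _ => a; by rewrite ffunE.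
Qed.

Local Notation stab x := 'C_[set: 'S_d][x | conj_action]%g.

Lemma mem_stab x s : (s \in stab x) = (cj x s == x).
Proof. by rewrite finset.inE finset.in_setT; apply/astab1P/eqP. Qed.

(** Automorphisms move the sheet labels by the permutations that fix the data, and distinct
    permutations give distinct automorphisms. *)
Lemma iso_card X x : HC X -> adm x -> has_data X x ->
  ([set phi | @covering_iso R _ X X phi] #= `I_#|stab x|)%card.
Proof.
move=> hX ax hx.
have [F [F1 F2 F3]] := iso_correspondence xsS xw b0 hX hX ax hx hx.
pose f n := F (nth 1%g (enum (stab x)) n).
have st n : (n < #|stab x|)%N -> cj x (nth 1%g (enum (stab x)) n) = x.
  by move=> nn; apply/eqP; rewrite -mem_stab -mem_enum mem_nth // -cardE.
have -> : [set phi | @covering_iso R _ X X phi] = f @` `I_#|stab x|.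
  apply/seteqP; split=> [phi /F3[s e ->]|_ [n nn <-]]; last by apply: F1; exact: st.
  have ss : s \in enum (stab x) by rewrite mem_enum mem_stab e.
  exists (index s (enum (stab x))); first by rewrite /= cardE index_mem.
  by rewrite /f nth_index.
apply: inj_card_eq => n n'; rewrite !inE => nn nn' e.
have := F2 _ _ (st _ nn) (st _ nn') e => /eqP.
by rewrite nth_uniq ?enum_uniq // -?cardE // => /eqP.
Qed.

(** Orbit-stabiliser: the inverse order of a stabiliser is the size of the orbit divided by d!, and
    the orbits of the representatives partition the admissible data. *)
Lemma stab_sum r (x : 'I_r -> D) : (forall k, adm (x k)) ->
  (forall y, adm y -> exists k s, cj (x k) s = y) ->
  (forall k l s, cj (x k) s = x l -> k = l) ->
  \sum_(k < r) (#|stab (x k)|%:R^-1 : algC) = #|[set y : D | `[< adm y >]]%SET|%:R / (d`!)%:R.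
Proof.
move=> h1 h2 h3; have G : #|[set: 'S_d]%SET| = d`! by rewrite cardsT card_Sn.
have orb k : (#|stab (x k)|%:R^-1 : algC) = #|orbit conj_action [set: 'S_d]%SET (x k)|%:R / (d`!)%:R.
  have := card_orbit_stab conj_action [set: 'S_d]%G (x k); rewrite G => /(congr1 (fun n => n%:R : algC)).
  rewrite natrM => <-; rewrite invfM mulrA divff ?mul1r // pnatr_eq0.
  by rewrite -lt0n; apply/card_gt0P; exists (x k); exact: orbit_refl.
rewrite (eq_bigr _ (fun k _ => orb k)) -mulr_suml; congr (_ / _).
rewrite -natr_sum; congr (_%:R).
have orbP k y : (y \in orbit conj_action [set: 'S_d]%SET (x k)) <-> exists s, cj (x k) s = y.
  by split=> [/orbitP[s _ /= <-]|[s <-]]; [exists s|apply/orbitP; exists s; rewrite ?finset.in_setT].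
transitivity (\sum_(y in [set y : D | `[< adm y >]]%SET)
    \sum_(k < r) (y \in orbit conj_action [set: 'S_d]%SET (x k)))%N.
  rewrite exchange_big /=; apply: eq_bigr => k _.
  rewrite -sum1_card big_mkcond [RHS]big_mkcond; apply: eq_bigr => y _; rewrite inE.
  have [yo|yo] := boolP (y \in orbit _ _ _); last by case: ifP.
  suff -> : `[< adm y >] by [].
  by apply/asboolP; have [s <-] := (orbP _ _).1 yo; exact: admissibleJ.
rewrite -sum1_card; apply: eq_bigr => y; rewrite inE => /asboolP ay.
have [k [s e]] := h2 _ ay; have yk := (orbP k y).2 (ex_intro _ s e).
rewrite (bigD1 k) //= yk big1 // => l lk; apply/eqP; rewrite eqb0.
apply: contraNN lk => /orbP[s' e']; apply/eqP; apply: (h3 _ _ (s' * s^-1)%g).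
by rewrite conj_dataM e' -e -conj_dataM mulgV conj_data1.
Qed.

(** Being an equivalence, it yields existence and uniqueness of the number at once, which pins down
    the choice made in [hurwitz]. Through [key], lists of representatives of coverings and of orbits
    of data correspond. *)
Lemma hurwitz_number_count c : is_hurwitz_number w g b c <->
  c = #|[set y : D | `[< adm y >]]%SET|%:R / (d`!)%:R.
Proof.
have key r (rep : 'I_r -> marked_covering R (size b)) (x : 'I_r -> D) :
    (forall k, HC (rep k)) -> (forall k, adm (x k)) -> (forall k, has_data (rep k) (x k)) ->
    ((forall X, HC X -> exists k phi, @covering_iso R _ (rep k) X phi) <->
      (forall y, adm y -> exists k s, cj (x k) s = y)) /\
    ((forall k l phi, @covering_iso R _ (rep k) (rep l) phi -> k = l) <->
      (forall k l s, cj (x k) s = x l -> k = l)).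
  move=> hr ax hx; split; split.
  - move=> h y ay; have [X hX Xy] := cover_exists xsS xw w0 wr xr b0 bpos ay.
    have [k [phi iso]] := h _ hX; have [F [_ _ F3]] := iso_correspondence xsS xw b0 (hr k) hX (ax k) (hx k) Xy.
    by have [s e _] := F3 _ iso; exists k, s.
  - move=> h X hX; have [y ay Xy] := data_exists xsS xw hX.
    have [k [s e]] := h _ ay; have [F [F1 _ _]] := iso_correspondence xsS xw b0 (hr k) hX (ax k) (hx k) Xy.
    by exists k, (F s); exact: F1.
  - move=> h k l s e; have [F [F1 _ _]] := iso_correspondence xsS xw b0 (hr k) (hr l) (ax k) (hx k) (hx l).
    exact: h (F1 _ e).
  - move=> h k l phi iso; have [F [_ _ F3]] := iso_correspondence xsS xw b0 (hr k) (hr l) (ax k) (hx k) (hx l).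
    by have [s e _] := F3 _ iso; exact: h e.
split.
  move=> [r [rep [a [hr hcov hiso ha ->]]]].
  have /choice[x xP] : forall k, exists y, adm y /\ has_data (rep k) y.
    by move=> k; have [y ay hy] := data_exists xsS xw (hr k); exists y.
  have ax k : adm (x k) by case: (xP k).
  have hx k : has_data (rep k) (x k) by case: (xP k).
  have [k1 k2] := key _ _ _ hr ax hx.
  rewrite -(stab_sum ax (k1.1 hcov) (k2.1 hiso)); apply: eq_bigr => k _; congr (_%:R^-1).
  have := iso_card (hr k) (ax k) (hx k); have := ha k.
  by rewrite card_eq_sym => /card_eq_trans h /h /card_eq_II.
move=> ->; pose O := [set orbit conj_action [set: 'S_d]%SET y | y in [set y : D | `[< adm y >]]]%SET.
have /choice[x xP] : forall k : 'I_#|O|, exists y, adm y /\ enum_val k = orbit conj_action [set: 'S_d]%SET y.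
  by move=> k; have /imsetP[y] := enum_valP k; rewrite inE => /asboolP ay e; exists y.
have /choice[rep rP] : forall k, exists X, HC X /\ has_data X (x k).
  move=> k; have [ax _] := xP k; have [X hX hx] := cover_exists xsS xw w0 wr xr b0 bpos ax.
  by exists X.
have ax k : adm (x k) by case: (xP k).
have hr k : HC (rep k) by case: (rP k).
have hx k : has_data (rep k) (x k) by case: (rP k).
have [k1 k2] := key _ _ _ hr ax hx.
have c1 : forall y, adm y -> exists k s, cj (x k) s = y.
  move=> y ay; have yO : orbit conj_action [set: 'S_d]%SET y \in O by apply: imset_f; rewrite inE; apply/asboolP.
  pose k := enum_rank_in yO (orbit conj_action [set: 'S_d]%SET y); exists k.
  have [_ e] := xP k; rewrite enum_rankK_in // in e.
  have : y \in orbit conj_action [set: 'S_d]%SET (x k) by rewrite -e; exact: orbit_refl.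
  by move=> /orbitP[s _ /= <-]; exists s.
have c2 : forall k l s, cj (x k) s = x l -> k = l.
  move=> k l s e; apply: enum_val_inj; have [_ ->] := xP k; have [_ ->] := xP l.
  apply/eqP; rewrite orbit_eq_mem; apply/orbitP; exists (s^-1)%g; rewrite ?finset.in_setT //=.
  by rewrite -e -conj_dataM mulgV conj_data1.
exists #|O|, rep, (fun k => #|stab (x k)|); split=> //.
- exact: k1.2 c1.
- exact: k2.2 c2.
- by move=> k; exact: iso_card.
- by rewrite (stab_sum ax c1 c2).
Qed.

End Counting.
End Covering_18.
Import Covering_18.

(** * Moving the branch points to the real axis *)

Module Covering_19.
Section Transport.
Local Open Scope classical_set_scope.
Local Open Scope ring_scope.
Local Open Scope complex_scope.
Variable (R : realType).
Local Notation re := (@complex.Re R).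
Local Notation im := (@complex.Im R).

Section Push.
Variables (h h' : sphere R -> sphere R).
Hypotheses (ch : continuous h) (ch' : continuous h') (hK : cancel h h') (h'K : cancel h' h).

Lemma chart_push y B (v : sphere R -> plane R) : chart_at y B v -> chart_at (h y) (h' @^-1` B) (v \o h').
Proof.
move=> [oB By [v' [/withinP cv /withinP cv' vK v'K]] vy]; split=> /=; rewrite ?hK //.
  by apply: open_comp oB => z _; exact: ch'.
exists (h \o v'); split.
- apply/withinP => z Bz P nP.
  have n1 : \forall y \near h' z, B y -> P (v y) by exact: cv nP.
  exact: (ch' n1).
- apply/withinP => z dz P nP; have n1 : nbhs (v' z) (h @^-1` P) by exact: ch.
  exact: cv' dz _ n1.
- by move=> z Bz /=; have [dz e] := vK _ Bz; rewrite e h'K.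
- by move=> z dz /=; have [Bz e] := v'K _ dz; rewrite hK.
Qed.

Lemma ramification_push (X : topologicalType) (f : X -> sphere R) x k :
  ramification_index f x k -> ramification_index (h \o f) x k.
Proof.
move=> [A [B [u [v [cu cv uv]]]]]; exists A, (h' @^-1` B), u, (v \o h').
by split=> //; [exact: chart_push|move=> y /= Ay; rewrite hK; exact: uv].
Qed.

Lemma numbered_fiber_push (X : topologicalType) (f : X -> sphere R) y s l :
  @numbered_fiber R X f y s l -> @numbered_fiber R X (h \o f) (h y) s l.
Proof.
move=> [lI lr lram]; split=> //; last by move=> k; exact: ramification_push.
by rewrite lr; apply/seteqP; split=> x /= => [->|/(can_inj hK)].
Qed.

Lemma fiber_profile_push (X : topologicalType) (f : X -> sphere R) y s :
  fiber_profile f y s -> fiber_profile (h \o f) (h y) s.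
Proof. by move=> [l hl]; exists l; exact: numbered_fiber_push. Qed.

Definition push n (X : marked_covering R n) : marked_covering R n :=
  MarkedCovering (h \o @covering_map _ _ X) (mark X).

Lemma covering_iso_push n (X Y : marked_covering R n) phi :
  @covering_iso _ _ X Y phi <-> @covering_iso _ _ (push X) (push Y) phi.
Proof.
split=> -[h1 h2 h3]; split=> // x /=; first by rewrite h2.
by apply: (can_inj hK); exact: h2.
Qed.

Variables (phi : R[i] -> R[i]) (w w' : seq R[i]).
Hypotheses (hphi : forall z, h (Some z) = Some (phi z)) (hinf : h None = None) (phi0 : phi 0 = 0).
Hypotheses (phiw : forall z, (phi z \in w') = (z \in w)).

Lemma hurwitz_push g b X : @hurwitz_covering R w g b X -> @hurwitz_covering R w' g b (push X).
Proof.
move=> [hs cf [h0 hi hw hg]]; split=> //.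
  move=> x; apply: continuous_comp; [exact: cf|exact: ch].
have phiS z : exists z', z = phi z'.
  case e : (h' (Some z)) => [z'|]; last by have := h'K (Some z); rewrite e hinf.
  by exists z'; have := h'K (Some z); rewrite e hphi => -[].
split.
- by have := fiber_profile_push h0; rewrite hphi phi0.
- by have := numbered_fiber_push hi; rewrite hinf.
- move=> z; have [z' ->] := phiS z; rewrite phiw => /hw[d1 hf]; split=> //.
  by rewrite -hphi; exact: fiber_profile_push.
- move=> z; have [z' ->] := phiS z => zw.
  have {}zw : z' \notin 0 :: w.
    move: zw; rewrite !inE phiw; apply: contraNN => /orP[/eqP ->|->]; rewrite ?phi0 ?eqxx ?orbT //.
  by rewrite -hphi; exact/fiber_profile_push/hg.
Qed.
End Push.

Definition extend (phi : plane R -> plane R) (y : sphere R) : sphere R :=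
  if y is Some z then Some (phi z) else None.

Lemma extend_continuous (phi phi' : plane R -> plane R) : continuous phi -> continuous phi' ->
  cancel phi phi' -> cancel phi' phi -> continuous (extend phi).
Proof.
move=> c c' pK p'K [z|] P.
  by move=> /nbhs_sphere/(c z) n1; apply/nbhs_sphere.
move=> [U [cU clU] UP]; exists (phi' @` U).
  have cc : compact (phi' @` U) by apply: continuous_compact cU; exact: continuous_subspaceT.
  by split=> //; apply: compact_closed cc; exact: plane_hausdorff.
move=> _ [[z nz <-]|->]; last by apply: UP; right.
by apply: UP; left; exists (phi z) => // Uz; apply: nz; exists (phi z).
Qed.

Lemma extendK (phi phi' : plane R -> plane R) : cancel phi phi' -> cancel (extend phi) (extend phi').
Proof. by move=> pK [z|] //=; rewrite pK. Qed.

(** Ramification indices are defined by topological charts, so composition with a homeomorphism of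
    the sphere fixing 0 and infinity changes nothing but the position of the simple branch
    points. *)
Lemma hurwitz_number_transport (phi phi' : plane R -> plane R) w w' g b c :
  continuous phi -> continuous phi' -> cancel phi phi' -> cancel phi' phi -> phi 0 = 0 ->
  (forall z : R[i], ((phi z : R[i]) \in w') = (z \in w)) ->
  is_hurwitz_number w g b c -> is_hurwitz_number w' g b c.
Proof.
move=> c1 c2 pK p'K p0 pw.
have ch := extend_continuous c1 c2 pK p'K; have ch' := extend_continuous c2 c1 p'K pK.
have hK := extendK pK; have h'K := extendK p'K.
have pw' z : ((phi' z : R[i]) \in w) = (z \in w') by rewrite -pw p'K.
have p0' : phi' 0 = 0 by rewrite -[X in phi' X]p0 pK.
have hur X := @hurwitz_push _ _ ch ch' hK h'K phi w w' (fun=> erefl) erefl p0 pw g b X.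
have hur' X := @hurwitz_push _ _ ch' ch h'K hK phi' w' w (fun=> erefl) erefl p0' pw' g b X.
move=> [r [rep [a [h1 h2 h3 h4 ->]]]].
exists r, (fun k => push (extend phi) (rep k)), a; split=> //.
- by move=> k; exact: hur.
- move=> X hX; have [k [f [f1 f2 f3]]] := h2 _ (hur' _ hX); exists k, f; split=> // x.
  by have /= := f2 x => <-; rewrite h'K.
- by move=> k l f H; apply: (h3 k l f); apply/(@covering_iso_push _ _ hK _ (rep k) (rep l)).
- move=> k; have -> : [set f | @covering_iso _ _ (push (extend phi) (rep k)) (push (extend phi) (rep k)) f] =
    [set f | @covering_iso _ _ (rep k) (rep k) f]; last exact: h4.
  by apply/seteqP; split=> f /= H; apply/(@covering_iso_push _ _ hK _ (rep k) (rep k)).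
Qed.

Lemma interpolation (s : seq (R * R)) : uniq [seq x.1 | x <- s] ->
  exists p : {poly R}, forall x, x \in s -> p.[x.1] = x.2.
Proof.
elim: s => [|[a c] s IH] /=; first by exists 0.
move=> /andP[na /IH[p hp]]; pose q : {poly R} := \prod_(x <- [seq x.1 | x <- s]) ('X - x%:P).
have qa : q.[a] != 0 by move: na; rewrite -root_prod_XsubC.
exists (p + ((c - p.[a]) / q.[a])%:P * q) => x; rewrite inE => /orP[/eqP ->|xs] /=.
  by rewrite !hornerE divfK // addrC subrK.
have /rootP qx : root q x.1 by rewrite root_prod_XsubC; exact: map_f.
by rewrite !hornerE qx mulr0 addr0; exact: hp.
Qed.

Lemma horner_continuous (p : {poly R}) : continuous (fun x : R => p.[x]).
Proof.
elim/poly_ind: p => [|p c IH] x.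
  by rewrite (_ : (fun x : R => _) = cst 0); [exact: cvg_cst|apply/funext => y; rewrite horner0].
rewrite (_ : (fun x : R => _) = (fun x => p.[x] * x + c)); last by apply/funext => y; rewrite !hornerE.
by apply: cvgD; [apply: cvgM; [exact: IH|exact: cvg_id]|exact: cvg_cst].
Qed.

(** The real part of [(1 +i* t) * z] is [re z - t * im z]. Two distinct points collide only if [t]
    equals their quotient [q], and [t] exceeds the sum of the absolute values of all of these. *)
Lemma generic_slope (s : seq R[i]) : uniq s ->
  exists t : R, uniq [seq re ((1 +i* t) * z) | z <- s].
Proof.
move=> us; pose q (z z' : R[i]) := (re z - re z') / (im z - im z').
pose t := 1 + \sum_(z <- s) \sum_(z' <- s) `|q z z'|; exists t.
rewrite map_inj_in_uniq // => -[a c] [a' c'] zs zs' /= e.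
have [ec|nc] := eqVneq c c'; first by rewrite ec in e *; congr (_ +i* _); lra.
have : t = q (a +i* c) (a' +i* c').
  rewrite /q /=; have nz : c - c' != 0 by rewrite subr_eq0.
  apply: (mulIf nz); rewrite divfK //; lra.
have le1 z : 0 <= \sum_(z' <- s) `|q z z'| by apply: sumr_ge0 => ? _; exact: normr_ge0.
have : `|q (a +i* c) (a' +i* c')| <= \sum_(z <- s) \sum_(z' <- s) `|q z z'|.
  rewrite (big_rem _ zs) (big_rem _ zs') /= -addrA lerDl addr_ge0 //; apply: sumr_ge0 => ? _ //.
move=> h1 h2; have h3 := le_trans (ler_norm _) h1.
by move: h3; rewrite -h2 /t gerDr leNgt ltr01.
Qed.

(** After a multiplication that separates the real parts, a vertical shear by an interpolation
    polynomial of the imaginary parts drops all the points onto the real axis. A shear is a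
    homeomorphism, its inverse being the opposite shear. *)
Lemma straighten (w : seq R[i]) : uniq (0 :: w) ->
  exists phi phi' : plane R -> plane R,
    [/\ continuous phi, continuous phi', cancel phi phi', cancel phi' phi &
      phi 0 = 0 /\ forall z : R[i], z \in w -> im (phi z) = 0].
Proof.
move=> uw; have [t ut] := generic_slope uw.
pose m : R[i] := 1 +i* t; have m0 : m != 0 by rewrite /m eq_complex /= oner_eq0.
have ut' : uniq [seq x.1 | x <- [seq (re (m * z), im (m * z)) | z <- 0 :: w]].
  by rewrite -map_comp.
have [p hp] := interpolation ut'.
pose sh (e : R) (z : plane R) : plane R := re z +i* (im z + e * p.[re z]).
have shK e : cancel (sh e) (sh (- e)).
  by move=> [a c]; rewrite /sh /=; congr (_ +i* _); rewrite mulNr addrK.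
have csh e : continuous (sh e).
  move=> z; apply: (cvg_plane (nbhs_filter z)); first exact: (@re_continuous R z).
  have h1 : im @ z --> im z := @im_continuous R z.
  have h2 : (fun z : plane R => e * p.[re z]) @ z --> e * p.[re z].
    apply: (cvg_comp re (fun x => e * p.[x]) (@re_continuous R z)).
    by apply: cvgM; [exact: cvg_cst|exact: horner_continuous].
  exact: (@cvgD _ _ _ _ (nbhs_filter z) _ _ _ _ h1 h2).
pose mu (a : R[i]) (z : plane R) : plane R := a * (z : R[i]).
have cmu a : continuous (mu a).
  move=> z; have := @plane_affine_continuous R a 0 z.
  rewrite (_ : (fun z : plane R => _) = mu a) ?addr0 //.
  by apply/funext => y; rewrite addr0.
exists (sh (-1) \o mu m), (mu m^-1 \o sh 1); split.
- by move=> z; apply: continuous_comp; [exact: cmu|exact: csh].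
- by move=> z; apply: continuous_comp; [exact: csh|exact: cmu].
- move=> z /=; have := shK (-1) (mu m z); rewrite opprK => ->.
  by rewrite /mu mulKf.
- by move=> z /=; rewrite /mu mulVKf // shK.
have key z : z \in 0 :: w -> im ((sh (-1) \o mu m) z) = 0.
  move=> zw; rewrite /= mulN1r (hp (re (m * z), im (m * z))) ?subrr //.
  by apply/mapP; exists z.
split; last by move=> z zw; apply: key; rewrite inE zw orbT.
by have := key 0 (mem_head _ _); rewrite /sh /mu /= mulr0 /= => ->; rewrite mulr0 subr0.
Qed.

Lemma hurwitz_number_value (w : seq R[i]) g b : uniq (0 :: w) ->
  size w = (2 * g + size b - 1)%N -> (0 < size b)%N -> 0%N \notin b ->
  exists (xs : seq R) , size xs = (size w).+1 /\ (exists2 i, (i < size xs)%N & 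
    (forall j, (j < size xs)%N -> (nth 0 xs j == 0) = (j == i))) /\
    (forall c, is_hurwitz_number w g b c <->
      c = #|[set y | `[< @admissible R xs b y >]]%SET|%:R / ((sumn b)`!)%:R).
Proof.
move=> uw sw b0 bpos; have [phi [phi' [c1 c2 pK p'K [p0 pim]]]] := straighten uw.
pose w' := map phi w.
have re0 z : z \in 0 :: w' -> z = re z +i* 0.
  rewrite inE => /orP[/eqP -> //|/mapP[z' zw ->]].
  by rewrite -(pim _ zw); case: (phi z').
have u' : uniq (0 :: w').
  have -> : 0 :: w' = map phi (0 :: w) by rewrite /= p0.
  by rewrite map_inj_uniq //; exact: can_inj pK.
pose xs := sort <=%R (map re (0 :: w')).
have ux : uniq (map re (0 :: w')).
  by rewrite map_inj_in_uniq // => z z' /re0 -> /re0 -> /= ->.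
have xsS : sorted <%R xs by rewrite sort_lt_sorted.
have memx x : (x \in xs) = (x \in map re (0 :: w')) by rewrite mem_sort.
have xw z : (z \in 0 :: w') = special xs (Some z : sphere R).
  rewrite /= memx; apply/idP/andP => [zw|[/eqP z0 /mapP[z' zw e]]].
    by split; [rewrite {1}(re0 _ zw) /= eqxx|exact: map_f].
  by have -> : z = z' by rewrite (re0 _ zw) -e -z0; case: (z).
have w0 : 0 \notin w' by move: u' => /andP[].
have wr : size w' = (2 * g + size b - 1)%N by rewrite size_map.
have xr : size xs = (size w').+1 by rewrite size_sort size_map.
have cnt := hurwitz_number_count xsS xw w0 wr xr b0 bpos.
have pw (z : R[i]) : ((phi z : R[i]) \in w') = (z \in w) by rewrite mem_map //; exact: can_inj pK.
have pw' (z : R[i]) : ((phi' z : R[i]) \in w) = (z \in w') by rewrite -pw p'K.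
have p0' : phi' 0 = 0 by rewrite -[X in phi' X]p0 pK.
exists xs; split; first by rewrite xr size_map.
split; last first.
  move=> c; rewrite -cnt; split; first exact: (hurwitz_number_transport c1 c2 pK p'K p0 pw).
  exact: (hurwitz_number_transport c2 c1 p'K pK p0' pw').
have x0 : 0 \in xs by rewrite memx mem_head.
exists (index 0 xs); first by rewrite index_mem.
move=> j js; rewrite -[X in _ == X](nth_index 0 x0) nth_uniq ?index_mem //.
by rewrite sort_uniq.
Qed.

End Transport.
End Covering_19.
Import Covering_19.

(** * Formal power series as a commutative ring *)

Module Series_1.
Section FpsRing.
Local Open Scope mset_scope.
Local Open Scope ring_scope.
Implicit Types (F G H : fps) (m u v : monomial) (b n : nat).

Lemma mset_ind (P : monomial -> Prop) : P mset0 -> (forall b m, P m -> P (b +` m)%mset) -> forall m, P m.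
Proof.
move=> P0 PS m; rewrite -[m]seq_mset_id; elim: (m : seq nat) => [|b s IH]; last first.
  by rewrite mset_cons; exact: PS.
suff -> : seq_mset [::] = mset0 :> monomial by [].
by apply/msetP => x; rewrite mset_seqE mset0E.
Qed.

Lemma splits_finite m : finite_set [set uv : monomial * monomial | (uv.1 `+` uv.2)%mset = m].
Proof.
elim/mset_ind: m => [|b m IH].
  apply: (@sub_finite_set _ _ [set (mset0, mset0)]); last exact: finite_set1.
  move=> [u v] /= /msetP e; congr pair; apply/msetP => x; have := e x; rewrite msetE2 !mset0E; lia.
apply: (@sub_finite_set _ _
  ((fun uv : monomial * monomial => ((b +` uv.1)%mset, uv.2)) @`
     [set uv | (uv.1 `+` uv.2)%mset = m] `|`
   (fun uv : monomial * monomial => (uv.1, (b +` uv.2)%mset)) @`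
     [set uv | (uv.1 `+` uv.2)%mset = m])%classic); last first.
  by rewrite finite_setU; split; exact: finite_image.
move=> [u v] /= e; have : b \in (u `+` v)%mset by rewrite e mset1D1.
move=> /msetDP[bu|bv]; [left|right].
  exists ((u `\ b)%mset, v) => /=; last by rewrite msetB1K.
  apply/msetP => x; move/msetP: e => /(_ x); rewrite !msetE2 !msetnE.
  have : (0 < u b)%N by rewrite -in_mset.
  by case: eqP => [->|_]; lia.
exists (u, (v `\ b)%mset) => /=; last by rewrite msetB1K.
apply/msetP => x; move/msetP: e => /(_ x); rewrite !msetE2 !msetnE.
have : (0 < v b)%N by rewrite -in_mset.
by case: eqP => [->|_]; lia.
Qed.

Lemma fps_mul0 F G : fps_mul F G mset0 = F mset0 * G mset0.
Proof.
rewrite /fps_mul (_ : [set uv : monomial * monomial | _]%classic = [set (mset0, mset0)]%classic) ?fsbig_set1 //.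
apply/seteqP; split=> [[u v] /= /msetP e|_ -> /=]; last by rewrite msetD0.
by congr pair; apply/msetP => x; have := e x; rewrite msetE2 !mset0E; lia.
Qed.

Lemma msetB_add b (u v m : monomial) : (0 < u b)%N -> (u `+` v)%mset = (m `+` [mset b])%mset ->
  ((u `\ b) `+` v)%mset = m.
Proof.
move=> ub e; apply/msetP => x; move/msetP: e => /(_ x); rewrite !msetE2 !msetnE.
by case: eqP => [->|_]; lia.
Qed.

(** The weight kills the splittings whose first part lacks [b]; the others arise from splittings of
    [m] by adding one [b] there. *)
Lemma splits_shift b m (f : monomial * monomial -> algC) :
  \sum_(uv \in [set uv : monomial * monomial | (uv.1 `+` uv.2)%mset = (m `+` [mset b])%mset])
     (uv.1 b)%:R * f uv =
  \sum_(uv \in [set uv : monomial * monomial | (uv.1 `+` uv.2)%mset = m])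
     (uv.1 b).+1%:R * f ((uv.1 `+` [mset b])%mset, uv.2).
Proof.
pose h (uv : monomial * monomial) := ((uv.1 `+` [mset b])%mset, uv.2).
pose Q := (h @` [set uv : monomial * monomial | (uv.1 `+` uv.2)%mset = m])%classic.
rewrite -(@fsbig_widen _ _ _ _ Q).
- rewrite (@reindex_fsbig _ _ _ _ _ h [set uv : monomial * monomial | (uv.1 `+` uv.2)%mset = m]%classic).
    by apply: eq_fsbigr => -[u v] _ /=; rewrite msetE2 msetnE eqxx addn1.
  split=> //; first by move=> uv huv; exists uv.
  move=> [u v] [u' v'] _ _ [/= e ->]; congr pair.
  by have := congr1 (fun x => x `\` [mset b])%mset e; rewrite !msetDKBC.
- move=> _ [[u v] /= <- <-] /=; by rewrite msetDAC.
- move=> [u v] [/= e nQ]; suff -> : u b = 0%N by rewrite mul0r.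
  apply/eqP; apply: contra_notT nQ; rewrite -lt0n => ub; exists ((u `\ b)%mset, v) => /=.
    exact: msetB_add.
  by rewrite /h /= msetDC msetB1K // in_mset.
Qed.

(** The multiplicity of [b] in a product monomial is the sum of its multiplicities in both factors,
    which splits the convolution into the two terms. *)
Lemma fps_derivM b F G : fps_deriv b (fps_mul F G) =
  (fps_mul (fps_deriv b F) G + fps_mul F (fps_deriv b G)) :> fps.
Proof.
apply/funext => m; rewrite /fps_deriv {1}/fps_mul.
pose f (uv : monomial * monomial) := F uv.1 * G uv.2.
pose S k := [set uv : monomial * monomial | (uv.1 `+` uv.2)%mset = k]%classic.
have swapS k (g : monomial * monomial -> algC) : \sum_(uv \in S k) g uv = \sum_(uv \in S k) g (uv.2, uv.1).
  rewrite (@reindex_fsbig _ _ _ _ _ (fun uv : monomial * monomial => (uv.2, uv.1)) (S k)) //.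
  split=> [[u v] /= <-|[u v] [u' v'] _ _ [-> ->] //|[u v] /= <-]; first by rewrite msetDC.
  by exists (v, u) => //=; rewrite msetDC.
have -> : (m b).+1%:R * \sum_(uv \in S (m `+` [mset b])%mset) F uv.1 * G uv.2 =
    \sum_(uv \in S (m `+` [mset b])%mset) (uv.1 b)%:R * f uv +
    \sum_(uv \in S (m `+` [mset b])%mset) (uv.2 b)%:R * f uv.
  rewrite fsbig_finite ?mulr_sumr -?fsbig_finite; try exact: splits_finite.
  rewrite -fsbig_split; last exact: splits_finite.
  apply: eq_fsbigr => -[u v]; rewrite inE /= => /msetP/(_ b); rewrite !msetE2 msetnE eqxx => e.
  by rewrite -mulrDl -natrD e addn1.
rewrite [X in _ + X]swapS /= (splits_shift b m f) (splits_shift b m (fun uv => f (uv.2, uv.1))).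
congr (_ + _); first by apply: eq_fsbigr => -[u v] _ /=; rewrite /f /= mulrA.
rewrite swapS; apply: eq_fsbigr => -[u v] _ /=; rewrite /f /=; ring.
Qed.

Lemma fps_derivD b F G : fps_deriv b (F + G) = fps_deriv b F + fps_deriv b G.
Proof. by apply/funext => m; rewrite /fps_deriv /= mulrDr. Qed.

Lemma fps_derivN b F : fps_deriv b (- F) = - fps_deriv b F.
Proof. by apply/funext => m; rewrite /fps_deriv /= mulrN. Qed.

Lemma fps_deriv0 b : fps_deriv b 0 = 0.
Proof. by apply/funext => m; rewrite /fps_deriv /= mulr0. Qed.

Lemma fps_derivC b n F : fps_deriv b (fps_deriv n F) = fps_deriv n (fps_deriv b F).
Proof.
apply/funext => m; rewrite /fps_deriv !msetE2 !msetnE [in RHS]eq_sym msetDAC.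
by case: eqP => [->//|_]; rewrite !addn0; ring.
Qed.

Lemma fps_deriv_inj F G : F mset0 = G mset0 -> (forall b, fps_deriv b F = fps_deriv b G) -> F = G.
Proof.
move=> e0 eS; apply/funext => m; elim/mset_ind: m => // b m _.
have := congr1 (fun f : fps => f m) (eS b); rewrite /fps_deriv => /(mulfI _).
by rewrite msetDC; apply; rewrite pnatr_eq0.
Qed.

(* Coinduction: two series are equal if they have the same constant term and
   their derivatives are sums of pairs in the same relation. *)
Inductive sum_closure (P : fps -> fps -> Prop) : fps -> fps -> Prop :=
| closure_base F G : P F G -> sum_closure P F G
| closure_refl F : sum_closure P F F
| closure_add F G F' G' : sum_closure P F G -> sum_closure P F' G' -> sum_closure P (F + F') (G + G').

Lemma fps_coind (P : fps -> fps -> Prop) :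
  (forall F G, P F G -> F mset0 = G mset0) ->
  (forall F G b, P F G -> sum_closure P (fps_deriv b F) (fps_deriv b G)) ->
  forall F G, P F G -> F = G.
Proof.
move=> h0 hS F G /closure_base PFG; apply/funext => m.
elim/mset_ind: m F G PFG => [|b m IH] F G.
  by elim=> [F1 G1 /h0|//|F1 G1 F2 G2 _ e1 _ e2] //; rewrite /= !fctE e1 e2.
have dP F1 G1 : sum_closure P F1 G1 -> sum_closure P (fps_deriv b F1) (fps_deriv b G1).
  elim=> [F2 G2 /hS //|F2|F2 G2 F3 G3 _ c1 _ c2]; first exact: closure_refl.
  by rewrite !fps_derivD; exact: closure_add.
move=> /dP/IH; rewrite /fps_deriv => /(mulfI _); rewrite [in F _]msetDC [in G _]msetDC.
by apply; rewrite pnatr_eq0.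
Qed.

(** This law and those that follow are proved by coinduction: constant terms multiply, and the
    Leibniz rule reproduces the law in the derivatives, so convolutions need not be rearranged. *)
Lemma fps_mulC : commutative fps_mul.
Proof.
move=> F G; apply: (fps_coind (P := fun X Y => exists F G, X = fps_mul F G /\ Y = fps_mul G F)).
- by move=> _ _ [F1 [G1 [-> ->]]]; rewrite !fps_mul0 mulrC.
- move=> _ _ b [F1 [G1 [-> ->]]]; rewrite !fps_derivM [X in sum_closure _ _ X]addrC.
  by apply: closure_add; apply: closure_base; eexists; eexists.
- by exists F, G.
Qed.

Lemma fps_mulDl : left_distributive fps_mul (fun F G => F + G).
Proof.
move=> F G H; apply: (fps_coind (P := fun X Y => exists F G H, X = fps_mul (F + G) H /\ Y = fps_mul F H + fps_mul G H)).
- by move=> _ _ [F1 [G1 [H1 [-> ->]]]]; rewrite /= !fctE !fps_mul0 /= mulrDl.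
- move=> _ _ b [F1 [G1 [H1 [-> ->]]]]; rewrite fps_derivM !fps_derivD !fps_derivM [X in sum_closure _ _ X]addrACA.
  by apply: closure_add; apply: closure_base; eexists; eexists; eexists.
- by exists F, G, H.
Qed.

Lemma fps_mulA : associative fps_mul.
Proof.
move=> F G H; apply: (fps_coind (P := fun X Y => exists F G H, X = fps_mul F (fps_mul G H) /\ Y = fps_mul (fps_mul F G) H)).
- by move=> _ _ [F1 [G1 [H1 [-> ->]]]]; rewrite !fps_mul0 mulrA.
- move=> _ _ b [F1 [G1 [H1 [-> ->]]]]; rewrite !fps_derivM [X in _ + X]fps_mulC !fps_mulDl.
  rewrite -[X in sum_closure _ _ X]addrA [fps_mul (fps_mul _ H1) F1]fps_mulC [fps_mul (fps_mul G1 _) F1]fps_mulC.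
  do 2?apply: closure_add; by apply: closure_base; eexists; eexists; eexists.
- by exists F, G, H.
Qed.

Lemma fps_mul0r F : fps_mul 0 F = 0.
Proof.
by apply: (addrI (fps_mul 0 F)); rewrite -fps_mulDl !addr0.
Qed.

Lemma fps_deriv1 b : fps_deriv b fps1 = 0.
Proof.
apply/funext => m; rewrite /fps_deriv /fps1 (_ : _ == _ = false) ?mulr0 //.
by apply/negbTE/eqP => /msetP/(_ b); rewrite msetE2 msetnE eqxx mset0E addn1.
Qed.

Lemma fps_mul1 : left_id fps1 fps_mul.
Proof.
move=> F; apply: (fps_coind (P := fun X Y => X = fps_mul fps1 Y)) => //.
- by move=> _ G ->; rewrite fps_mul0 /fps1 eqxx mul1r.
- move=> _ G b ->; rewrite fps_derivM fps_deriv1 fps_mul0r add0r; exact: closure_base.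
Qed.

Lemma fps1_neq0 : fps1 != 0 :> fps.
Proof.
apply/eqP => /(congr1 (fun f : fps => f mset0)); rewrite /fps1 eqxx /= => /eqP.
by rewrite oner_eq0.
Qed.
End FpsRing.

(** A separate name on which multiplication is the convolution; addition stays the pointwise one. *)
Definition fps_ring : Type := fps.
HB.instance Definition _ := GRing.Zmodule.copy fps_ring (monomial -> algC).
HB.instance Definition _ := GRing.Zmodule_isComNzRing.Build fps_ring
  fps_mulA fps_mulC fps_mul1 fps_mulDl fps1_neq0.
End Series_1.
Import Series_1.

(** * Derivations, Euler operator and cut-and-join operator *)

Module Series_2.
Section Operators.
Local Open Scope mset_scope.
Local Open Scope ring_scope.
Implicit Types (F G H : fps_ring) (m u v : monomial) (b n : nat).

(** The index 0 of [beta] adds nothing, so this is the degree of the covering that a monomial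
    records. *)
Definition wt m : nat := sumn m.

Lemma sumn_perm (s t : seq nat) : perm_eq s t -> sumn s = sumn t.
Proof. by move=> st; rewrite !sumnE; exact: perm_big. Qed.

Lemma wt0 : wt mset0 = 0%N.
Proof. by rewrite /wt enum_mset0. Qed.

Lemma wt_add b m : wt (m `+` [mset b]) = (wt m + b)%N.
Proof.
rewrite /wt -{1}[m]seq_mset_id msetDC -mset_cons.
by rewrite (sumn_perm (perm_eq_seq_mset _)) /= addnC.
Qed.

Lemma wtE m N : (wt m < N)%N -> wt m = (\sum_(n < N) n * m n)%N.
Proof.
elim/mset_ind: m => [|b m IH] mN; first by rewrite wt0 big1 // => n _; rewrite mset0E muln0.
rewrite msetDC wt_add in mN *; rewrite IH; last by apply: leq_ltn_trans mN; exact: leq_addr.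
have bN : (b < N)%N by apply: leq_ltn_trans mN; exact: leq_addl.
under [RHS]eq_bigr => n _ do rewrite msetE2 msetnE mulnDr.
rewrite big_split /=; congr (_ + _)%N; rewrite (bigD1 (Ordinal bN)) //= eqxx muln1.
rewrite big1 ?addn0 // => n; rewrite -val_eqE /= => /negbTE ->; by rewrite muln0.
Qed.

Lemma mem_wt b m : b \in m -> (b <= wt m)%N.
Proof. by move=> bm; rewrite -(msetB1K bm) msetDC wt_add leq_addl. Qed.

Lemma fps_addE F G m : (F + G) m = F m + G m. Proof. by []. Qed.
Lemma fps_oppE F m : (- F) m = - F m. Proof. by []. Qed.
Lemma fps_sumE (I : Type) (r : seq I) (P : pred I) (E : I -> fps_ring) m :
  (\sum_(i <- r | P i) E i) m = \sum_(i <- r | P i) E i m.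
Proof. by elim/big_rec2: _ => // i x y _ <-. Qed.
Lemma fps_mulrnE F k m : (F *+ k) m = F m *+ k.
Proof. by elim: k => // k IH; rewrite !mulrS fps_addE IH. Qed.

Definition D b F : fps_ring := (fps_deriv b F : fps_ring) *+ b.
Definition dbeta F : fps_ring := fps_deriv 0 F.

Lemma DE b F m : D b F m = (b * (m b).+1)%:R * F (m `+` [mset b]).
Proof. by rewrite /D fps_mulrnE /fps_deriv natrM -mulrA -[LHS]mulr_natl. Qed.

Lemma DD b F G : D b (F + G) = D b F + D b G.
Proof. by rewrite /D fps_derivD mulrnDl. Qed.
Lemma DN b F : D b (- F) = - D b F.
Proof. by rewrite /D fps_derivN mulNrn. Qed.
Lemma D0 b : D b 0 = 0.
Proof. by rewrite /D fps_deriv0 mul0rn. Qed.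
Lemma Dmulrn b F k : D b (F *+ k) = D b F *+ k.
Proof. by elim: k => [|k IH]; rewrite ?D0 // !mulrS DD IH. Qed.
Lemma Dsum b (I : Type) (r : seq I) (P : pred I) (E : I -> fps_ring) :
  D b (\sum_(i <- r | P i) E i) = \sum_(i <- r | P i) D b (E i).
Proof. by elim/big_rec2: _ => [|i x y _ <-]; rewrite ?D0 // DD. Qed.
Lemma DM b F G : D b (F * G) = D b F * G + F * D b G.
Proof. by rewrite /D [fps_deriv b (F * G)]fps_derivM mulrnDl mulrnAl mulrnAr. Qed.
Lemma DC b n F : D b (D n F) = D n (D b F).
Proof.
apply/funext => m; rewrite !DE !msetE2 !msetnE [in RHS]eq_sym msetDAC.
by case: eqP => [->//|_]; rewrite !addn0; ring.
Qed.

Lemma dbetaD F G : dbeta (F + G) = dbeta F + dbeta G. Proof. exact: fps_derivD. Qed.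
Lemma dbeta0 : dbeta 0 = 0. Proof. exact: fps_deriv0. Qed.
Lemma dbetaM F G : dbeta (F * G) = dbeta F * G + F * dbeta G. Proof. exact: fps_derivM. Qed.
Lemma dbetamulrn F k : dbeta (F *+ k) = dbeta F *+ k.
Proof. by elim: k => [|k IH]; rewrite ?dbeta0 // !mulrS dbetaD IH. Qed.
Lemma dbetasum (I : Type) (r : seq I) (P : pred I) (E : I -> fps_ring) :
  dbeta (\sum_(i <- r | P i) E i) = \sum_(i <- r | P i) dbeta (E i).
Proof. by elim/big_rec2: _ => [|i x y _ <-]; rewrite ?dbeta0 // dbetaD. Qed.
Lemma dbeta_D b F : dbeta (D b F) = D b (dbeta F).
Proof. by rewrite /dbeta /D -/(dbeta _) -/(dbeta _) dbetamulrn /dbeta fps_derivC. Qed.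

(* The sum over n > 0 of p_n * F n. *)
Definition psum (F : nat -> fps_ring) : fps_ring := fun m =>
  \sum_(n < (wt m).+1 | (0 < n)%N && (val n \in m)) F n (m `\ val n).

Lemma psum_bound (F : nat -> fps_ring) m N : (wt m < N)%N ->
  psum F m = \sum_(n < N | (0 < n)%N && (val n \in m)) F n (m `\ val n).
Proof.
move=> mN; rewrite /psum (big_ord_widen_cond _ (fun n => (0 < n)%N && (n \in m)) (fun n => F n (m `\ n)) mN).
apply: eq_bigl => n; case: (boolP (val n \in m)) => [nm|]; last by rewrite !andbF.
by rewrite ltnS (mem_wt nm) andbT.
Qed.

Lemma eq_psum (F G : nat -> fps_ring) : (forall n, (0 < n)%N -> F n = G n) -> psum F = psum G.
Proof. by move=> h; apply/funext => m; apply: eq_bigr => n /andP[n0 _]; rewrite h. Qed.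

Lemma psumD (F G : nat -> fps_ring) : psum (fun n => F n + G n) = psum F + psum G.
Proof. by apply/funext => m; rewrite fps_addE /psum -big_split. Qed.
Lemma psum0 : psum (fun=> 0) = 0.
Proof. by apply/funext => m; rewrite /psum big1. Qed.
Lemma psumN (F : nat -> fps_ring) : psum (fun n => - F n) = - psum F.
Proof. by apply/funext => m; rewrite fps_oppE /psum -sumrN. Qed.
Lemma psummulrn (F : nat -> fps_ring) k : psum (fun n => F n *+ k) = psum F *+ k.
Proof.
elim: k => [|k IH]; first by rewrite mulr0n -psum0.
by rewrite mulrS -IH -psumD; apply: eq_psum => n _; rewrite mulrS.
Qed.
Lemma psumsum (I : Type) (r : seq I) (P : pred I) (E : nat -> I -> fps_ring) :
  psum (fun n => \sum_(i <- r | P i) E n i) = \sum_(i <- r | P i) psum (fun n => E n i).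
Proof.
elim: r => [|a r IH]; first by rewrite big_nil; apply: (etrans _ psum0); apply: eq_psum => n _; rewrite big_nil.
rewrite big_cons -IH; case Pa: (P a); last by apply: eq_psum => n _; rewrite big_cons Pa.
by rewrite -psumD; apply: eq_psum => n _; rewrite big_cons Pa.
Qed.

Lemma fps_deriv_psum b (F : nat -> fps_ring) : fps_deriv b (psum F) =
  (if (0 < b)%N then F b else 0) + psum (fun n => fps_deriv b (F n)) :> fps_ring.
Proof.
apply/funext => m; pose N := (wt m + b).+1.
have mN : (wt m < N)%N by rewrite ltnS leq_addr.
have mbN : (wt (m `+` [mset b]) < N)%N by rewrite wt_add.
rewrite fps_addE /fps_deriv (psum_bound _ mN) (psum_bound _ mbN).
have bN : (b < N)%N by rewrite ltnS leq_addl.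
have -> : (if (0 < b)%N then F b else 0) m = \sum_(n < N | (0 < n)%N) if n == b :> nat then F b m else 0.
  have [b0|b0] := ltnP 0 b.
    rewrite (bigD1 (Ordinal bN)) //= eqxx big1 ?addr0 // => n /andP[_].
    by rewrite -val_eqE /= => /negbTE ->.
  rewrite big1 // => n n0; case: eqP => // e; by rewrite e ltnNge b0 in n0.
rewrite big_mkcondr [X in _ = _ + X]big_mkcondr -big_split /= mulr_sumr; apply: eq_bigr => n n0.
rewrite in_msetE in_mset1; case: eqP => [nb|nb].
  rewrite nb orbT [m `+` _]msetDC msetD1K; case: (boolP (b \in m)) => bm.
    rewrite !msetE2 msetnE eqxx [(m `\ b) `+` _]msetDC msetB1K //.
    have : (0 < m b)%N by rewrite -in_mset.
    by case: (m b) => // k _; rewrite subn1 /= [in LHS]mulrS mulrDl mul1r.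
  have -> : m b = 0%N by apply/eqP; rewrite -[_ == _]negbK -lt0n -in_mset.
  by rewrite mul1r addr0.
rewrite orbF add0r; case: ifP => nm; last by rewrite mulr0.
have -> : (m `\ val n) b = m b by rewrite msetE2 msetnE; case: eqP => [e|_]; [case: nb|rewrite subn0].
congr (_ * F n _); apply/msetP => x; rewrite !msetE2 !msetnE.
have : (0 < m n)%N by rewrite -in_mset.
by case: (x =P n :> nat) => [->|_]; lia.
Qed.

Lemma D_psum b (F : nat -> fps_ring) : (0 < b)%N -> D b (psum F) = F b *+ b + psum (fun n => D b (F n)).
Proof. by move=> b0; rewrite /D fps_deriv_psum b0 mulrnDl -psummulrn. Qed.

Lemma psum_at0 (F : nat -> fps_ring) : psum F mset0 = 0.
Proof. by rewrite /psum big1 // => n /andP[_]; rewrite in_mset0. Qed.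

Lemma psumM (F : nat -> fps_ring) G : psum F * G = psum (fun n => F n * G).
Proof.
apply: (fps_coind (P := fun X Y => exists (F : nat -> fps_ring) G, X = psum F * G /\ Y = psum (fun n => F n * G))).
- move=> _ _ [F1 [G1 [-> ->]]]; by rewrite [LHS]fps_mul0 !psum_at0 mul0r.
- move=> _ _ b [F1 [G1 [-> ->]]].
  rewrite fps_deriv_psum [X in sum_closure _ X]fps_derivM fps_deriv_psum.
  have -> : psum (fun n => fps_deriv b (F1 n * G1)) =
      psum (fun n => (fps_deriv b (F1 n) : fps_ring) * G1) + psum (fun n => F1 n * (fps_deriv b G1 : fps_ring)).
    by rewrite -psumD; apply: eq_psum => n _; exact: fps_derivM.
  set X := (if _ then F1 b else 0); set Y := (if _ then _ else 0).
  have XY : X * G1 = Y by rewrite /X /Y; case: ifP => _ //; rewrite mul0r.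
  change (sum_closure (fun X Y => exists (F : nat -> fps_ring) G, X = psum F * G /\ Y = psum (fun n => F n * G))
    ((X + psum (fun n => fps_deriv b (F1 n))) * G1 + psum F1 * (fps_deriv b G1 : fps_ring))
    (Y + (psum (fun n => (fps_deriv b (F1 n) : fps_ring) * G1) + psum (fun n => F1 n * (fps_deriv b G1 : fps_ring))))).
  rewrite mulrDl XY -addrA; apply: closure_add.
    exact: closure_refl.
  by apply: closure_add; apply: closure_base; eexists; eexists.
- by exists F, G.
Qed.

(** The Euler operator in the variables [p_b], diagonal on monomials with eigenvalue the weight. *)
Definition E F : fps_ring := psum (fun b => D b F).

Lemma EE F m : E F m = (wt m)%:R * F m.
Proof.
rewrite /E (psum_bound _ (ltnSn _)) [in RHS](wtE (ltnSn _)) natr_sum mulr_suml.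
rewrite big_mkcond; apply: eq_bigr => n _; case: ifP => [/andP[n0 nm]|].
  have mn : (0 < m n)%N by rewrite -in_mset.
  rewrite DE [(m `\ _) `+` _]msetDC msetB1K // msetE2 msetnE eqxx.
  by rewrite subn1 prednK.
move/negbT; rewrite negb_and -leqNgt leqn0 => /orP[/eqP ->|]; first by rewrite mul0n mul0r.
by rewrite in_mset -leqNgt leqn0 => /eqP ->; rewrite muln0 mul0r.
Qed.

Lemma E_psum (F : nat -> fps_ring) : E (psum F) = psum (fun n => F n *+ n) + psum (fun n => E (F n)).
Proof.
rewrite -psumD; apply/funext => m; rewrite EE /psum mulr_sumr.
apply: eq_bigr => n /andP[n0 nm]; rewrite fps_addE fps_mulrnE EE.
have e : wt m = (wt (m `\ val n) + n)%N by rewrite -wt_add msetDC msetB1K.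
by rewrite [in LHS](congr1 (fun k => k%:R * _) e) natrD mulrDl addrC mulr_natl.
Qed.

(** Twice the cut-and-join operator, since [i] and [j] run over ordered pairs: p_(i+j) D_i D_j joins
    two cycles and p_i p_j D_(i+j) cuts one. *)
Definition CJ2 F : fps_ring :=
  psum (fun k => \sum_(1 <= i < k) D i (D (k - i) F)) + psum (fun i => psum (fun j => D (i + j) F)).

End Operators.
End Series_2.
Import Series_2.

(** * The series A_k and B_l and their evolution in beta *)

Module Series_3.
Section HeatFlow.
Local Open Scope ring_scope.
Implicit Types (F G H : fps_ring) (m u v : monomial) (b n k l : nat).

Lemma E_D F : E (E F) = psum (fun b => D b F *+ b) + psum (fun b => E (D b F)).
Proof. by rewrite -E_psum. Qed.

Lemma CJ2D F G : CJ2 (F + G) = CJ2 F + CJ2 G.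
Proof.
rewrite /CJ2 [RHS]addrACA; congr (_ + _); rewrite -psumD.
  by apply: eq_psum => k _; rewrite -big_split /=; apply: eq_bigr => i _; rewrite !DD.
by apply: eq_psum => i _; rewrite -psumD; apply: eq_psum => j _; rewrite DD.
Qed.

Lemma CJ20 : CJ2 0 = 0.
Proof. by apply: (addrI (CJ2 0)); rewrite -CJ2D !addr0. Qed.

Lemma CJ2sum (I : Type) (r : seq I) (P : pred I) (X : I -> fps_ring) :
  CJ2 (\sum_(i <- r | P i) X i) = \sum_(i <- r | P i) CJ2 (X i).
Proof. by elim/big_rec2: _ => [|i x y _ <-]; rewrite ?CJ20 // CJ2D. Qed.

Lemma psumMr (F : nat -> fps_ring) G : G * psum F = psum (fun n => G * F n).
Proof. by rewrite mulrC psumM; apply: eq_psum => n _; rewrite mulrC. Qed.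

(* The second order part of the operator is a derivation up to the cross terms. *)
Lemma CJ2M F G : CJ2 (F * G) = CJ2 F * G + F * CJ2 G +
  psum (fun k => \sum_(1 <= i < k) D i F * D (k - i) G) *+ 2.
Proof.
have h1 : psum (fun k => \sum_(1 <= i < k) D i (D (k - i) (F * G))) =
    psum (fun k => \sum_(1 <= i < k) D i (D (k - i) F)) * G +
    F * psum (fun k => \sum_(1 <= i < k) D i (D (k - i) G)) +
    psum (fun k => \sum_(1 <= i < k) D i F * D (k - i) G) *+ 2.
  rewrite psumM psumMr -psumD -psummulrn -psumD; apply: eq_psum => k _.
  rewrite mulr_suml mulr_sumr mulr2n.
  have -> : \sum_(1 <= i < k) D i F * D (k - i) G + \sum_(1 <= i < k) D i F * D (k - i) G =
      \sum_(1 <= i < k) (D i F * D (k - i) G + D (k - i) F * D i G).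
    rewrite big_split /=; congr (_ + _); rewrite big_nat_rev /=.
    apply: eq_big_nat => i /andP[i1 ik]; rewrite add1n subSS; congr (D _ _ * D _ _); lia.
  rewrite -!big_split /=; apply: eq_bigr => i _; rewrite !DM DD !DM; ring.
have h2 : psum (fun i => psum (fun j => D (i + j) (F * G))) =
    psum (fun i => psum (fun j => D (i + j) F)) * G + F * psum (fun i => psum (fun j => D (i + j) G)).
  rewrite psumM psumMr -psumD; apply: eq_psum => i _; rewrite psumM psumMr -psumD.
  by apply: eq_psum => j _; rewrite DM.
rewrite /CJ2 h1 h2; ring.
Qed.

(* The commutator of D b with the cut-and-join operator. *)
Lemma D_CJ2 b F : (0 < b)%N -> D b (CJ2 F) = CJ2 (D b F) +
  (\sum_(1 <= i < b) D i (D (b - i) F)) *+ b + psum (fun j => D (b + j) F) *+ (2 * b).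
Proof.
move=> b0; rewrite /CJ2 DD !(D_psum _ b0).
have -> : psum (fun k => D b (\sum_(1 <= i < k) D i (D (k - i) F))) =
    psum (fun k => \sum_(1 <= i < k) D i (D (k - i) (D b F))).
  apply: eq_psum => k _; rewrite Dsum; apply: eq_bigr => i _.
  by rewrite DC [D b (D (k - i) F)]DC.
have -> : psum (fun i => D b (psum (fun j => D (i + j) F))) =
    psum (fun j => D (b + j) F) *+ b + psum (fun i => psum (fun j => D (i + j) (D b F))).
  rewrite -psummulrn -psumD; apply: eq_psum => i _; rewrite (D_psum _ b0) addnC; congr (_ + _).
  by apply: eq_psum => j _; rewrite DC.
rewrite mul2n -addnn mulrnDr; ring.
Qed.

Section Exponential.
(* Series h with D_b h = e h_(b) where e is a sign: the two cases are the
   generating series of the complete and of the signed elementary symmetric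
   functions. *)
Variables (h : nat -> fps_ring) (e : bool).
Hypothesis Dh : forall b k, (0 < b)%N -> D b (h k) = (-1) ^+ e * h (k + b)%N.

Lemma E_shift k : E (h k) = (-1) ^+ e * psum (fun b => h (k + b)%N).
Proof. by rewrite psumMr; apply: eq_psum => b b0; rewrite Dh. Qed.

(** The [n - 1] joining terms at p_n are all equal to [h (k + n)], and the cutting part is an
    iterated Euler operator up to a correction. On this family the operator is therefore diagonal,
    with eigenvalue plus or minus wt (wt - 1), which permits closed formulas in [beta]. *)
Lemma CJ2_shift k : CJ2 (h k) = (-1) ^+ e * (E (E (h k)) - E (h k)).
Proof.
have s2 : (-1) ^+ e * (-1) ^+ e = 1 :> fps_ring by rewrite -signr_addb addbb.
have h1 : psum (fun n => \sum_(1 <= i < n) D i (D (n - i) (h k))) =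
    psum (fun n => h (k + n)%N *+ n) - psum (fun n => h (k + n)%N).
  rewrite -psumN -psumD; apply: eq_psum => n n0.
  have -> : \sum_(1 <= i < n) D i (D (n - i) (h k)) = \sum_(1 <= i < n) h (k + n)%N.
    apply: eq_big_nat => i /andP[i1 ik].
    have ni : (0 < n - i)%N by rewrite subn_gt0.
    rewrite Dh // (_ : D i ((-1) ^+ e * h (k + (n - i))%N) = (-1) ^+ e * D i (h (k + (n - i))%N)).
      by rewrite Dh // mulrA s2 mul1r; congr h; lia.
    by case: (e); rewrite ?mulN1r ?DN ?mul1r // mulNr mul1r.
  rewrite big_const_nat iter_addr_0; case: n n0 => // n _.
  by rewrite subn1 /= mulrSr addrK.
have h2 : psum (fun i => psum (fun j => D (i + j) (h k))) = (-1) ^+ e * psum (fun i => psum (fun j => h (k + i + j)%N)).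
  rewrite psumMr; apply: eq_psum => i i0; rewrite psumMr; apply: eq_psum => j _.
  by rewrite Dh ?addn_gt0 ?i0 // addnA.
have h3 : psum (fun i => psum (fun j => h (k + i + j)%N)) = E (E (h k)) - (-1) ^+ e * psum (fun n => h (k + n)%N *+ n).
  rewrite E_D; have -> : psum (fun b => D b (h k) *+ b) = (-1) ^+ e * psum (fun n => h (k + n)%N *+ n).
    by rewrite psumMr; apply: eq_psum => b b0; rewrite Dh // mulrnAr.
  rewrite addrAC subrr add0r; apply: eq_psum => i i0.
  have -> : E (D i (h k)) = (-1) ^+ e * E (h (k + i)%N).
    by rewrite Dh //; case: (e); rewrite ?mul1r // !mulN1r; apply/funext => m; rewrite fps_oppE !EE fps_oppE mulrN.
  by rewrite E_shift mulrA s2 mul1r.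
by rewrite /CJ2 h1 h2 h3 mulrBr mulrA s2 mul1r E_shift mulrBr mulrA s2 mul1r; ring.
Qed.
End Exponential.

(* The coefficient of p^m/z_m is 1 when sg = 0 and (-1)^(length of m) when sg = 1;
   z_m is the order of the centralizer of a permutation of cycle type m. *)
Definition inv_z (sg : bool) m : algC :=
  \prod_(n < (wt m).+1 | (0 < n)%N) ((-1) ^+ (sg * m n) / (n ^ m n * (m n)`!)%:R).

Lemma inv_z_bound sg m N : (wt m < N)%N ->
  inv_z sg m = \prod_(n < N | (0 < n)%N) ((-1) ^+ (sg * m n) / (n ^ m n * (m n)`!)%:R).
Proof.
move=> mN; rewrite /inv_z (big_ord_widen_cond _ (fun n => (0 < n)%N) (fun n => (-1) ^+ (sg * m n) / (n ^ m n * (m n)`!)%:R) mN).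
rewrite big_mkcondr /=; apply: eq_bigr => n n0; case: ifP => // /negbT; rewrite -leqNgt => mn.
have -> : m n = 0%N; last by rewrite muln0 expn0 fact0 mul1n expr0 divr1.
apply/eqP; rewrite -leqn0 leqNgt -in_mset; apply/negP => /mem_wt; lia.
Qed.

Lemma inv_z_add sg b m : (0 < b)%N ->
  (b * (m b).+1)%:R * inv_z sg (m `+` [mset b])%mset = (-1) ^+ sg * inv_z sg m.
Proof.
move=> b0; pose N := (wt m + b).+1.
have mN : (wt m < N)%N by rewrite ltnS leq_addr.
have mbN : (wt (m `+` [mset b])%mset < N)%N by rewrite wt_add.
have bN : (b < N)%N by rewrite ltnS leq_addl.
rewrite (inv_z_bound _ mN) (inv_z_bound _ mbN) (bigD1 (Ordinal bN)) //= [in RHS](bigD1 (Ordinal bN)) //=.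
rewrite !mulrA; congr (_ * _); last first.
  apply: eq_bigr => n /andP[_]; rewrite -val_eqE /= => nb.
  by rewrite msetE2 msetnE (negbTE nb) addn0.
rewrite msetE2 msetnE eqxx addn1 [(sg * _)%N]mulnS exprD expnS factS !natrM.
have bz : b%:R != 0 :> algC by rewrite pnatr_eq0 -lt0n.
have z2 : (m b).+1%:R != 0 :> algC by rewrite pnatr_eq0.
have z3 : (b ^ m b)%:R != 0 :> algC by rewrite pnatr_eq0 expn_eq0 negb_and -lt0n b0.
have z4 : ((m b)`!)%:R != 0 :> algC by rewrite pnatr_eq0 -lt0n fact_gt0.
field. by rewrite z4 z3 nat1r z2 bz.
Qed.

Lemma inv_z_beta sg m : inv_z sg (m `+` [mset 0])%mset = inv_z sg m.
Proof.
have e : wt (m `+` [mset 0])%mset = wt m by rewrite wt_add addn0.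
rewrite (inv_z_bound sg (_ : _ < (wt m).+1)%N) ?e // /inv_z; apply: eq_bigr => n n0.
by rewrite msetE2 msetnE (gtn_eqF n0) addn0.
Qed.

Lemma inv_z0 sg : inv_z sg mset0 = 1.
Proof. by rewrite /inv_z big1 // => n _; rewrite mset0E muln0 expr0 expn0 fact0 divr1. Qed.

Definition tri n : algC := (n * n.+1)%:R / 2.

(** The sum over n of the complete symmetric functions h_n times exp (beta tri (n + k - 1)); the
    exponent is the content sum of a row of n + k boxes. *)
Definition Aser k : fps_ring := fun m => tri (wt m + k).-1 ^+ m 0 / ((m 0)`!)%:R * inv_z false m.
(** The signed elementary symmetric functions (-1)^n e_n times exp (- beta tri (n + l)); the
    exponent is the content sum of a column of n + l boxes with contents -1, -2 and so on. *)
Definition Bser l : fps_ring := fun m => (- tri (wt m + l)) ^+ m 0 / ((m 0)`!)%:R * inv_z true m.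

Lemma D_Aser b k : (0 < b)%N -> D b (Aser k) = Aser (k + b)%N.
Proof.
move=> b0; apply/funext => m; rewrite DE /Aser mulrCA inv_z_add // expr0 mul1r wt_add msetE2 msetnE.
by rewrite (ltn_eqF b0) addn0 -addnA [(b + k)%N]addnC.
Qed.

Lemma D_Bser b l : (0 < b)%N -> D b (Bser l) = - Bser (l + b)%N.
Proof.
move=> b0; apply/funext => m; rewrite DE fps_oppE /Bser mulrCA inv_z_add // expr1 mulN1r wt_add msetE2 msetnE.
by rewrite (ltn_eqF b0) addn0 -addnA [(b + l)%N]addnC mulrN.
Qed.

Lemma dbeta_coeff (c : algC) (x : algC) n : n.+1%:R * (x ^+ n.+1 / (n.+1)`!%:R * c) = x * (x ^+ n / n`!%:R * c).
Proof.
have z1 : n.+1%:R != 0 :> algC by rewrite pnatr_eq0.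
have z2 : (n`!)%:R != 0 :> algC by rewrite pnatr_eq0 -lt0n fact_gt0.
rewrite exprS factS natrM; field. by rewrite z2 nat1r z1.
Qed.

(** In weight n all operators are scalars, and the identity is 2 tri (n + k) = n (n - 1) + 2 (k + 1)
    n + k (k + 1). *)
Lemma dbeta_Aser k : dbeta (Aser k.+1) *+ 2 = CJ2 (Aser k.+1) + E (Aser k.+1) *+ (2 * k.+1) + Aser k.+1 *+ (k * k.+1).
Proof.
have Dh b j : (0 < b)%N -> D b (Aser j) = (-1) ^+ false * Aser (j + b)%N by move=> ?; rewrite mul1r D_Aser.
rewrite (CJ2_shift Dh) mul1r; apply/funext => m.
rewrite !fps_addE fps_oppE !fps_mulrnE !EE /dbeta /fps_deriv {1}/Aser wt_add addn0 inv_z_beta.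
rewrite msetE2 msetnE eqxx addn1 dbeta_coeff -/(Aser k.+1 m) addnS /= -(mulr_natl _ 2) -(mulr_natl _ (2 * _)) -(mulr_natl _ (k * _)) /tri !natrM -!natr1 !natrD.
by field.
Qed.

Lemma dbeta_Bser l : dbeta (Bser l) *+ 2 = CJ2 (Bser l) - E (Bser l) *+ (2 * l.+1) - Bser l *+ (l * l.+1).
Proof.
have Dh b j : (0 < b)%N -> D b (Bser j) = (-1) ^+ true * Bser (j + b)%N by move=> ?; rewrite mulN1r D_Bser.
rewrite (CJ2_shift Dh) mulN1r; apply/funext => m.
rewrite !fps_addE !fps_oppE !fps_mulrnE !fps_addE fps_oppE !EE /dbeta /fps_deriv {1}/Bser wt_add addn0 inv_z_beta.
rewrite msetE2 msetnE eqxx addn1 dbeta_coeff -/(Bser l m) -(mulr_natl _ 2) -(mulr_natl _ (2 * _)) -(mulr_natl _ (l * _)) /tri !natrM -!natr1 !natrD.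
by field.
Qed.
End HeatFlow.
End Series_3.
Import Series_3.

(** * Bilinear solution of the cut-and-join equation and the action of row operators *)

Module Series_4.
Section Bilinear.
Local Open Scope ring_scope.
Implicit Types (F G H : fps_ring) (m u v : monomial) (b n k l : nat).

Section Telescoping.
Variables (V : zmodType) (x : nat -> V).

Lemma sum_lower b : \sum_(j < b) x j *+ (b - j) = \sum_(j < b) \sum_(0 <= s < j.+1) x s.
Proof.
elim: b => [|b IH]; first by rewrite !big_ord0.
rewrite [RHS]big_ord_recr -IH /= big_ord_recr /= subSnn mulr1n [in RHS]big_nat_recr //= big_mkord addrA; congr (_ + _).
rewrite -big_split /=; apply: eq_bigr => j _; rewrite subSn ?mulrSr //; exact: ltnW (ltn_ord j).
Qed.

Lemma sum_upper b k : \sum_(j < b) x (j + k)%N *+ j.+1 = \sum_(j < b) \sum_(j + k <= s < b + k) x s.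
Proof.
elim: b => [|b IH]; first by rewrite !big_ord0.
rewrite big_ord_recr /= IH [RHS]big_ord_recr /= addSn big_nat_recr //= big_geq // add0r mulrSr addrA; congr (_ + _).
have h (j : 'I_b) : \sum_(j + k <= s < (b + k).+1) x s = \sum_(j + k <= s < b + k) x s + x (b + k)%N.
  by rewrite big_nat_recr //= leq_add2r; exact: ltnW (ltn_ord j).
by rewrite (eq_bigr _ (fun j _ => h j)) big_split /= sumr_const card_ord.
Qed.

Lemma sum_middle j k : \sum_(1 <= i < k) x (j + (k - i))%N = \sum_(j.+1 <= s < j + k) x s.
Proof.
rewrite big_nat_rev /= -[in RHS]add1n big_addn addKn; apply: eq_big_nat => i /andP[i1 ik].
by congr x; lia.
Qed.

(** For every [j] three consecutive ranges, up to [j], between [j + 1] and [j + k - 1], and from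
    [j + k] on, fill the interval below [b + k] exactly once. *)
Lemma sum_wave b k : (0 < k)%N ->
  \sum_(j < b) (x j *+ (b - j) + x (j + k)%N *+ j.+1 + \sum_(1 <= i < k) x (j + (k - i))%N) =
  (\sum_(s < b + k) x s) *+ b.
Proof.
move=> k0; rewrite !big_split /= sum_lower sum_upper -!big_split /=.
rewrite (eq_bigr (fun=> \sum_(s < b + k) x s)) ?sumr_const ?card_ord // => j _.
rewrite sum_middle addrAC -(big_cat_nat (n := j.+1)) //=; last by lia.
by rewrite -(big_cat_nat (n := (j + k)%N)) //= ?big_mkord //; have := ltn_ord j; lia.
Qed.

Lemma sum_triangle b : \sum_(1 <= i < b) (\sum_(j < b - i) x j - \sum_(j < b - i) x (j + i)%N) =
  \sum_(s < b) (x s *+ (b.-1 - s) - x s *+ s).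
Proof.
rewrite sumrB sumrB; congr (_ - _).
  have -> : \sum_(1 <= i < b) \sum_(j < b - i) x j = \sum_(1 <= i < b) \sum_(j < i) x j.
    by rewrite big_nat_rev /=; apply: eq_big_nat => i /andP[i1 ib]; rewrite (_ : (b - (1 + b - i.+1))%N = i) //; lia.
  elim: b => [|b IH]; first by rewrite big_ord0 big_geq.
  case: b IH => [|b] IH; first by rewrite big_geq // big_ord_recr big_ord0 /= subn0 mulr0n addr0.
  rewrite big_nat_recr //= IH -big_split /= [RHS]big_ord_recr /= subnn mulr0n addr0.
  by apply: eq_bigr => j _; rewrite -mulrSr -subSn // -ltnS.
have -> : \sum_(1 <= i < b) \sum_(j < b - i) x (j + i)%N = \sum_(1 <= i < b) \sum_(i <= s < b) x s.
  apply: eq_big_nat => i /andP[i1 ib]; rewrite -[X in _ = \sum_(X <= _ < _) _]add0n big_addn big_mkord.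
  by apply: eq_bigr => j _; rewrite addnC.
elim: b => [|b IH]; first by rewrite big_ord0 big_geq.
rewrite big_ord_recr /= -IH; case: b {IH} => [|b]; first by rewrite !big_geq // mulr0n addr0.
rewrite big_nat_recr //= big_nat1 (eq_big_nat _ _ (F2 := fun i => \sum_(i <= s < b.+1) x s + x b.+1)); last first.
  by move=> i /andP[i1 ib]; rewrite big_nat_recr //= ltnW.
by rewrite big_split /= sumr_const_nat subn1 /= -addrA -mulrSr.
Qed.

Lemma sum_telescope b : \sum_(j < b) (x j - x j.+1) = x 0%N - x b.
Proof.
elim: b => [|b IH]; first by rewrite big_ord0 subrr.
by rewrite big_ord_recr /= IH addrA subrK.
Qed.
End Telescoping.

Lemma fps_mulrnI k F G : (0 < k)%N -> F *+ k = G *+ k -> F = G.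
Proof.
move=> k0 e; apply/funext => m; have := congr1 (fun f : fps => f m) e; rewrite !fps_mulrnE.
by move/eqP; rewrite (eqr_pMn2r k0) => /eqP.
Qed.

Definition Yser b : fps_ring := \sum_(j < b) Aser (b - j) * Bser j.

(** The system that the derivatives of a solution of the cut-and-join equation satisfy: apply [D b]
    to the equation and use the commutator [D_CJ2]. It is stated for any family, so that solutions
    can be compared. *)
Definition wave (U : nat -> fps_ring) := forall b, (0 < b)%N ->
  dbeta (U b) *+ 2 = CJ2 (U b) + (\sum_(1 <= i < b) D i (U (b - i)%N)) *+ b +
    psum (fun j => U (b + j)%N) *+ (2 * b).

Lemma E_Aser k : E (Aser k) = psum (fun n => Aser (k + n)).
Proof. by apply: eq_psum => n n0; rewrite D_Aser. Qed.

Lemma E_Bser k : E (Bser k) = - psum (fun n => Bser (k + n)).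
Proof. by rewrite -psumN; apply: eq_psum => n n0; rewrite D_Bser. Qed.

Lemma wave_identity (V : comNzRingType) (A B cA cB X Q P : V) (a1 j1 p q : nat) :
  (cA + X *+ (2 * a1) + A *+ p) * B + A * (cB - - Q *+ (2 * j1) - B *+ q) =
  cA * B + A * cB + - P *+ 2 + (X * B *+ a1 + A * Q *+ j1 + P) *+ 2 + (A * B *+ p - A * B *+ q).
Proof. by ring. Qed.

Lemma dbeta_AB a j : (0 < a)%N -> dbeta (Aser a * Bser j) *+ 2 = CJ2 (Aser a * Bser j) +
  psum (fun k => Aser (a + k) * Bser j *+ a + Aser a * Bser (j + k) *+ j.+1 +
     \sum_(1 <= i < k) Aser (a + i) * Bser (j + (k - i))) *+ 2 +
  (Aser a * Bser j *+ (a.-1 * a) - Aser a * Bser j *+ (j * j.+1)).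
Proof.
case: a => // a _; rewrite dbetaM mulrnDl -[dbeta (Aser _) * _ *+ 2]mulrnAl -[_ * dbeta _ *+ 2]mulrnAr dbeta_Aser dbeta_Bser CJ2M E_Aser E_Bser /=.
have -> : psum (fun k => \sum_(1 <= i < k) D i (Aser a.+1) * D (k - i) (Bser j)) =
    - psum (fun k => \sum_(1 <= i < k) Aser (a.+1 + i) * Bser (j + (k - i))).
  rewrite -psumN; apply: eq_psum => k _; rewrite -sumrN; apply: eq_big_nat => i /andP[i1 ik].
  by rewrite D_Aser // D_Bser ?subn_gt0 // mulrN.
have -> : psum (fun k => Aser (a.+1 + k) * Bser j *+ a.+1 + Aser a.+1 * Bser (j + k) *+ j.+1 +
     \sum_(1 <= i < k) Aser (a.+1 + i) * Bser (j + (k - i))) =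
   psum (fun k => Aser (a.+1 + k)) * Bser j *+ a.+1 + Aser a.+1 * psum (fun k => Bser (j + k)) *+ j.+1 +
   psum (fun k => \sum_(1 <= i < k) Aser (a.+1 + i) * Bser (j + (k - i))).
  by rewrite !psumD !psummulrn -psumM -psumMr.
set P := psum (fun k => \sum_(1 <= i < k) _); set X := psum _; set Q := psum _.
exact: wave_identity.
Qed.

Lemma wave_coefficient p j : (j < p)%N ->
  ((p.-1 - j) * p + j * j.+1 = (p - j).-1 * (p - j) + j * p)%N.
Proof.
case: p => // p; rewrite ltnS => jp; have [c ->] : exists c, p = (c + j)%N by exists (p - j)%N; rewrite subnK.
by rewrite subSn ?leq_addl // addnK /=; ring.
Qed.

(** The terms outside any [psum] balance by [sum_triangle] and [wave_coefficient]; those under a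
    [psum] balance by [sum_wave]. *)
Lemma Yser_wave : wave Yser.
Proof.
move=> b b0; rewrite /Yser dbetasum -sumrMnl.
have hAB (j : 'I_b) := @dbeta_AB (b - j) j (etrans (subn_gt0 _ _) (ltn_ord j)).
rewrite (eq_bigr _ (fun j _ => hAB j)).
rewrite big_split big_split /= -CJ2sum -[LHS]addrA -[RHS]addrA; congr (_ + _); rewrite [LHS]addrC; congr (_ + _).
  have -> : \sum_(1 <= i < b) D i (\sum_(j < b - i) Aser (b - i - j) * Bser j) =
      \sum_(s < b) (Aser (b - s) * Bser s *+ (b.-1 - s) - Aser (b - s) * Bser s *+ s).
    rewrite -(sum_triangle (fun s => Aser (b - s) * Bser s)); apply: eq_big_nat => i /andP[i1 ib].
    rewrite Dsum -sumrB; apply: eq_bigr => j _; have jb := ltn_ord j.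
    rewrite DM D_Aser // D_Bser // mulrN; congr (Aser _ * _ - Aser _ * _); lia.
  rewrite -sumrMnl /=; apply: eq_bigr => j _; have jb := ltn_ord j.
  set x := Aser _ * _; rewrite mulrnBl -!mulrnA.
  apply/eqP; rewrite subr_eq addrAC eq_sym subr_eq -!mulrnDr; apply/eqP; congr (_ *+ _).
  exact: wave_coefficient.
rewrite sumrMnl mulnC mulrnA; congr (_ *+ 2); rewrite -psummulrn -psumsum; apply: eq_psum => k k0.
rewrite -(sum_wave (fun s => Aser (b + k - s) * Bser s) b k0); apply: eq_bigr => j _.
have jb := ltn_ord j.
have e1 : (b - j + k = b + k - j)%N by lia.
have e2 : (b + k - (j + k) = b - j)%N by lia.
rewrite e1 e2; congr (_ + _); apply: eq_big_nat => i /andP[i1 ik]; congr (Aser _ * _); lia.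
Qed.

(** The operators on the right preserve the exponent of [beta], so the coefficients at exponent r
    determine those at r + 1. *)
Lemma wave_unique (U V : nat -> fps_ring) : wave U -> wave V ->
  (forall b m, (0 < b)%N -> m 0 = 0%N -> U b m = V b m) -> forall b, (0 < b)%N -> U b = V b.
Proof.
move=> wU wV h0 b b0; apply/funext => m.
have [r] : exists r, m 0 = r by exists (m 0).
elim: r b b0 m => [|r IH] b b0 m mr; first exact: h0.
pose agree (F G : fps_ring) := forall m, m 0 = r -> F m = G m.
have aD i F G : (0 < i)%N -> agree F G -> agree (D i F) (D i G).
  move=> i0 FG u ur; rewrite !DE FG // msetE2 msetnE (ltn_eqF i0) addn0 //.
have aS (F G : nat -> fps_ring) : (forall n, (0 < n)%N -> agree (F n) (G n)) -> agree (psum F) (psum G).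
  move=> FG u ur; apply: eq_bigr => n /andP[n0 nu]; apply: FG => //.
  by rewrite msetE2 msetnE (ltn_eqF n0) subn0.
have aadd F G F' G' : agree F G -> agree F' G' -> agree (F + F') (G + G').
  by move=> h1 h2 u ur; rewrite !fps_addE h1 // h2.
have amul F G k : agree F G -> agree (F *+ k) (G *+ k) by move=> h u ur; rewrite !fps_mulrnE h.
have asum lo hi (F G : nat -> fps_ring) : (forall i, (lo <= i < hi)%N -> agree (F i) (G i)) ->
    agree (\sum_(lo <= i < hi) F i) (\sum_(lo <= i < hi) G i).
  by move=> h u ur; rewrite !fps_sumE; apply: eq_big_nat => i hi'; exact: h.
have aUV k : (0 < k)%N -> agree (U k) (V k) by move=> k0 u ur; exact: IH.
have key : agree (dbeta (U b) *+ 2) (dbeta (V b) *+ 2).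
  rewrite wU // wV //; apply: (aadd); last by apply: (amul); apply: (aS) => n n0; apply: aUV; rewrite addn_gt0 b0.
  apply: (aadd); last first.
    apply: (amul); apply: (asum) => i /andP[i1 ib]; apply: (aD) => //; apply: aUV; by rewrite subn_gt0.
  apply: (aadd); apply: (aS) => n n0.
    by apply: (asum) => i /andP[i1 ik]; apply: (aD) => //; apply: (aD); [rewrite subn_gt0|exact: aUV].
  by apply: (aS) => j j0; apply: (aD); [rewrite addn_gt0 n0|exact: aUV].
have m0 : (0 \in m)%mset by rewrite in_mset mr.
have := key (m `\ 0)%mset; rewrite msetE2 msetnE eqxx mr subn1 /= => /(_ erefl).
rewrite !fps_mulrnE => /eqP; rewrite eqr_pMn2r // => /eqP; rewrite /dbeta /fps_deriv => /(mulfI _).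
by rewrite [(_ `+` _)%mset]msetDC msetB1K //; apply; rewrite pnatr_eq0.
Qed.

(** At [beta = 0] the two series are the generating series of h_n and of (-1)^n e_n for all [a] and
    [j], and these are inverse to each other. In the proof the two terms of each derivative cancel
    by induction. *)
Lemma AB_beta0 a j m : m 0 = 0%N -> (Aser a * Bser j) m = (m == mset0)%:R.
Proof.
elim/mset_ind: m a j => [|b m IH] a j.
  by move=> _; rewrite [LHS]fps_mul0 /Aser /Bser !mset0E !expr0 fact0 !inv_z0 eqxx divr1 !mul1r.
rewrite msetE2 msetnE => e; have b0 : (0 < b)%N by rewrite lt0n; apply: contraPneq e => ->.
have m0 : m 0 = 0%N by lia.
have -> : ((b +` m)%mset == mset0) = false.
  by apply/negbTE/eqP => /msetP/(_ b); rewrite msetE2 msetnE eqxx mset0E.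
have : D b (Aser a * Bser j) m = 0.
  by rewrite DM D_Aser // D_Bser // mulrN fps_addE fps_oppE !IH // subrr.
rewrite DE msetDC => /eqP; rewrite mulf_eq0 pnatr_eq0 muln_eq0 (gtn_eqF b0) /= => /eqP ->.
by [].
Qed.

Section Solution.
Variable Z : fps_ring.
Hypotheses (ZCJ : dbeta Z *+ 2 = CJ2 Z) (Z0 : forall b m, (0 < b)%N -> m 0 = 0%N -> Z (m `+` [mset b])%mset = (m == mset0)%:R).

Lemma D_solution b : (0 < b)%N -> D b Z = Yser b.
Proof.
apply: (@wave_unique (fun b => D b Z) Yser); last first.
- move=> {}b m b0 m0; rewrite DE Z0 // /Yser fps_sumE.
  rewrite (eq_bigr (fun=> (m == mset0)%:R)) => [|j _]; last exact: AB_beta0.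
  rewrite sumr_const card_ord; case: eqP => [->|_]; last by rewrite mulr0 mul0rn.
  by rewrite mset0E muln1 mulr1.
- exact: Yser_wave.
- by move=> {}b b0; rewrite dbeta_D -Dmulrn ZCJ D_CJ2.
Qed.

(** [S k] abstracts the row operator [Dop [:: k]] to additivity, its value at 0 and Newton's
    identity, the recursion that defines complete symmetric functions from power sums. *)
Variable S : nat -> fps_ring -> fps_ring.
Hypotheses (SD : forall k F G, S k (F + G) = S k F + S k G) (S0 : forall F, S 0 F = F).
Hypothesis newton : forall k F, S k F *+ k = \sum_(b < k) S (k - b.+1) (D b.+1 F).

Lemma S_zero k : S k 0 = 0.
Proof. by apply: (addrI (S k 0)); rewrite -SD !addr0. Qed.
Lemma S_opp k F : S k (- F) = - S k F.
Proof. by apply: (addrI (S k F)); rewrite -SD !subrr S_zero. Qed.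
Lemma S_sum k (I : Type) (r : seq I) (P : pred I) (X : I -> fps_ring) :
  S k (\sum_(i <- r | P i) X i) = \sum_(i <- r | P i) S k (X i).
Proof. by elim/big_rec2: _ => [|i x y _ <-]; rewrite ?S_zero // SD. Qed.

(** The generating series of the [S k] is the exponential of the sum of t^b D_b / b, hence
    multiplicative. On A it acts as 1 / (1 - t shift), on B as 1 - t shift, and the product has two
    terms in each degree. *)
Lemma S_AB k a l : S k.+1 (Aser a * Bser l) = Aser (a + k.+1) * Bser l - Aser (a + k) * Bser l.+1.
Proof.
elim/ltn_ind: k a l => k IH a l; apply: (@fps_mulrnI k.+1) => //; rewrite newton.
pose x s := Aser (a + k.+1 - s) * Bser (l + s).
have h (b : 'I_k) : S (k.+1 - b.+1) (D b.+1 (Aser a * Bser l)) = (x 0%N - x 1%N) - (x b.+1 - x b.+2).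
  have bk := ltn_ord b; have kb : (k.+1 - b.+1 = (k - b.+1).+1)%N by lia.
  have kb' : (k - b.+1 < k)%N by lia.
  rewrite DM D_Aser // D_Bser // mulrN kb SD S_opp !IH // /x addn0 addn1 !addnS !subn0 !subSS.
  have e1 : ((a + b).+1 + (k - b.+1) = a + k)%N by lia.
  have e2 : ((a + (k - b.+1)).+1 = a + k - b)%N by lia.
  have e3 : (a + (k - b.+1) = a + k - b.+1)%N by lia.
  by rewrite e1 e2 e3 subn0.
rewrite big_ord_recr /= subnn !S0 (eq_bigr (fun b : 'I_k => (x 0%N - x 1%N) - (x b.+1 - x b.+2))) => [|b _]; last exact: h.
rewrite sumrB sumr_const card_ord.
have -> : \sum_(b < k) (x b.+1 - x b.+2) = x 1%N - x k.+1.
  exact: (sum_telescope (fun s => x s.+1)).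
have -> : D k.+1 (Aser a * Bser l) = x 0%N - x k.+1.
  by rewrite DM D_Aser // D_Bser // mulrN /x subn0 addn0 addnK.
have -> : Aser (a + k.+1) * Bser l - Aser (a + k) * Bser l.+1 = x 0%N - x 1%N.
  by rewrite /x subn0 addn0 addn1 addnS subSS subn0.
by rewrite mulrSr; ring.
Qed.

Lemma S_Yser k b : (0 < b)%N -> S k.+1 (Yser b) = Aser (b + k.+1) * Bser 0 - Aser k.+1 * Bser b.
Proof.
move=> b0; rewrite /Yser S_sum.
pose x s := Aser (b + k.+1 - s) * Bser s.
rewrite (eq_bigr (fun j : 'I_b => x j - x j.+1)) => [|j _].
  by rewrite sum_telescope /x subn0 addKn.
have jb := ltn_ord j; rewrite S_AB /x.
have e1 : (b - j + k.+1 = b + k.+1 - j)%N by lia.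
have e2 : (b - j + k = b + k.+1 - j.+1)%N by lia.
by rewrite e1 e2.
Qed.

Lemma S_solution k : S k.+1 Z = Aser k.+1 * Bser 0.
Proof.
apply: (@fps_mulrnI k.+1) => //; rewrite newton big_ord_recr /= subnn S0 D_solution //.
pose x s := Aser (k.+1 - s) * Bser s.
rewrite (eq_bigr (fun b : 'I_k => x 0%N - x b.+1)) => [|b _]; last first.
  have bk := ltn_ord b; have kb : (k.+1 - b.+1 = (k - b.+1).+1)%N by lia.
  rewrite D_solution // kb S_Yser // /x subn0.
  have e1 : (b.+1 + (k - b.+1).+1 = k.+1)%N by lia.
  by rewrite e1 -kb.
rewrite sumrB sumr_const card_ord /Yser big_ord_recl /= -/(x 0%N) -/(\sum_(i < k) x i.+1).
by rewrite /x subn0 mulrSr; ring.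
Qed.

Lemma S_two_rows i j : (2 <= i)%N -> S j.+1 (S i Z) - S j.+2 (S (i - 1) Z) = 0.
Proof.
case: i => [|[|i]] // _; rewrite subn1 /= !S_solution !S_AB.
have -> : (i.+2 + j.+1 = i.+1 + j.+2)%N by lia.
have -> : (i.+2 + j = i.+1 + j.+1)%N by lia.
by rewrite subrr.
Qed.

Lemma S_hook j : S j.+1 (S 1 Z) - S j.+2 Z = - (Aser j.+1 * Bser 1).
Proof. by rewrite !S_solution S_AB add1n addrAC subrr sub0r addnC addn1. Qed.
End Solution.
End Bilinear.
End Series_4.
Import Series_4.

(** * Sums over partitions, Newton's identities and pairs of rows *)

Module Row_operators.
Section CardAut.
Local Open Scope nat_scope.

Lemma fix0_perm n (s : 'S_n.+1) : s ord0 = ord0 -> exists s', s = lift_perm ord0 ord0 s'.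
Proof.
move=> s0; have nz k : s (lift ord0 k) != ord0.
  by rewrite -[X in _ != X]s0 (inj_eq perm_inj) eq_sym neq_lift.
pose f k := odflt k (unlift ord0 (s (lift ord0 k))).
have fE k : lift ord0 (f k) = s (lift ord0 k).
  by rewrite /f; case: unliftP => [j -> //|e]; have := nz k; rewrite e eqxx.
have fI : injective f by move=> k k' e; apply/(@lift_inj _ ord0)/(@perm_inj _ s); rewrite -!fE e.
exists (perm fI); apply/permP => k; case: (unliftP ord0 k) => [j ->|->].
  by rewrite lift_perm_lift permE fE.
by rewrite lift_perm_id.
Qed.

(** Automorphisms are sorted by the image of the first position, which must hold the value [b]; each
    possible image accounts for a translate of the stabiliser of that position. *)
Lemma card_Aut_cons b mu : card_Aut (b :: mu) = ((count_mem b mu).+1 * card_Aut mu)%N.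
Proof.
pose la := b :: mu; pose n := size mu.
pose A := [set s : 'S_n.+1 | [forall k, nth 0 la (s k) == nth 0 la k]]%SET.
have AP (s : 'S_n.+1) : reflect (forall k : 'I_n.+1, nth 0 la (s k) = nth 0 la k) (s \in A).
  by rewrite inE; apply: (iffP forallP) => h k; [apply/eqP|apply/eqP].
have A0 : #|[set s in A | s ord0 == ord0]%SET| = card_Aut mu.
  have lI : injective (@lift_perm n ord0 ord0).
    move=> s s' e; apply/permP => k; apply: (@lift_inj _ ord0).
    by have := congr1 (fun t : 'S_n.+1 => t (lift ord0 k)) e; rewrite !lift_perm_lift.
  rewrite /card_Aut -[RHS](card_imset _ lI).
  apply: eq_card => s; rewrite inE; apply/andP/imsetP => [[/AP sA /eqP/fix0_perm[s' e]]|[s']].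
    exists s' => //; rewrite inE; apply/forallP => k; apply/eqP.
    by have := sA (lift ord0 k); rewrite e lift_perm_lift.
  rewrite inE => /forallP h ->; split; last by rewrite lift_perm_id.
  apply/AP => k; case: (unliftP ord0 k) => [j ->|->]; last by rewrite lift_perm_id.
  by rewrite lift_perm_lift /= (eqP (h j)).
have Aj j : #|[set s in A | s ord0 == j]%SET| = if nth 0 la j == b then card_Aut mu else 0.
  case: eqP => [jb|jb]; last first.
    apply/eqP; rewrite -leqn0 leqNgt; apply/negP => /card_gt0P[s]; rewrite inE => /andP[/AP h /eqP e].
    by apply: jb; have := h ord0; rewrite e.
  have tA s : s \in A -> (s * tperm ord0 j)%g \in A.
    move=> /AP h; apply/AP => k; rewrite permM -(h k); by case: tpermP => [e|e|//]; rewrite e jb.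
  rewrite -A0 -(card_imset _ (mulIg (tperm ord0 j))); apply: eq_card => s; apply/imsetP/idP.
    move=> [s']; rewrite inE => /andP[sA /eqP e] ->.
    by rewrite inE tA //= permM e tpermR.
  rewrite inE => /andP[sA /eqP e]; exists (s * tperm ord0 j)%g; last by rewrite -mulgA tperm2 mulg1.
  by rewrite inE tA //= permM e tpermL.
have -> : card_Aut (b :: mu) = #|A| by [].
rewrite -sum1_card (partition_big (fun s : 'S_n.+1 => s ord0) xpredT) //=.
rewrite (eq_bigr (fun j : 'I_n.+1 => if nth 0 la j == b then card_Aut mu else 0)) => [|j _]; last first.
  by rewrite -Aj -sum1_card; apply: eq_bigl => s; rewrite !inE.
rewrite -big_mkcond /= sum_nat_const; congr (_ * _).
have -> : (count_mem b mu).+1 = count_mem b la by rewrite /= eqxx.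
by rewrite -sum1_card -sum1_count (big_nth 0) big_mkord; apply: eq_bigl => j.
Qed.

Lemma card_Aut_prod N la : all (fun x => x < N) la -> card_Aut la = \prod_(x < N) (count_mem (x : nat) la)`!.
Proof.
elim: la => [|b mu IH] /=.
  move=> _; rewrite big1 // /card_Aut (_ : [set s : 'S_0 | _]%SET = [set 1%g]%SET) ?cards1 //.
  by apply/setP => s; rewrite !inE; apply/forallP/eqP => [_|_ []//]; apply/permP => -[].
move=> /andP[bN mN]; rewrite card_Aut_cons IH // (bigD1 (Ordinal bN)) //= [in RHS](bigD1 (Ordinal bN)) //=.
rewrite eqxx add1n factS mulnA; congr (_ * _); apply: eq_bigr => x; rewrite -val_eqE /= => xb.
by rewrite eq_sym (negbTE xb).
Qed.

Lemma card_Aut_perm la mu : perm_eq la mu -> card_Aut la = card_Aut mu.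
Proof.
move=> p; pose N := (sumn la).+1.
have le (s : seq nat) : all (fun x => x < (sumn s).+1) s.
  elim: s => //= x s /allP h; rewrite ltnS leq_addr /=; apply/allP => y /h; rewrite !ltnS => ys.
  exact: leq_trans ys (leq_addl _ _).
rewrite (card_Aut_prod (le la)) (@card_Aut_prod N mu); last by rewrite -(perm_all _ p); exact: le.
by apply: eq_bigr => x _; rewrite (seq.permP p).
Qed.

Lemma card_Aut_gt0 la : 0 < card_Aut la.
Proof. by apply/card_gt0P; exists 1%g; rewrite inE; apply/forallP => k; rewrite perm1. Qed.
End CardAut.

Section Partitions.
Local Open Scope ring_scope.

Definition part_set k : set (seq nat) := [set la | is_part la && (sumn la == k)]%classic.

Lemma is_part_cons b la : is_part (b :: la) -> is_part la /\ (0 < b)%N.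
Proof.
rewrite /is_part inE negb_or => /andP[so /andP[b0 l0]]; split; last by rewrite lt0n eq_sym.
by rewrite l0 andbT; exact: path_sorted so.
Qed.

Lemma part_set_finite k : finite_set (part_set k).
Proof.
elim/ltn_ind: k => k IH.
have sub : (part_set k `<=` [set [::]] `|` \bigcup_(b in `I_k.+1 `&` [set b | (0 < b)%N]) (cons b @` part_set (k - b)%N))%classic.
  move=> [|b la] /=; first by left.
  move=> /andP[/is_part_cons[pl b0] /eqP s]; right; exists b => /=; first by split=> //; rewrite ltnS -s leq_addr.
  by exists la => //; rewrite /part_set /= pl -s addKn eqxx.
apply: (sub_finite_set sub); rewrite finite_setU; split; first exact: finite_set1.
apply: bigcup_finite; first exact/finite_setIl/finite_II.
move=> b [/= bk b0]; apply/finite_image/IH; move: bk b0; rewrite /=; lia.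
Qed.

Lemma derivs_cat s1 b s2 (F : fps) : fps_derivs (s1 ++ b :: s2) F = fps_deriv b (fps_derivs (s1 ++ s2) F).
Proof. by elim: s1 => //= x s1 ->; rewrite fps_derivC. Qed.

Lemma derivs_perm la mu (F : fps) : perm_eq la mu -> fps_derivs la F = fps_derivs mu F.
Proof.
elim: la mu => [|b la IH] mu p; first by move: p; rewrite perm_sym => /perm_nilP ->.
have bm : b \in mu by rewrite -(perm_mem p) mem_head.
move: p; case/splitPr: bm => p1 p2 p; rewrite derivs_cat /=; congr fps_deriv; apply: IH.
by move: p; rewrite -[b :: p2]cat1s perm_sym perm_catCA /= perm_cons perm_sym.
Qed.

Lemma derivs_deriv la b (F : fps) : fps_derivs la (fps_deriv b F) = fps_deriv b (fps_derivs la F).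
Proof. by elim: la => //= x la ->; rewrite fps_derivC. Qed.

Definition dsum (f : seq nat -> algC) k (F : fps_ring) : fps_ring := fun m =>
  \sum_(la \in part_set k) f la * (fps_derivs la F m / (card_Aut la)%:R).

Lemma Dop_dsum mu F : Dop mu F = dsum (chi mu) (sumn mu) F. Proof. by []. Qed.

Lemma dsumE f k F m : dsum f k F m = \sum_(la <- fset_set (part_set k)) f la * (fps_derivs la F m / (card_Aut la)%:R).
Proof. by rewrite /dsum fsbig_finite //; exact: part_set_finite. Qed.

Lemma mem_part_set k la : (la \in fset_set (part_set k)) = (is_part la && (sumn la == k)).
Proof.
by rewrite in_fset_set; [apply/idP/idP => [/set_mem|h]; [|exact: mem_set]|exact: part_set_finite].
Qed.

Lemma dsum_eq f g k F : (forall la, is_part la -> sumn la = k -> f la = g la) -> dsum f k F = dsum g k F.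
Proof.
move=> h; apply/funext => m; rewrite !dsumE; apply: eq_big_seq => la.
by rewrite mem_part_set => /andP[pl /eqP s]; rewrite h.
Qed.

Lemma derivs_add la (F G : fps) : fps_derivs la (F + G) = fps_derivs la F + fps_derivs la G.
Proof. by elim: la => //= b la ->; rewrite fps_derivD. Qed.

Lemma derivs_mulrn la F n : fps_derivs la (F *+ n) = (fps_derivs la F : fps_ring) *+ n.
Proof.
elim: n => [|n IH]; last by rewrite !mulrS -IH -derivs_add.
by rewrite !mulr0n; elim: la => //= b la ->; exact: fps_deriv0.
Qed.

Lemma dsumD f k F G : dsum f k (F + G) = dsum f k F + dsum f k G.
Proof.
apply/funext => m; rewrite fps_addE !dsumE -big_split; apply: eq_bigr => la _.
by rewrite derivs_add /= mulrDl mulrDr.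
Qed.

Lemma dsum0 f F : dsum f 0 F = (fun m => f [::] * F m).
Proof.
apply/funext => m; rewrite /dsum (_ : part_set 0 = [set [::]]%classic) ?fsbig_set1 /=.
  by rewrite (@card_Aut_prod 0 [::]) // big_ord0 divr1.
apply/seteqP; split=> [[|b la] //= /andP[/is_part_cons[_ b0]]|_ -> //=].
by rewrite addn_eq0 (gtn_eqF b0).
Qed.

Lemma is_part_sort b mu : (0 < b)%N -> is_part mu -> is_part (sort geq (b :: mu)).
Proof.
move=> b0 /andP[_ m0]; rewrite /is_part sort_sorted ?mem_sort ?inE ?negb_or ?m0 ?(ltn_eqF b0) //.
Qed.

Lemma geq_trans' : transitive geq. Proof. by move=> x y z h1 h2; exact: leq_trans h2 h1. Qed.
Lemma geq_anti : antisymmetric geq. Proof. by move=> x y; rewrite /geq /= => h; apply/eqP; rewrite eqn_leq andbC. Qed.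

(* Euler's identity for the differential operators Sum f(la) d_la / |Aut la|. *)
Lemma dsum_euler (f : seq nat -> algC) k F :
  (forall la mu, perm_eq la mu -> f la = f mu) ->
  dsum f k F *+ k = \sum_(b < k) dsum (fun mu => f (b.+1 :: mu)) (k - b.+1)%N (D b.+1 F).
Proof.
move=> fp; apply/funext => m; rewrite fps_mulrnE fps_sumE dsumE -mulr_natl mulr_sumr.
(* The size [k] of a partition is the sum over the part sizes of size times multiplicity. *)
transitivity (\sum_(la <- fset_set (part_set k)) \sum_(b < k)
    (b.+1 * count_mem b.+1 la)%:R * (f la * (fps_derivs la F m / (card_Aut la)%:R))).
  apply: eq_big_seq => la; rewrite mem_part_set => /andP[/andP[_ l0] /eqP s].
  rewrite -mulr_suml -natr_sum; congr (_%:R * _).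
  have lk : all (fun x => x <= k)%N la.
    rewrite -s; elim: (la) => //= x l /allP h; rewrite leq_addr /=; apply/allP => y /h yl.
    exact: leq_trans yl (leq_addl _ _).
  rewrite -{1}s; elim: la {s} l0 lk => [|x la IH] /=; first by rewrite big1 // => b _; rewrite muln0.
  rewrite inE negb_or => /andP[x0 l0] /andP[xk lk]; rewrite IH //.
  under [RHS]eq_bigr => b _ do rewrite mulnDr.
  rewrite [RHS]big_split /=; congr (_ + _)%N; case: x x0 xk => // x _ xk.
  rewrite (bigD1 (Ordinal xk)) //= eqxx muln1 big1 ?addn0 // => b.
  by rewrite -val_eqE /= => bx; rewrite eqSS eq_sym (negbTE bx) muln0.
rewrite exchange_big /=; apply: eq_bigr => b _.
(* Partitions without the part [b.+1] contribute nothing; the others are obtained by inserting it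
   into a unique smaller partition. *)
pose h mu := sort geq (b.+1 :: mu).
pose Q := (h @` part_set (k - b.+1)%N)%classic.
have bk := ltn_ord b.
have hp mu : perm_eq (h mu) (b.+1 :: mu) by rewrite perm_sort.
have QP : (Q `<=` part_set k)%classic.
  move=> _ [mu /andP[pm /eqP sm] <-]; rewrite /part_set /= is_part_sort //=.
  by rewrite (sumn_perm (hp mu)) /= sm; apply/eqP; lia.
pose t la := (b.+1 * count_mem b.+1 la)%:R * (f la * (fps_derivs la F m / (card_Aut la)%:R)).
rewrite -[LHS](@fsbig_finite _ _ _ _ (part_set k) t); last exact: part_set_finite.
rewrite -(@fsbig_widen _ _ _ _ Q) //; last first.
  move=> la [/andP[pl /eqP sl] nQ]; rewrite /t /= (_ : count_mem b.+1 la = 0%N) ?muln0 ?mul0r //.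
  apply/count_memPn/negP => bl; apply: nQ; exists (rem b.+1 la).
    have p := perm_to_rem bl; have := sumn_perm p; rewrite /= sl => e.
    rewrite /part_set /= (_ : sumn _ == _); last by apply/eqP; lia.
    move: pl => /andP[so l0]; rewrite andbT /is_part (subseq_sorted geq_trans' (rem_subseq _ _) so) /=.
    by apply: contra l0; exact: mem_rem.
  apply: (sorted_eq geq_trans' geq_anti); first by apply: sort_sorted => x y; exact: leq_total.
    by case/andP: pl.
  by apply: perm_trans (hp _) _; rewrite perm_sym perm_to_rem.
rewrite (@reindex_fsbig _ _ _ _ _ h (part_set (k - b.+1)%N)); last first.
  split=> //; first by move=> mu pm; exists mu.
  move=> mu nu /set_mem/andP[/andP[sm _] _] /set_mem/andP[/andP[sn _] _] e.
  apply: (sorted_eq geq_trans' geq_anti) => //.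
  by rewrite -(perm_cons b.+1) -(permPl (hp mu)) e hp.
rewrite /dsum; apply: eq_fsbigr => mu _; rewrite /t (fp _ _ (hp mu)) (derivs_perm _ (hp mu)) (card_Aut_perm (hp mu)).
rewrite card_Aut_cons (seq.permP (hp mu)) /= eqxx add1n.
rewrite /D derivs_mulrn (derivs_deriv mu) fps_mulrnE -(mulr_natl (fps_deriv _ _ m)) !natrM.
have z1 : (count_mem b.+1 mu).+1%:R != 0 :> algC by rewrite pnatr_eq0.
have z2 : (card_Aut mu)%:R != 0 :> algC by rewrite pnatr_eq0 -lt0n card_Aut_gt0.
move: (fps_deriv _ _ m) (f _) z1 z2; move: (count_mem _ _).+1%:R (card_Aut _)%:R b.+1%:R => x y z u v z1 z2.
by field; rewrite z1 z2.
Qed.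

Section TwoRows.
(** Counts the choices of positions in [la] whose entries add up to [i]. On a cycle type this is the
    number of invariant subsets of size [i]. *)
Fixpoint subsums (i : nat) (la : seq nat) : nat :=
  if la is b :: mu then (subsums i mu + (if b <= i then subsums (i - b) mu else 0))%N else (i == 0)%N.

Lemma subsums_catC i s1 b s2 : subsums i (s1 ++ b :: s2) = subsums i (b :: s1 ++ s2).
Proof.
elim: s1 i => //= x s1 IH i; rewrite !IH /= -!addnA; congr (_ + _)%N.
case: (leqP x i) => xi; case: (leqP b i) => bi; rewrite ?addn0 ?IH //=.
- rewrite addnCA; congr (_ + _)%N; congr (_ + _)%N; rewrite subnAC.
  by rewrite (_ : (b <= i - x)%N = (x <= i - b)%N) //; lia.
- by rewrite (_ : (b <= i - x)%N = false) ?addn0 //; lia.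
- by rewrite (_ : (x <= i - b)%N = false) ?addn0 //; lia.
Qed.

Lemma subsums_perm i la mu : perm_eq la mu -> subsums i la = subsums i mu.
Proof.
elim: la mu i => [|b la IH] mu i p; first by move: p; rewrite perm_sym => /perm_nilP ->.
have bm : b \in mu by rewrite -(perm_mem p) mem_head.
move: p; case/splitPr: bm => p1 p2 p; rewrite subsums_catC.
have p' : perm_eq la (p1 ++ p2).
  by move: p; rewrite -[b :: p2]cat1s perm_sym perm_catCA /= perm_cons perm_sym.
by rewrite /= !(IH _ _ p').
Qed.

Lemma subsums_gt i la : (sumn la < i)%N -> subsums i la = 0%N.
Proof.
elim: la i => [|b la IH] i /= h; first by rewrite (gtn_eqF h).
by rewrite IH; [case: ifP => // bi; rewrite IH //; lia|lia].
Qed.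

Definition rowsum k := dsum (fun=> 1) k.

Lemma rowsumD k F G : rowsum k (F + G) = rowsum k F + rowsum k G. Proof. exact: dsumD. Qed.
Lemma rowsum0 F : rowsum 0 F = F.
Proof. by rewrite /rowsum dsum0; apply/funext => m; rewrite mul1r. Qed.
Lemma rowsum_newton k F : rowsum k F *+ k = \sum_(b < k) rowsum (k - b.+1)%N (D b.+1 F).
Proof. exact: dsum_euler. Qed.

Lemma D_rowsum b k F : D b (rowsum k F) = rowsum k (D b F).
Proof.
elim/ltn_ind: k F => -[|k] IH F; first by rewrite !rowsum0.
apply: (@fps_mulrnI k.+1) => //; rewrite -Dmulrn !rowsum_newton Dsum; apply: eq_bigr => i _.
by rewrite IH ?subSS ?ltnS ?leq_subr //; congr rowsum; exact: DC.
Qed.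

Lemma dsum_zero f k : dsum f k 0 = 0.
Proof. by apply: (addrI (dsum f k 0)); rewrite -dsumD !addr0. Qed.

Lemma dsum_add f g k F : dsum (fun la => f la + g la) k F = dsum f k F + dsum g k F.
Proof. by apply/funext => m; rewrite fps_addE !dsumE -big_split; apply: eq_bigr => la _; rewrite mulrDl. Qed.

Lemma dsum_sub f g k F : dsum (fun la => f la - g la) k F = dsum f k F - dsum g k F.
Proof.
apply/funext => m; rewrite fps_addE fps_oppE !dsumE -sumrB; apply: eq_bigr => la _; exact: mulrBl.
Qed.

Lemma dsum_nil f k F : (forall la, f la = 0) -> dsum f k F = 0.
Proof. by move=> h; apply/funext => m; rewrite dsumE big1 // => la _; rewrite h mul0r. Qed.

(** Euler's identity gives both sides the same recursion: the part removed lies either outside or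
    inside the chosen subset of parts, which matches the two row operators. *)
Lemma dsum_subsums i k F : (i <= k)%N ->
  dsum (fun la => (subsums i la)%:R) k F = rowsum (k - i)%N (rowsum i F).
Proof.
elim/ltn_ind: k i F => k IH i F ik.
have [k0|k0] := posnP k.
  by move: ik; rewrite k0 leqn0 => /eqP ->; rewrite subn0 !rowsum0 dsum0; apply/funext => m; rewrite mul1r.
apply: (@fps_mulrnI k) => //; rewrite dsum_euler; last by move=> la mu p; rewrite (subsums_perm _ p).
have -> : rowsum (k - i)%N (rowsum i F) *+ k =
    rowsum (k - i)%N (rowsum i F) *+ (k - i) + rowsum (k - i)%N (rowsum i F *+ i).
  rewrite -[X in _ *+ X = _](subnK ik) mulrnDr; congr (_ + _).
  have Rm n p G : rowsum n (G *+ p) = rowsum n G *+ p.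
    by elim: p => [|p IHp]; [exact: dsum_zero|rewrite !mulrS rowsumD IHp].
  by rewrite Rm.
rewrite (rowsum_newton (k - i)%N) (rowsum_newton i).
have Rs (I : Type) (r : seq I) (P : pred I) n (X : I -> fps_ring) :
    rowsum n (\sum_(i <- r | P i) X i) = \sum_(i <- r | P i) rowsum n (X i).
  by elim/big_rec2: _ => [|j x y _ <-]; rewrite ?[rowsum n 0]dsum_zero // rowsumD.
rewrite Rs (big_ord_widen_cond k xpredT (fun b => rowsum (k - i - b.+1)%N (D b.+1 (rowsum i F)))) ?leq_subr //.
rewrite (big_ord_widen_cond k xpredT (fun b => rowsum (k - i)%N (rowsum (i - b.+1)%N (D b.+1 F)))) //.
rewrite [X in _ = X + _]big_mkcond [X in _ = _ + X]big_mkcond -big_split /=; apply: eq_bigr => b _; have bk := ltn_ord b.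
rewrite (dsum_eq (g := fun mu => (subsums i mu)%:R + (if (b < i)%N then (subsums (i - b.+1) mu)%:R else 0))); last first.
  by move=> la _ _ /=; rewrite natrD; case: ifP.
rewrite dsum_add D_rowsum; congr (_ + _).
  case: ifP => bi; first by rewrite IH; [congr rowsum; lia|lia|lia].
  apply/funext => m; rewrite dsumE big1_seq // => la /andP[_]; rewrite mem_part_set => /andP[_ /eqP s].
  by rewrite subsums_gt ?mul0r //; lia.
case: ifP => bi; last by rewrite dsum_nil.
by rewrite IH; [congr rowsum; lia|lia|lia].
Qed.
End TwoRows.
End Partitions.
End Row_operators.
Import Row_operators.

(** * The exponential of a series and the linear part of the KP equations *)

Module Linearization.
Section Exponential.
Local Open Scope ring_scope.
Implicit Types (F G : fps_ring) (m : monomial).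

Definition fscale (c : algC) F : fps_ring := fun m => c * F m.

Lemma fscaleM c F G : fscale c (F * G) = fscale c F * G.
Proof.
apply: (fps_coind (P := fun X Y => exists F G, X = fscale c (F * G) /\ Y = fscale c F * G)).
- by move=> _ _ [F1 [G1 [-> ->]]]; change (c * fps_mul F1 G1 mset0 = fps_mul (fscale c F1) G1 mset0); rewrite !fps_mul0 mulrA.
- move=> _ _ b [F1 [G1 [-> ->]]].
  have e H : fps_deriv b (fscale c H) = fscale c (fps_deriv b H).
    by apply/funext => m; rewrite /fps_deriv /fscale mulrCA.
  rewrite e [X in fscale c X]fps_derivM [X in sum_closure _ _ X]fps_derivM e.
  rewrite (_ : fscale c _ = fscale c ((fps_deriv b F1 : fps_ring) * G1) + fscale c (F1 * (fps_deriv b G1 : fps_ring))).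
    by apply: closure_add; apply: closure_base; eexists; eexists.
  by apply/funext => m; rewrite /fscale fps_addE -mulrDr.
- by exists F, G.
Qed.

Lemma fscaleMr c F G : fscale c (F * G) = F * fscale c G.
Proof. by rewrite mulrC fscaleM mulrC. Qed.
Lemma fscaleA c e F : fscale c (fscale e F) = fscale (c * e) F.
Proof. by apply/funext => m; rewrite /fscale mulrA. Qed.
Lemma fscaleD c F G : fscale c (F + G) = fscale c F + fscale c G.
Proof. by apply/funext => m; rewrite /fscale fps_addE mulrDr. Qed.
Lemma fscale1 F : fscale 1 F = F.
Proof. by apply/funext => m; rewrite /fscale mul1r. Qed.
Lemma deriv_fscale b c F : fps_deriv b (fscale c F) = fscale c (fps_deriv b F).
Proof. by apply/funext => m; rewrite /fps_deriv /fscale mulrCA. Qed.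

Definition deg m : nat := size m.
Lemma degD b m : deg (m `+` [mset b])%mset = (deg m).+1.
Proof.
by rewrite /deg -{1}[m]seq_mset_id msetDC -mset_cons (perm_size (perm_eq_seq_mset _)).
Qed.

Lemma deg0 m : deg m = 0%N -> m = mset0.
Proof. by move=> /eqP; rewrite size_mset_eq0 => /eqP. Qed.

(** Agreement up to total degree, [beta] included; it lets finite truncations stand for the
    exponential. *)
Definition upto n F G := forall m, (deg m <= n)%N -> F m = G m.

Lemma uptoP n F G : upto n.+1 F G <-> F mset0 = G mset0 /\ forall b, upto n (fps_deriv b F) (fps_deriv b G).
Proof.
split=> [h|[h0 h] m].
  split; first by apply: h; rewrite /deg size_mset0.
  by move=> b m mn; rewrite /fps_deriv h // degD.
elim/mset_ind: m => // b m _; rewrite msetDC degD ltnS => mn.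
have := h b m mn; rewrite /fps_deriv => /(mulfI _); apply; by rewrite pnatr_eq0.
Qed.

Lemma uptoW n F G : upto n.+1 F G -> upto n F G.
Proof. by move=> h m mn; apply: h; exact: leqW. Qed.

Lemma uptoM n F F' G G' : upto n F F' -> upto n G G' -> upto n (F * G) (F' * G').
Proof.
elim: n F F' G G' => [|n IH] F F' G G' hF hG.
  move=> m; rewrite leqn0 => /eqP/deg0 ->; rewrite [LHS]fps_mul0 [RHS]fps_mul0.
  by rewrite hF ?hG // /deg size_mset0.
apply/uptoP; split.
  rewrite [LHS]fps_mul0 [RHS]fps_mul0; have [-> _] := (uptoP _ _ _).1 hF.
  by have [-> _] := (uptoP _ _ _).1 hG.
move=> b; rewrite [fps_deriv b (F * G)]fps_derivM [fps_deriv b (F' * G')]fps_derivM => m mn.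
have [_ dF] := (uptoP _ _ _).1 hF; have [_ dG] := (uptoP _ _ _).1 hG.
rewrite !fps_addE; congr (_ + _).
  exact: (IH _ _ _ _ (dF b) (uptoW hG)).
exact: (IH _ _ _ _ (uptoW hF) (dG b)).
Qed.

Lemma fps_exp_natE F k : fps_exp_nat F k = (F ^+ k : fps_ring).
Proof. by elim: k => //= k IH; rewrite exprS -IH. Qed.

Lemma fps_derivX b F k : fps_deriv b (F ^+ k) = (F ^+ k.-1 * (fps_deriv b F : fps_ring)) *+ k.
Proof.
elim: k => [|k IH]; first by rewrite expr0 mulr0n; exact: fps_deriv1.
rewrite exprS.
transitivity ((fps_deriv b F : fps_ring) * F ^+ k + F * (fps_deriv b (F ^+ k) : fps_ring)); first exact: fps_derivM.
rewrite IH; move: (fps_deriv b F : fps_ring) => y; case: k {IH} => [|k] /=.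
  by rewrite mulr0n mulr0 addr0 mulrC.
by rewrite [y * _]mulrC mulrnAr mulrA -exprS -mulrS.
Qed.

Lemma fps_deriv_sum b (I : Type) (r : seq I) (P : pred I) (X : I -> fps_ring) :
  fps_deriv b (\sum_(i <- r | P i) X i) = \sum_(i <- r | P i) (fps_deriv b (X i) : fps_ring).
Proof. by elim/big_rec2: _ => [|i x y _ <-]; rewrite ?fps_deriv0 // -fps_derivD. Qed.

Lemma expr_vanish F k n : F mset0 = 0 -> (n < k)%N -> upto n (F ^+ k) 0.
Proof.
move=> F0; elim: n k => [|n IH] [|k] // nk.
  move=> m; rewrite leqn0 => /eqP/deg0 ->; rewrite exprS [LHS]fps_mul0 F0 mul0r. by [].
apply/uptoP; split; first by rewrite exprS [LHS]fps_mul0 F0 mul0r.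
move=> b; rewrite fps_derivX fps_deriv0 /= => m mn.
have h := uptoM (IH k nk) (fun m (_ : (deg m <= n)%N) => erefl (fps_deriv b F m)).
by rewrite fps_mulrnE (h m mn) mul0r mul0rn.
Qed.

Definition expN N F : fps_ring := \sum_(k < N) fscale ((k`!)%:R^-1) (F ^+ k).

Lemma fps_expE F m N : F mset0 = 0 -> (deg m < N)%N -> fps_exp F m = expN N F m.
Proof.
move=> F0 mN; rewrite /fps_exp /expN fps_sumE.
transitivity (\sum_(k \in [set: nat]) fscale (k`!)%:R^-1 (F ^+ k) m).
  by apply: eq_fsbigr => k _; rewrite fps_exp_natE.
rewrite (fsbig_ord _ N (fun k => fscale (k`!)%:R^-1 (F ^+ k) m)); symmetry; apply: fsbig_widen => // k.
rewrite /= => -[_ /negP kN]; rewrite /fscale (expr_vanish F0 _ (leqnn (deg m))) ?mulr0 //.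
by apply: leq_trans mN _; rewrite leqNgt.
Qed.

Lemma expN_deriv b N F : fps_deriv b (expN N.+1 F) = expN N F * (fps_deriv b F : fps_ring).
Proof.
rewrite /expN big_ord_recl fps_derivD deriv_fscale fps_derivX mulr0n.
rewrite (_ : fscale _ 0 = 0) ?add0r; last by apply/funext => m; rewrite /fscale mulr0.
rewrite [LHS]fps_deriv_sum mulr_suml; apply: eq_bigr => k _; rewrite deriv_fscale fps_derivX /= -fscaleM.
have h (x : algC) : (k.+1%:R)^-1 / (k`!)%:R * (x *+ k.+1) = (k`!)%:R^-1 * x.
  by rewrite -(mulr_natl x) mulrACA mulVf ?pnatr_eq0 // mul1r.
apply/funext => m; rewrite /fscale fps_mulrnE /bump /= add1n factS natrM invfM; exact: h.
Qed.

Lemma fps_exp_upto F n : F mset0 = 0 -> upto n (fps_exp F) (expN n.+1 F).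
Proof. by move=> F0 m mn; apply: fps_expE. Qed.

Lemma fps_exp_deriv b F : F mset0 = 0 -> fps_deriv b (fps_exp F) = (fps_exp F : fps_ring) * (fps_deriv b F : fps_ring).
Proof.
move=> F0; apply/funext => m.
rewrite (uptoM (fps_exp_upto (n := deg m) F0) (fun m (_ : (deg m <= _)%N) => erefl (fps_deriv b F m)) (leqnn _)).
by rewrite -expN_deriv /fps_deriv (@fps_expE _ _ (deg m).+2) // degD.
Qed.

Lemma fps_exp0 F : F mset0 = 0 -> fps_exp F mset0 = 1.
Proof.
move=> F0; rewrite (@fps_expE _ _ 1) // ?/deg ?size_mset0 // /expN big_ord1 /fscale fact0 invr1 mul1r expr0.
by rewrite /GRing.one /= /fps1 eqxx.
Qed.

(** The product has constant term 1 and all its derivatives vanish. *)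
Lemma fps_exp_inv F : F mset0 = 0 ->
  (fps_exp F : fps_ring) * (fps_exp F : fps_ring) * (fps_exp (- (F + F)) : fps_ring) = 1.
Proof.
move=> F0; have F0' : (- (F + F)) mset0 = 0 by rewrite fps_oppE fps_addE F0 addr0 oppr0.
apply: fps_deriv_inj.
  by rewrite [LHS]fps_mul0 [X in X * _]fps_mul0 !fps_exp0 // !mul1r /GRing.one /= /fps1 eqxx.
move=> b; rewrite [RHS]fps_deriv1 [LHS]fps_derivM [X in fps_mul X _]fps_derivM !fps_exp_deriv //.
rewrite fps_derivN fps_derivD.
change ((((fps_exp F : fps_ring) * (fps_deriv b F : fps_ring)) * (fps_exp F : fps_ring) + (fps_exp F : fps_ring) * ((fps_exp F : fps_ring) * (fps_deriv b F : fps_ring))) * (fps_exp (- (F + F)) : fps_ring) +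
  ((fps_exp F : fps_ring) * (fps_exp F : fps_ring)) * ((fps_exp (- (F + F)) : fps_ring) * - ((fps_deriv b F : fps_ring) + (fps_deriv b F : fps_ring))) = 0).
move: (fps_exp _ : fps_ring) (fps_exp _ : fps_ring) (fps_deriv b F : fps_ring) => x y z; ring.
Qed.

Definition dprod (s : seq (seq nat)) F : fps_ring := \prod_(la <- s) (fps_derivs la F : fps_ring).

Lemma dp_evalE (P : dpoly) F : dp_eval P F = \sum_(t <- P) fscale t.1 (dprod t.2 F).
Proof. by apply/funext => m; rewrite fps_sumE. Qed.

Lemma dp_eval_cat (P Q : dpoly) F : dp_eval (P ++ Q) F = (dp_eval P F : fps_ring) + (dp_eval Q F : fps_ring).
Proof. by rewrite !dp_evalE big_cat. Qed.

Lemma dp_linear_cat (P Q : dpoly) : dp_linear (P ++ Q) = dp_linear P ++ dp_linear Q.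
Proof. exact: filter_cat. Qed.

Definition dp_scale c (P : dpoly) : dpoly := [seq (c * t.1, t.2) | t <- P].
Definition dp_mul (P Q : dpoly) : dpoly := [seq (t.1 * u.1, t.2 ++ u.2) | t <- P, u <- Q].
Definition no_constant (P : dpoly) := all (fun t => 0 < size t.2)%N P.

Lemma dp_eval_scale c P F : dp_eval (dp_scale c P) F = fscale c (dp_eval P F).
Proof.
rewrite !dp_evalE big_map; elim/big_rec2: _ => [|t x y _ ->]; last by rewrite fscaleD fscaleA.
by apply/funext => m; rewrite /fscale mulr0.
Qed.

Lemma dp_linear_scale c P : dp_linear (dp_scale c P) = dp_scale c (dp_linear P).
Proof. by rewrite /dp_linear filter_map. Qed.

Lemma dp_eval_mul P Q F : dp_eval (dp_mul P Q) F = (dp_eval P F : fps_ring) * (dp_eval Q F : fps_ring).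
Proof.
rewrite !dp_evalE /dp_mul big_allpairs_dep mulr_suml; apply: eq_bigr => t _; rewrite mulr_sumr; apply: eq_bigr => u _ /=.
by rewrite -fscaleM -fscaleMr fscaleA /dprod big_cat.
Qed.

Lemma dp_linear_mul P Q : no_constant P -> no_constant Q -> dp_linear (dp_mul P Q) = [::].
Proof.
move=> /allP hP /allP hQ; apply/eqP; rewrite -size_eq0 size_filter -leqn0 leqNgt -has_count.
apply/hasPn => _ /allpairsP[[t u] [/= /hP t0 /hQ u0 ->]] /=; rewrite size_cat; lia.
Qed.

Fixpoint leibniz b (s : seq (seq nat)) : seq (seq (seq nat)) :=
  if s is la :: s' then ((b :: la) :: s') :: [seq la :: u | u <- leibniz b s'] else [::].

Lemma leibniz_size b s u : u \in leibniz b s -> size u = size s.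
Proof.
elim: s u => //= la s IH u; rewrite inE => /orP[/eqP -> //|/mapP[v /IH e ->]] /=; by rewrite e.
Qed.

Lemma deriv_dprod b s F : fps_deriv b (dprod s F) = \sum_(u <- leibniz b s) dprod u F.
Proof.
elim: s => [|la s IH]; first by rewrite /dprod !big_nil; exact: fps_deriv1.
rewrite /dprod big_cons [LHS]fps_derivM IH /= big_cons big_map /dprod big_cons; congr (_ + _).
transitivity ((fps_derivs la F : fps_ring) * \sum_(u <- leibniz b s) \prod_(la <- u) (fps_derivs la F : fps_ring)); first by [].
by rewrite mulr_sumr; apply: eq_bigr => u _; rewrite big_cons.
Qed.

Definition dp_deriv b (P : dpoly) : dpoly := flatten [seq [seq (t.1, u) | u <- leibniz b t.2] | t <- P].

Lemma dp_eval_deriv b P F : dp_eval (dp_deriv b P) F = fps_deriv b (dp_eval P F).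
Proof.
rewrite !dp_evalE fps_deriv_sum big_flatten big_map; apply: eq_bigr => t _.
rewrite big_map deriv_fscale deriv_dprod /=; elim/big_rec2: _ => [|u x y _ ->]; last by rewrite fscaleD.
by apply/funext => m; rewrite /fscale mulr0.
Qed.

Lemma dp_linear_deriv b P : dp_linear (dp_deriv b P) = dp_deriv b (dp_linear P).
Proof.
rewrite /dp_linear /dp_deriv; elim: P => //= t P IH; rewrite filter_cat IH.
have h : forall u, u \in leibniz b t.2 -> (size u == 1%N) = (size t.2 == 1%N) by move=> u /leibniz_size ->.
rewrite filter_map; case: ifP => t1 /=.
  by congr (map _ _ ++ _); apply/all_filterP/allP => u /h /= ->.
rewrite (_ : seq.filter _ (leibniz b t.2) = [::]) //; apply/eqP; rewrite -size_eq0 size_filter.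
by rewrite -leqn0 leqNgt -has_count; apply/hasPn => u /h /= ->; rewrite t1.
Qed.

(** The polynomial q for which d_la (e^F) = e^F q(F). The recursion is d_b (e^F q) = e^F (d_b F * q
    + d_b q). *)
Fixpoint exp_dpoly (la : seq nat) : dpoly :=
  if la is b :: mu then dp_mul [:: (1, [:: [:: b]])] (exp_dpoly mu) ++ dp_deriv b (exp_dpoly mu)
  else [:: (1, [::])].

Lemma exp_dpolyP la F : F mset0 = 0 ->
  fps_derivs la (fps_exp F) = (fps_exp F : fps_ring) * (dp_eval (exp_dpoly la) F : fps_ring).
Proof.
move=> F0; elim: la => [|b la IH] /=.
  by rewrite dp_evalE big_seq1 fscale1 /dprod big_nil mulr1.
rewrite IH [LHS]fps_derivM fps_exp_deriv // dp_eval_cat dp_eval_mul dp_eval_deriv [in RHS]dp_evalE big_seq1 fscale1 /dprod big_seq1 /=.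
by rewrite mulrDr mulrA.
Qed.

Lemma exp_dpoly_no_constant b la : no_constant (exp_dpoly (b :: la)).
Proof.
apply/allP => t; rewrite mem_cat => /orP[/allpairsP[[v u] [/=]]|].
  by rewrite inE => /eqP -> _ ->.
elim: la b t => [|c la IH] b t; first by rewrite /dp_deriv.
move=> /flatten_mapP[v hv /mapP[u /leibniz_size us ->]] /=; rewrite us; move: hv.
rewrite mem_cat => /orP[/allpairsP[[v' u'] [/=]]|]; last exact: IH.
by rewrite inE => /eqP -> _ ->.
Qed.

(** The product with d_b F is at least quadratic as soon as the other factor has no constant term,
    so only the derived polynomial reaches the linear part. *)
Lemma exp_dpoly_linear b la F : dp_eval (dp_linear (exp_dpoly (b :: la))) F = fps_derivs (b :: la) F.
Proof.
elim: la b => [|c la IH] b.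
  by rewrite /= dp_evalE /= big_seq1 mul1r fscale1 /dprod big_seq1.
rewrite [exp_dpoly _]/= -/(exp_dpoly (c :: la)) dp_linear_cat dp_eval_cat dp_linear_mul //; last exact: exp_dpoly_no_constant.
by rewrite dp_linear_deriv dp_eval_deriv IH dp_evalE big_nil add0r.
Qed.

Definition dsum_dpoly (f : seq nat -> algC) k : dpoly :=
  flatten [seq dp_scale (f la / (card_Aut la)%:R) (exp_dpoly la) | la <- fset_set (part_set k)].

Lemma dsum_fscale f k F : dsum f k F = \sum_(la <- fset_set (part_set k)) fscale (f la / (card_Aut la)%:R) (fps_derivs la F).
Proof.
by apply/funext => m; rewrite dsumE fps_sumE; apply: eq_bigr => la _; rewrite /fscale mulrCA mulrC.
Qed.

Lemma dsum_dpolyP f k F : F mset0 = 0 ->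
  dsum f k (fps_exp F) = (fps_exp F : fps_ring) * (dp_eval (dsum_dpoly f k) F : fps_ring).
Proof.
move=> F0; rewrite dsum_fscale dp_evalE big_flatten big_map mulr_sumr; apply: eq_bigr => la _.
by rewrite exp_dpolyP // -(dp_evalE (dp_scale _ _)) dp_eval_scale fscaleMr.
Qed.

Lemma part_set_cons k la : (0 < k)%N -> la \in fset_set (part_set k) -> exists b mu, la = b :: mu.
Proof.
move=> k0; rewrite mem_part_set => /andP[_ /eqP]; case: la => [|b mu] e; last by exists b, mu.
by move: k0; rewrite -e.
Qed.

Lemma dsum_dpoly_no_constant f k : (0 < k)%N -> no_constant (dsum_dpoly f k).
Proof.
move=> k0; apply/allP => t /flatten_mapP[la hla /mapP[u hu ->]] /=.
by have [b [mu e]] := part_set_cons k0 hla; subst la; have /allP := exp_dpoly_no_constant b mu; exact.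
Qed.

Lemma dsum_dpoly_linear f k F : (0 < k)%N -> dp_eval (dp_linear (dsum_dpoly f k)) F = dsum f k F.
Proof.
move=> k0; rewrite dsum_fscale dp_evalE /dsum_dpoly.
have : forall la, la \in (fset_set (part_set k) : seq (seq nat)) -> exists b mu, la = b :: mu.
  by move=> la hla; exact: (part_set_cons k0 hla).
elim: (fset_set _ : seq (seq nat)) => [|la r IH] h; first by rewrite !big_nil.
rewrite /= dp_linear_cat big_cat big_cons /= IH => [|mu mr]; last by apply: h; rewrite inE mr orbT.
congr (_ + _); rewrite -dp_evalE dp_linear_scale dp_eval_scale.
by have [b [mu ->]] := h la (mem_head _ _); rewrite exp_dpoly_linear.
Qed.

(** The last two Hirota terms are products of polynomials without constant term, so the linear part
    is a multiple of [Dop [:: j; i]]. The factor [c] contributed by the empty partition is left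
    unevaluated. *)
Lemma LKP_of_Dop i j (Z : fps) : (2 <= i <= j)%N -> Dop [:: j; i] Z = 0 -> is_LKP i j Z 0.
Proof.
move=> /andP[i2 ij] DZ.
pose Q mu := dsum_dpoly (chi mu) (sumn mu).
pose c := chi [::] [::].
exists (dp_scale c (Q [:: j; i]) ++ dp_scale (-1) (dp_mul (Q [:: (i - 1)%N]) (Q [:: j; 1%N])) ++
  dp_mul (Q [:: j]) (Q [:: (i - 1)%N; 1%N])); split.
  move=> F F0; have e mu : Dop mu (fps_exp F) = (fps_exp F : fps_ring) * (dp_eval (Q mu) F : fps_ring).
    by rewrite Dop_dsum dsum_dpolyP.
  have e0 : Dop [::] (fps_exp F) = fscale c (fps_exp F) by rewrite Dop_dsum [sumn _]/= dsum0.
  rewrite !dp_eval_cat !dp_eval_scale !dp_eval_mul /KP /Hir e0 !e.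
  have inv := fps_exp_inv F0.
  rewrite (_ : fscale (-1) _ = - ((dp_eval (Q [:: (i - 1)%N]) F : fps_ring) * (dp_eval (Q [:: j; 1%N]) F : fps_ring))); last first.
    by apply/funext => m; rewrite /fscale mulN1r.
  change ((fscale c (fps_exp F) * ((fps_exp F : fps_ring) * (dp_eval (Q [:: j; i]) F : fps_ring))
     - ((fps_exp F : fps_ring) * (dp_eval (Q [:: (i - 1)%N]) F : fps_ring)) * ((fps_exp F : fps_ring) * (dp_eval (Q [:: j; 1%N]) F : fps_ring))
     + ((fps_exp F : fps_ring) * (dp_eval (Q [:: j]) F : fps_ring)) * ((fps_exp F : fps_ring) * (dp_eval (Q [:: (i - 1)%N; 1%N]) F : fps_ring)))
     * (fps_exp (- (F + F)) : fps_ring) =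
     fscale c (dp_eval (Q [:: j; i]) F) + (- ((dp_eval (Q [:: (i - 1)%N]) F : fps_ring) * (dp_eval (Q [:: j; 1%N]) F : fps_ring)) +
       (dp_eval (Q [:: j]) F : fps_ring) * (dp_eval (Q [:: (i - 1)%N; 1%N]) F : fps_ring))).
  rewrite -fscaleM -[fscale c (dp_eval _ _)]mul1r -inv -fscaleMr.
  move: (fps_exp F : fps_ring) (fps_exp (- (F + F)) : fps_ring) inv => x y inv.
  move: (dp_eval _ F : fps_ring) (dp_eval _ F : fps_ring) (dp_eval _ F : fps_ring) (dp_eval _ F : fps_ring) (dp_eval _ F : fps_ring) => q5 q4 q3 q2 q1.
  have -> : fscale c (x * (x * q1)) = x * x * fscale c q1 by rewrite mulrA fscaleMr.
  have -> : fscale c (x * x * y * q1) = x * x * y * fscale c q1 by rewrite fscaleMr.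
  rewrite -[- (q2 * q3) + _]mul1r -inv; ring.
rewrite !dp_linear_cat !dp_linear_scale !dp_linear_mul ?cats0; try (apply: dsum_dpoly_no_constant; rewrite /=; lia).
rewrite dp_eval_scale dsum_dpoly_linear ?addn_gt0 /=; last by rewrite (leq_trans _ ij) // (leq_trans _ i2).
rewrite -[dsum _ _ _]/(Dop [:: j; i] Z) DZ; by apply/funext => m; rewrite /fscale mulr0.
Qed.
End Exponential.
End Linearization.
Import Linearization.

(** * Permutation characters on subsets *)

Module Coset_modules.
Section RepresentationTheory.
Local Open Scope ring_scope.

Section SubmoduleTrace.
Variables (gT : finGroupType) (G : {group gT}) (n : nat) (rG : mx_representation algC G n).

Lemma cyclic_annihilated u p (N : 'M[algC]_(n, p)) :
  (forall x, x \in G -> u *m rG x *m N = 0) -> cyclic_mx rG u *m N = 0.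
Proof.
move=> h; apply/sub_kermxP; rewrite genmxE; apply/row_subP => i.
by rewrite row_mul mul_rV_lin1 /= rowK mxvecK; apply/sub_kermxP/h/enum_valP.
Qed.

(** For a projection [E] onto [U], cyclicity of the trace moves the computation from [U] to the
    whole space, with no basis of [U] to be known. *)
Lemma trace_submod U (modU : mxmodule rG U) E g : (E <= U)%MS -> U *m E = U -> g \in G ->
  \tr (submod_repr modU g) = \tr (E *m rG g).
Proof.
move=> EU UE Gg; pose B := row_base U; pose P := in_submod U E.
have BE : B *m E = B.
  have /submxP[W e] : (B <= U)%MS by rewrite eq_row_base.
  by rewrite e -mulmxA UE.
have eE : E = P *m B by rewrite -[LHS](in_submodK EU).
have XB : submod_repr modU g *m B = B *m rG g.
  by have := val_submodJ modU 1%:M Gg; rewrite mul1mx /val_submod /= mul1mx.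
have BP : B *m P = 1%:M.
  by apply: (row_free_inj (row_base_free U)); rewrite /= -mulmxA -eE mul1mx.
by rewrite eE -mulmxA -XB mulmxA [RHS]mxtrace_mulC [in RHS]mulmxA BP mul1mx.
Qed.
End SubmoduleTrace.

Section CosetModule.
Variables (gT : finGroupType) (R : {group gT}).
Local Notation G := [set: gT]%G.
Local Notation aG := (regular_repr algC G).
Local Notation ell x := (delta_mx 0 (gring_index G x) : 'rV[algC]_#|G|).

Lemma ellM (x g : gT) : ell x *m aG g = ell (x * g)%g.
Proof. by rewrite -rowE rowK gring_indexK // finset.in_setT. Qed.

Definition set_sum (A : {set gT}) : 'rV[algC]_#|G| := \sum_(p in A) ell p.

Lemma set_sumM p : p \in R -> set_sum R *m aG p = set_sum R.
Proof.
move=> pR; rewrite mulmx_suml (reindex_inj (mulIg p^-1%g)) /=; apply: eq_big => x.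
  by rewrite groupMr // groupV.
by rewrite ellM mulgKV.
Qed.

(** The right ideal generated by the sum of [R] is the permutation module on the cosets of [R]. The
    projection is left multiplication by the averaged sum, and its trace is read in the basis of
    group elements. *)
Lemma coset_trace g :
  \tr (submod_repr (cyclic_mx_module aG (set_sum R)) g) =
  #|[set x | (x * g * x^-1)%g \in R]%SET|%:R / #|R|%:R.
Proof.
have R0 : #|R|%:R != 0 :> algC by rewrite pnatr_eq0 -lt0n cardG_gt0.
pose E : 'M[algC]_#|G| := \matrix_i (#|R|%:R^-1 *: (set_sum R *m aG (enum_val i))).
have ellE x : ell x *m E = #|R|%:R^-1 *: (set_sum R *m aG x).
  by rewrite -rowE rowK gring_indexK // finset.in_setT.
rewrite (@trace_submod _ _ _ _ _ _ E) ?finset.in_setT //; last 2 first.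
- apply/row_subP => i; rewrite rowK scalemx_sub //.
  apply: submx_trans (mxmoduleP (cyclic_mx_module aG (set_sum R)) _ (enum_valP i)).
  exact: submxMr (cyclic_mx_id _ _).
- apply/eqP; rewrite -subr_eq0 -{2}[cyclic_mx _ _]mulmx1 -mulmxBr; apply/eqP.
  apply: cyclic_annihilated => x _; rewrite mulmxBr mulmx1; apply/eqP; rewrite subr_eq0; apply/eqP.
  rewrite {1}/set_sum mulmx_suml mulmx_suml.
  transitivity (\sum_(p in R) #|R|%:R^-1 *: (set_sum R *m aG x)).
    by apply: eq_bigr => p pR; rewrite ellM ellE repr_mxM ?finset.in_setT // mulmxA set_sumM.
  by rewrite sumr_const -scaler_nat scalerA mulfV // scale1r /set_sum mulmx_suml.
have -> : #|[set x | (x * g * x^-1)%g \in R]%SET|%:R = \sum_(x | (x * g * x^-1)%g \in R) 1 :> algC.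
  by rewrite -sum1_card natr_sum; apply: eq_bigl => x; rewrite inE.
rewrite /mxtrace mulr_suml [RHS]big_mkcond /=.
transitivity (\sum_(x in [set: gT]%SET) if (x * g * x^-1)%g \in R then #|R|%:R^-1 else 0 : algC); last first.
  by apply: eq_big => x; rewrite !inE // mul1r.
rewrite [RHS]big_enum_val; apply: eq_bigr => i _; set x := enum_val i.
have -> : (E *m aG g) i i = (row i E *m aG g) 0 i by rewrite -row_mul [RHS]mxE.
rewrite rowK -scalemxAl mxE -mulmxA -repr_mxM ?finset.in_setT // -/x mulmx_suml summxE.
have e p : (ell p *m aG (x * g)%g) 0 i = (p == (x * g * x^-1)^-1)%g%:R.
  have ei : i = gring_index G x by rewrite /x gring_valK.
  rewrite ellM mxE eqxx /= [in LHS]ei.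
  rewrite (inj_in_eq (can_in_inj (@gring_indexK _ G))) ?finset.in_setT //.
  congr (nat_of_bool _)%:R; rewrite invMg invgK; apply/eqP/eqP => [e1|->].
    by rewrite {1}e1 mulgK.
  by rewrite mulgKV.
rewrite (eq_bigr _ (fun p _ => e p)) -(groupV R (x * g * x^-1)%g); case: ifP => h.
  rewrite (bigD1 _ h) /= eqxx big1 ?addr0 ?mulr1 // => p /andP[_ /negPf ->]; by [].
rewrite big1 ?mulr0 // => p pR; case: eqP => // e'; by rewrite -e' pR in h.
Qed.
End CosetModule.

Lemma recolor d (T : eqType) (c c' : 'I_d -> T) :
  (forall t, #|[set k | c k == t]%SET| = #|[set k | c' k == t]%SET|) ->
  exists s : 'S_d, forall k, c' (s k) = c k.
Proof.
move=> h.
have cnt (f : 'I_d -> T) t : count_mem t (map f (enum 'I_d)) = #|[set k | f k == t]%SET|.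
  rewrite count_map -size_filter cardE; congr size; rewrite /enum_mem -enumT /=.
  by rewrite {2}/enum_mem -enumT; apply: eq_filter => k; rewrite !inE.
have : perm_eq (map c (enum 'I_d)) [tuple c' k | k < d].
  by apply/allP => t _ /=; rewrite cnt h -cnt.
case/tuple_permP => s e; exists s => k.
have := congr1 (fun l => nth (c k) l k) e.
rewrite (nth_map k) ?size_enum_ord // nth_ord_enum => ->.
by rewrite -tnth_nth !tnth_mktuple.
Qed.

Section Subsets.
Variable d : nat.
Implicit Types (s g : 'S_d) (X Y : {set 'I_d}).

Lemma mem_stab s X : (s \in 'N(X | 'P))%g = (s @: X == X)%SET.
Proof.
apply/astabsP/eqP => [h|e x].
  apply/eqP; rewrite eqEcard card_imset ?leqnn ?andbT; last exact: perm_inj.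
  by apply/fintype.subsetP => _ /imsetP[x xX ->]; rewrite -[s x]/(aperm x s) h.
by rewrite -{1}e /= /aperm mem_imset //; exact: perm_inj.
Qed.

Lemma imset_perm_trans X Y : #|X| = #|Y| -> exists s, (s @: X = Y)%SET.
Proof.
move=> XY; have [[] |s hs] := @recolor d bool (fun k => k \in X) (fun k => k \in Y).
- by rewrite (_ : [set _ | _]%SET = X) ?XY; [apply: eq_card => k; rewrite !inE eqb_id|apply/setP => k; rewrite inE eqb_id].
- rewrite (_ : [set _ | _]%SET = ~: X)%SET; last by apply/setP => k; rewrite !inE eqbF_neg.
  rewrite (_ : [set k | (k \in Y) == false]%SET = ~: Y)%SET; last by apply/setP => k; rewrite !inE eqbF_neg.
  by apply: (@addnI #|X|); rewrite cardsC XY cardsC.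
exists s; apply/eqP; rewrite eqEcard card_imset ?XY ?leqnn ?andbT; last exact: perm_inj.
by apply/fintype.subsetP => _ /imsetP[x xX ->]; rewrite hs.
Qed.

Definition fixed_sets i s : {set {set 'I_d}} := [set X : {set 'I_d} | (#|X| == i) && (s @: X == X)%SET]%SET.

Lemma imsetM (s t : 'S_d) X : ((s * t)%g @: X = t @: (s @: X))%SET.
Proof. by rewrite -imset_comp; apply: eq_imset => x /=; rewrite permM. Qed.

Lemma imset_perm1 X : ((1 : 'S_d)%g @: X = X)%SET.
Proof. by rewrite -[RHS]imset_id; apply: eq_imset => x; rewrite perm1. Qed.

(** A conjugate of [g] by [x] stabilises [X] exactly when [g] fixes the image of [X] under [x], and
    every set of the same size is the image under one coset of the stabiliser. *)
Lemma coset_fixed_sets X g :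
  #|[set x : 'S_d | (x * g * x^-1)%g \in 'N(X | 'P)%g]%SET| = (#|fixed_sets #|X| g| * #|'N(X | 'P)%g|)%N.
Proof.
have e x : ((x * g * x^-1)%g \in 'N(X | 'P)%g) = ((x : 'S_d) @: X \in fixed_sets #|X| g)%SET.
  rewrite mem_stab !imsetM inE card_imset ?eqxx /=; last exact: perm_inj.
  apply/eqP/eqP => [h|->]; last by rewrite -imsetM mulgV imset_perm1.
  by rewrite -[in RHS]h -[RHS]imsetM mulVg imset_perm1.
rewrite -sum1_card (eq_bigl (fun x : 'S_d => x @: X \in fixed_sets #|X| g)%SET); last by move=> x; rewrite inE e.
rewrite (partition_big (fun x : 'S_d => x @: X)%SET (mem (fixed_sets #|X| g))) //= -sum_nat_const.
apply: eq_bigr => Y YF; have [s sX] : exists s : 'S_d, (s @: X = Y)%SET.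
  by apply: imset_perm_trans; move: YF; rewrite inE => /andP[/eqP ->].
rewrite -[RHS](card_imset _ (mulIg s)) -sum1_card; apply: eq_bigl => x.
apply/andP/imsetP => [[_ /eqP xX]|[y yN ->]].
  exists (x * s^-1)%g; last by rewrite mulgKV.
  by rewrite mem_stab imsetM xX -sX -imsetM mulgV imset_perm1.
by move: yN; rewrite mem_stab imsetM => /eqP ->; rewrite sX YF.
Qed.

Definition coset_char X : 'CF([set: 'S_d]%G) :=
  cfRepr (submod_repr (cyclic_mx_module (regular_repr algC [set: 'S_d]%G) (set_sum 'N(X | 'P)%g))).

Lemma coset_charE X g : coset_char X g = #|fixed_sets #|X| g|%:R.
Proof.
rewrite cfunE finset.in_setT mulr1n coset_trace coset_fixed_sets natrM mulfK //.
by rewrite pnatr_eq0 -lt0n cardG_gt0.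
Qed.

Lemma card_imset_le (A B C : finType) (f : A -> B) (g : A -> C) (S : {set A}) :
  (forall x y, x \in S -> y \in S -> g x = g y -> f x = f y) -> (#|f @: S| <= #|g @: S|)%N.
Proof.
move=> h; have [->|/finset.set0Pn[x0 _]] := eqVneq S finset.set0; first by rewrite !finset.imset0 !cards0.
pose r v := odflt x0 [pick x in S | f x == v].
have rP v : v \in (f @: S)%SET -> r v \in S /\ f (r v) = v.
  case/imsetP => x xS ->; rewrite /r; case: pickP => [y /andP[? /eqP ?] //|/(_ x)].
  by rewrite xS eqxx.
rewrite -(card_in_imset (f := g \o r) (D := (f @: S)%SET)).
  by apply/subset_leq_card/fintype.subsetP => _ /imsetP[v /rP[vS _] ->]; apply: imset_f.
move=> u v uI vI e; have [ru eu] := rP _ uI; have [rv ev] := rP _ vI.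
by rewrite -eu -ev; exact: h.
Qed.

Definition pair_image (P : {set 'I_d} * {set 'I_d}) (s : 'S_d) := (s @: P.1, s @: P.2)%SET.

Lemma pair_image_action : is_action [set: 'S_d] pair_image.
Proof.
apply: is_total_action => [[X Y]|[X Y] s t]; first by rewrite /pair_image !imset_perm1.
by rewrite /pair_image !imsetM.
Qed.
Canonical pair_action := Action pair_image_action.

Definition set_pairs i k : {set {set 'I_d} * {set 'I_d}} := [set P : {set 'I_d} * {set 'I_d} | (#|P.1| == i) && (#|P.2| == k)]%SET.

(** By the Frobenius-Cauchy count the sum is the group order times the number of orbits on pairs of
    subsets. The size of the intersection classifies these orbits, and the bound on [i + k] lets it
    take every value from 0 to the minimum. *)
Lemma sum_fixed_sets i k : (i + k <= d)%N ->
  (\sum_(s : 'S_d) #|fixed_sets i s| * #|fixed_sets k s| = (minn i k).+1 * #|'S_d|)%N.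
Proof.
move=> ikd.
have acts : [acts [set: 'S_d], on set_pairs i k | pair_action]%g.
  apply/actsP => s _ [X Y]; rewrite !inE /= !card_imset //; exact: perm_inj.
have := Frobenius_Cauchy acts; rewrite cardsT => FC.
transitivity (\sum_(s in [set: 'S_d]%SET) #|'Fix_(set_pairs i k | pair_action)[s]%g|)%N.
  apply: eq_big => [s|s _]; first by rewrite !inE.
  rewrite -cardsX; apply: eq_card => -[X Y]; rewrite !inE /= finset.sub1set !inE /= /pair_image xpair_eqE /=.
  by rewrite andbACA.
rewrite FC; congr (_ * _)%N.
pose f (P : {set 'I_d} * {set 'I_d}) : 'I_d.+1 := inord #|(P.1 :&: P.2)%SET|.
have fE P : f P = #|(P.1 :&: P.2)%SET| :> nat.
  by rewrite inordK // ltnS -[X in (_ <= X)%N]card_ord max_card.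
transitivity #|(f @: set_pairs i k)%SET|; last first.
  have {1}-> : (f @: set_pairs i k)%SET = [set t : 'I_d.+1 | (t <= minn i k)%N]%SET.
    apply/setP => t; rewrite inE; apply/imsetP/idP => [[P]|tik].
      rewrite inE => /andP[/eqP <- /eqP <-] ->; rewrite fE leq_min.
      by rewrite !subset_leq_card // (subsetIl, subsetIr).
    pose X := [set x : 'I_d | (x < i)%N]%SET; pose Y := [set x : 'I_d | (i - t <= x < i - t + k)%N]%SET.
    have itv a b : (a + b <= d)%N -> #|[set x : 'I_d | (a <= x < a + b)%N]%SET| = b.
      move=> abd; rewrite -[RHS]card_ord -[RHS](card_imset _ (f := fun y : 'I_b => widen_ord abd (rshift a y))).
        apply: eq_card => x; rewrite inE; apply/andP/imsetP => [[ax xb]|[y _ ->]] /=.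
          have yb : (x - a < b)%N by lia.
          by exists (Ordinal yb) => //; apply/val_inj => /=; lia.
        by rewrite leq_addr ltn_add2l.
      by move=> y z /(congr1 val) /= /addnI e; apply/val_inj.
    exists (X, Y); last first.
      apply/val_inj; transitivity #|(X :&: Y)%SET|; last by rewrite -[RHS]/(nat_of_ord (f (X, Y))) fE.
      rewrite -[LHS](itv (i - t)%N t); last lia.
      by apply: eq_card => x; rewrite !inE; lia.
    rewrite inE /= itv ?eqxx ?andbT; last lia.
    by rewrite -[X in _ == X](itv 0%N i) ?(leq_trans _ ikd) ?leq_addr //; apply/eqP/eq_card => x; rewrite !inE.
  rewrite -[RHS]card_ord.
  have mn : ((minn i k).+1 <= d.+1)%N by rewrite ltnS; lia.
  rewrite -[RHS](card_imset _ (f := widen_ord mn)).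
    apply: eq_card => x; rewrite inE; apply/idP/imsetP => [h|[y _ ->]].
      by exists (Ordinal (h : (x < (minn i k).+1)%N)) => //; apply/val_inj.
    by rewrite -ltnS /=.
  by move=> y z /(congr1 val) /= e; apply/val_inj.
apply/eqP; rewrite eqn_leq; apply/andP; split; apply: card_imset_le => -[X Y] [X' Y'].
  rewrite !inE /= => /andP[/eqP X1 /eqP Y1] /andP[/eqP X2 /eqP Y2] e0.
  have e : #|(X :&: Y)%SET| = #|(X' :&: Y')%SET|.
    by have := congr1 (@nat_of_ord _) e0; rewrite (fE (X, Y)) (fE (X', Y')).
  have [|s hs] := @recolor d (bool * bool)%type (fun k => (k \in X, k \in Y)) (fun k => (k \in X', k \in Y')).
    have c1 (A B : {set 'I_d}) : #|[set k | (k \in A, k \in B) == (true, true)]%SET| = #|(A :&: B)%SET|.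
      by apply: eq_card => x; rewrite !inE xpair_eqE !eqb_id.
    have c2 (A B : {set 'I_d}) : #|[set k | (k \in A, k \in B) == (true, false)]%SET| = (#|A| - #|(A :&: B)%SET|)%N.
      by rewrite -cardsD; apply: eq_card => x; rewrite !inE xpair_eqE eqb_id eqbF_neg andbC.
    have c3 (A B : {set 'I_d}) : #|[set k | (k \in A, k \in B) == (false, true)]%SET| = (#|B| - #|(A :&: B)%SET|)%N.
      by rewrite finset.setIC -cardsD; apply: eq_card => x; rewrite !inE xpair_eqE eqb_id eqbF_neg.
    have c4 (A B : {set 'I_d}) : #|[set k | (k \in A, k \in B) == (false, false)]%SET| = (d - (#|A| + #|B| - #|(A :&: B)%SET|))%N.
      have cC := cardsC (A :|: B)%SET; rewrite card_ord cardsU in cC.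
      transitivity #|(~: (A :|: B))%SET|; last lia.
      by apply: eq_card => x; rewrite !inE xpair_eqE !eqbF_neg negb_or.
    by move=> [[] []]; rewrite ?c1 ?c2 ?c3 ?c4 ?X1 ?X2 ?Y1 ?Y2 ?e.
  have im (A A' : {set 'I_d}) : #|A| = #|A'| -> (forall k, (s k \in A') = (k \in A)) -> (s @: A = A')%SET.
    move=> AA h; apply/eqP; rewrite eqEcard card_imset ?AA ?leqnn ?andbT; last exact: perm_inj.
    by apply/fintype.subsetP => _ /imsetP[x xX ->]; rewrite h.
  apply: esym; apply/orbit_eqP/orbitP; exists s; first exact: finset.in_setT.
  rewrite /= /pair_image /= (im X X') ?(im Y Y') ?X1 ?X2 ?Y1 ?Y2 // => x.
    by case: (hs x).
  by case: (hs x).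
move=> _ _ /orbit_eqP/orbitP[s _ /= [<- <-]]; apply: ord_inj; rewrite !fE /=.
rewrite -imsetI; last by move=> x y _ _; exact: perm_inj.
by rewrite card_imset //; exact: perm_inj.
Qed.

Lemma coset_char_dot X Y : (#|X| + #|Y| <= d)%N ->
  '[coset_char X, coset_char Y] = (minn #|X| #|Y|).+1%:R.
Proof.
move=> XY; rewrite cfdotE.
transitivity (#|[set: 'S_d]|%:R^-1 * (\sum_(s : 'S_d) #|fixed_sets #|X| s| * #|fixed_sets #|Y| s|)%N%:R : algC).
  congr (_ * _); rewrite natr_sum; apply: eq_big => [s|s _]; first by rewrite !inE.
  by rewrite !coset_charE conjC_nat natrM.
rewrite sum_fixed_sets // natrM cardsT mulrC mulfK // pnatr_eq0 -lt0n.
by apply/card_gt0P; exists 1%g.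
Qed.

End Subsets.
End RepresentationTheory.
End Coset_modules.
Import Coset_modules.

(** * Effect of a transposition on the cycle type *)

Module Cycle_types.
Section CycleTypes.
Local Open Scope ring_scope.
Local Open Scope mset_scope.

Section OnePerm.
Variable d : nat.
Implicit Types (s : 'S_d) (x y : 'I_d).

Definition ctype s : monomial := seq_mset [seq #|(C : {set 'I_d})| | C in porbits s].

Lemma ctypeE s k : ctype s k = #|[set C in porbits s | #|(C : {set 'I_d})| == k]%SET|.
Proof.
rewrite /ctype mset_seqE count_map -size_filter cardE; congr size.
rewrite /enum_mem -enumT -filter_predI; apply: eq_filter => C /=.
by rewrite !inE andbC.
Qed.

Lemma ctype_cycle_type s : ctype s = seq_mset (cycle_type s).
Proof. by apply/eq_seq_msetP; rewrite /cycle_type perm_sym perm_sort. Qed.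

Lemma ctype0 s : ctype s 0%N = 0%N.
Proof.
rewrite ctypeE; apply/eqP; rewrite cards_eq0; apply/eqP/setP => C; rewrite !inE.
apply/negbTE/negP => /andP[/imsetP[x _ ->] /eqP e].
by have := card_porbit_neq0 s x; rewrite e.
Qed.

Lemma card_porbit_eq s k : #|[set x | #|porbit s x| == k]%SET| = (k * ctype s k)%N.
Proof.
rewrite ctypeE mulnC -sum_nat_const -sum1_card.
rewrite (partition_big (porbit s) (mem [set C in porbits s | #|(C : {set 'I_d})| == k]%SET)) /=; last first.
  by move=> x; rewrite !inE => ->; rewrite imset_f.
apply: eq_bigr => C; rewrite inE => /andP[/imsetP[x _ ->] /eqP Ck].
rewrite -[RHS]Ck -[RHS]sum1_card; apply: eq_bigl => y; rewrite !inE eq_porbit_mem porbit_sym.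
case h : (x \in porbit s y); rewrite ?andbF // andbT.
by move: h; rewrite -eq_porbit_mem => /eqP <-; rewrite Ck eqxx.
Qed.

Lemma porbit_sub_stable s x (A : {set 'I_d}) : x \in A -> (forall z, z \in A -> s z \in A) ->
  porbit s x \subset A.
Proof.
move=> xA sA; apply/fintype.subsetP => _ /porbitP[n ->].
by elim: n => [|n IH]; rewrite ?perm1 // expgSr permM sA.
Qed.

Lemma porbit_tperm_out s x y z : z \notin porbit s x -> z \notin porbit s y ->
  porbit (tperm x y * s) z = porbit s z.
Proof.
move=> zx zy.
have h w : w \in porbit s z -> (tperm x y * s)%g w = s w.
  move=> wz; rewrite permM tpermD //; apply/eqP => e; rewrite -e in wz.
    by rewrite porbit_sym wz in zx.
  by rewrite porbit_sym wz in zy.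
have k n : ((tperm x y * s) ^+ n)%g z = (s ^+ n)%g z.
  elim: n => [|n IH]; first by rewrite !expg0 !perm1.
  by rewrite expgSr permM IH h ?mem_porbit // expgSr permM.
by apply/porbit_setP => w; apply/porbitP/porbitP => -[n ->]; exists n; rewrite k.
Qed.

(** The other orbits are unchanged and the number of orbits drops by exactly one, so the elements of
    the two orbits must form a single one. *)
Lemma porbits_join s x y : x \notin porbit s y ->
  porbits (tperm x y * s) = ((porbit s x :|: porbit s y) |: (porbits s :\ porbit s x :\ porbit s y))%SET.
Proof.
move=> xy; set u := (tperm x y * s)%g; set A := (porbit s x :|: porbit s y)%SET.
have xny : x != y by apply: contraNneq xy => ->; exact: porbit_id.
have pxy : porbit s x != porbit s y by rewrite eq_porbit_mem.
have Au z : z \in A -> u z \in A.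
  have st a b : b \in porbit s a -> s b \in porbit s a.
    by rewrite -!eq_porbit_mem => /eqP <-; have := porbit_perm s 1 b; rewrite expg1 => ->.
  rewrite /u permM !inE => zA; case: tpermP => [_|_|_ _].
  - by rewrite [X in _ || X]st ?orbT ?porbit_id.
  - by rewrite st ?porbit_id.
  by case/orP: zA => /st ->; rewrite ?orbT.
set O := (porbits s :\ porbit s x :\ porbit s y)%SET.
have Oc : (#|O| + 2 = #|porbits s|)%N.
  have hx : porbit s x \in porbits s by rewrite imset_f.
  have hy : porbit s y \in (porbits s :\ porbit s x)%SET by rewrite !inE eq_sym pxy imset_f.
  have := cardsD1 (porbit s x) (porbits s); rewrite hx => ->.
  by have := cardsD1 (porbit s y) (porbits s :\ porbit s x)%SET; rewrite hy => ->; rewrite -/O; lia.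
have zout z : z \notin A -> porbit u z = porbit s z /\ porbit s z \in O.
  rewrite !inE negb_or => /andP[zx zy]; split; first exact: porbit_tperm_out.
  by rewrite !eq_porbit_mem zx zy imset_f.
have Ou C : C \in O -> C \in porbits u.
  rewrite !inE => /and3P[Cy Cx /imsetP[z _ e]]; subst C.
  rewrite !eq_porbit_mem in Cx Cy.
  by apply/imsetP; exists z => //; rewrite porbit_tperm_out.
have xA : x \in A by rewrite inE porbit_id.
have cu : (#|porbits u| + 1 = #|porbits s|)%N.
  have := porbits_mul_tperm s x y; rewrite /= -/u xy xny /= => cu.
  by apply: (@addIn 1); rewrite -addnA; exact: cu.
have xO : porbit u x \notin O.
  apply/negP; rewrite !inE => /and3P[Cy Cx /imsetP[z _ e]].
  by have := porbit_id u x; rewrite e -eq_porbit_mem => /eqP ex; rewrite e -ex eqxx in Cx.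
have eu : porbits u = (porbit u x |: O)%SET.
  apply: esym; apply/eqP; rewrite eqEcard; apply/andP; split.
    apply/fintype.subsetP => C; rewrite inE => /orP[|/Ou //].
    by rewrite inE => /eqP ->; rewrite imset_f.
  by rewrite cardsU1 xO /= add1n -(leq_add2r 1) cu -Oc addn1 addn2.
suff -> : A = porbit u x by [].
apply/eqP; rewrite eq_sym finset.eqEsubset porbit_sub_stable //=.
apply/fintype.subsetP => z zA; rewrite porbit_sym -eq_porbit_mem eq_sym.
have : porbit u z \in porbits u by rewrite imset_f.
rewrite eu inE inE => /orP[/eqP -> //|]; rewrite !inE => /and3P[Cy Cx /imsetP[w _ e]].
have := porbit_id u z; rewrite e -eq_porbit_mem => /eqP ez; rewrite e -ez !eq_porbit_mem in Cx Cy.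
by move: zA; rewrite inE (negPf Cx) (negPf Cy).
Qed.

(** Stated additively so that the truncated difference of multisets does not enter. *)
Lemma ctype_join s x y : x \notin porbit s y ->
  ctype (tperm x y * s) `+` [mset #|porbit s x|] `+` [mset #|porbit s y|] =
  ctype s `+` [mset (#|porbit s x| + #|porbit s y|)%N].
Proof.
move=> xy; apply/msetP => k; rewrite !msetE2 !ctypeE (porbits_join xy) !msetnE.
set A := porbit s x; set B := porbit s y; set O := (porbits s :\ A :\ B)%SET.
have AB : A != B by rewrite eq_porbit_mem.
have AO : A \in porbits s by rewrite imset_f.
have BO : B \in porbits s by rewrite imset_f.
have dAB : [disjoint A & B].
  apply/pred0P => z /=; apply/negbTE/negP => /andP[]; rewrite -!eq_porbit_mem => /eqP e1 /eqP e2.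
  by rewrite /A /B -e1 -e2 eqxx in AB.
have cAB : #|(A :|: B)%SET| = (#|A| + #|B|)%N.
  by apply/eqP; rewrite (leq_card_setU A B).2.
have UO : (A :|: B)%SET \notin O.
  apply/negP; rewrite !inE => /and3P[_ Cx /imsetP[z _ e]].
  have : x \in porbit s z by rewrite -e inE porbit_id.
  by rewrite -eq_porbit_mem => /eqP ez; rewrite e -ez eqxx in Cx.
have split1 (S : {set {set 'I_d}}) C : C \notin S ->
    #|[set C' in (C |: S)%SET | #|(C' : {set 'I_d})| == k]%SET| = ((#|C| == k) + #|[set C in S | #|(C : {set 'I_d})| == k]%SET|)%N.
  move=> CS; rewrite (cardsD1 C) !inE eqxx /=; congr (_ + _)%N; apply: eq_card => C'; rewrite !inE.
  by case: eqP => //= ->; rewrite (negPf CS).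
rewrite split1 // cAB -(finset.setD1K AO) split1 ?inE ?eqxx //.
have BO' : B \in (porbits s :\ A)%SET by rewrite !inE eq_sym AB.
rewrite -(finset.setD1K BO') split1 ?inE ?eqxx // -/O.
rewrite (eq_sym k #|A|) (eq_sym k #|B|) (eq_sym k (#|A| + #|B|)%N).
by case: (#|A| == k); case: (#|B| == k); case: ((#|A| + #|B|)%N == k); rewrite /=; lia.
Qed.

(** Undoing the transposition is a join, so only the two lengths are to be found. Upper bounds [r]
    and [k - r] suffice, because both orbits together cover the old one of [k] elements. *)
Lemma ctype_split s x r : (0 < r < #|porbit s x|)%N ->
  ctype (tperm x ((s ^+ r)%g x) * s) `+` [mset #|porbit s x|] =
  ctype s `+` [mset r] `+` [mset (#|porbit s x| - r)%N].
Proof.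
set k := #|porbit s x| => /andP[r0 rk]; set y := (s ^+ r)%g x; set u := (tperm x y * s)%g.
have inj a b : (a < k)%N -> (b < k)%N -> (s ^+ a)%g x = (s ^+ b)%g x -> a = b.
  move=> ak bk; rewrite !permX => e; have U := uniq_traject_porbit s x.
  apply/eqP; rewrite -(nth_uniq x _ _ U) ?size_traject //; by rewrite !nth_traject // e.
have sk : (s ^+ k)%g x = x by rewrite permX iter_porbit.
have xny : x != y.
  by apply/eqP => e; have := inj 0%N r; rewrite perm1 -/y => /(_ _ _ e); lia.
have yx : y \in porbit s x by exact: mem_porbit.
have cu := porbits_mul_tperm s x y; rewrite /= -/u xny porbit_sym yx /= in cu.
have tu : (tperm x y * u)%g = s by rewrite /u mulgA tperm2 mul1g.
have cs := porbits_mul_tperm u x y; rewrite /= tu xny in cs.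
have xyu : x \notin porbit u y.
  apply/negP => h; rewrite h in cs.
  move: (cs : (#|porbits s| + 0 = #|porbits u| + 1)%N) (cu : (#|porbits u| + 0 = #|porbits s| + 1)%N); lia.
have J := ctype_join xyu; rewrite tu in J.
have ux e : (e < k)%N -> e != 0%N -> e != r -> u ((s ^+ e)%g x) = (s ^+ e.+1)%g x.
  move=> ek e0 er; rewrite /u permM tpermD ?expgSr ?permM //.
    by apply/eqP => h; have := inj 0%N e; rewrite perm1 => /(_ _ _ h); lia.
  by apply/eqP => h; have := inj r e; move=> /(_ _ _ h); lia.
have imc (f : nat -> nat) n : (#|[set (s ^+ f (nat_of_ord e))%g x | e : 'I_n]%SET| <= n)%N.
  by apply: leq_trans (leq_imset_card _ _) _; rewrite card_ord.
have cy : (#|porbit u y| <= r)%N.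
  apply: leq_trans (imc S r); apply/subset_leq_card/porbit_sub_stable.
    have r1 : (r.-1 < r)%N by lia.
    by apply/imsetP; exists (Ordinal r1) => //=; rewrite prednK.
  move=> _ /imsetP[e _ ->]; have er := ltn_ord e.
  have [er1|er1] := eqVneq e.+1 r.
    rewrite er1 -/y /u permM tpermR; have r0' : (0 < r)%N by [].
    by apply/imsetP; exists (Ordinal r0') => //=; rewrite expg1.
  rewrite ux //; [|lia]; have er2 : (e.+1 < r)%N by lia.
  by apply/imsetP; exists (Ordinal er2).
have cx : (#|porbit u x| <= k - r)%N.
  apply: leq_trans (imc (fun e => r + e.+1)%N (k - r)%N); apply/subset_leq_card/porbit_sub_stable.
    have r1 : ((k - r).-1 < k - r)%N by lia.
    apply/imsetP; exists (Ordinal r1) => //=; rewrite -{1}sk; congr ((s ^+ _)%g x); lia.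
  move=> _ /imsetP[e _ ->]; have er := ltn_ord e.
  have [er1|er1] := eqVneq (r + e.+1)%N k.
    rewrite er1 sk /u permM tpermL /y; have r0' : (0 < k - r)%N by lia.
    by apply/imsetP; exists (Ordinal r0') => //=; rewrite -permM -expgSr addn1.
  rewrite ux; [|lia|lia|lia]; have er2 : (e.+1 < k - r)%N by lia.
  by rewrite -addnS; apply/imsetP; exists (Ordinal er2).
have sub : porbit s x \subset (porbit u x :|: porbit u y)%SET.
  have hx : (porbit u x :|: porbit u y)%SET \in porbits s.
    by rewrite -tu (porbits_join xyu) !inE eqxx.
  case/imsetP: hx => z _ e; have : x \in porbit s z by rewrite -e inE porbit_id.
  by rewrite -eq_porbit_mem => /eqP ez; rewrite e ez.
have := leq_trans (subset_leq_card sub) (leq_card_setU _ _).1; rewrite -/k => cxy.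
have ar a b : (a <= r)%N -> (b <= k - r)%N -> (k <= b + a)%N -> a = r /\ b = (k - r)%N by lia.
have [ey ex] := ar _ _ cy cx cxy.
move: J; rewrite ex ey => J; rewrite msetDAC J; congr (_ `+` [mset _]); lia.
Qed.

End OnePerm.
End CycleTypes.
End Cycle_types.
Import Cycle_types.

(** * Characters of one-row and two-row shapes *)

Module Two_row_characters.
Section TwoRowCharacters.
Local Open Scope ring_scope.
Local Notation young_char := Pilot.Defs.irr_char.

Section TwoRows.
Variables j i : nat.
Hypotheses (i0 : (0 < i)%N) (ij : (i <= j)%N).
Local Notation mu := [:: j; i].
Local Notation d := (sumn mu).
Local Notation G := [set: 'S_d]%G.
Local Notation aG := (regular_repr algC G).
Local Notation ell x := (delta_mx 0 (gring_index G x) : 'rV[algC]_#|G|).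

Lemma two_rows_index (k : 'I_d) : reshape_index mu k = (j <= k)%N :> nat.
Proof.
have kd : (k < j + i)%N by have := ltn_ord k; rewrite /=; lia.
have e1 : (k.+1 - j == 0)%N = (k < j)%N by rewrite subn_eq0.
have e2 : (k.+1 - j - i == 0)%N = true by rewrite -subnDA subn_eq0.
rewrite -[reshape_index mu k]/(if (k.+1 - j == 0)%N then 0%N else (if (k.+1 - j - i == 0)%N then 0%N else 1%N).+1).
by rewrite e1 e2; case: ltnP.
Qed.

Lemma two_rows_offset (k : 'I_d) : reshape_offset mu k = (k - (if j <= k then j else 0))%N.
Proof. by rewrite /reshape_offset two_rows_index; case: (j <= k)%N => /=; congr (_ - _)%N; lia. Qed.

Definition second_row : {set 'I_d} := [set k : 'I_d | (j <= k)%N]%SET.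

Lemma lt_first (k : 'I_i) : (k < d)%N. Proof. have := ltn_ord k; rewrite /= addn0; lia. Qed.
Lemma lt_second (k : 'I_i) : (j + k < d)%N. Proof. have := ltn_ord k; rewrite /= addn0; lia. Qed.
Definition first k : 'I_d := Ordinal (lt_first k).
Definition second k : 'I_d := Ordinal (lt_second k).

Lemma card_second_row : #|second_row| = i.
Proof.
rewrite -[RHS]card_ord -[RHS](card_imset _ (f := second)).
  apply: eq_card => k; rewrite inE; apply/idP/imsetP => [jk|[y _ ->]]; last exact: leq_addr.
  have kd : (k < j + i)%N by have := ltn_ord k; rewrite /=; lia.
  have ki : (k - j < i)%N by lia.
  by exists (Ordinal ki) => //; apply: ord_inj; rewrite /= subnKC.
by move=> y z /(congr1 val) /= /addnI e; apply/val_inj.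
Qed.

Lemma row_stab2 : row_stab mu = 'N(second_row | 'P)%g.
Proof.
apply/setP => s; rewrite inE; apply/forallP/astabsP => h k; have := h k.
  by rewrite !two_rows_index !inE /aperm; case: (j <= s k)%N; case: (j <= k)%N.
by rewrite !inE /aperm /= => e; rewrite !two_rows_index e.
Qed.

Local Notation y := (young_symmetrizer mu).

Lemma col_antisymmetric (t : 'S_d) : t \in col_stab mu -> odd_perm t -> y *m aG t = - y.
Proof.
rewrite inE => /forallP tC ot; rewrite /young_symmetrizer !mulmx_suml -sumrN; apply: eq_bigr => p _.
rewrite mulmx_suml -sumrN (reindex_inj (mulIg t^-1%g)) /=; apply: eq_big => q.
  rewrite !inE; apply: eq_forallb => k; rewrite permM.
  by have /eqP := tC ((t^-1)%g (q k)); rewrite permKV => ->.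
move=> _; rewrite -scalemxAl ellM mulgA mulgKV odd_permM odd_permV ot addbT signrN.
by rewrite scaleNr.
Qed.

(** Pigeonhole: fewer than [i] elements cannot meet the images under [x] of all [i] columns of
    height two. The transposition of a column that is missed fixes [X] after conjugation. *)
Lemma free_column (X : {set 'I_d}) (x : 'S_d) : (#|X| < i)%N ->
  exists t : 'S_d, [/\ t \in col_stab mu, odd_perm t & (t ^ x)%g \in 'N(X | 'P)%g].
Proof.
move=> Xi; have [/existsP[k /andP[ka kb]]|/existsPn h] := boolP [exists k, (x (first k) \notin X) && (x (second k) \notin X)].
  have ki := ltn_ord k.
  have ne : first k != second k by apply/eqP => /(congr1 val) /=; lia.
  have off : reshape_offset mu (first k) = reshape_offset mu (second k).
    rewrite !two_rows_offset /= leq_addr; case: (leqP j k) => ?; lia.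
  exists (tperm (first k) (second k)); split.
  - by rewrite inE; apply/forallP => z; case: tpermP => [->|->|//]; rewrite off.
  - by rewrite odd_tperm.
  rewrite tpermJ; apply/astabsP => z; rewrite /= /aperm.
  by case: tpermP => [->|->|//]; rewrite (negPf ka) (negPf kb).
pose g k := if x (first k) \in X then x (first k) else x (second k).
have gI : injective g.
  move=> a b; have := ltn_ord a; have := ltn_ord b; rewrite /g.
  by case: ifP => _; case: ifP => _ bi ai /perm_inj/(congr1 val) /= e; apply/val_inj => /=; lia.
have : (#|[set g k | k : 'I_i]%SET| <= #|X|)%N.
  apply/subset_leq_card/fintype.subsetP => _ /imsetP[k _ ->]; rewrite /g.
  by have := h k; rewrite negb_and !negbK; case: ifP.
by rewrite card_imset // card_ord leqNgt Xi.
Qed.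

(** The transposition given by [free_column] is absorbed by the sum over the stabiliser and changes
    the sign of the symmetrizer, so the product equals its opposite. *)
Lemma young_stab_sum (X : {set 'I_d}) (x : 'S_d) : (#|X| < i)%N ->
  y *m aG x *m (\sum_(h in 'N(X | 'P)%g) aG h) = 0.
Proof.
move=> /(free_column x)[t [tC ot tN]]; set N := \sum_(h in _) _; set v := y *m aG x *m N.
have eN : aG (t ^ x)%g *m N = N.
  rewrite /N mulmx_sumr [RHS](reindex_inj (mulgI (t ^ x)%g)); apply: eq_big => h.
    by rewrite groupMl.
  by move=> _; apply: esym; apply: (repr_mxM aG); exact: finset.in_setT.
have : v = - v.
  rewrite {1}/v -{1}eN !mulmxA -(mulmxA y) -repr_mxM ?finset.in_setT // conjgE mulgA mulgA mulgV mul1g.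
  by rewrite repr_mxM ?finset.in_setT // mulmxA col_antisymmetric // !mulNmx.
move=> e; have /eqP : v + v = 0 by rewrite {1}e addNr.
by rewrite -mulr2n -scaler_nat scaler_eq0 pnatr_eq0 /= => /eqP.
Qed.

Lemma irr_stab_sum (X : {set 'I_d}) : (#|X| < i)%N -> \sum_(h in 'N(X | 'P)%g) young_char mu h = 0.
Proof.
move=> Xi; pose U := cyclic_mx aG y; pose N := \sum_(h in 'N(X | 'P)%g) aG h.
have UN : U *m N = 0 by apply: cyclic_annihilated => x _; exact: young_stab_sum.
have BN : row_base U *m N = 0.
  have /submxP[W ->] : (row_base U <= U)%MS by rewrite eq_row_base.
  by rewrite -mulmxA UN mulmx0.
transitivity (\tr (row_base U *m N *m (invmx (row_ebase U) *m pid_mx (\rank U)))).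
  rewrite mulmx_sumr mulmx_suml raddf_sum; apply: eq_bigr => h _.
  by rewrite cfunE finset.in_setT mulr1n /= /submod_mx /in_submod /val_submod /= mul1mx.
by rewrite BN mul0mx mxtrace0.
Qed.

Lemma irr_coset_orthogonal (X : {set 'I_d}) : (#|X| < i)%N -> '[young_char mu, coset_char X] = 0.
Proof.
move=> Xi; rewrite cfdotE; apply/eqP; rewrite mulf_eq0; apply/orP; right; apply/eqP.
transitivity (\sum_(Y : {set 'I_d} | #|Y| == #|X|) \sum_(h in 'N(Y | 'P)%g) young_char mu h).
  under [RHS]eq_bigr do rewrite big_mkcond.
  rewrite exchange_big /=; apply: eq_big => [h|h _]; first by rewrite !inE.
  have e : (coset_char X h)^* = \sum_(Y : {set 'I_d} | #|Y| == #|X|) (h \in 'N(Y | 'P)%g)%:R.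
    have s1 (T : finType) (A : {set T}) : #|A|%:R = \sum_(a in A) 1 :> algC by rewrite -sum1_card natr_sum.
    rewrite (coset_charE X h) conjC_nat s1 [LHS]big_mkcond [RHS]big_mkcond /=.
    by apply: eq_bigr => Y _; rewrite inE mem_stab; case: (#|Y| == _); case: (_ == Y).
  rewrite e mulr_sumr; apply: eq_bigr => Y _.
  by case: (h \in _); rewrite ?mulr1 ?mulr0.
by rewrite big1 // => Y /eqP YX; rewrite irr_stab_sum // YX.
Qed.

(** The symmetrizer lies in the right ideal generated by the sum over the row stabiliser, and
    Maschke's theorem supplies a complement. *)
Lemma coset_char_split : exists2 phi : 'CF(G), phi \is a character & coset_char second_row = young_char mu + phi.
Proof.
pose M := cyclic_mx aG (set_sum 'N(second_row | 'P)%g); pose S := cyclic_mx aG y.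
have modM : mxmodule aG M := cyclic_mx_module _ _; have modS : mxmodule aG S := cyclic_mx_module _ _.
have SM : (S <= M)%MS.
  apply: cyclic_mx_sub => //; rewrite /young_symmetrizer exchange_big summx_sub // => q _.
  rewrite -scaler_sumr scalemx_sub // row_stab2.
  rewrite (_ : \sum_(p in _) _ = set_sum 'N(second_row | 'P)%g *m aG q).
    apply: submx_trans (mxmoduleP modM q (finset.in_setT q)); exact: submxMr (cyclic_mx_id _ _).
  by rewrite mulmx_suml; apply: eq_bigr => p _; rewrite ellM.
have [W modW defM dx] := mx_reducibleS modM (submx1 M) (mx_Maschke_pchar aG (algC'G_pchar G)) modS SM.
exists (cfRepr (submod_repr modW)); first exact: cfRepr_char.
apply/cfun_inP => g Gg; rewrite !cfunE Gg !mulr1n.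
by rewrite -(mxtrace_dadd_mod modS modW modM defM dx).
Qed.

(** The identity has coefficient 1 in the symmetrizer, because a row permutation and a column
    permutation are inverse to each other only if both are trivial. *)
Lemma irr_char_nonzero : young_char mu != 0.
Proof.
apply/eqP => e; have := cfRepr1 (submod_repr (cyclic_mx_module aG y)); rewrite -/(young_char mu) e cfunE => /eqP.
rewrite eq_sym pnatr_eq0 mxrank_eq0 cyclic_mx_eq0 => /eqP /(congr1 (fun v : 'rV_#|G| => v 0 (gring_index G 1%g))).
rewrite /young_symmetrizer mxE summxE (bigD1 1%g) /=; last by rewrite inE; apply/forallP => k; rewrite perm1.
have key0 (a b : nat) : (b - (if j <= b then j else 0) = a - (if j <= a then j else 0))%N ->
    nat_of_bool (j <= a)%N = (j <= b)%N -> a = b.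
  by case: (leqP j a) => ?; case: (leqP j b) => ? //=; lia.
have key p q : p \in row_stab mu -> q \in col_stab mu -> (p * q)%g = 1%g -> p = 1%g.
  rewrite !inE => /forallP hp /forallP hq pq; apply/permP => k; rewrite perm1; apply/val_inj => /=.
  have /eqP := hp k; have /eqP := hq (p k); rewrite -permM pq perm1 !two_rows_offset !two_rows_index.
  exact: key0.
have ent p q : ((-1) ^+ odd_perm q *: ell (p * q)%g) 0 (gring_index G 1%g) =
    if (p * q == 1)%g then (-1) ^+ odd_perm q else 0 :> algC.
  rewrite mxE mxE eqxx /= (inj_in_eq (can_in_inj (@gring_indexK _ G))) ?finset.in_setT // eq_sym.
  by case: eqP; rewrite ?mulr1 ?mulr0.
rewrite summxE (bigD1 1%g) /=; last by rewrite inE; apply/forallP => k; rewrite perm1.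
rewrite ent mulg1 eqxx odd_perm1 expr0 big1 => [|q /andP[_ q1]]; last by rewrite ent mul1g (negPf q1).
rewrite addr0 big1 => [/eqP|p /andP[pR p1]]; first by rewrite addr0 oner_eq0.
rewrite summxE big1 // => q qC; rewrite ent; case: eqP => // pq.
by rewrite (key p q) ?eqxx in p1.
Qed.

(** The squared norm of the difference of both sides is 1 - x - 2 p, where x is the squared norm of
    the character, at least 1, and p its product with the complement [phi], at least 0. Hence it
    vanishes, without irreducibility being known beforehand. *)
Lemma irr_char2 (X : {set 'I_d}) : #|X| = i.-1 -> young_char mu = coset_char second_row - coset_char X.
Proof.
move=> Xi; have [phi Nphi e] := coset_char_split.
have Nchi : young_char mu \is a character by exact: cfRepr_char.
have dj : d = (j + i)%N by rewrite /= addn0.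
have cs := card_second_row; set t1 := coset_char second_row; set t0 := coset_char X; set c := young_char mu.
have n11 : '[t1, t1] = i.+1%:R by rewrite coset_char_dot cs ?minnn ?dj //; lia.
have n00 : '[t0, t0] = i%:R by rewrite coset_char_dot Xi ?minnn ?prednK ?dj //; lia.
have n10 : '[t1, t0] = i%:R by rewrite coset_char_dot cs Xi ?dj; [rewrite (minn_idPr _) ?prednK ?leq_pred|lia].
have n01 : '[t0, t1] = i%:R by rewrite cfdotC n10 conjC_nat.
have c0 : '[c, t0] = 0 by rewrite irr_coset_orthogonal // Xi; lia.
have c0' : '[t0, c] = 0 by rewrite cfdotC c0 conjC0.
have c1 : '[c, t1] = '[c, c] + '[c, phi] by rewrite {1}/t1 e cfdotDr.
have c1' : '[t1, c] = '[c, c] + '[c, phi].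
  by rewrite cfdotC c1 conj_natr // rpredD // Cnat_cfdot_char.
have x1 : 1 <= '[c, c].
  have /natrP[n en] := Cnat_cfdot_char Nchi Nchi; rewrite -/c in en; rewrite en ler1n lt0n.
  by apply: contraNneq irr_char_nonzero => n0; rewrite -cfnorm_eq0 -/c en n0.
have p0 : 0 <= '[c, phi] by rewrite natr_ge0 // Cnat_cfdot_char.
apply/eqP; rewrite -subr_eq0 -cfnorm_eq0 -/c -/t1 -/t0 eq_le cfnorm_ge0 andbT.
rewrite !(cfdotBl, cfdotBr) n11 n00 n10 n01 c0 c0' c1 c1' -natr1.
move: '[c, c] '[c, phi] x1 p0 => x p x1 p0.
have -> : x - (x + p - 0) - (x + p - (i%:R + 1 - i%:R) - (0 - (i%:R - i%:R))) = 1 - x - p *+ 2 by ring.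
by rewrite subr_le0 (le_trans (y := 0)) ?subr_le0 ?mulrn_wge0.
Qed.

Lemma irr_char2E (g : 'S_d) : young_char mu g = #|fixed_sets i g|%:R - #|fixed_sets i.-1 g|%:R.
Proof.
have k0 : first (Ordinal i0) \notin second_row by rewrite inE /= -ltnNge; lia.
have s0 : second (Ordinal i0) \in second_row by rewrite inE /= leq_addr.
have Xi : #|(second_row :\ second (Ordinal i0))%SET| = i.-1.
  have := cardsD1 (second (Ordinal i0)) second_row; rewrite s0 card_second_row => e.
  by rewrite [X in _ = X.-1]e.
transitivity (coset_char second_row g - coset_char (second_row :\ second (Ordinal i0))%SET g).
  by rewrite (irr_char2 Xi) [LHS]cfunE; congr (_ + _); rewrite [LHS]cfunE.
by rewrite !coset_charE Xi card_second_row.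
Qed.
End TwoRows.

Lemma irr_char1E k (g : 'S_(sumn [:: k])) : young_char [:: k] g = 1.
Proof.
have off (x : 'I_(sumn [:: k])) : reshape_index [:: k] x = 0%N /\ reshape_offset [:: k] x = x.
  have kd : (x < k)%N by have := ltn_ord x; rewrite /=; lia.
  suff e : reshape_index [:: k] x = 0%N by rewrite /reshape_offset e /= subn0.
  rewrite -[LHS]/(if (x.+1 - k == 0)%N then 0%N else 1%N).
  by rewrite subn_eq0 kd.
have eR : row_stab [:: k] = [set: 'S_(sumn [:: k])]%SET.
  by apply/setP => s; rewrite !inE; apply/forallP => x; rewrite !(off _).1.
have eC : col_stab [:: k] = [set 1%g]%SET.
  apply/setP => s; rewrite !inE; apply/forallP/eqP => [h|-> x]; last by rewrite perm1.
  by apply/permP => x; rewrite perm1; apply/val_inj; have /eqP := h x; rewrite !(off _).2.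
have ey : young_symmetrizer [:: k] = set_sum [set: 'S_(sumn [:: k])]%G.
  rewrite /young_symmetrizer eR eC; apply: eq_bigr => p _.
  by rewrite big_set1 odd_perm1 expr0 scale1r mulg1.
rewrite cfunE finset.in_setT mulr1n ey coset_trace.
rewrite (_ : [set x | _]%SET = [set: 'S_(sumn [:: k])]%SET); last by apply/setP => x; rewrite !inE.
by rewrite mulfV // pnatr_eq0 -lt0n cardsT; apply/card_gt0P; exists 1%g.
Qed.
End TwoRowCharacters.
End Two_row_characters.
Import Two_row_characters.

(** * From the characters to the operators of one and two rows *)

Module Two_row_operators.
Section TwoRowOperators.
Local Open Scope ring_scope.
Local Notation young_char := Pilot.Defs.irr_char.

Lemma subsums_sets (T : finType) (w : T -> nat) (t : seq T) i : uniq t ->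
  #|[set P : {set T} | (P \subset t) && (\sum_(C in P) w C == i)%N]%SET| = subsums i (map w t).
Proof.
elim: t i => [|c t IH] i /=.
  move=> _; rewrite (_ : [set P : {set T} | _]%SET = if i == 0%N then [set finset.set0]%SET else finset.set0).
    by case: eqP; rewrite ?cards1 ?cards0.
  apply/setP => P; rewrite inE; have [->|P0] := eqVneq P finset.set0.
    have -> : (finset.set0 : {set T}) \subset ([::] : seq T) by apply/fintype.subsetP => x; rewrite inE.
    by rewrite big_set0 eq_sym; case: eqP; rewrite !inE ?eqxx.
  rewrite (_ : (P \subset [::]) = false); last first.
    by apply/negbTE; apply: contra P0 => /fintype.subsetP h; apply/eqP/setP => x; rewrite inE; apply/negbTE/negP => /h.
  by case: ifP; rewrite !inE ?(negPf P0).
case/andP => ct ut; rewrite -!IH //; set S := [set P : {set T} | _]%SET.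
rewrite -(cardsID [set P : {set T} | c \in P]%SET S) addnC; congr (_ + _)%N.
  apply: eq_card => P; rewrite !inE andbC -andbA; apply/andP/andP => [[h /andP[e /negP cP]]|[h e]]; last first.
    have cP : c \notin P by apply: contra ct => /(fintype.subsetP h).
    by split; [apply/fintype.subsetP => x /(fintype.subsetP h); rewrite inE orbC => ->|rewrite e cP].
  split=> //; apply/fintype.subsetP => x xP; have := fintype.subsetP h x xP; rewrite inE => /orP[/eqP xc|//].
  by rewrite -xc xP in cP.
have sumU (P : {set T}) : c \notin P -> (\sum_(C in c |: P) w C = w c + \sum_(C in P) w C)%N.
  by move=> cP; rewrite big_setU1.
case: ifP => wi; last first.
  apply: eq_card0 => P; rewrite !inE; apply/negbTE/negP => /andP[/andP[_ /eqP e] cP].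
  by move: wi; rewrite -e (big_setD1 c cP) leq_addr.
rewrite -[RHS](card_in_imset (f := fun P => (c |: P)%SET)); last first.
  move=> P Q; rewrite !inE => /andP[/fintype.subsetP hP _] /andP[/fintype.subsetP hQ _] /setP e; apply/setP => x.
  have := e x; rewrite !inE; case: eqP => [-> _|//].
  by apply/idP/idP => [/hP|/hQ] h; rewrite h in ct.
apply: eq_card => P; rewrite !inE; apply/andP/imsetP => [[/andP[/fintype.subsetP h /eqP e] cP]|[Q]].
  exists (P :\ c)%SET; last by rewrite finset.setD1K.
  rewrite inE; apply/andP; split; last by rewrite -e (big_setD1 c cP) addKn.
  apply/fintype.subsetP => x; rewrite !inE => /andP[xc /h]; by rewrite inE (negPf xc).
rewrite inE => /andP[/fintype.subsetP h /eqP e] ->; rewrite !inE eqxx; split=> //; apply/andP; split.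
  apply/fintype.subsetP => x; rewrite !inE => /orP[-> //|/h ->]; by rewrite orbT.
have cQ : c \notin Q by apply: contra ct => /h.
by rewrite sumU // e subnKC.
Qed.

Lemma trivIset_porbits d (s : 'S_d) : finset.trivIset (porbits s).
Proof.
apply/finset.trivIsetP => _ _ /imsetP[x _ ->] /imsetP[y _ ->] ne; apply/pred0P => z /=.
apply/negbTE/negP => /andP[]; rewrite -!eq_porbit_mem => /eqP e1 /eqP e2.
by rewrite -e1 -e2 eqxx in ne.
Qed.

(** An invariant set is the union of the cycles that it contains, so it amounts to a choice of
    cycles with total length [i]. *)
Lemma card_fixed_sets d i (s : 'S_d) : #|fixed_sets i s| = subsums i (cycle_type s).
Proof.
have pe : perm_eq (cycle_type s) (map (fun C : {set 'I_d} => #|C|) (enum (porbits s))).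
  by rewrite /cycle_type perm_sort.
rewrite (subsums_perm _ pe) -subsums_sets ?enum_uniq //.
rewrite -[RHS](card_in_imset (f := fun P : {set {set 'I_d}} => finset.cover P)); last first.
  have rec (P : {set {set 'I_d}}) : P \subset porbits s -> P = [set C in porbits s | C \subset finset.cover P]%SET.
    move=> /fintype.subsetP h; apply/setP => C; rewrite inE; apply/idP/andP => [CP|[CO Cc]].
      by split; [exact: h|exact: (finset.bigcup_max C)].
    case/imsetP: CO Cc => x _ -> /fintype.subsetP /(_ x (porbit_id s x)) /finset.bigcupP[D DP xD].
    have /imsetP[z _ eD] := h D DP; move: xD DP; rewrite eD -eq_porbit_mem => /eqP -> //.
  have sub P : (P \subset enum (porbits s)) = (P \subset porbits s) by apply: eq_subset_r => C; rewrite mem_enum.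
  move=> P Q; rewrite !inE !sub => /andP[hP _] /andP[hQ _] e.
  by rewrite (rec P hP) (rec Q hQ) e.
have st x z : z \in porbit s x -> s z \in porbit s x.
  by rewrite -!eq_porbit_mem => /eqP <-; have := porbit_perm s 1 z; rewrite expg1 => ->.
apply: eq_card => X; rewrite !inE; apply/andP/imsetP => [[/eqP Xi /eqP sX]|[P]].
  pose P := [set C in porbits s | C \subset X]%SET.
  have cP : finset.cover P = X.
    apply/setP => x; apply/finset.bigcupP/idP => [[C]|xX]; first by rewrite inE => /andP[_ /fintype.subsetP h /h].
    exists (porbit s x); last exact: porbit_id.
    rewrite inE imset_f //= porbit_sub_stable // => z zX; by rewrite -sX imset_f.
  exists P => //; rewrite inE; apply/andP; split.
    by apply/fintype.subsetP => C; rewrite inE mem_enum => /andP[].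
  have tP : finset.trivIset P.
    by apply: (finset.trivIsetS _ (trivIset_porbits s)); apply/fintype.subsetP => C; rewrite inE => /andP[].
  by rewrite (eqP (tP : _ == _)) cP Xi.
rewrite inE => /andP[hP /eqP e] ->.
have hP' : P \subset porbits s by rewrite -(eq_subset_r (mem_enum _)).
have tP : finset.trivIset P by exact: (finset.trivIsetS hP' (trivIset_porbits s)).
split; first by rewrite -(eqP (tP : _ == _)) e.
rewrite eqEcard card_imset ?leqnn ?andbT; last exact: perm_inj.
apply/fintype.subsetP => _ /imsetP[x /finset.bigcupP[C CP xC] ->]; apply/finset.bigcupP; exists C => //.
by case/imsetP: (fintype.subsetP hP' C CP) xC => z _ ->; exact: st.
Qed.

(** Starting from the identity, a part [b > 1] is obtained by joining a fixed point to a cycle of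
    length [b - 1]; breaking [b] this way lengthens the list, which bounds the induction. *)
Lemma exists_ctype d (la : seq nat) : 0%N \notin la -> sumn la = d -> exists s : 'S_d, ctype s = seq_mset la.
Proof.
have [n] := ubnP (d - size la)%N; elim: n la => // n IH la lan la0 sla.
have sz (l : seq nat) : 0%N \notin l -> (size l <= sumn l)%N.
  elim: l => //= a l IHl; rewrite inE negb_or => /andP[a0 /IHl]; lia.
have [/hasP[b bla b2]|/hasPn h] := boolP (has (fun b => 1 < b)%N la); last first.
  have el : la = nseq d 1%N.
    have a1 : all (pred1 1%N) la by apply/allP => b bla /=; have := h b bla; case: b bla => [|[]] // z; rewrite z in la0.
    have e := all_pred1P _ _ a1.
    by rewrite -sla [in RHS]e sumn_nseq mul1n.
  have one x : #|porbit (1 : 'S_d) x| = 1%N.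
    rewrite (_ : porbit _ x = [set x]%SET) ?cards1 //; apply/setP => z; rewrite inE.
    apply/porbitP/eqP => [[k ->]|->]; first by rewrite expg1n perm1.
    by exists 0%N; rewrite perm1.
  exists 1%g; apply/msetP => k; rewrite mset_seqE el count_nseq /=.
  case: k => [|k]; first by rewrite ctype0.
  have := card_porbit_eq (1 : 'S_d) k.+1.
  rewrite (_ : [set x | _]%SET = if k == 0%N then [set: 'I_d]%SET else finset.set0); last first.
    by apply/setP => x; rewrite inE one eqSS eq_sym; case: (k == 0%N); rewrite !inE.
  by case: k => [|k] /=; rewrite ?cardsT ?cards0 ?card_ord; move: (ctype _ _) => c; nia.
have p := perm_to_rem bla; set r := rem b la in p.
have br0 : 0%N \notin r by apply: contra la0 => /mem_rem.
have sr : (b + sumn r)%N = d by rewrite -sla (sumn_perm p).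
have sizer : size la = (size r).+1 by rewrite (perm_size p).
have [|||s es] := IH (1 :: b.-1 :: r)%N.
- have arith (D B S R N L : nat) : (D - L < N.+1 -> L = R.+1 -> B + S = D -> 1 < B -> R <= S -> D - R.+2 < N)%N by lia.
  exact: (arith _ _ _ _ _ _ lan sizer sr b2 (sz _ br0)).
- by rewrite !inE !negb_or br0 andbT; lia.
- by rewrite /= -sr; lia.
have c1 : (0 < ctype s 1%N)%N by rewrite es mset_seqE /=; lia.
have /card_gt0P[x] : (0 < #|[set x | #|porbit s x| == 1%N]%SET|)%N by rewrite card_porbit_eq mul1n.
rewrite inE => /eqP px.
have /card_gt0P[y] : (0 < #|([set y | #|porbit s y| == b.-1]%SET :\ x)%SET|)%N.
  have := cardsD1 x [set y | #|porbit s y| == b.-1]%SET; rewrite card_porbit_eq es mset_seqE inE px /= eqxx.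
  move: #|_| (count_mem _ _) => u v; case: (eqVneq 1%N b.-1) => [<-|] /=; rewrite ?mul1n; nia.
rewrite !inE => /andP[yx /eqP py].
have xy : x \notin porbit s y.
  rewrite porbit_sym; move/eqP/cards1P: px => [z ez]; rewrite ez inE.
  by have := porbit_id s x; rewrite ez inE => /eqP <-.
exists (tperm x y * s)%g; have := ctype_join xy; rewrite px py es.
have /eq_seq_msetP -> := p; move=> /msetP e; apply/msetP => k; have := e k.
rewrite !msetE2 !msetnE !mset_seqE /= (_ : (1 + b.-1)%N = b); last lia.
rewrite (eq_sym k 1%N) (eq_sym k b.-1) (eq_sym k b); move: (ctype (tperm x y * s)%g k) (count _ r) => u v.
by case: (1%N == k); case: (b.-1 == k); case: (b == k); rewrite /=; lia.
Qed.

(** [chi] picks some permutation of the given type and defaults to 0, so what has to be known is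
    that a permutation of this type exists. *)
Lemma chiE mu (f : seq nat -> algC) la : (forall s : 'S_(sumn mu), young_char mu s = f (cycle_type s)) ->
  is_part la -> sumn la = sumn mu -> chi mu la = f la.
Proof.
move=> h /andP[sla la0] /(exists_ctype la0)[s es]; rewrite /chi.
case: pickP => [t /eqP <-|/(_ s)]; first exact: h.
suff -> : cycle_type s = la by rewrite eqxx.
apply: (@sorted_eq _ geq) => //.
- by move=> a b c; rewrite /geq /= => ba ac; exact: leq_trans ac ba.
- by move=> a b; rewrite /geq /= => /andP[? ?]; apply/eqP; rewrite eqn_leq; apply/andP.
- by apply: sort_sorted => a b; rewrite /geq /=; exact: leq_total.
by apply/eq_seq_msetP; rewrite -es ctype_cycle_type.
Qed.

Lemma Dop_row k (F : fps_ring) : Dop [:: k] F = rowsum k F.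
Proof.
rewrite Dop_dsum /rowsum (_ : sumn [:: k] = k); last exact: addn0.
apply: dsum_eq => la p s; apply: (@chiE _ (fun=> 1)) => //; last by rewrite /= addn0.
exact: irr_char1E.
Qed.

(** The Jacobi-Trudi determinant for two rows: the character is a difference of two subset counts,
    and each count is a product of two row operators. *)
Lemma Dop_two_rows j i (F : fps_ring) : (0 < i <= j)%N ->
  Dop [:: j; i] F = rowsum j (rowsum i F) - rowsum j.+1 (rowsum i.-1 F).
Proof.
case/andP=> i0 ij; have si : sumn [:: j; i] = (j + i)%N by rewrite /= addn0.
rewrite Dop_dsum si (dsum_eq (g := fun la => (subsums i la)%:R - (subsums i.-1 la)%:R)); last first.
  move=> la p s; apply: (@chiE _ (fun la => (subsums i la)%:R - (subsums i.-1 la)%:R)) => //; last by rewrite si.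
  by move=> g; rewrite (irr_char2E i0 ij) !card_fixed_sets.
rewrite dsum_sub !dsum_subsums; try lia.
by congr (_ - _); congr (rowsum _ _); lia.
Qed.
End TwoRowOperators.
End Two_row_operators.
Import Two_row_operators.

(** * The cut-and-join equation for a single permutation *)

Module Cut_and_join.
Section CutAndJoin.
Local Open Scope ring_scope.
Local Open Scope mset_scope.

(* The operator CJ2 only involves coefficients of the same weight and of the same degree in beta. *)
Definition CJ2_terms (m : monomial) : seq (nat * monomial) :=
  flatten [seq [seq ((i * (k - i) * ((m `\ k) i).+1 * ((m `\ k `+` [mset i]) (k - i)%N).+1)%N,
                      m `\ k `+` [mset i] `+` [mset (k - i)%N]) | i <- index_iota 1 k]
          | k <- iota 0 (wt m).+1 & (0 < k)%N && (k \in m)] ++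
  flatten [seq [seq (((i + j) * ((m `\ i `\ j) (i + j)%N).+1)%N, m `\ i `\ j `+` [mset (i + j)%N])
               | j <- iota 0 (wt (m `\ i)).+1 & (0 < j)%N && (j \in m `\ i)]
          | i <- iota 0 (wt m).+1 & (0 < i)%N && (i \in m)].

Lemma CJ2E (F : fps_ring) m : CJ2 F m = \sum_(t <- CJ2_terms m) t.1%:R * F t.2.
Proof.
rewrite /CJ2 fps_addE big_cat; congr (_ + _).
  rewrite /psum -[X in \sum_(n < X | _) _]/(_) -(big_mkord (fun n => (0 < n)%N && (n \in m)) (fun n => (\sum_(1 <= i < n) D i (D (n - i) F)) (m `\ n))).
  rewrite big_flatten big_map big_filter /index_iota subn0; apply: eq_bigr => k _.
  rewrite fps_sumE big_map; apply: eq_bigr => i _; rewrite !DE /= mulrA -natrM; congr (_%:R * _); lia.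
rewrite /psum -(big_mkord (fun n => (0 < n)%N && (n \in m)) (fun n => (psum (fun j => D (n + j) F)) (m `\ n))).
rewrite big_flatten big_map big_filter /index_iota subn0; apply: eq_bigr => i _.
rewrite /psum -(big_mkord (fun n => (0 < n)%N && (n \in m `\ i)) (fun n => (D (i + n) F) (m `\ i `\ n))).
by rewrite big_map big_filter /index_iota subn0; apply: eq_bigr => j _; rewrite DE.
Qed.

Lemma wt_sub m k : k \in m -> (wt (m `\ k) + k)%N = wt m.
Proof. by move=> km; rewrite -wt_add msetDC msetB1K. Qed.

Lemma mset1_pos a : (0 < a)%N -> ([mset a] : monomial) 0%N = 0%N.
Proof. by rewrite msetnE; case: a. Qed.

Lemma CJ2_terms_same m t : t \in CJ2_terms m -> wt t.2 = wt m /\ t.2 0%N = m 0%N.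
Proof.
rewrite mem_cat => /orP[] /flatten_mapP[k]; rewrite mem_filter => /andP[/andP[k0 km] _].
  case/mapP=> i; rewrite mem_index_iota => /andP[i1 ik] -> /=.
  rewrite !wt_add -addnA subnKC ?(ltnW ik) // wt_sub //; split=> //.
  by rewrite !msetE2 !mset1_pos ?subn_gt0 // subn0 !addn0.
case/mapP=> j; rewrite mem_filter => /andP[/andP[j0 jm] _] -> /=.
rewrite !wt_add [(k + j)%N]addnC addnA wt_sub // wt_sub //; split=> //.
by rewrite !msetE2 !mset1_pos ?addn_gt0 ?j0 // !subn0 addn0.
Qed.

Lemma sum_antidiagonal (V : nmodType) (T : nat -> nat -> V) M N :
  (forall i j, i = 0%N \/ j = 0%N -> T i j = 0) ->
  (forall i j, (M <= i)%N \/ (M <= j)%N \/ (N <= i + j)%N -> T i j = 0) ->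
  \sum_(i < M) \sum_(j < M) T i j = \sum_(k < N) \sum_(1 <= i < k) T i (k - i)%N.
Proof.
move=> T0 TN.
have ext n L (F : nat -> V) : (n <= L)%N -> (forall a, (n <= a)%N -> F a = 0) -> \sum_(a < n) F a = \sum_(a < L) F a.
  move=> nL F0; rewrite -(big_mkord xpredT) -[RHS](big_mkord xpredT) [RHS](big_cat_nat (n := n)) //=.
  have -> : \sum_(n <= a < L) F a = 0 by rewrite big_nat big1 // => a /andP[na _]; exact: F0.
  by rewrite addr0.
have pick n (x : nat) (v : V) : \sum_(k < n) (if x == k :> nat then v else 0) = if (x < n)%N then v else 0.
  case: ltnP => h; last by rewrite big1 // => k _; case: eqP => // e; have := ltn_ord k; lia.
  rewrite (bigD1 (Ordinal h)) //= eqxx big1 ?addr0 // => k; rewrite -val_eqE /= eq_sym => /negPf -> //.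
transitivity (\sum_(k < N) \sum_(i < M) \sum_(j < M) (if (i + j)%N == k :> nat then T i j else 0)).
  rewrite [RHS]exchange_big /=; apply: eq_bigr => i _; rewrite [RHS]exchange_big /=; apply: eq_bigr => j _.
  by rewrite pick; case: ltnP => // h; apply: TN; right; right.
apply: eq_bigr => k _; pose U i := if (0 < i < k)%N then T i (k - i)%N else 0.
transitivity (\sum_(i < M) U i).
  apply: eq_bigr => i _.
  rewrite (eq_bigr (fun j : 'I_M => if (k - i)%N == j :> nat then U i else 0)); last first.
    move=> j _; rewrite /U; case: (ltnP 0 i) => i0; last first.
      by rewrite T0 ?if_same //; left; apply/eqP; rewrite -leqn0.
    case: (ltnP i k) => ik /=; last first.
      rewrite if_same; case: eqP => // e; apply: T0; right; apply/eqP; rewrite -(eqn_add2l i) addn0 eqn_leq; apply/andP; split; lia.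
    have -> : ((i + j)%N == k) = ((k - i)%N == j) by apply/eqP/eqP; lia.
    by case: eqP => // ->.
  rewrite pick; case: ltnP => // h; rewrite /U; case: ifP => // _; by rewrite TN //; right; left.
rewrite (ext M (M + k)%N) ?leq_addr //; last first.
  by move=> a Ma; rewrite /U; case: ifP => // _; apply: TN; left.
rewrite -(ext k (M + k)%N) ?leq_addl //; last first.
  by move=> a ka; rewrite /U ltnNge [(a < k)%N]ltnNge ka andbF.
rewrite -(big_mkord xpredT U); have [k0|k0] := posnP k; first by rewrite !big_geq ?k0.
rewrite [LHS]big_ltn // (_ : U 0%N = 0) // add0r; apply: eq_big_nat => i hi; by rewrite /U hi.
Qed.

Lemma mset_addI (a b e : monomial) : (a `+` e == b `+` e) = (a == b).
Proof.
by apply/eqP/eqP => [/msetP h|-> //]; apply/msetP => k; have := h k; rewrite !msetE2 => /addIn.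
Qed.

Lemma join_mem (m n : monomial) i j : (0 < i)%N -> (0 < j)%N ->
  m `+` [mset i] `+` [mset j] = n `+` [mset (i + j)%N] -> (i + j)%N \in m.
Proof.
move=> i0 j0 /msetP/(_ (i + j)%N); rewrite !msetE2 !msetnE eqxx -mset_gt0.
by move: (m _) (n _) => u v; case: eqP => ?; case: eqP => ?; lia.
Qed.

Lemma split_mem (m n : monomial) i j : (0 < i)%N -> (0 < j)%N ->
  n `+` [mset i] `+` [mset j] = m `+` [mset (i + j)%N] -> i \in m /\ j \in m `\ i.
Proof.
move=> i0 j0 /msetP e; have := e j; have := e i; rewrite -!mset_gt0 !msetE2 !msetnE !eqxx.
case: (eqVneq i j) => [<-|ij].
  by move: (m i) (n i) => u v; case: eqP => ? /=; lia.
rewrite ?(eq_sym j i) ?(negPf ij); move: (m i) (n i) (m j) (n j) => u v u' v'.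
by do 2 case: eqP => ? /=; lia.
Qed.

Lemma join_eq (m n : monomial) i j k : k \in m ->
  (m `+` [mset i] `+` [mset j] == n `+` [mset k]) = (n == m `\ k `+` [mset i] `+` [mset j]).
Proof.
move=> km; rewrite -{1}(msetB1K km) eq_sym -[in RHS](mset_addI n _ [mset k]); congr (_ == _).
by rewrite -!msetDA [LHS]msetDC !msetDA.
Qed.

Lemma split_eq (m n : monomial) i j : i \in m -> j \in m `\ i ->
  (n `+` [mset i] `+` [mset j] == m `+` [mset (i + j)%N]) = (n == m `\ i `\ j `+` [mset (i + j)%N]).
Proof.
move=> im jm; rewrite -{1}(msetB1K im) -{1}(msetB1K jm).
rewrite -[in RHS](mset_addI n _ [mset i]) -[in RHS](mset_addI (n `+` [mset i]) _ [mset j]); congr (_ == _).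
have ac (a b e f : monomial) : a `+` (b `+` e) `+` f = e `+` f `+` a `+` b.
  by apply/msetP => x; rewrite !msetE2; move: (a x) (b x) (e x) (f x) => *; lia.
exact: ac.
Qed.

Lemma join_arith i j a b (e : bool) : (e -> i = j /\ a = b) ->
  (i * (a + 1 + e) * (j * (b + e + 1 - e)) = i * a.+1 * (j * (b + e).+1))%N.
Proof. by case: e => [/(_ isT)[-> ->]|_]; rewrite /= ?addnK ?addn0 ?subn0; ring. Qed.

Section Perm.
Variables (d r : nat).
Implicit Types s t : 'S_d.

(* A monomial of the permutation s, weighted by beta^r. *)
Definition cmonom s : monomial := ctype s `+` seq_mset (nseq r 0%N).

Lemma cmonom_pos s k : (0 < k)%N -> cmonom s k = ctype s k.
Proof. by case: k => // k _; rewrite msetE2 mset_seqE count_nseq /= mul0n addn0. Qed.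

Definition indicator s : fps_ring := fun m => (cmonom s == m)%:R.

Lemma card_porbit_le s x : (0 < #|porbit s x| <= d)%N.
Proof.
by rewrite lt0n card_porbit_neq0 -[X in (_ <= X)%N]card_ord max_card.
Qed.

(** Ordered pairs are sorted by cycles. Two distinct cycles of lengths i and j are joined, with c_j
    - [i = j] choices for the second one; within a cycle of length k, the point [s ^+ q] of [x] cuts
    it into q and k - q. The conditions [J] and [P] are written additively, and ordered pairs
    account for the factor two in [CJ2]. *)
Lemma cut_and_join s (m : monomial) :
  \sum_x \sum_(y | x != y) (cmonom (tperm x y * s)%g == m)%:R = CJ2 (indicator s) m.
Proof.
set n := cmonom s; pose c i := ctype s i; pose Z : monomial := seq_mset (nseq r 0%N).
have nE k : (0 < k)%N -> n k = c k by exact: cmonom_pos.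
pose J i j : algC := (m `+` [mset i] `+` [mset j] == n `+` [mset (i + j)%N])%:R.
pose P i j : algC := (n `+` [mset i] `+` [mset j] == m `+` [mset (i + j)%N])%:R.
have joinE x y : x \notin porbit s y -> (cmonom (tperm x y * s)%g == m)%:R = J #|porbit s x| #|porbit s y|.
  move=> xy; rewrite /J -[cmonom _ == m](mset_addI _ _ [mset #|porbit s x|]) -(mset_addI _ _ [mset #|porbit s y|]).
  congr (nat_of_bool _)%:R; rewrite [LHS]eq_sym; congr (_ == _).
  by rewrite /n /cmonom (msetDAC _ Z) (msetDAC _ Z) ctype_join // msetDAC.
have splitE x q : (0 < q < #|porbit s x|)%N ->
    (cmonom (tperm x ((s ^+ q)%g x) * s)%g == m)%:R = P q (#|porbit s x| - q)%N.
  move=> hq; rewrite /P subnKC; last lia.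
  rewrite -[cmonom _ == m](mset_addI _ _ [mset #|porbit s x|]); congr (nat_of_bool (_ == _))%:R.
  by rewrite /n /cmonom (msetDAC _ Z) ctype_split // [in RHS](msetDAC _ Z) [in RHS](msetDAC _ Z).
have cnt k : #|[set x | #|porbit s x| == k]%SET| = (k * c k)%N by exact: card_porbit_eq.
have join_sum : \sum_x \sum_(y | x \notin porbit s y) (cmonom (tperm x y * s)%g == m)%:R =
    \sum_(i < d.+1) \sum_(j < d.+1) ((i * c i * (j * (c j - (i == j :> nat))))%N%:R * J i j).
  transitivity (\sum_x \sum_(j < d.+1) ((j * (c j - (#|porbit s x| == j))))%N%:R * J #|porbit s x| j).
    apply: eq_bigr => x _; rewrite (eq_bigr (fun y => J #|porbit s x| #|porbit s y|)); last by move=> y; exact: joinE.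
    have lt y : (#|porbit s y| < d.+1)%N by have := card_porbit_le s y; lia.
    rewrite (partition_big (fun y => Ordinal (lt y)) xpredT) //=; apply: eq_bigr => j _.
    rewrite (eq_bigr (fun=> J #|porbit s x| j)); last by move=> y /andP[_ /eqP <-].
    rewrite sumr_const -[LHS]mulr_natl; congr (_%:R * _).
    have e1 := cardsID (porbit s x) [set y | #|porbit s y| == j]%SET.
    rewrite mulnBr -cnt -e1 -[LHS](addnK #|([set y | #|porbit s y| == j] :&: porbit s x)%SET|) addnC.
    congr (_ + _ - _)%N.
      by apply: eq_card => y; rewrite !inE -[LHS]/((x \notin porbit s y) && (#|porbit s y| == j)) porbit_sym.
    have same y : y \in porbit s x -> #|porbit s y| = #|porbit s x|.
      by rewrite -eq_porbit_mem => /eqP ->.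
    case: eqP => e; rewrite ?muln1 ?muln0.
      rewrite -e; apply: eq_card => y; rewrite !inE andbC; case h : (y \in porbit s x) => //=.
      by rewrite same ?eqxx.
    apply: eq_card0 => y; rewrite !inE; apply/negbTE/negP => /andP[/eqP e' h].
    by apply: e; rewrite -(same y h).
  have lt y : (#|porbit s y| < d.+1)%N by have := card_porbit_le s y; lia.
  rewrite (partition_big (fun y => Ordinal (lt y)) xpredT) //=; apply: eq_bigr => i _.
  rewrite (eq_bigr (fun=> \sum_(j < d.+1) ((j * (c j - (i == j :> nat))))%N%:R * J i j)); last by move=> y /eqP <-.
  rewrite sumr_const -[LHS]mulr_natl mulr_sumr; apply: eq_big => // j _; rewrite mulrA -natrM; congr (_%:R * _).
  congr (_ * _)%N; rewrite -cnt; by apply: eq_card => y; rewrite !inE -[LHS]/(#|porbit s y| == i).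
have split_sum : \sum_x \sum_(y | (x != y) && (x \in porbit s y)) (cmonom (tperm x y * s)%g == m)%:R =
    \sum_(k < d.+1) \sum_(1 <= q < k) ((k * c k)%N%:R * P q (k - q)%N).
  transitivity (\sum_x \sum_(1 <= q < #|porbit s x|) P q (#|porbit s x| - q)%N).
    apply: eq_bigr => x _; set k := #|porbit s x|.
    have ut := uniq_traject_porbit s x; have k0 : (0 < k)%N by have := card_porbit_le s x; rewrite -/k; lia.
    have E : traject s x k = x :: traject s (s x) k.-1 by rewrite -trajectS prednK.
    rewrite -/k E /= in ut; case/andP: ut => xl ul.
    transitivity (\sum_(y <- traject s (s x) k.-1) (cmonom (tperm x y * s)%g == m)%:R : algC).
      rewrite [RHS]big_uniq //; apply: eq_bigl => y; rewrite porbit_sym porbit_traject -/k E inE [y == x]eq_sym.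
      by case: eqP => //= <-; rewrite (negPf xl).
    have -> : traject s (s x) k.-1 = [seq (s ^+ q.+1)%g x | q <- iota 0 k.-1].
      apply: (@eq_from_nth _ x) => [|q]; rewrite ?size_map ?size_traject ?size_iota // => qk.
      by rewrite (set_nth_default (s x)) ?size_traject // nth_traject // (nth_map 0%N) ?size_iota // nth_iota // add0n permX iterSr.
    rewrite big_map big_add1 /index_iota subn0 big_seq [RHS]big_seq; apply: eq_bigr => q.
    rewrite mem_iota add0n => /andP[_ qk]; rewrite splitE //; rewrite -/k; lia.
  have lt y : (#|porbit s y| < d.+1)%N by have := card_porbit_le s y; lia.
  rewrite (partition_big (fun y => Ordinal (lt y)) xpredT) //=; apply: eq_bigr => k _.
  rewrite (eq_bigr (fun=> \sum_(1 <= q < k) P q (k - q)%N)); last by move=> y /eqP <-.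
  rewrite sumr_const -[LHS]mulr_natl mulr_sumr; apply: eq_big => // q _; congr (_%:R * _).
  rewrite -cnt; by apply: eq_card => y; rewrite !inE -[LHS]/(#|porbit s y| == k).
transitivity ((\sum_x \sum_(y | x \notin porbit s y) (cmonom (tperm x y * s)%g == m)%:R) +
    \sum_x \sum_(y | (x != y) && (x \in porbit s y)) (cmonom (tperm x y * s)%g == m)%:R : algC).
  rewrite -big_split; apply: eq_bigr => x _; rewrite (bigID (fun y => x \notin porbit s y)) /=; congr (_ + _).
    by apply: eq_bigl => y; case: eqP => //= <-; rewrite porbit_id.
  by apply: eq_bigl => y; rewrite negbK.
have c0 : c 0%N = 0%N by exact: ctype0.
have cd k : (d < k)%N -> c k = 0%N.
  move=> dk; have := cnt k; rewrite (_ : [set _ | _]%SET = finset.set0) ?cards0; last first.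
    by apply/setP => x; rewrite !inE; apply/negbTE/eqP => e; have := card_porbit_le s x; lia.
  by move: (c k) => e; nia.
have n_le : (wt m < (wt m).+1)%N by [].
rewrite join_sum split_sum /CJ2 fps_addE; congr (_ + _).
  pose T i j : algC := ((i * c i * (j * (c j - (i == j :> nat))))%N%:R * J i j).
  have T0 i j : (0 < i)%N -> (0 < j)%N -> (i + j)%N \notin m -> T i j = 0.
    move=> i0 j0 h; rewrite /T /J; case: (m `+` [mset i] `+` [mset j] =P n `+` [mset (i + j)%N]) => [/join_mem e|_]; last by rewrite mulr0.
    by rewrite (e i0 j0) in h.
  rewrite (@sum_antidiagonal _ T _ (maxn (wt m).+1 (d + d).+1)); last 2 first.
  - by move=> i j [->|->]; rewrite /T ?muln0 ?mul0n mul0r.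
  - move=> i j h; rewrite /T; have [id|id] := ltnP d i; first by rewrite (cd i) // muln0 mul0n mul0r.
    have [jd|jd] := ltnP d j; first by rewrite (cd j) // sub0n !muln0 mul0r.
    by exfalso; move: h id jd; clear; move: (wt m) => W; lia.
  rewrite (@psum_bound _ _ (maxn (wt m).+1 (d + d).+1)); last exact: leq_maxl.
  rewrite [RHS]big_mkcond /=; apply: eq_bigr => k _.
  case: ifP => [/andP[k0 km]|h]; last first.
    rewrite big_nat big1 // => i /andP[i1 ik]; apply: T0; rewrite ?subn_gt0 // subnKC ?(ltnW ik) //.
    by apply/negP => km; rewrite km andbT (leq_ltn_trans (leq0n i) ik) in h.
  rewrite fps_sumE; apply: eq_big_nat => i /andP[i1 ik]; rewrite !DE.
  rewrite /T /J subnKC ?(ltnW ik) // /indicator -/n.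
  set j := (k - i)%N.
  rewrite (join_eq n i j km).
  case: (n =P _) => en; last by rewrite !mulr0.
  rewrite !mulr1 -natrM; congr (_%:R).
  have ni : c i = ((m `\ nat_of_ord k) i + 1 + (i == j))%N by rewrite -nE // en [LHS]msetE2 [(_ `+` _) i]msetE2 !msetnE eqxx; case: (i == j).
  have nj : c j = ((m `\ nat_of_ord k) j + (j == i) + 1)%N by rewrite -nE ?subn_gt0 // en [LHS]msetE2 [(_ `+` _) j]msetE2 !msetnE eqxx; case: (j == i).
  rewrite ni nj [(_ `+` [mset i]) j]msetE2 msetnE [j == i]eq_sym; apply: join_arith => /eqP e.
  by rewrite -e.
pose T i j : algC := if (0 < i)%N && (0 < j)%N then ((i + j) * c (i + j))%N%:R * P i j else 0.
have T0 i j : ~~ ((i \in m) && (j \in m `\ i)) -> T i j = 0.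
  move=> h; rewrite /T; case: ifP => // /andP[i0 j0]; rewrite /P; case: eqP => [/split_mem|]; last by rewrite mulr0.
  by move=> /(_ i0 j0) [h1 h2]; rewrite h1 h2 in h.
transitivity (\sum_(k < d.+1) \sum_(1 <= q < k) T q (k - q)%N).
  apply: eq_bigr => k _; apply: eq_big_nat => q /andP[q1 qk].
  by rewrite /T q1 subn_gt0 qk subnKC // ltnW.
rewrite -(@sum_antidiagonal _ T (maxn (wt m).+1 d.+1)); last 2 first.
- by move=> i j [->|->]; rewrite /T ?andbF.
- move=> i j h; have [id|id] := ltnP d (i + j)%N; first by rewrite /T (cd (i + j)%N) // muln0 mul0r; case: ifP.
  by rewrite /T; case: ifP => // /andP[ip jp]; exfalso; move: h id ip jp; clear; move: (wt m) => W; lia.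
rewrite (@psum_bound _ _ (maxn (wt m).+1 d.+1)); last exact: leq_maxl.
rewrite [RHS]big_mkcond /=; apply: eq_bigr => i _.
case: ifP => [/andP[i0 im]|h]; last first.
  rewrite big1 // => j _; have [i0|i0] := posnP i; first by rewrite /T i0.
  by apply: T0; rewrite i0 /= in h; rewrite h.
rewrite (@psum_bound _ _ (maxn (wt m).+1 d.+1)); last by apply: leq_trans (leq_maxl _ _); have := leq_addr i (wt (m `\ nat_of_ord i)); rewrite (wt_sub im) ltnS.
rewrite [RHS]big_mkcond /=; apply: eq_bigr => j _.
case: ifP => [/andP[j0 jm]|h]; last first.
  have [j0|j0] := posnP j; first by rewrite /T j0 andbF.
  by apply: T0; rewrite j0 /= in h; rewrite h andbF.
rewrite DE /T i0 j0 /P /indicator -/n /=.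
rewrite (split_eq n im jm).
case: (n =P _) => en; last by rewrite !mulr0.
rewrite !mulr1; congr (_ * _)%:R.
by rewrite -nE ?addn_gt0 ?i0 // en !msetE2 !msetnE eqxx addn1.
Qed.
End Perm.
End CutAndJoin.
End Cut_and_join.
Import Cut_and_join.

(** * Generating series of products of a full cycle and transpositions *)

Module Cycle_series_equation.
Section CycleSeries.
Local Open Scope ring_scope.
Local Open Scope mset_scope.

Section Fixed.
Variable d : nat.
Implicit Types (s t c : 'S_d) (F : 'S_d -> algC).

Definition transpositions : {set 'S_d} := [set tperm p.1 p.2 | p : 'I_d * 'I_d & p.1 != p.2]%SET.
Definition dcycles : {set 'S_d} := [set c : 'S_d | #|porbits c| == 1%N]%SET.
Definition tstep F s := \sum_(t in transpositions) F (t * s)%g.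

Lemma tstep2 F s : tstep F s *+ 2 = \sum_x \sum_(y | x != y) F (tperm x y * s)%g.
Proof.
rewrite pair_big_dep /= (partition_big (fun p => tperm p.1 p.2) (mem transpositions)) /=; last first.
  by move=> p hp; apply: imset_f; rewrite inE.
rewrite /tstep -sumrMnl; apply: eq_bigr => t /imsetP[[a b]]; rewrite inE /= => ab ->.
rewrite (eq_bigr (fun=> F (tperm a b * s)%g)) => [|p /andP[_ /eqP -> //]].
rewrite sumr_const; congr (_ *+ _).
rewrite -[LHS](_ : #|[set (a, b); (b, a)]%SET| = 2%N); last by rewrite cards2 xpair_eqE (negPf ab).
apply: eq_card => -[x y]; rewrite !inE /= unfold_in /= !xpair_eqE; apply/idP/idP => [/orP[/andP[/eqP -> /eqP ->]|/andP[/eqP -> /eqP ->]]|/andP[xy /eqP/permP/(_ x)]].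
- by rewrite ab eqxx.
- by rewrite eq_sym ab tpermC eqxx.
rewrite tpermL; case: tpermP => [-> ->|-> ->|_ _ e]; rewrite ?eqxx ?orbT //.
by rewrite e eqxx in xy.
Qed.

Lemma iter_tstep_sum r (I : Type) (l : seq I) (a : I -> algC) (G : I -> 'S_d -> algC) s :
  iter r tstep (fun s => \sum_(i <- l) a i * G i s) s = \sum_(i <- l) a i * iter r tstep (G i) s.
Proof.
elim: r s => //= r IH s.
transitivity (\sum_(t in transpositions) \sum_(i <- l) a i * iter r tstep (G i) (t * s)%g).
  by apply: eq_bigr => t _; rewrite IH.
by rewrite exchange_big; apply: eq_bigr => i _; rewrite -mulr_sumr.
Qed.

Lemma eq_iter_tstep r F G : F =1 G -> iter r tstep F =1 iter r tstep G.
Proof.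
move=> h; elim: r => //= r IH s; by apply: eq_bigr => t _; rewrite IH.
Qed.

Lemma dcycles_transitive c x y : c \in dcycles -> y \in porbit c x.
Proof.
rewrite inE => /cards1P[Ob e].
have h z : porbit c z = Ob.
  by have : porbit c z \in porbits c := imset_f _ isT; rewrite e inE => /eqP.
by rewrite -eq_porbit_mem !h.
Qed.

Lemma transitive_dcycles c x : (forall y, y \in porbit c x) -> c \in dcycles.
Proof.
move=> h; rewrite inE; apply/cards1P; exists (porbit c x); apply/setP => C; rewrite inE.
apply/imsetP/eqP => [[y _ ->]|->]; last by exists x.
by apply/eqP; rewrite eq_porbit_mem.
Qed.

Lemma card_porbit_dcycles c x : c \in dcycles -> #|porbit c x| = d.
Proof.
by move=> cc; rewrite -[RHS]card_ord; apply: eq_card => y; rewrite dcycles_transitive.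
Qed.
End Fixed.

Lemma ctype_dcycles d (c : 'S_d) : (0 < d)%N -> c \in dcycles d -> ctype c = [mset d].
Proof.
move=> d0 cc; apply/msetP => k; rewrite msetnE; case: k => [|k].
  by rewrite ctype0; case: eqP d0 => // <-.
have := card_porbit_eq c k.+1.
rewrite (_ : [set x | _]%SET = if k.+1 == d then [set: 'I_d]%SET else finset.set0); last first.
  by apply/setP => x; rewrite !inE card_porbit_dcycles // eq_sym; case: eqP; rewrite !inE.
by case: eqP => [e|_]; rewrite ?cardsT ?cards0 ?card_ord; move: (ctype c _) => u; nia.
Qed.

(** Full cycles form one conjugacy class. The centraliser of one has order [d]: it contains the
    powers, and a commuting permutation is determined by the image of one point. *)
Lemma card_dcycles d : (0 < d)%N -> #|dcycles d| = (d.-1)`!.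
Proof.
move=> d0; pose x0 := Ordinal d0.
have [c ec] : exists c : 'S_d, ctype c = seq_mset [:: d].
  by apply: exists_ctype; rewrite ?inE /= ?addn0 // eq_sym -lt0n.
have px : #|[set x | #|porbit c x| == d]%SET| = d.
  by rewrite card_porbit_eq ec mset_seqE /= eqxx addn0 muln1.
have tr x : #|porbit c x| = d.
  have : [set x | #|porbit c x| == d]%SET = [set: 'I_d]%SET.
    by apply/eqP; rewrite eqEcard finset.subsetT cardsT card_ord px leqnn.
  by move=> /setP/(_ x); rewrite !inE => /eqP.
have cc : c \in dcycles d.
  apply: (@transitive_dcycles _ _ x0) => y.
  have : porbit c x0 = [set: 'I_d]%SET by apply/eqP; rewrite eqEcard finset.subsetT cardsT card_ord tr leqnn.
  by move=> ->.
have cls : dcycles d = (c ^: [set: 'S_d])%g.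
  apply/setP => s; apply/idP/imsetP => [sc|[g _ ->]]; last first.
    apply: (@transitive_dcycles _ _ (g x0)) => y; have := dcycles_transitive x0 ((g^-1)%g y) cc.
    case/porbitP => n e; apply/porbitP; exists n; rewrite -conjXg /conjg !permM permK -e.
    by rewrite permKV.
  have [gam [gI gS _]] := conj_orbit (fun a => dcycles_transitive x0 a cc) (card_porbit_dcycles x0 sc).
  exists (perm gI) => //; apply/permP => x; rewrite /conjg !permM.
  by rewrite permE gS -(permE gI) permKV.
have cent : #|'C_[set: 'S_d][c]%g| = d.
  apply/eqP; rewrite eqn_leq; apply/andP; split.
    rewrite -[X in (_ <= X)%N]card_ord -(card_in_imset (f := fun z : 'S_d => z x0)) ?max_card //.
    move=> z z' /setIP[_ /cent1P zc] /setIP[_ /cent1P zc'] e; apply/permP => y.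
    have /porbitP[n ->] := dcycles_transitive x0 y cc.
    by rewrite -!permM -(commuteX n zc) -(commuteX n zc') !permM e.
  rewrite -[X in (X <= _)%N](tr x0) porbit.unlock; apply: leq_trans (leq_imset_card _ _) _.
  by apply: subset_leq_card; rewrite finset.subsetI finset.subsetT cycle_subG; exact/cent1P.
have := Lagrange (subsetIl [set: 'S_d]%G 'C[c])%g; rewrite cent index_cent1 -cls cardsT card_Sn.
have fin n : (0 < n)%N -> forall u, (n * u = n`!)%N -> u = (n.-1)`!.
  by case: n => // n _ u; rewrite factS => /eqP; rewrite eqn_pmul2l // => /eqP.
exact: fin.
Qed.

(** An average over the (d - 1)! full cycles, divided by r! for the exponential in [beta]. In
    [cycle_series] the degree and [r] are read from the monomial itself. *)
Definition cycle_coef d r (m : monomial) : algC :=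
  (r`! * (d.-1)`!)%:R^-1 * \sum_(c in dcycles d) iter r (@tstep d) (fun s => (cmonom r s == m)%:R) c.

Definition cycle_series : fps_ring := fun m => cycle_coef (wt m) (m 0%N) m.

Lemma cmonomS d r (s : 'S_d) m : (cmonom r.+1 s == m `+` [mset 0%N]) = (cmonom r s == m).
Proof.
have e : cmonom r.+1 s = cmonom r s `+` [mset 0%N] by rewrite /cmonom /= mset_cons [_ +` _]msetDC msetDA.
rewrite e; apply/eqP/eqP => [/msetP h|-> //]; apply/msetP => k; have := h k.
by rewrite !msetE2 => /addIn.
Qed.

(** The step next to the monomial test is replaced by the cut-and-join operator. As that operator
    preserves the weight and the exponent of [beta], all its terms have the same normalisation. *)
Lemma cycle_series_pde : dbeta cycle_series *+ 2 = CJ2 cycle_series.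
Proof.
apply/funext => m; rewrite fps_mulrnE /dbeta /fps_deriv /cycle_series wt_add addn0 msetE2 msetnE eqxx addn1.
rewrite CJ2E; set d := wt m; set r := m 0%N.
transitivity ((r`! * (d.-1)`!)%:R^-1 * \sum_(c in dcycles d) iter r (@tstep d) (fun s => CJ2 (indicator r s) m) c).
  rewrite /cycle_coef factS -mulnA natrM invfM !mulrA mulfV ?mul1r ?pnatr_eq0 // -mulrnAr; congr (_ * _).
  rewrite -sumrMnl; apply: eq_bigr => c _.
  transitivity (iter r (@tstep d) (fun s => tstep (fun s => (cmonom r s == m)%:R) s *+ 2) c); last first.
    by apply: eq_iter_tstep => s; rewrite tstep2 cut_and_join.
  transitivity (iter r (@tstep d) (fun s => \sum_(i <- [:: tt]) 2 * tstep (fun s => (cmonom r s == m)%:R) s) c).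
    rewrite iter_tstep_sum big_seq1 iterSr -[LHS]mulr_natl; congr (_ * _); apply: eq_iter_tstep => s.
    by apply: eq_bigr => t _; rewrite cmonomS.
  by apply: eq_iter_tstep => s; rewrite big_seq1 mulr_natl.
rewrite (eq_bigr (fun c => \sum_(t <- CJ2_terms m) t.1%:R * iter r (@tstep d) (fun s => (cmonom r s == t.2)%:R) c)); last first.
  move=> c _; rewrite -iter_tstep_sum; apply: eq_iter_tstep => s; exact: CJ2E.
rewrite exchange_big mulr_sumr big_seq [RHS]big_seq; apply: eq_bigr => t /CJ2_terms_same[wt_t t0].
by rewrite -mulr_sumr mulrCA wt_t t0.
Qed.

Lemma cycle_series_initial b (m : monomial) : (0 < b)%N -> m 0%N = 0%N -> cycle_series (m `+` [mset b]) = (m == mset0)%:R.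
Proof.
move=> b0 m0; rewrite /cycle_series msetE2 m0 mset1_pos // wt_add /cycle_coef /= fact0 mul1n.
set d := (wt m + b)%N; have d0 : (0 < d)%N by rewrite /d; lia.
rewrite (eq_bigr (fun=> (m == mset0)%:R)); last first.
  move=> c cc; congr (nat_of_bool _)%:R; rewrite /cmonom /= ctype_dcycles //.
  rewrite (_ : seq_mset [::] = mset0); last by apply/msetP => k; rewrite mset_seqE mset0E.
  rewrite msetD0; apply/eqP/eqP => [/msetP e|m00]; last by rewrite /d m00 wt0 add0n msetDC msetD0.
  apply/msetP => k; rewrite mset0E; have := e b; have := e k; rewrite !msetE2 !msetnE eqxx.
  case: (eqVneq b d) => [<-|]; last by rewrite addn1.
  by case: eqP => [->|]; [rewrite addn1 => _ []|rewrite addn0].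
by rewrite sumr_const card_dcycles // -[X in _ * X]mulr_natl mulrA mulVf ?mul1r // pnatr_eq0 -lt0n fact_gt0.
Qed.
End CycleSeries.
End Cycle_series_equation.
Import Cycle_series_equation.

(** * Coefficients of the Hurwitz series and counts of factorisations *)

Module Hurwitz_expansion.
Section HurwitzSeries.
Local Open Scope ring_scope.

Lemma psum_single (G : fps_ring) b m : (0 < b)%N ->
  psum (fun n => if n == b then G else 0) m = if b \in m then G (m `\ b)%mset else 0.
Proof.
move=> b0; rewrite /psum; case: ifP => bm; last first.
  rewrite big1 // => n /andP[_ nm]; case: eqP => // e; by move: nm; rewrite -[\val n]/(nat_of_ord n) e bm.
have bw : (b < (wt m).+1)%N by rewrite ltnS; exact: mem_wt.
rewrite (bigD1 (Ordinal bw)) /= ?b0 //= eqxx big1 ?addr0 // => n /andP[_].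
by rewrite -val_eqE /= => /negPf ->.
Qed.

Lemma fps_var_mul (G : fps_ring) b m : (0 < b)%N ->
  fps_mul (fps_var b) G m = if b \in m then G (m `\ b)%mset else 0.
Proof.
move=> b0; have ev : fps_var b = psum (fun n => if n == b then (1 : fps_ring) else 0).
  apply/funext => m'; rewrite psum_single // /fps_var; case: ifP => bm.
    rewrite /GRing.one /= /fps1 -{1}(msetB1K bm); congr (nat_of_bool _)%:R; apply/eqP/eqP => [/msetP h|->].
      by apply/msetP => k; have := h k; rewrite !msetE2 mset0E => e; move: e; move: ((m' `\ b)%mset k) (([mset b] : monomial)%mset k) => u v; lia.
    by rewrite msetD0.
  by case: eqP => // e; rewrite e in_mset1 eqxx in bm.
rewrite ev; change ((psum (fun n => if n == b then (1 : fps_ring) else 0) * G) m = if b \in m then G (m `\ b)%mset else 0).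
rewrite psumM -psum_single //; congr (psum _ m); apply/funext => n; case: eqP => _; by rewrite ?mul1r ?mul0r.
Qed.

Lemma LpE (F : fps) m : Lp F m = (wt m)%:R * F m.
Proof.
rewrite /Lp (wtE (ltnSn _)) natr_sum mulr_suml.
have e b : (0 < b)%N -> b%:R * fps_mul (fps_var b) (fps_deriv b F) m = (b * m b)%:R * F m.
  move=> b0; rewrite fps_var_mul // natrM -mulrA; congr (_ * _); case: ifP => bm.
    rewrite /fps_deriv [(_ `+` _)%mset]msetDC msetB1K //; congr (_%:R * _).
    by have := congr1 (fun M : monomial => M b) (msetB1K bm); rewrite /= msetE2 msetnE eqxx add1n.
  by move/negbT: bm; rewrite -mset_eq0 => /eqP ->; rewrite mul0r.
transitivity (\sum_(b \in [set b : nat | (0 < b)%N]%classic) ((b * m b)%:R * F m)).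
  by apply: eq_fsbigr => b /set_mem; exact: e.
rewrite (fsbig_ord _ (wt m).+1 (fun n => (n * m n)%:R * F m)).
rewrite (fsbig_widen `I_(wt m).+1 [set: nat]) //=; last first.
  move=> b [_ /= /negP]; rewrite -leqNgt => wb.
  have -> : m b = 0%N; last by rewrite muln0 mul0r.
  by apply/eqP; rewrite mset_eq0; apply/negP => /mem_wt; lia.
apply: fsbig_widen => //= b [_ /= /negP]; rewrite -leqNgt leqn0 => /eqP ->.
by rewrite mul0n mul0r.
Qed.

Definition parts (m : monomial) : seq nat := [seq k <- (m : seq nat) | (0 < k)%N].

Lemma parts0 m : 0%N \notin parts m. Proof. by rewrite mem_filter. Qed.

Lemma monom_parts (m : monomial) : m = seq_mset (nseq (m 0%N) 0%N ++ parts m).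
Proof.
apply/msetP => k; rewrite mset_seqE count_cat count_nseq /=.
have em : m k = count_mem k (m : seq nat) by rewrite -mset_seqE seq_mset_id.
case: k em => [|k] em.
  have -> : count_mem 0%N (parts m) = 0%N by apply/count_memPn; exact: parts0.
  by rewrite /= ?eqxx mul1n addn0.
rewrite mul0n add0n em /parts count_filter; apply: eq_count => x /=.
by case: eqP => // ->.
Qed.

Lemma parts_wt m : sumn (parts m) = wt m.
Proof.
rewrite [in RHS](monom_parts m) /wt (sumn_perm (perm_eq_seq_mset _)) sumn_cat sumn_nseq mul0n.
by [].
Qed.

Lemma monom_eq (m : monomial) r b : 0%N \notin b ->
  (m == seq_mset (nseq r 0%N ++ b)) = (m 0%N == r) && perm_eq b (parts m).
Proof.
move=> b0; apply/eqP/andP => [e|[/eqP <- p]].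
  have m0 : m 0%N = r by rewrite e mset_seqE count_cat count_nseq /= mul1n (count_memPn b0) addn0.
  rewrite m0 eqxx; split=> //; have /eq_seq_msetP : seq_mset (nseq r 0%N ++ b) = seq_mset (nseq r 0%N ++ parts m).
    by rewrite -e [LHS]monom_parts m0.
  by rewrite perm_cat2l.
by rewrite {1}(monom_parts m); apply/eq_seq_msetP; rewrite perm_cat2l perm_sym.
Qed.

(** Only orderings of the positive part of [m] contribute, and the exponent of [beta] bounds the
    genus, so the formal sum over all pairs is finite. *)
Lemma hurwitz_seriesE h (m : monomial) : hurwitz_series h m =
  \sum_(b <- permutations (parts m)) \sum_(g < (m 0%N).+1)
    if (0 < size b)%N && ((2 * g + size b - 1)%N == m 0%N)
    then ((size b)`!%:R^-1 * (m 0%N)`!%:R^-1 * (h g b / (wt m)%:R)) else 0.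
Proof.
rewrite /hurwitz_series; set r := m 0%N.
pose l := [seq (g, b) | b <- permutations (parts m), g <- iota 0 r.+1].
have ul : uniq l by apply: allpairs_uniq; rewrite ?permutations_uniq ?iota_uniq // => -[? ?] [? ?] _ _ [-> ->].
pose f (gb : nat * seq nat) : algC :=
  if [&& (0 < size gb.2)%N, perm_eq gb.2 (parts m) & (2 * gb.1 + size gb.2 - 1)%N == r]
  then ((size gb.2)`!%:R^-1 * r`!%:R^-1 * (h gb.1 gb.2 / (wt m)%:R)) else 0.
transitivity (\sum_(gb <- l) f gb); last first.
  rewrite big_allpairs_dep big_seq [RHS]big_seq; apply: eq_bigr => b; rewrite mem_permutations => pb.
  rewrite -{1}(subn0 r.+1) -/(index_iota 0 r.+1) big_mkord.
  by apply: eq_bigr => g _; rewrite /f /= pb.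
rewrite (fsbig_seq _ f ul) [RHS](fsbig_widen _ [set: nat * seq nat]) //=; last first.
  move=> [g b] [_ /= gl]; rewrite /f /=; case: ifP => // /and3P[b0 pb /eqP e]; case: gl.
  by apply/allpairsPdep; exists b, g; split; [rewrite mem_permutations|rewrite mem_iota; lia|].
set A := (X in \sum_(gb \in X) _).
rewrite [RHS](_ : _ = \sum_(gb \in A) f gb); last first.
  apply: esym; apply: fsbig_widen => // -[g b] [_ /= h1]; rewrite /f /=; case: ifP => // /and3P[b0 pb _]; case: h1.
  by rewrite /A /= b0 (perm_mem pb) parts0.
apply: eq_fsbigr => -[g b] /set_mem; rewrite /A /= => /andP[b0 bz]; rewrite /f /= monom_eq // b0 /=.
rewrite [m 0%N == _]eq_sym andbC; case: ifP => [/andP[pb /eqP e]|_]; last by rewrite mulr0.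
by rewrite mulr1 e -/r (sumn_perm pb) parts_wt.
Qed.

Section Steps.
Variable d : nat.
Implicit Types (s t c : 'S_d) (F : 'S_d -> algC) (A : {set 'S_d}).

Definition astep F A : 'S_d -> algC := fun s => \sum_(x in A) F (x * s)%g.

(** The sum over tuples with prescribed types is an iteration of operators, one for each factor,
    which can then be interchanged. *)
Lemma sum_tuples k (X : nat -> {set 'S_d}) F s :
  \sum_(t : k.-tuple 'S_d | [forall i : 'I_k, tnth t i \in X i]) F ((\prod_(x <- t) x) * s)%g =
  foldl astep F (mkseq X k) s.
Proof.
elim: k X F s => [|k IH] X F s.
  rewrite (bigD1 [tuple]) /=; last by apply/forallP => -[].
  by rewrite big_nil mul1g big1 ?addr0 // => t /andP[_ /eqP []]; exact: tuple0.
rewrite /mkseq /= (iotaDl 1 0) -map_comp -[map _ _]/(mkseq (X \o S) k) -IH.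
rewrite (reindex (fun p : 'S_d * k.-tuple 'S_d => [tuple of p.1 :: p.2])) /=; last first.
  exists (fun t : k.+1.-tuple 'S_d => (thead t, [tuple of behead t])) => [[x t] _|t _] /=.
    by congr (_, _); apply/val_inj.
  by apply/val_inj; case/tupleP: t.
rewrite (eq_bigl (fun p => [forall i : 'I_k, tnth p.2 i \in X i.+1] && (p.1 \in X 0%N))); last first.
  move=> [x t] /=; apply/forallP/andP => [h|[/forallP h x0] i].
    split; last exact: (h ord0).
    by apply/forallP => i; have := h (lift ord0 i); rewrite tnthS.
  by case: (unliftP ord0 i) => [j ->|->]; rewrite ?tnthS //; exact: h.
rewrite /astep [RHS]pair_big_dep /= [RHS](reindex (fun p : 'S_d * k.-tuple 'S_d => (p.2, p.1))) /=; last first.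
  by exists (fun p : k.-tuple 'S_d * 'S_d => (p.2, p.1)) => -[? ?].
by apply: eq_bigr => -[x t] _; rewrite /= big_cons mulgA.
Qed.

Lemma mem_dcyclesJ c t : ((c ^ t)%g \in dcycles d) = (c \in dcycles d).
Proof.
have h c' t' : c' \in dcycles d -> (c' ^ t')%g \in dcycles d.
  move=> cc; case: (posnP d) => [d0|d0].
    move: cc; rewrite inE => /cards1P[Ob e]; have : Ob \in porbits c' by rewrite e inE eqxx.
    by move=> /imsetP[x _ _]; have := ltn_ord x; lia.
  by apply: (@transitive_dcycles _ _ (Ordinal d0)) => y; rewrite porbitJ dcycles_transitive.
by apply/idP/idP => [/(h _ t^-1%g)|]; [rewrite conjgK|exact: h].
Qed.

(** Full cycles are stable under conjugation, so the place of the full cycle among the factors does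
    not affect the count. *)
Lemma astepC F : astep (astep F (dcycles d)) (transpositions d) =1 astep (astep F (transpositions d)) (dcycles d).
Proof.
move=> s; rewrite /astep [RHS]exchange_big /=; apply: eq_bigr => t _.
rewrite (reindex_inj (conjg_inj t^-1%g)) /=; apply: eq_big => c; first by rewrite mem_dcyclesJ.
by move=> _; rewrite conjgE invgK !mulgA mulgKV.
Qed.

Lemma eq_astep F G A : F =1 G -> astep F A =1 astep G A.
Proof. by move=> h s; apply: eq_bigr => x _; rewrite h. Qed.

Lemma foldl_astep k i0 F s : (i0 < k)%N ->
  foldl astep F (mkseq (fun i => if i == i0 then dcycles d else transpositions d) k) s =
  astep (iter k.-1 (@tstep d) F) (dcycles d) s.
Proof.
have eqf l G H : G =1 H -> foldl astep G l =1 foldl astep H l.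
  by elim: l G H => //= A l IH G H h; apply: IH; exact: eq_astep.
have allT n X G : (forall i, (i < n)%N -> X i = transpositions d) -> foldl astep G (mkseq X n) =1 iter n (@tstep d) G.
  elim: n => // n IH h s'; rewrite mkseqS -cats1 foldl_cat /= h //.
  by apply: eq_astep; apply: IH => i hi; apply: h; lia.
have swap n G : iter n (@tstep d) (astep G (dcycles d)) =1 astep (iter n (@tstep d) G) (dcycles d).
  elim: n => // n IH s'; rewrite [LHS]/= -[RHS]/(astep (astep (iter n (@tstep d) G) (transpositions d)) (dcycles d) s') -astepC.
  by apply: eq_astep.
move=> ik; have ek : k = (i0 + (1 + (k - i0.+1)))%N by lia.
rewrite ek /mkseq iotaD map_cat foldl_cat add0n iotaD map_cat foldl_cat /= eqxx.
have e1 : foldl astep F [seq (if i == i0 then dcycles d else transpositions d) | i <- iota 0 i0] =1 iter i0 (@tstep d) F.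
  by apply: allT => i hi; rewrite ltn_eqF.
have e2 G : foldl astep G [seq (if i == i0 then dcycles d else transpositions d) | i <- iota (i0 + 1) (k - i0.+1)] =1 iter (k - i0.+1) (@tstep d) G.
  rewrite -[(i0 + 1)%N]addn0 iotaDl -map_comp; apply: (allT _ (fun i => if (i0 + 1 + i == i0)%N then _ else _)) => i _.
  by rewrite (_ : (i0 + 1 + i == i0)%N = false) //; apply/eqP; lia.
rewrite e2 (eq_iter_tstep _ (eq_astep _ e1)) swap.
by apply: eq_astep => s'; rewrite -iterD; congr (iter _ _ _ s'); lia.
Qed.

(** Each transposition changes the number of cycles by one, up or down, so after [r] of them both
    the bound and the parity hold. *)
Lemma iter_tstep_zero r F s :
  (forall t, (#|porbits t| <= #|porbits s| + r)%N -> odd #|porbits t| = odd (#|porbits s| + r) -> F t = 0) ->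
  iter r (@tstep d) F s = 0.
Proof.
elim: r s => [|r IH] s h /=; first by apply: h; rewrite addn0.
apply: big1 => t /imsetP[[x y]]; rewrite inE /= => xy ->; apply: IH => u hu ou; apply: h.
  apply: leq_trans hu _; rewrite -addSnnS leq_add2r -addn1.
  have := porbits_mul_tperm s x y; rewrite /= xy => e; exact: leq_trans (leq_addr _ _) (eq_leq e).
rewrite ou; have := porbits_mul_tperm s x y; rewrite /= xy => /(congr1 odd); rewrite oddD odd_double addbF => e.
by rewrite !oddD e !oddD /=; case: (odd #|porbits s|); case: (odd r).
Qed.

Definition numberings b s : {set {ffun 'I_d -> 'I_(size b)}} := [set kap : {ffun 'I_d -> 'I_(size b)} | `[< @cycle_numbering d s b kap >]]%SET.

(** A numbering is the same as an ordering of the cycles whose lengths, read in order, form [b]: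
    cycle number k is the fibre of the numbering over k. *)
Lemma card_numberings b s : #|numberings b s| = count (fun l => map (fun C : {set 'I_d} => #|C|) l == b) (permutations (enum (porbits s))).
Proof.
pose phi (kap : {ffun 'I_d -> 'I_(size b)}) := [seq [set a | kap a == k]%SET | k <- enum 'I_(size b)].
have nthphi kap (k : 'I_(size b)) : nth finset.set0 (phi kap) k = [set a | kap a == k]%SET.
  by rewrite /phi (nth_map k) ?size_enum_ord // nth_ord_enum.
have sphi kap : size (phi kap) = size b by rewrite /phi size_map size_enum_ord.
rewrite -size_filter cardE -(size_map phi); apply/perm_size/uniq_perm.
- rewrite map_inj_uniq ?enum_uniq // => kap kap' e; apply/ffunP => a.
  have := congr1 (fun l => nth finset.set0 l (kap a)) e.
  rewrite /= !nthphi => /setP/(_ a).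
  by rewrite !inE eqxx => /esym/eqP.
- by rewrite filter_uniq // permutations_uniq.
move=> l; rewrite mem_filter mem_permutations; apply/mapP/andP => [[kap]|[/eqP lb pl]].
  rewrite mem_enum inE => /asboolP[h1 h2] ->; split.
    apply/eqP/(@eq_from_nth _ 0%N); first by rewrite size_map sphi.
    move=> k; rewrite size_map sphi => kb.
    rewrite (nth_map finset.set0) ?sphi //.
    have e1 : nth finset.set0 (phi kap) k = [set a | kap a == Ordinal kb]%SET := nthphi kap (Ordinal kb).
    by rewrite e1; have [_ ->] := h2 (Ordinal kb).
  have fib a : [set a' | kap a' == kap a]%SET = porbit s a by apply/setP => a'; rewrite inE eq_sym h1.
  have ne k : exists a, kap a = k.
    have [k0 k1] := h2 k; rewrite -k1 in k0; have /card_gt0P[a] := k0; rewrite inE => /eqP; by exists a.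
  apply: uniq_perm; rewrite ?enum_uniq //.
    rewrite map_inj_uniq ?enum_uniq // => k k' /setP e; have [a ka] := ne k; have := e a.
    by rewrite !inE ka eqxx => /esym/eqP.
  move=> C; rewrite mem_enum; apply/mapP/imsetP => [[k _ ->]|[a _ ->]].
    by have [a <-] := ne k; exists a; rewrite ?fib.
  by exists (kap a); rewrite ?mem_enum ?fib.
have ul : uniq l by rewrite (perm_uniq pl) enum_uniq.
have ml C : (C \in l) = (C \in porbits s) by rewrite (perm_mem pl) mem_enum.
have lt a : (index (porbit s a) l < size b)%N by rewrite -lb size_map index_mem ml imset_f.
pose kap := [ffun a => Ordinal (lt a)].
have fib (k : 'I_(size b)) : [set a | kap a == k]%SET = nth finset.set0 l k.
  have kl : (k < size l)%N by have := ltn_ord k; rewrite -{2}lb size_map.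
  apply/setP => a; rewrite inE ffunE -val_eqE /=; apply/eqP/idP => [<-|].
    by rewrite nth_index ?ml ?imset_f ?porbit_id.
  have : nth finset.set0 l k \in porbits s by rewrite -ml mem_nth.
  case/imsetP => z _ e; rewrite e -eq_porbit_mem => /eqP ez.
  by rewrite ez -e index_uniq.
exists kap.
  rewrite mem_enum inE; apply/asboolP; split=> [a a'|k].
    rewrite !ffunE -val_eqE /= -eq_porbit_mem eq_sym; apply/eqP/eqP => [e|-> //].
    by rewrite -[LHS](nth_index finset.set0 (s := l)) ?ml ?imset_f // e nth_index // ml imset_f.
  have kl : (k < size l)%N by have := ltn_ord k; rewrite -{2}lb size_map.
  rewrite fib; have -> : nth 0%N b k = #|nth finset.set0 l k| by rewrite -{1}lb (nth_map finset.set0).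
  split=> //; have : nth finset.set0 l k \in porbits s by rewrite -ml mem_nth.
  by case/imsetP => z _ ->; rewrite lt0n card_porbit_neq0.
apply: (@eq_from_nth _ finset.set0); first by rewrite sphi -[in RHS]lb size_map.
move=> k kl; have kb : (k < size b)%N by rewrite -lb size_map.
have e1 : nth finset.set0 (phi kap) k = [set a | kap a == Ordinal kb]%SET := nthphi kap (Ordinal kb).
by rewrite e1 fib.
Qed.

(** When [b] runs over all orderings of the parts, each ordering of the cycles is counted once. The
    resulting n! cancels the 1/n! in the definition of the series. *)
Lemma sum_numberings (m : monomial) s : \sum_(b <- permutations (parts m)) #|numberings b s|%:R =
  ((size (parts m))`!)%:R * (cmonom (m 0%N) s == m)%:R :> algC.
Proof.
set L := map (fun C : {set 'I_d} => #|C|) (enum (porbits s)).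
have e : (cmonom (m 0%N) s == m) = perm_eq L (parts m).
  have -> : cmonom (m 0%N) s = seq_mset (nseq (m 0%N) 0%N ++ L).
    by apply/msetP => k; rewrite msetE2 !mset_seqE count_cat addnC.
  rewrite {2}(monom_parts m); apply/eqP/idP => [/eq_seq_msetP|h]; first by rewrite perm_cat2l.
  by apply/eq_seq_msetP; rewrite perm_cat2l.
have cs (T : Type) (p : pred T) (l : seq T) : count p l = (\sum_(x <- l) p x)%N.
  by elim: l => [|x l IHl]; rewrite ?big_nil ?big_cons //= IHl.
transitivity ((\sum_(b <- permutations (parts m)) \sum_(l <- permutations (enum (porbits s))) (map (fun C : {set 'I_d} => #|C|) l == b))%N%:R : algC).
  by rewrite natr_sum; apply: eq_bigr => b _; rewrite card_numberings cs.
rewrite exchange_big -natrM; congr _%:R; rewrite big_seq.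
have one (l : seq {set 'I_d}) : l \in permutations (enum (porbits s)) ->
    (\sum_(b <- permutations (parts m)) (map (fun C : {set 'I_d} => #|C|) l == b) = perm_eq L (parts m))%N.
  rewrite mem_permutations => pl; have pL := perm_map (fun C : {set 'I_d} => #|C|) pl.
  rewrite -(permPl pL) -mem_permutations -count_uniq_mem ?permutations_uniq // cs.
  by apply: eq_bigr => b _; rewrite /= eq_sym.
rewrite (eq_bigr _ one) -big_seq big_const_seq count_predT size_permutations ?enum_uniq // iter_addn_0 e.
case pe : (perm_eq L (parts m)); rewrite ?muln0 ?mul0n // mul1n muln1.
by rewrite -(perm_size pe) size_map.
Qed.
End Steps.
End HurwitzSeries.
End Hurwitz_expansion.
Import Hurwitz_expansion.

(** * Hurwitz numbers as counts of permutations, and the conclusion *)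

Module Hirota.
Section Monodromy.
Local Open Scope ring_scope.

Lemma cycle_numberingV d (s : 'S_d) b kap : @cycle_numbering d s^-1%g b kap <-> @cycle_numbering d s b kap.
Proof. by split=> -[h1 h2]; split=> // a a'; rewrite h1 porbitV. Qed.

Lemma numbering_dcycle d (x : 'S_d) : (0 < d)%N ->
  (exists kap, @cycle_numbering d x [:: d] kap) <-> x \in dcycles d.
Proof.
move=> d0; split=> [[kap [h1 _]]|xd].
  by apply: (@transitive_dcycles _ _ (Ordinal d0)) => y; rewrite -h1 !ord1.
exists (fun=> ord0); split=> [a a'|k]; first by rewrite eqxx dcycles_transitive.
rewrite ord1 /= (_ : [set a | _]%SET = [set: 'I_d]%SET); last by apply/setP => a; rewrite !inE.
by rewrite cardsT card_ord.
Qed.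

Lemma map_perm_eq (T : eqType) (f : T -> nat) (l : seq T) (b : seq nat) :
  perm_eq b (map f l) -> exists2 l', perm_eq l' l & map f l' = b.
Proof.
elim: b l => [|a b IH] l p.
  exists [::] => //; have := perm_size p; by case: (l).
have : a \in map f l by rewrite -(perm_mem p) mem_head.
case/mapP => c cl ac; have pl := perm_to_rem cl.
have : perm_eq b (map f (rem c l)).
  by rewrite -(perm_cons a) (perm_trans p) // [in X in perm_eq _ X]ac -map_cons perm_map.
case/IH => l' pl' e; exists (c :: l'); last by rewrite /= e -ac.
by rewrite (perm_trans _ (_ : perm_eq (c :: rem c l) l)) ?perm_cons // perm_sym.
Qed.

Lemma porbit1 d (a : 'I_d) : porbit (1 : 'S_d) a = [set a]%SET.
Proof.
apply/setP => z; rewrite inE; apply/porbitP/eqP => [[k ->]|->]; first by rewrite expg1n perm1.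
by exists 0%N; rewrite perm1.
Qed.

Lemma ctype1 d : ctype (1 : 'S_d)%g = seq_mset (nseq d 1%N).
Proof.
apply/msetP => k; rewrite mset_seqE count_nseq /=.
case: k => [|k]; first by rewrite ctype0.
have := card_porbit_eq (1 : 'S_d) k.+1.
rewrite (_ : [set x | _]%SET = if k == 0%N then [set: 'I_d]%SET else finset.set0); last first.
  by apply/setP => x; rewrite inE porbit1 cards1 eqSS eq_sym; case: (k == 0%N); rewrite !inE.
by case: k => [|k] /=; rewrite ?cardsT ?cards0 ?card_ord; move: (ctype _ _) => c; nia.
Qed.

(** In a numbering, the class of number 0 has two elements, which [x] must exchange, and every other
    class is a fixed point. Conversely, the cycle type of a transposition is a join of the type of
    the identity. *)
Lemma numbering_transposition d (x : 'S_d) :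
  (exists kap, @cycle_numbering d x (2%N :: nseq (d - 2) 1%N) kap) <-> x \in transpositions d.
Proof.
split=> [[kap [h1 h2]]|/imsetP[[a b]]].
  have [_ /eqP/cards2P[a [b [ab e]]]] := h2 ord0.
  have fib c : porbit x c = [set c' | kap c' == kap c]%SET by apply/setP => c'; rewrite inE eq_sym h1.
  have ka : kap a = ord0 by have : a \in [set a; b]%SET; [rewrite !inE eqxx|rewrite -e inE => /eqP].
  have kb : kap b = ord0 by have : b \in [set a; b]%SET; [rewrite !inE eqxx orbT|rewrite -e inE => /eqP].
  have memx c : x c \in porbit x c by have := mem_porbit x 1 c; rewrite expg1.
  have out c : c \notin [set a; b]%SET -> x c = c.
    move=> cn; have /eqP/cards1P[z ez] : #|porbit x c| = 1%N.
      rewrite fib; have [_ ->] := h2 (kap c); move: cn; rewrite -e inE.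
      case: (kap c) => -[|q] hq; rewrite -val_eqE //= => _.
      by rewrite nth_nseq; move: hq; rewrite /= size_nseq ltnS => ->.
    have := memx c; have := porbit_id x c; rewrite ez !inE => /eqP <- /eqP //.
  have pa : porbit x a = [set a; b]%SET by rewrite fib ka e.
  have pb : porbit x b = [set a; b]%SET by rewrite fib kb e.
  have xa : x a = b.
    have := memx a; rewrite pa !inE => /orP[/eqP xa|/eqP //].
    have := @porbit_sub_stable _ x a [set a]%SET; rewrite inE eqxx => /(_ isT) h.
    have /fintype.subsetP/(_ b) : porbit x a \subset [set a]%SET by apply: h => z; rewrite inE => /eqP ->; rewrite xa inE.
    by rewrite pa !inE eqxx orbT => /(_ isT)/eqP ba; rewrite ba eqxx in ab.
  have xb : x b = a.
    have := memx b; rewrite pb !inE => /orP[/eqP //|/eqP xb].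
    by have ba : a = b; [apply: (@perm_inj _ x); rewrite xa xb|rewrite ba eqxx in ab].
  apply/imsetP; exists (a, b); rewrite ?inE //=; apply/permP => c.
  by case: tpermP => [->|->|/eqP ca /eqP cb] //; apply: out; rewrite !inE negb_or ca cb.
rewrite inE /= => ab ->.
have [kap] : exists kap, kap \in numberings (2%N :: nseq (d - 2) 1%N) (tperm a b).
  apply/card_gt0P; rewrite card_numberings -has_count.
  suff : perm_eq (2%N :: nseq (d - 2) 1%N) (map (fun C : {set 'I_d} => #|C|) (enum (porbits (tperm a b)))).
    case/map_perm_eq => l pl e; apply/hasP; exists l; [by rewrite mem_permutations|by rewrite /= e eqxx].
  apply/eq_seq_msetP; rewrite -[RHS]/(ctype (tperm a b)).
  have d2 : (2 <= d)%N by have := max_card [set a; b]%SET; rewrite cards2 ab card_ord.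
  have abn : a \notin porbit (1 : 'S_d) b by rewrite porbit1 inE.
  have /msetP e := ctype_join abn; apply/msetP => k; have := e k.
  rewrite mulg1 !porbit1 !cards1 ctype1 !msetE2 !msetnE !mset_seqE /= !count_nseq /= (eq_sym k 1%N) (eq_sym k 2%N).
  by move: (count_mem k _) => u; case: (eqVneq 1%N k) => [<-|_] /=; [|case: (2%N == k) => /=]; lia.
by rewrite inE => /asboolP h; exists kap.
Qed.

Section Count.
Variables (R : realType) (xs : seq R) (b : seq nat) (i0 : nat).
Hypotheses (i0s : (i0 < size xs)%N) (xs0 : forall j, (j < size xs)%N -> (nth 0 xs j == 0) = (j == i0)).
Hypotheses (b0 : (0 < size b)%N) (bpos : 0%N \notin b).
Let d := sumn b.

Definition cover_count e r : algC :=
  astep (iter r (@tstep e) (fun s => #|numberings b s|%:R)) (dcycles e) 1%g.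

Lemma sumn_gt0 : (0 < d)%N.
Proof. by rewrite /d; move: b0 bpos; case: b => // a l _; rewrite inE negb_or /=; case: a. Qed.

(** The full cycle stands at position [i0], the place of 0 among the ordered branch values.
    [foldl_astep] brings it to a fixed place, so the count no longer depends on [w]. *)
Lemma card_admissible : #|[set y | `[< @admissible R xs b y >]]%SET|%:R = cover_count d (size xs).-1.
Proof.
pose X i := if i == i0 then dcycles d else transpositions d.
rewrite /cover_count -(@foldl_astep d _ i0 _ _ i0s) -(sum_tuples _ X).
have hp (A B : finType) (P : pred (A * B)) : #|[set y | P y]%SET| = (\sum_(t : A) #|[set kap | P (t, kap)]%SET|)%N.
  rewrite -sum1dep_card; under [RHS]eq_bigr do rewrite -sum1dep_card.
  by rewrite pair_big_dep /=; apply: eq_bigl => -[t kap].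
rewrite hp natr_sum [RHS]big_mkcond; apply: eq_bigr => t _; rewrite mulg1.
have typeP : (forall i, (i < size xs)%N -> exists kap, @cycle_numbering d (nth 1%g t i) (profile xs b i) kap) <->
    [forall i : 'I_(size xs), tnth t i \in X i].
  have one i : (i < size xs)%N -> (exists kap, @cycle_numbering d (nth 1%g t i) (profile xs b i) kap) <-> nth 1%g t i \in X i.
    by move=> si; rewrite /profile xs0 // /X; case: (i == i0); [exact: numbering_dcycle sumn_gt0|exact: numbering_transposition].
  split=> [h|/forallP h i si].
    by apply/forallP => i; rewrite (tnth_nth 1%g); apply/(one _ (ltn_ord i))/h.
  by apply/(one i si); have := h (Ordinal si); rewrite (tnth_nth 1%g).
have pp : prefix_prod t (size xs) = (\prod_(x <- t) x)%g.
  by rewrite -[RHS]prefix_prod_size size_tuple.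
case: ifP => ht.
  congr _%:R; apply: eq_card => kap; rewrite !inE; apply/asboolP/asboolP => [[_]|h].
    by rewrite /= pp => /cycle_numberingV.
  split; first exact/typeP.
  by rewrite /= pp; apply/cycle_numberingV.
rewrite (_ : [set kap | _]%SET = finset.set0) ?cards0 //; apply/setP => kap; rewrite !inE.
by apply/negbTE/negP => /asboolP[/typeP]; rewrite ht.
Qed.
End Count.

Section Series.
Variables (R : realType) (w : nat -> seq R[i]).
Hypotheses (w_size : forall m, size (w m) = m) (w_uniq : forall m, uniq (0 :: w m)).

Lemma hurwitz_value g b : (0 < size b)%N -> 0%N \notin b ->
  hurwitz w g b = cover_count b (sumn b) (2 * g + size b - 1) / ((sumn b)`!)%:R.
Proof.
move=> b0 bpos.
have [xs [sx [[i0 i0s xs0] h]]] := hurwitz_number_value (w_uniq (2 * g + size b - 1)) (w_size _) b0 bpos.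
have e := card_admissible i0s xs0 b0 bpos; have en : (size xs).-1 = (2 * g + size b - 1)%N by rewrite sx /= w_size.
rewrite en in e.
rewrite /hurwitz; case: xgetP => [c _ /h ->|/(_ (cover_count b (sumn b) (2 * g + size b - 1) / ((sumn b)`!)%:R))].
  by rewrite e.
by case; apply/h; rewrite e.
Qed.

Lemma sum_cover_count (m : monomial) d r : m 0%N = r ->
  \sum_(b <- permutations (parts m)) cover_count b d r =
  ((size (parts m))`!)%:R * \sum_(c in dcycles d) iter r (@tstep d) (fun s => (cmonom r s == m)%:R) c.
Proof.
move=> m0; rewrite /cover_count /astep exchange_big mulr_sumr; apply: eq_bigr => c _; rewrite mulg1.
transitivity (iter r (@tstep d) (fun s => \sum_(b <- permutations (parts m)) 1 * #|numberings b s|%:R) c).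
  by rewrite iter_tstep_sum; apply: eq_bigr => b _; rewrite mul1r.
transitivity (iter r (@tstep d) (fun s => \sum_(u <- [:: tt]) ((size (parts m))`!)%:R * (cmonom r s == m)%:R) c).
  apply: eq_iter_tstep => s; rewrite big_seq1 -m0 -sum_numberings; apply: eq_bigr => b _; exact: mul1r.
by rewrite iter_tstep_sum big_seq1.
Qed.

Lemma card_porbits_monom d (s : 'S_d) r (m : monomial) : cmonom r s = m -> m 0%N = r -> #|porbits s| = size (parts m).
Proof.
move=> e m0; have : seq_mset (nseq r 0%N ++ map (fun C : {set 'I_d} => #|C|) (enum (porbits s))) = m.
  by rewrite -e; apply/msetP => k; rewrite msetE2 !mset_seqE count_cat addnC.
rewrite {1}(monom_parts m) m0 => /eq_seq_msetP; rewrite perm_cat2l => /perm_size <-.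
by rewrite size_map cardE.
Qed.

(** Applying L_p twice gives d^2, which against the 1/d of the series and the 1/d! of the count
    leaves 1/(d - 1)!, the normalisation of [cycle_coef]. If no genus fits the monomial, the cycle
    sum vanishes as well, by [iter_tstep_zero]. *)
Lemma Lp_hurwitz_series : Lp (Lp (hurwitz_series (hurwitz w))) = cycle_series.
Proof.
apply/funext => m; rewrite !LpE hurwitz_seriesE /cycle_series.
set r := m 0%N; set n := size (parts m); have [d0|d0] := posnP (wt m).
  rewrite d0 mul0r /cycle_coef big_pred0 ?mulr0 // => c; rewrite inE; apply/negbTE/negP => /cards1P[Ob e].
  have : Ob \in porbits c by rewrite e inE eqxx.
  by case/imsetP => x _ _; have := ltn_ord x; lia.
have n0 : (0 < n)%N by rewrite /n; have := parts_wt m; case: (parts m) => //= e; rewrite -e in d0.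
set S := \sum_(c in dcycles (wt m)) iter r (@tstep (wt m)) (fun s => (cmonom r s == m)%:R) c.
have NZ k : (k`!)%:R != 0 :> algC by rewrite pnatr_eq0 -lt0n fact_gt0.
have inner : \sum_(b <- permutations (parts m)) \sum_(g < r.+1)
    (if (0 < size b)%N && ((2 * g + size b - 1)%N == r)
     then (size b)`!%:R^-1 * r`!%:R^-1 * (hurwitz w g b / (wt m)%:R) else 0) =
    \sum_(g < r.+1) if (2 * g + n - 1)%N == r then r`!%:R^-1 * (S / ((wt m)`!)%:R / (wt m)%:R) else 0.
  rewrite exchange_big; apply: eq_bigr => g _; case: eqP => [gr|gr]; last first.
    rewrite big_seq big1 // => b; rewrite mem_permutations => pb; rewrite (perm_size pb) -/n.
    by case: eqP => //; rewrite andbF.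
  transitivity (\sum_(b <- permutations (parts m)) n`!%:R^-1 * r`!%:R^-1 / ((wt m)`!)%:R / (wt m)%:R * cover_count b (wt m) r).
    rewrite big_seq [RHS]big_seq; apply: eq_bigr => b; rewrite mem_permutations => pb.
    have sb := perm_size pb; rewrite sb -/n n0 gr eqxx /= hurwitz_value ?sb ?(perm_mem pb) ?parts0 //.
    rewrite (sumn_perm pb) parts_wt -/n gr; move: (cover_count _ _ _) => x.
    by rewrite -!mulrA; congr (_ * (_ * _)); rewrite mulrC -!mulrA.
  rewrite -mulr_sumr (@sum_cover_count m _ r) // -/n -/S; have := NZ n.
  move: (n`!%:R : algC) (r`!%:R^-1) (((wt m)`!)%:R^-1) ((wt m)%:R^-1) S => u v x y z u0.
  by rewrite -!mulrA; rewrite (mulrCA z); rewrite !mulrA; rewrite ![_ * u]mulrC; rewrite !mulrA mulfV // mul1r; ring.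
rewrite inner /cycle_coef -/S.
have [/existsP[g /eqP gr]|/existsPn ng] := boolP [exists g : 'I_r.+1, (2 * g + n - 1)%N == r].
  rewrite (bigD1 g) //= gr eqxx big1 ?addr0 => [|g' g'g]; last first.
    by case: eqP => // g'r; case/eqP: g'g; apply: ord_inj; lia.
  have -> : ((wt m)`!)%:R = (wt m)%:R * ((wt m).-1`!)%:R :> algC.
    by rewrite -natrM -{1}(prednK d0) factS prednK.
  have dz : (wt m)%:R != 0 :> algC by rewrite pnatr_eq0 -lt0n.
  rewrite natrM; have := NZ r; have := NZ (wt m).-1; move: dz.
  clear inner; clearbody S; move: ((wt m)%:R : algC) (((wt m).-1`!)%:R : algC) (r`!%:R : algC) S => D E u z D0 E0 u0.
  by field; rewrite D0 E0 u0.
rewrite big1 => [|g _]; last by rewrite (negPf (ng g)).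
suff -> : S = 0 by rewrite !mulr0.
rewrite /S big1 // => c; rewrite inE => /eqP c1; apply: iter_tstep_zero => t; rewrite c1 => le od.
case: eqP => // e; have en := card_porbits_monom e erefl; rewrite -/n in en.
exfalso; rewrite en in le od.
(* From one cycle, [r] transpositions lead to at most 1 + r cycles, with the parity of 1 + r. A
   nonzero term would thus make half of 1 + r - n an admissible genus, against the assumption. *)
have gl : (((1 + r) - n)./2 < r.+1)%N by rewrite ltnS -[X in (_ <= X)%N]doubleK half_leq //; lia.
have /eqP := ng (Ordinal gl); apply => /=.
have ev : (((1 + r) - n)./2.*2 = (1 + r) - n)%N.
  by rewrite -[RHS]odd_double_half oddB // od addbb.
by rewrite mul2n ev; lia.
Qed.
End Series.
End Monodromy.


Section Conclusion.
Local Open Scope ring_scope.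

Lemma hirota (i j : nat) : (2 <= i <= j)%N -> Dop [:: j; i] cycle_series = 0 /\ Hir i j cycle_series = 0.
Proof.
case/andP=> i2 ij.
have tworows := S_two_rows cycle_series_pde cycle_series_initial rowsumD rowsum0 rowsum_newton.
have hook := S_hook cycle_series_pde cycle_series_initial rowsumD rowsum0 rowsum_newton.
have sol := S_solution cycle_series_pde cycle_series_initial rowsumD rowsum0 rowsum_newton.
have D2 : Dop [:: j; i] cycle_series = 0.
  rewrite Dop_two_rows; last by rewrite ij andbT ltnW.
  by have := tworows i j.-1 i2; rewrite prednK ?subn1 //; apply: leq_trans ij; exact: ltnW.
split=> //.
have D1 k : (0 < k)%N -> Dop [:: k] cycle_series = Aser k * Bser 0.
  by move=> k0; rewrite Dop_row; have := sol k.-1; rewrite prednK.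
have Dh k : (0 < k)%N -> Dop [:: k; 1%N] cycle_series = - (Aser k * Bser 1).
  move=> k0; rewrite Dop_two_rows ?k0 // rowsum0.
  by have := hook k.-1; rewrite prednK.
rewrite /Hir D2 D1 ?Dh ?D1 ?Dh; try lia.
change ((Dop [::] cycle_series : fps_ring) * 0 - (Aser (i - 1) * Bser 0) * (- (Aser j * Bser 1)) +
  (Aser j * Bser 0) * (- (Aser (i - 1) * Bser 1)) = 0 :> fps_ring).
move: (Aser _) (Aser _) (Bser _) (Bser _) (Dop _ _ : fps_ring) => x y u v z; ring.
Qed.

End Conclusion.
End Hirota.
Import Hirota.

Local Open Scope ring_scope.

Theorem theorem1 (R : realType) (w : nat -> seq R[i])
    (w_size : forall m : nat, size (w m) = m)
    (w_uniq : forall m : nat, uniq (0 :: w m)) :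
  let H : fps := hurwitz_series (hurwitz w) in
  (forall i j : nat, (2 <= i <= j)%N -> Hir i j (Lp (Lp H)) = 0) /\
  (forall i j : nat, (2 <= i <= j)%N -> is_LKP i j (Lp (Lp H)) 0).
Proof.
move=> H; rewrite /H (Lp_hurwitz_series w_size w_uniq).
split=> i j hij; have [D2 H2] := hirota hij; first exact: H2.
exact: LKP_of_Dop.
Qed.
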